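(* Let $\omega$, $\Omega$, $R_c$, $R_0$, $s_\pm(r)$, $d_\pm(r)$, $\mathcal{F}_\pm(r)$ be as in the context, and let $r \in (R_c,R_0)$. Let $\eta \in C^{2,\gamma}(\mathbb{R})$ be positive, let $D=\{(x,y): x\in\mathbb{R},\ 0<y<\eta(x)\}$, and let $\psi \in C^{2,\gamma}(\overline{D})$ solve $$\Delta\psi+\omega(\psi)=0 \text{ in } D,\qquad \tfrac12|\nabla\psi|^2+y=r \text{ and } \psi=1 \text{ on } y=\eta(x),\qquad \psi=0 \text{ on } y=0,$$ with $\inf_D \psi_y>0$. Let $$\mathcal{F}=\int_0^{\eta(x)}\Big(\tfrac12(\psi_y^2-\psi_x^2)-y+\Omega(1)-\Omega(\psi)+r\Big)\,dy$$ (this quantity is independent of $x$). Then: (i) $\mathcal{F}_-(r)\le \mathcal{F}\le \mathcal{F}_+(r)$; (ii) $\mathcal{F}=\mathcal{F}_-(r)$ holds only if $(\psi,\eta)$ is the supercritical laminar flow ($\eta\equiv d_-(r)$, $\psi(x,y)=U(y;s_+(r))$) or a symmetric solitary wave of positive elevation supported by the supercritical stream, i.e. $\eta$ is symmetric about some vertical line, $\eta(x)>d_-(r)$ for all $x$, and $\eta(x)\to d_-(r)$ as $x\to\pm\infty$; (iii) $\mathcal{F}=\mathcal{F}_+(r)$ holds only if $(\psi,\eta)$ is the subcritical laminar flow ($\eta\equiv d_+(r)$, $\psi(x,y)=U(y;s_-(r))$).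
   Context: Fix $\gamma\in(0,1)$ and a continuous vorticity function $\omega:[0,1]\to\mathbb{R}$. Set $\Omega(p)=\int_0^p\omega(\tau)\,d\tau$ and $s_0=\sqrt{\max_{p\in[0,1]}2\Omega(p)}$. For $s>s_0$ define $$H(p;s)=\int_0^p\frac{d\tau}{\sqrt{s^2-2\Omega(\tau)}},\qquad d(s)=H(1;s),\qquad R(s)=\tfrac12 s^2-\Omega(1)+d(s).$$ Let $U(\cdot;s):[0,d(s)]\to[0,1]$ be the inverse function of $p\mapsto H(p;s)$. Then $U$ solves $U''+\omega(U)=0$, $U(0)=0$, $U(d(s))=1$, $U'(0)=s$, and $(\psi,\eta)=(U(y;s),d(s))$ is a laminar flow with Bernoulli constant $R(s)$. Let $s_c>s_0$ be defined by $\int_0^1 (s_c^2-2\Omega(p))^{-3/2}\,dp=1$. The function $R$ decreases on $(s_0,s_c)$ and increases to $+\infty$ on $(s_c,\infty)$. Put $R_c=R(s_c)$ and $R_0=\lim_{s\to s_0+}R(s)\in(R_c,+\infty]$. For $r\in(R_c,R_0)$ the equation $R(s)=r$ has exactly two solutions $s_-(r)<s_c<s_+(r)$. Set $d_-(r)=d(s_+(r))$ (supercritical depth) and $d_+(r)=d(s_-(r))$ (subcritical depth). For $s>s_0$ define $$\sigma(s;r)=\int_0^1\Big(\frac{1}{2H_p(p;s)^2}-H(p;s)-\Omega(p)+\Omega(1)+r\Big)H_p(p;s)\,dp.$$ The flow force constants of the conjugate laminar flows are $\mathcal{F}_+(r)=\sigma(s_-(r);r)$ (subcritical) and $\mathcal{F}_-(r)=\sigma(s_+(r);r)$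 (supercritical). *)

(* Defs.v *)
From Stdlib Require Import Reals Lra List.
From Coquelicot Require Import Coquelicot.
Open Scope R_scope.

Definition cont_on_01 (om : R -> R) : Prop :=
  forall p, 0 <= p <= 1 -> forall eps, 0 < eps ->
    exists delta, 0 < delta /\
      forall q, 0 <= q <= 1 -> Rabs (q - p) < delta -> Rabs (om q - om p) < eps.

Definition Omega (om : R -> R) (p : R) : R := RInt om 0 p.

(* max_{p in [0,1]} Omega(p) (a supremum, attained since Omega is continuous) *)
Definition maxOmega (om : R -> R) : R :=
  real (Lub_Rbar (fun v => exists p, 0 <= p <= 1 /\ v = Omega om p)).

Definition s0 (om : R -> R) : R := sqrt (2 * maxOmega om).

Definition Hp (om : R -> R) (s p : R) : R := / sqrt (s ^ 2 - 2 * Omega om p).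

Definition H (om : R -> R) (s p : R) : R := RInt (Hp om s) 0 p.

Definition depth (om : R -> R) (s : R) : R := H om s 1.

Definition Bern (om : R -> R) (s : R) : R := s ^ 2 / 2 - Omega om 1 + depth om s.

Definition is_sc (om : R -> R) (sc : R) : Prop :=
  s0 om < sc /\
  RInt (fun p => / (sqrt (sc ^ 2 - 2 * Omega om p)) ^ 3) 0 1 = 1.

Definition sigmaF (om : R -> R) (s r : R) : R :=
  RInt (fun p => (/ (2 * (Hp om s p) ^ 2) - H om s p - Omega om p + Omega om 1 + r)
                 * Hp om s p) 0 1.

Definition dist2 (x y x' y' : R) : R := sqrt ((x - x') ^ 2 + (y - y') ^ 2).

Definition cont_on2 (S : R -> R -> Prop) (f : R -> R -> R) : Prop :=
  forall x y, S x y -> forall eps, 0 < eps ->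
    exists delta, 0 < delta /\
      forall x' y', S x' y' -> dist2 x' y' x y < delta -> Rabs (f x' y' - f x y) < eps.

Definition bounded2 (S : R -> R -> Prop) (f : R -> R -> R) : Prop :=
  exists M, forall x y, S x y -> Rabs (f x y) <= M.

Definition holder2 (S : R -> R -> Prop) (g : R) (f : R -> R -> R) : Prop :=
  exists C, forall x y x' y', S x y -> S x' y' -> (x, y) <> (x', y') ->
    Rabs (f x y - f x' y') <= C * Rpower (dist2 x y x' y') g.

Definition bounded1 (f : R -> R) : Prop := exists M, forall x, Rabs (f x) <= M.

Definition holder1 (g : R) (f : R -> R) : Prop :=
  exists C, forall x x', x <> x' -> Rabs (f x - f x') <= C * Rpower (Rabs (x - x')) g.

Definition C2g_R (g : R) (eta : R -> R) : Prop :=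
  (forall x, ex_derive eta x /\ ex_derive (Derive eta) x) /\
  bounded1 eta /\ bounded1 (Derive eta) /\ bounded1 (Derive_n eta 2) /\
  holder1 g (Derive_n eta 2).

Definition Dom (eta : R -> R) (x y : R) : Prop := 0 < y < eta x.
Definition Dbar (eta : R -> R) (x y : R) : Prop := 0 <= y <= eta x.

(* psi in C^{2,gamma}(closure D): psix, psiy, psixx, psixy, psiyy are the partial
   derivatives of psi in D, and (as functions on the closure) they are the
   continuous extensions to the closure; all are bounded and the second
   derivatives are uniformly gamma-Hoelder on the closure. *)
Definition C2g_Dbar (g : R) (eta : R -> R)
  (psi psix psiy psixx psixy psiyy : R -> R -> R) : Prop :=
  (forall x y, Dom eta x y ->
     is_derive (fun t => psi t y) x (psix x y) /\
     is_derive (fun t => psi x t) y (psiy x y) /\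
     is_derive (fun t => psix t y) x (psixx x y) /\
     is_derive (fun t => psix x t) y (psixy x y) /\
     is_derive (fun t => psiy t y) x (psixy x y) /\
     is_derive (fun t => psiy x t) y (psiyy x y)) /\
  (forall f, In f (psi :: psix :: psiy :: psixx :: psixy :: psiyy :: nil) ->
     cont_on2 (Dbar eta) f /\ bounded2 (Dbar eta) f) /\
  (forall f, In f (psixx :: psixy :: psiyy :: nil) -> holder2 (Dbar eta) g f).

Definition flowforce (om : R -> R) (r : R) (eta : R -> R) (psi psix psiy : R -> R -> R)
  (x : R) : R :=
  RInt (fun y => / 2 * (psiy x y ^ 2 - psix x y ^ 2) - y + Omega om 1
                 - Omega om (psi x y) + r) 0 (eta x).

(* (psi, eta) is the laminar flow (U(y;s), d(s)); U(.;s) being the inverse of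
   p |-> H(p;s) on [0,1], psi(x,y) = U(y;s) means psi(x,y) in [0,1] and
   H(psi(x,y);s) = y. *)
Definition laminar (om : R -> R) (s : R) (eta : R -> R) (psi : R -> R -> R) : Prop :=
  (forall x, eta x = depth om s) /\
  (forall x y, Dbar eta x y -> 0 <= psi x y <= 1 /\ H om s (psi x y) = y).

Definition sym_solitary (d : R) (eta : R -> R) : Prop :=
  (exists x0, forall x, eta (x0 + x) = eta (x0 - x)) /\
  (forall x, d < eta x) /\
  filterlim eta (Rbar_locally p_infty) (locally d) /\
  filterlim eta (Rbar_locally m_infty) (locally d).

(* Main.v *)
(** With [h(q, p)] the height of the streamline [psi = p] over [x = q], the wave becomes a flow on the
    strip [0 <= p <= 1]. The differences between [h] and laminar or reflected heights, and the flow
    force flux function [Phi] of the wave relative to a laminar flow, all satisfy an inequality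
    [|g_qq + 2 B g_qp + A g_pp| <= K (|g_q| + |g_p|)], so exponential barriers give maximum principles
    and Hopf lemmas for them without any compactness or regularity theory.

    Lower bound: let [L = inf eta] and take the laminar speed compatible with Bernoulli's law at depth
    [L]. Comparison with laminar flows puts this speed between [s_-] and [s_+]. If the flow force were
    below the one attached to this speed, [Phi] would almost attain a negative minimum at the top where
    [eta] is near [L], and the Hopf lemma would exclude points with [eta] near [L] and small slope,
    which exist.
    Upper bound: take the laminar flow with the bottom speed of the wave at one point; there
    [Phi_p] vanishes, so [Phi] cannot be positive on the whole top boundary.

    When [F = F_-] one has [inf eta = d_-]. Either the infimum is attained and the strong maximum
    principle makes the wave laminar, or the same argument excludes critical points with
    [d_- < eta <= d_+], so that [eta] decreases to [d_-] at one end; moving planes started from that end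
    (the supercritical condition yields the needed supersolution, and the other end is excluded since
    a monotone wave would converge to a conjugate laminar flow) prove the symmetry. *)

Require Import Defs.
From Stdlib Require Import Reals Lra List Classical ClassicalEpsilon.
From Coquelicot Require Import Coquelicot.
Open Scope R_scope.

(** * Continuity and differentiation on closed intervals *)

Section one_variable.
Implicit Types f g F : R -> R.

(** Two facts make maximum principles available although [om] is merely continuous and has no sign.
    In hodograph variables the vorticity is [om p], a function of the independent variable, hence
    the same for two heights compared at one point: their difference satisfies an inequality without
    zero-order term. For [Phi] the right side is quadratic in the velocity defect (v - m, u), but
    the physical gradient of [Phi] is half the complex square of that defect, so the quadratic term
    is again linear in the gradient. On the surface Bernoulli's law makes [Phi] a constant plus a
    square, and the constant compares the flow force of the wave with that of a laminar flow.

    The obstacle is that the strip is unbounded and infima need not be attained. Estimates are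
    therefore uniform in [q]: where a function almost reaches its boundary infimum, its slope is
    already bounded away from zero. In the moving planes the same concern leads to lower bounds by a
    multiple of [s * p], with [s] the distance to the plane, since a displacement of the plane
    changes the difference by a small multiple of the same weight. *)

Definition cont_in (a b : R) (f : R -> R) : Prop :=
  forall p, a <= p <= b -> forall eps, 0 < eps ->
    exists delta, 0 < delta /\
      forall q, a <= q <= b -> Rabs (q - p) < delta -> Rabs (f q - f p) < eps.

(** Composition with [clamp] extends a function continuous on [[a, b]] to one continuous on the
    whole line, to which the library theorems on global continuity, integration and compactness
    apply. *)
Definition clamp (a b x : R) : R := Rmax a (Rmin x b).

Lemma clamp_in a b x : a <= b -> a <= clamp a b x <= b.
Proof. intros; unfold clamp, Rmax, Rmin; repeat destruct Rle_dec; lra. Qed.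

Lemma clamp_id a b x : a <= x <= b -> clamp a b x = x.
Proof. intros; unfold clamp, Rmax, Rmin; repeat destruct Rle_dec; lra. Qed.

Lemma clamp_lip a b x y : a <= b -> Rabs (clamp a b x - clamp a b y) <= Rabs (x - y).
Proof.
  intros; unfold clamp, Rmax, Rmin, Rabs;
    repeat destruct Rle_dec; repeat destruct Rcase_abs; lra.
Qed.

Lemma continuous_epsd (f : R -> R) x :
  (forall eps, 0 < eps -> exists delta, 0 < delta /\
     forall y, Rabs (y - x) < delta -> Rabs (f y - f x) < eps) ->
  continuous f x.
Proof.
  intros Hf P [e He].
  destruct (Hf e (cond_pos e)) as [d [Hd Hd']].
  exists (mkposreal d Hd). intros y Hy. apply He. apply Hd'. exact Hy.
Qed.

Lemma epsd_continuous (f : R -> R) x :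
  continuous f x ->
  forall eps, 0 < eps -> exists delta, 0 < delta /\
     forall y, Rabs (y - x) < delta -> Rabs (f y - f x) < eps.
Proof.
  intros Hf eps Heps.
  destruct (Hf (fun z => Rabs (z - f x) < eps)) as [d Hd].
  { exists (mkposreal eps Heps). intros z Hz. exact Hz. }
  exists d. split. apply cond_pos. intros y Hy. apply Hd. exact Hy.
Qed.

Lemma is_derive_cont f (x l : R) : is_derive f x l -> continuous f x.
Proof. intros H. apply (ex_derive_continuous (V := R_NormedModule)). now exists l. Qed.

Lemma is_derive_continuity_pt f (x l : R) : is_derive f x l -> continuity_pt f x.
Proof. intros H. apply continuity_pt_filterlim. exact (is_derive_cont f x l H). Qed.

Lemma continuous_clamp a b f x :
  a <= b -> cont_in a b f -> continuous (fun y => f (clamp a b y)) x.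
Proof.
  intros Hab Hf. apply continuous_epsd. intros eps Heps.
  destruct (Hf (clamp a b x) (clamp_in a b x Hab) eps Heps) as [d [Hd Hd']].
  exists d. split; auto. intros y Hy. apply Hd'. apply clamp_in; auto.
  eapply Rle_lt_trans. apply clamp_lip; auto. auto.
Qed.

Lemma continuity_pt_clamp a b f x :
  a <= b -> cont_in a b f -> continuity_pt (fun y => f (clamp a b y)) x.
Proof. intros. apply continuity_pt_filterlim. now apply continuous_clamp. Qed.

Lemma clamp_loc a b x : a < x < b -> locally x (fun y => clamp a b y = y).
Proof.
  intros [H1 H2].
  assert (Hd : 0 < Rmin (x - a) (b - x)) by (apply Rmin_pos; lra).
  exists (mkposreal _ Hd). intros y Hy. apply clamp_id.
  change (Rabs (y - x) < Rmin (x - a) (b - x)) in Hy.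
  apply Rabs_def2 in Hy.
  pose proof (Rmin_l (x - a) (b - x)). pose proof (Rmin_r (x - a) (b - x)). lra.
Qed.

Lemma MVT_closed f df a b : a < b ->
  (forall x, a < x < b -> is_derive f x (df x)) -> cont_in a b f ->
  exists c, a < c < b /\ f b - f a = df c * (b - a).
Proof.
  intros Hab Hd Hc.
  set (g := fun y => f (clamp a b y)).
  assert (Hg : forall c, a < c < b -> is_derive g c (df c)).
  { intros c Hc'. apply is_derive_ext_loc with f.
    - destruct (clamp_loc a b c Hc') as [e He]. exists e. intros y Hy.
      unfold g. now rewrite He.
    - now apply Hd. }
  assert (pr : forall c, a < c < b -> derivable_pt g c).
  { intros c Hc'. exists (df c). apply is_derive_Reals. now apply Hg. }
  destruct (MVT g id a b pr (fun c _ => derivable_pt_id c) Hab) as [c [Hc' E]].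
  { intros. apply continuity_pt_clamp; auto; lra. }
  { intros. apply derivable_continuous_pt. apply derivable_pt_id. }
  exists c. split; auto.
  rewrite derive_pt_id in E.
  assert (E2 : derive_pt g c (pr c Hc') = df c).
  { apply derive_pt_eq. apply is_derive_Reals. now apply Hg. }
  rewrite E2 in E. unfold g, id in E. rewrite !clamp_id in E by lra. lra.
Qed.

Lemma cont_in_sub a b a' b' f : a <= a' -> b' <= b -> cont_in a b f -> cont_in a' b' f.
Proof.
  intros Ha Hb Hf p Hp eps Heps.
  destruct (Hf p ltac:(lra) eps Heps) as [d [Hd Hd']].
  exists d. split; auto. intros q Hq. apply Hd'. lra.
Qed.

Lemma cont_in_ext a b f g : (forall x, a <= x <= b -> f x = g x) -> cont_in a b f -> cont_in a b g.
Proof.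
  intros E Hf p Hp eps Heps. destruct (Hf p Hp eps Heps) as [d [Hd Hd']].
  exists d. split; auto. intros q Hq. rewrite <- !E; auto.
Qed.

Lemma cont_in_continuous a b f : (forall x, a <= x <= b -> continuous f x) -> cont_in a b f.
Proof.
  intros Hf p Hp eps Heps. destruct (epsd_continuous f p (Hf p Hp) eps Heps) as [d [Hd Hd']].
  exists d. split; auto.
Qed.

Lemma cont_in_clamp a b f : a <= b ->
  (forall x, continuous (fun y => f (clamp a b y)) x) -> cont_in a b f.
Proof.
  intros Hab Hf. apply (cont_in_ext a b (fun y => f (clamp a b y))).
  intros x Hx. now rewrite clamp_id. apply cont_in_continuous. auto.
Qed.

Lemma cont_in_plus a b f g : a <= b -> cont_in a b f -> cont_in a b g -> cont_in a b (fun x => f x + g x).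
Proof.
  intros Hab Hf Hg. apply cont_in_clamp; auto. intros x.
  apply (continuous_plus (fun y => f (clamp a b y)) (fun y => g (clamp a b y)));
    now apply continuous_clamp.
Qed.

Lemma cont_in_mult a b f g : a <= b -> cont_in a b f -> cont_in a b g -> cont_in a b (fun x => f x * g x).
Proof.
  intros Hab Hf Hg. apply cont_in_clamp; auto. intros x.
  apply (continuous_mult (fun y => f (clamp a b y)) (fun y => g (clamp a b y)));
    now apply continuous_clamp.
Qed.

Lemma cont_in_const a b c : cont_in a b (fun _ => c).
Proof. apply cont_in_continuous. intros. apply continuous_const. Qed.

Lemma cont_in_id a b : cont_in a b (fun x => x).
Proof. apply cont_in_continuous. intros. apply continuous_id. Qed.

Lemma cont_in_opp a b f : a <= b -> cont_in a b f -> cont_in a b (fun x => - f x).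
Proof.
  intros Hab Hf. apply cont_in_ext with (fun x => (-1) * f x). intros; ring.
  apply cont_in_mult; auto. apply cont_in_const.
Qed.

Lemma cont_in_minus a b f g : a <= b -> cont_in a b f -> cont_in a b g -> cont_in a b (fun x => f x - g x).
Proof. intros. apply cont_in_plus; auto. apply cont_in_opp; auto. Qed.

Lemma cont_in_inv a b f : a <= b -> (forall x, a <= x <= b -> f x <> 0) -> cont_in a b f ->
  cont_in a b (fun x => / f x).
Proof.
  intros Hab H0 Hf. apply cont_in_clamp; auto. intros x.
  apply continuity_pt_filterlim.
  apply (continuity_pt_inv (fun y => f (clamp a b y))).
  now apply continuity_pt_clamp. apply H0. now apply clamp_in.
Qed.

Lemma cont_in_comp a b f (g : R -> R) : a <= b -> cont_in a b f ->
  (forall x, a <= x <= b -> continuous g (f x)) -> cont_in a b (fun x => g (f x)).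
Proof.
  intros Hab Hf Hg. apply cont_in_clamp; auto. intros x.
  apply (continuous_comp (fun y => f (clamp a b y)) g).
  now apply continuous_clamp. apply Hg. now apply clamp_in.
Qed.

Lemma cont_in_bounded a b f : a <= b -> cont_in a b f ->
  exists M, forall x, a <= x <= b -> Rabs (f x) <= M.
Proof.
  intros Hab Hf.
  destruct (continuity_ab_maj (fun y => Rabs (f (clamp a b y))) a b Hab) as [x0 [H1 H2]].
  { intros c Hc. apply continuity_pt_filterlim.
    apply (continuous_comp (fun y => f (clamp a b y)) Rabs).
    now apply continuous_clamp. apply continuous_Rabs. }
  exists (Rabs (f (clamp a b x0))). intros x Hx. specialize (H1 x Hx).
  now rewrite (clamp_id a b x Hx) in H1.
Qed.

Lemma cont_in_min a b f : a <= b -> cont_in a b f ->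
  exists x0, a <= x0 <= b /\ forall x, a <= x <= b -> f x0 <= f x.
Proof.
  intros Hab Hf.
  destruct (continuity_ab_min (fun y => f (clamp a b y)) a b Hab) as [x0 [H1 H2]].
  { intros c Hc. now apply continuity_pt_clamp. }
  exists x0. split; auto. intros x Hx. specialize (H1 x Hx).
  now rewrite !clamp_id in H1.
Qed.

Lemma cont_in_unif a b f : a <= b -> cont_in a b f -> forall eps, 0 < eps ->
  exists delta, 0 < delta /\ forall x y, a <= x <= b -> a <= y <= b ->
    Rabs (x - y) < delta -> Rabs (f x - f y) < eps.
Proof.
  intros Hab Hf eps Heps.
  destruct (@Heine_cor2 (fun y => f (clamp a b y)) a b
     (fun x _ => continuity_pt_clamp a b f x Hab Hf) (mkposreal eps Heps)) as [d Hd].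
  exists d. split. apply cond_pos. intros x y Hx Hy Hxy.
  specialize (Hd x y Hx Hy Hxy). rewrite !clamp_id in Hd by auto. exact Hd.
Qed.

Lemma cont_in_ex_RInt a b f : a <= b -> cont_in a b f -> ex_RInt f a b.
Proof.
  intros Hab Hf. apply ex_RInt_ext with (fun y => f (clamp a b y)).
  - rewrite Rmin_left, Rmax_right by lra. intros x Hx. now rewrite clamp_id by lra.
  - apply (@ex_RInt_continuous R_CompleteNormedModule). intros z _. now apply continuous_clamp.
Qed.

Lemma RInt_cont_in_clamp a b f p : a <= p <= b ->
  RInt (fun y => f (clamp a b y)) a p = RInt f a p.
Proof.
  intros Hp. apply RInt_ext. rewrite Rmin_left, Rmax_right by lra. intros x Hx.
  now rewrite clamp_id by lra.
Qed.

Lemma RInt_clamp_derive a b f x : a <= b -> cont_in a b f ->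
  is_derive (fun p => RInt (fun y => f (clamp a b y)) a p) x (f (clamp a b x)).
Proof.
  intros Hab Hf. apply (is_derive_RInt (fun y => f (clamp a b y)) _ a).
  - exists (mkposreal 1 Rlt_0_1). intros y _. apply (@RInt_correct R_CompleteNormedModule).
    apply (@ex_RInt_continuous R_CompleteNormedModule). intros z _. now apply continuous_clamp.
  - now apply continuous_clamp.
Qed.

Lemma RInt_derive_in a b f x : a < x < b -> cont_in a b f ->
  is_derive (fun p => RInt f a p) x (f x).
Proof.
  intros Hx Hf.
  apply is_derive_ext_loc with (fun p => RInt (fun y => f (clamp a b y)) a p).
  - destruct (clamp_loc a b x Hx) as [e He]. exists e. intros y Hy.
    apply RInt_cont_in_clamp. rewrite <- (He y Hy). apply clamp_in. lra.
  - rewrite <- (clamp_id a b x) at 2 by lra. apply RInt_clamp_derive; auto. lra.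
Qed.

Lemma RInt_cont_in a b f : a <= b -> cont_in a b f -> cont_in a b (fun p => RInt f a p).
Proof.
  intros Hab Hf.
  apply cont_in_ext with (fun p => RInt (fun y => f (clamp a b y)) a p).
  intros; now apply RInt_cont_in_clamp.
  apply cont_in_continuous. intros x Hx.
  apply (ex_derive_continuous (V := R_NormedModule)). eexists. now apply RInt_clamp_derive.
Qed.

Lemma FTC_closed a b f F : a <= b -> cont_in a b f -> cont_in a b F ->
  (forall x, a < x < b -> is_derive F x (f x)) -> RInt f a b = F b - F a.
Proof.
  intros Hab Hf HF Hd. destruct (Req_dec a b) as [<-|Hne].
  { rewrite (@RInt_point R_CompleteNormedModule). change (0 = F a - F a). ring. }
  destruct (MVT_closed (fun x => F x - RInt f a x) (fun x => f x - f x) a b) as [c [Hc E]].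
  - lra.
  - intros x Hx. apply (is_derive_minus (V := R_NormedModule)). now apply Hd. now apply RInt_derive_in with b.
  - apply cont_in_minus; auto. now apply RInt_cont_in.
  - rewrite (@RInt_point R_CompleteNormedModule) in E. change (zero : R) with 0 in E. lra.
Qed.

Lemma le_closure_ab a b F l : a < b -> cont_in a b F -> (forall p, a < p < b -> F p <= l) ->
  forall p, a <= p <= b -> F p <= l.
Proof.
  intros Hab HF H p Hp. apply le_epsilon. intros eps Heps.
  destruct (HF p Hp eps Heps) as [d [Hd Hd']].
  set (e := Rmin (d / 2) ((b - a) / 2)).
  assert (He : 0 < e) by (apply Rmin_pos; lra).
  assert (He1 : e <= d / 2) by apply Rmin_l.
  assert (He2 : e <= (b - a) / 2) by apply Rmin_r.
  assert (Hq : exists q, a < q < b /\ Rabs (q - p) < d).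
  { destruct (Rle_dec p ((a + b) / 2)).
    - exists (p + e/2). split. lra. replace (p + e/2 - p) with (e/2) by ring.
      rewrite Rabs_pos_eq; lra.
    - exists (p - e/2). split. lra. replace (p - e/2 - p) with (-(e/2)) by ring.
      rewrite Rabs_Ropp, Rabs_pos_eq; lra. }
  destruct Hq as [q [Hq1 Hq2]].
  specialize (Hd' q ltac:(lra) Hq2). specialize (H q Hq1). apply Rabs_def2 in Hd'. lra.
Qed.

Lemma le_closure F l : cont_in 0 1 F -> (forall p, 0 < p < 1 -> F p <= l) ->
  forall p, 0 <= p <= 1 -> F p <= l.
Proof. apply le_closure_ab. lra. Qed.

Lemma choice2 (T : Type) (P : R -> R -> T -> Prop) : (forall x y, exists z, P x y z) ->
  exists G : R -> R -> T, forall x y, P x y (G x y).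
Proof.
  intros H. exists (fun x y => proj1_sig (constructive_indefinite_description _ (H x y))).
  intros x y. apply (proj2_sig (constructive_indefinite_description _ (H x y))).
Qed.

(* Suppose the infimum is not attained; a gauge bounded both by the oscillation and by
   the gap to the infimum then has a uniform positive lower bound. *)
Lemma min_rect (f : R -> R -> R) a b a' b' : a <= b -> a' <= b' ->
  (forall x y, a <= x <= b -> a' <= y <= b' -> forall eps, 0 < eps -> exists d, 0 < d /\
     forall x' y', a <= x' <= b -> a' <= y' <= b' -> Rabs (x' - x) < d -> Rabs (y' - y) < d ->
       Rabs (f x' y' - f x y) < eps) ->
  exists x0 y0, a <= x0 <= b /\ a' <= y0 <= b' /\
    forall x y, a <= x <= b -> a' <= y <= b' -> f x0 y0 <= f x y.
Proof.
  intros Hab Hab' Hc. apply NNPP. intros Hn.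
  assert (Hlt : forall x y, a <= x <= b -> a' <= y <= b' ->
     exists x' y', a <= x' <= b /\ a' <= y' <= b' /\ f x' y' < f x y).
  { intros x y Hx Hy. apply NNPP. intros Hn'. apply Hn. exists x, y. repeat split; try tauto.
    intros x' y' Hx' Hy'. destruct (Rle_or_lt (f x y) (f x' y')); auto.
    exfalso. apply Hn'. exists x', y'. auto. }
  set (E := fun z => exists x y, a <= x <= b /\ a' <= y <= b' /\ z = - f x y).
  assert (HB : bound E).
  (* Finiteness of the infimum comes before anything else: a gauge at most [1 / (1 + |f|)] has a
     uniform positive lower bound by compactness, and this bounds [|f|]. *)
  { assert (H1 : forall x y, exists d : posreal, a <= x <= b -> a' <= y <= b' ->
      d <= 1 / (1 + Rabs (f x y)) /\
     forall x' y', a <= x' <= b -> a' <= y' <= b' -> Rabs (x' - x) < d -> Rabs (y' - y) < d ->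
       Rabs (f x' y' - f x y) < 1).
    { intros x y. destruct (classic (a <= x <= b /\ a' <= y <= b')) as [[Hx Hy]|Hno].
      - destruct (Hc x y Hx Hy 1 Rlt_0_1) as [d [Hd Hd']].
        assert (Hp : 0 < Rmin d (1 / (1 + Rabs (f x y)))).
        { apply Rmin_pos; auto. apply Rdiv_lt_0_compat. lra. pose proof (Rabs_pos (f x y)); lra. }
        exists (mkposreal _ Hp). simpl. intros _ _. split. apply Rmin_r.
        intros x' y' Hx' Hy' K1 K2. apply Hd'; auto.
        eapply Rlt_le_trans. apply K1. apply Rmin_l.
        eapply Rlt_le_trans. apply K2. apply Rmin_l.
      - exists (mkposreal 1 Rlt_0_1). tauto. }
    destruct (choice2 posreal _ H1) as [del Hdel].
    destruct (compactness_value_2d a b a' b' del) as [d Hd].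
    exists (1 / d + 1). intros z [x [y [Hx [Hy ->]]]].
    apply Rnot_lt_le. intros Hz. apply (Hd x y Hx Hy).
    intros [u [v [Hu [Hv [K1 [K2 K3]]]]]].
    destruct (Hdel u v Hu Hv) as [L1 L2].
    specialize (L2 x y Hx Hy K1 K2).
    assert (Hfu : 0 < 1 + Rabs (f u v)) by (pose proof (Rabs_pos (f u v)); lra).
    assert (d * (1 + Rabs (f u v)) <= 1).
    { apply Rle_trans with (1 / (1 + Rabs (f u v)) * (1 + Rabs (f u v))).
      apply Rmult_le_compat_r. lra. lra. right. field. lra. }
    assert (1 + Rabs (f u v) <= 1 / d).
    { apply Rmult_le_reg_l with d. apply cond_pos. replace (d * (1 / d)) with 1. lra.
      field. apply Rgt_not_eq. apply cond_pos. }
    assert (- f x y <= Rabs (f u v) + 1).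
    { apply Rabs_def2 in L2. pose proof (Rle_abs (- f u v)) as K; rewrite Rabs_Ropp in K; lra. }
    lra. }
  destruct (completeness E HB) as [l [Hl1 Hl2]].
  { exists (- f a a'). exists a, a'. repeat split; lra. }
  assert (Hgt : forall x y, a <= x <= b -> a' <= y <= b' -> - l < f x y).
  { intros x y Hx Hy. destruct (Hlt x y Hx Hy) as [x' [y' [Hx' [Hy' K]]]].
    assert (- f x' y' <= l) by (apply Hl1; exists x', y'; auto). lra. }
  assert (H1 : forall x y, exists d : posreal, a <= x <= b -> a' <= y <= b' ->
      d <= (f x y + l) / 2 /\
     forall x' y', a <= x' <= b -> a' <= y' <= b' -> Rabs (x' - x) < d -> Rabs (y' - y) < d ->
       Rabs (f x' y' - f x y) < (f x y + l) / 2).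
  { intros x y. destruct (classic (a <= x <= b /\ a' <= y <= b')) as [[Hx Hy]|Hno].
    - pose proof (Hgt x y Hx Hy).
      destruct (Hc x y Hx Hy ((f x y + l)/2) ltac:(lra)) as [d [Hd Hd']].
      assert (Hp : 0 < Rmin d ((f x y + l) / 2)) by (apply Rmin_pos; lra).
      exists (mkposreal _ Hp). simpl. intros _ _. split. apply Rmin_r.
      intros x' y' Hx' Hy' K1 K2. apply Hd'; auto.
      eapply Rlt_le_trans. apply K1. apply Rmin_l.
      eapply Rlt_le_trans. apply K2. apply Rmin_l.
    - exists (mkposreal 1 Rlt_0_1). tauto. }
  destruct (choice2 posreal _ H1) as [del Hdel].
  destruct (compactness_value_2d a b a' b' del) as [d Hd].
  assert (l <= l - d).
  { apply Hl2. intros z [x [y [Hx [Hy ->]]]].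
    apply Rnot_lt_le. intros Hz. apply (Hd x y Hx Hy).
    intros [u [v [Hu [Hv [K1 [K2 K3]]]]]].
    destruct (Hdel u v Hu Hv) as [L1 L2].
    specialize (L2 x y Hx Hy K1 K2). apply Rabs_def2 in L2.
    lra. }
  pose proof (cond_pos d). lra.
Qed.

Lemma second_derivative_min f f1 (l x : R) : (exists d, 0 < d /\
    (forall y, Rabs (y - x) < d -> is_derive f y (f1 y)) /\
    (forall y, Rabs (y - x) < d -> f x <= f y)) ->
  is_derive f1 x l -> f1 x = 0 /\ 0 <= l.
Proof.
  intros [d [Hd [Hf Hmin]]] H2.
  assert (E : f1 x = 0).
  { assert (pr : derivable_pt f x).
    { exists (f1 x). apply is_derive_Reals. apply Hf. rewrite Rminus_diag, Rabs_R0. auto. }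
    rewrite <- (derive_pt_eq_0 f x (f1 x) pr).
    - apply deriv_minimum with (x - d) (x + d); try lra.
      intros y Hy1 Hy2. apply Hmin. apply Rabs_def1; lra.
    - apply is_derive_Reals. apply Hf. rewrite Rminus_diag, Rabs_R0. auto. }
  split; auto. apply Rnot_lt_le. intros Hneg.
  apply is_derive_Reals in H2.
  destruct (H2 (- l / 2) ltac:(lra)) as [e He].
  set (t := Rmin (d / 2) (e / 2)).
  assert (Ht : 0 < t) by (apply Rmin_pos; pose proof (cond_pos e); lra).
  assert (Ht1 : t <= d / 2) by apply Rmin_l.
  assert (Ht2 : t <= e / 2) by apply Rmin_r.
  destruct (MVT_closed f f1 x (x + t)) as [c [Hc Ec]]. lra.
  { intros y Hy. apply Hf. apply Rabs_def1; lra. }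
  { apply cont_in_continuous. intros y Hy. apply (ex_derive_continuous (V := R_NormedModule)).
    exists (f1 y). apply Hf. apply Rabs_def1; lra. }
  assert (f1 c < 0).
  { specialize (He (c - x) ltac:(lra)). rewrite Rabs_pos_eq in He by lra.
    pose proof (cond_pos e). specialize (He ltac:(lra)).
    replace (x + (c - x)) with c in He by ring. rewrite E in He.
    apply Rabs_def2 in He. destruct He as [He _].
    assert (f1 c / (c - x) < 0) by (replace (f1 c) with (f1 c - 0) by ring; lra).
    replace (f1 c) with (f1 c / (c - x) * (c - x)) by (field; lra).
    rewrite <- (Rmult_0_l (c - x)). apply Rmult_lt_compat_r; lra. }
  assert (f (x + t) - f x < 0).
  { rewrite Ec. replace (x + t - x) with t by ring. rewrite <- (Rmult_0_l t). apply Rmult_lt_compat_r; lra. }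
  specialize (Hmin (x + t)). replace (x + t - x) with t in Hmin by ring.
  rewrite Rabs_pos_eq in Hmin by lra. specialize (Hmin ltac:(lra)). lra.
Qed.

End one_variable.

(** * Functions on the strip and comparison on rectangles *)

Notation fun2 := (R -> R -> R).

(** Gateaux differentiability: derivatives along all lines, linear in the direction. The maximum
    principle tests second-order conditions along lines only, so this notion suffices for it, and it
    makes no demand of equality on the mixed derivatives. *)
Definition grad_at (f : fun2) (q p fq fp : R) : Prop :=
  forall a b, is_derive (fun t => f (q + t * a) (p + t * b)) 0 (a * fq + b * fp).

Definition D1 (f fq fp : fun2) : Prop :=
  forall q p, 0 < p < 1 -> grad_at f q p (fq q p) (fp q p).

Definition UC (f : fun2) : Prop := forall eps, 0 < eps -> exists d, 0 < d /\
  forall q p q' p', 0 <= p <= 1 -> 0 <= p' <= 1 -> Rabs (q' - q) < d -> Rabs (p' - p) < d ->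
    Rabs (f q' p' - f q p) < eps.

Definition BD (f : fun2) : Prop := exists M, forall q p, 0 <= p <= 1 -> Rabs (f q p) <= M.

Definition UCB (f : fun2) : Prop := UC f /\ BD f.

Definition Lip (f : fun2) : Prop := exists M, 0 < M /\ forall q p q' p',
  0 <= p <= 1 -> 0 <= p' <= 1 -> Rabs (f q' p' - f q p) <= M * (Rabs (q' - q) + Rabs (p' - p)).

Lemma is_derive_eq (f : R -> R) x (l l' : R) : is_derive f x l -> l = l' -> is_derive f x l'.
Proof. intros H <-. exact H. Qed.

Lemma is_derive_shift (f : R -> R) (t l : R) :
  is_derive f 0 l -> is_derive (fun s => f (s - t)) t l.
Proof.
  intros H. apply is_derive_eq with (scal 1 l).
  - apply (is_derive_comp f (fun s => s - t)). now rewrite Rminus_diag. auto_derive; auto; ring.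
  - unfold scal; simpl; unfold mult; simpl; ring.
Qed.

Lemma D1_line f fq fp q p a b t : D1 f fq fp -> 0 < p + t * b < 1 ->
  is_derive (fun s => f (q + s * a) (p + s * b)) t
    (a * fq (q + t * a) (p + t * b) + b * fp (q + t * a) (p + t * b)).
Proof.
  intros H Hp. specialize (H (q + t * a) (p + t * b) Hp a b).
  apply (is_derive_shift _ t) in H.
  eapply is_derive_ext; [|exact H]. intros s. simpl. f_equal; ring.
Qed.

Lemma D1_dq (f fq fp : fun2) (q p : R) : D1 f fq fp -> 0 < p < 1 -> is_derive (fun x => f x p) q (fq q p).
Proof.
  intros H Hp. pose proof (D1_line f fq fp 0 p 1 0 q H ltac:(lra)) as K.
  rewrite Rmult_0_r, Rplus_0_r, Rmult_1_r, Rplus_0_l in K.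
  apply is_derive_eq with (1 * fq q p + 0 * fp q p); [|ring].
  eapply is_derive_ext; [|exact K]. intros s. simpl. f_equal; ring.
Qed.

Lemma D1_dp (f fq fp : fun2) (q p : R) : D1 f fq fp -> 0 < p < 1 -> is_derive (fun x => f q x) p (fp q p).
Proof.
  intros H Hp. pose proof (D1_line f fq fp q 0 0 1 p H ltac:(lra)) as K.
  rewrite Rmult_0_r, Rplus_0_r, Rmult_1_r, Rplus_0_l in K.
  apply is_derive_eq with (0 * fq q p + 1 * fp q p); [|ring].
  eapply is_derive_ext; [|exact K]. intros s. simpl. f_equal; ring.
Qed.

Lemma grad_ext f g q p fq fp : 0 < p < 1 ->
  (forall q p, 0 <= p <= 1 -> f q p = g q p) -> grad_at f q p fq fp -> grad_at g q p fq fp.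
Proof.
  intros Hp E H a b. eapply is_derive_ext_loc; [|exact (H a b)].
  assert (He : 0 < Rmin p (1 - p) / (1 + Rabs b)).
  { apply Rdiv_lt_0_compat. apply Rmin_pos; lra. pose proof (Rabs_pos b); lra. }
  exists (mkposreal _ He). intros t Ht. apply E.
  change (Rabs (t - 0) < Rmin p (1 - p) / (1 + Rabs b)) in Ht.
  rewrite Rminus_0_r in Ht.
  assert (Hb : Rabs (t * b) <= Rmin p (1 - p)).
  { rewrite Rabs_mult. apply Rle_trans with (Rabs t * (1 + Rabs b)).
    apply Rmult_le_compat_l. apply Rabs_pos. lra.
    apply Rle_trans with (Rmin p (1 - p) / (1 + Rabs b) * (1 + Rabs b)).
    apply Rmult_le_compat_r. pose proof (Rabs_pos b); lra. lra.
    right. field. pose proof (Rabs_pos b); lra. }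
  pose proof (Rmin_l p (1 - p)). pose proof (Rmin_r p (1 - p)).
  apply Rabs_le_between in Hb. lra.
Qed.

Lemma at_line (f : fun2) q p a b : f (q + 0 * a) (p + 0 * b) = f q p.
Proof. f_equal; ring. Qed.

Lemma grad_plus f g q p fq fp gq gp : grad_at f q p fq fp -> grad_at g q p gq gp ->
  grad_at (fun q p => f q p + g q p) q p (fq + gq) (fp + gp).
Proof.
  intros H1 H2 a b. eapply is_derive_eq.
  apply (is_derive_plus (V := R_NormedModule) _ _ _ _ _ (H1 a b) (H2 a b)).
  unfold plus; simpl; ring.
Qed.

Lemma grad_mult f g q p fq fp gq gp : grad_at f q p fq fp -> grad_at g q p gq gp ->
  grad_at (fun q p => f q p * g q p) q p (fq * g q p + f q p * gq) (fp * g q p + f q p * gp).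
Proof.
  intros H1 H2 a b. eapply is_derive_eq.
  apply (is_derive_mult (K := R_AbsRing) _ _ _ _ _ (H1 a b) (H2 a b)).
  intros; apply Rmult_comm. simpl. rewrite !at_line. unfold plus, mult; simpl; ring.
Qed.

Lemma grad_inv f q p fq fp : f q p <> 0 -> grad_at f q p fq fp ->
  grad_at (fun q p => / f q p) q p (- fq / f q p ^ 2) (- fp / f q p ^ 2).
Proof.
  intros H0 H a b. eapply is_derive_eq.
  apply (is_derive_inv _ _ _ (H a b)). now rewrite at_line. rewrite at_line. field. auto.
Qed.

Lemma grad_const c q p : grad_at (fun _ _ => c) q p 0 0.
Proof. intros a b. eapply is_derive_eq. apply (is_derive_const (V := R_NormedModule)). unfold zero; simpl; ring. Qed.

Lemma grad_p (f : R -> R) (q p l : R) : is_derive f p l -> grad_at (fun _ p => f p) q p 0 l.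
Proof.
  intros H a b. eapply is_derive_eq.
  apply (is_derive_comp f (fun t => p + t * b) 0 l b).
  replace (p + 0 * b) with p by ring. exact H. auto_derive; auto; ring.
  unfold scal; simpl; unfold mult; simpl; ring.
Qed.

Lemma grad_q (f : R -> R) (q p l : R) : is_derive f q l -> grad_at (fun q _ => f q) q p l 0.
Proof.
  intros H a b. eapply is_derive_eq.
  apply (is_derive_comp f (fun t => q + t * a) 0 l a).
  replace (q + 0 * a) with q by ring. exact H. auto_derive; auto; ring.
  unfold scal; simpl; unfold mult; simpl; ring.
Qed.

Lemma grad_eq f q p fq fp gq gp : grad_at f q p fq fp -> fq = gq -> fp = gp -> grad_at f q p gq gp.
Proof. intros H <- <-. exact H. Qed.

Lemma grad_reflect f lam q p fq fp : grad_at f (2 * lam - q) p fq fp ->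
  grad_at (fun q p => f (2 * lam - q) p) q p (- fq) fp.
Proof.
  intros H a b. apply is_derive_eq with ((- a) * fq + b * fp); [|ring].
  eapply is_derive_ext; [|exact (H (- a) b)]. intros t. simpl. f_equal; ring.
Qed.

Lemma UC_ext f g : (forall q p, 0 <= p <= 1 -> f q p = g q p) -> UC f -> UC g.
Proof.
  intros E H eps Heps. destruct (H eps Heps) as [d [Hd Hd']]. exists d. split; auto.
  intros q p q' p' Hp Hp' K1 K2. rewrite <- !E by auto. now apply Hd'.
Qed.

Lemma UCB_ext f g : (forall q p, 0 <= p <= 1 -> f q p = g q p) -> UCB f -> UCB g.
Proof.
  intros E [H [M HM]]. split. now apply UC_ext with f. exists M. intros q p Hp. rewrite <- E; auto.
Qed.

Lemma BD_pos f : BD f -> exists M, 0 < M /\ forall q p, 0 <= p <= 1 -> Rabs (f q p) <= M.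
Proof.
  intros [M HM]. exists (M + 1). assert (0 <= M).
  { eapply Rle_trans. apply Rabs_pos. apply (HM 0 0). lra. }
  split. lra. intros q p Hp. specialize (HM q p Hp). lra.
Qed.

Lemma UCB_plus f g : UCB f -> UCB g -> UCB (fun q p => f q p + g q p).
Proof.
  intros [H1 [M1 B1]] [H2 [M2 B2]]. split.
  - intros eps Heps. destruct (H1 (eps/2) ltac:(lra)) as [d1 [Hd1 K1]].
    destruct (H2 (eps/2) ltac:(lra)) as [d2 [Hd2 K2]].
    exists (Rmin d1 d2). split. now apply Rmin_pos. intros q p q' p' Hp Hp' L1 L2.
    pose proof (Rmin_l d1 d2). pose proof (Rmin_r d1 d2).
    specialize (K1 q p q' p' Hp Hp' ltac:(lra) ltac:(lra)).
    specialize (K2 q p q' p' Hp Hp' ltac:(lra) ltac:(lra)).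
    replace (f q' p' + g q' p' - (f q p + g q p)) with ((f q' p' - f q p) + (g q' p' - g q p)) by ring.
    eapply Rle_lt_trans. apply Rabs_triang. lra.
  - exists (M1 + M2). intros q p Hp. eapply Rle_trans. apply Rabs_triang.
    specialize (B1 q p Hp). specialize (B2 q p Hp). lra.
Qed.

Lemma UCB_mult f g : UCB f -> UCB g -> UCB (fun q p => f q p * g q p).
Proof.
  intros [H1 B1] [H2 B2]. destruct (BD_pos f B1) as [M1 [P1 B1']]. destruct (BD_pos g B2) as [M2 [P2 B2']].
  split.
  - intros eps Heps.
    destruct (H1 (eps/(2*M2))) as [d1 [Hd1 K1]]. apply Rdiv_lt_0_compat; lra.
    destruct (H2 (eps/(2*M1))) as [d2 [Hd2 K2]]. apply Rdiv_lt_0_compat; lra.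
    exists (Rmin d1 d2). split. now apply Rmin_pos. intros q p q' p' Hp Hp' L1 L2.
    pose proof (Rmin_l d1 d2). pose proof (Rmin_r d1 d2).
    specialize (K1 q p q' p' Hp Hp' ltac:(lra) ltac:(lra)).
    specialize (K2 q p q' p' Hp Hp' ltac:(lra) ltac:(lra)).
    replace (f q' p' * g q' p' - f q p * g q p)
      with ((f q' p' - f q p) * g q' p' + f q p * (g q' p' - g q p)) by ring.
    eapply Rle_lt_trans. apply Rabs_triang. rewrite !Rabs_mult.
    specialize (B1' q p Hp). specialize (B2' q' p' Hp').
    assert (Rabs (f q' p' - f q p) * Rabs (g q' p') <= Rabs (f q' p' - f q p) * M2).
    { apply Rmult_le_compat_l; auto. apply Rabs_pos. }
    assert (Rabs (f q' p' - f q p) * M2 < eps / (2 * M2) * M2) by (apply Rmult_lt_compat_r; auto).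
    assert (Rabs (f q p) * Rabs (g q' p' - g q p) <= M1 * Rabs (g q' p' - g q p)).
    { apply Rmult_le_compat_r; auto. apply Rabs_pos. }
    assert (M1 * Rabs (g q' p' - g q p) < M1 * (eps / (2 * M1))) by (apply Rmult_lt_compat_l; auto).
    replace (eps / (2 * M2) * M2) with (eps / 2) in * by (field; lra).
    replace (M1 * (eps / (2 * M1))) with (eps / 2) in * by (field; lra). lra.
  - exists (M1 * M2). intros q p Hp. rewrite Rabs_mult. apply Rmult_le_compat; auto; apply Rabs_pos.
Qed.

Lemma UCB_inv f c : 0 < c -> (forall q p, 0 <= p <= 1 -> c <= f q p) -> UCB f -> UCB (fun q p => / f q p).
Proof.
  intros Hc Hf [H B]. split.
  - intros eps Heps. destruct (H (eps * c * c)) as [d [Hd K]].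
    { repeat apply Rmult_lt_0_compat; auto. }
    exists d. split; auto. intros q p q' p' Hp Hp' L1 L2.
    specialize (K q p q' p' Hp Hp' L1 L2). pose proof (Hf q p Hp). pose proof (Hf q' p' Hp').
    replace (/ f q' p' - / f q p) with ((f q p - f q' p') * / (f q' p' * f q p)) by (field; lra).
    rewrite Rabs_mult, (Rabs_minus_sym (f q p)).
    assert (0 < f q' p' * f q p) by (apply Rmult_lt_0_compat; lra).
    rewrite (Rabs_pos_eq (/ _)) by (left; now apply Rinv_0_lt_compat).
    apply Rmult_lt_reg_r with (f q' p' * f q p); auto. rewrite Rmult_assoc, Rinv_l, Rmult_1_r by lra.
    eapply Rlt_le_trans. apply K. rewrite Rmult_assoc. apply Rmult_le_compat_l. lra.
    apply Rmult_le_compat; lra.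
  - exists (/ c). intros q p Hp. specialize (Hf q p Hp). rewrite Rabs_pos_eq.
    apply Rinv_le_contravar; lra. left. apply Rinv_0_lt_compat. lra.
Qed.

Lemma UCB_p (f : R -> R) : cont_in 0 1 f -> UCB (fun _ p => f p).
Proof.
  intros H. split.
  - intros eps Heps. destruct (cont_in_unif 0 1 f ltac:(lra) H eps Heps) as [d [Hd Hd']].
    exists d. split; auto.
  - destruct (cont_in_bounded 0 1 f ltac:(lra) H) as [M HM]. exists M. auto.
Qed.

Lemma UCB_const c : UCB (fun _ _ => c).
Proof. apply (UCB_p (fun _ => c)). apply cont_in_const. Qed.

Lemma UCB_reflect f lam : UCB f -> UCB (fun q p => f (2 * lam - q) p).
Proof.
  intros [H [M B]]. split.
  - intros eps Heps. destruct (H eps Heps) as [d [Hd K]]. exists d. split; auto.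
    intros q p q' p' Hp Hp' L1 L2. apply K; auto.
    replace (2 * lam - q' - (2 * lam - q)) with (- (q' - q)) by ring. now rewrite Rabs_Ropp.
  - exists M. auto.
Qed.

Lemma UC_cont_in f q : UC f -> cont_in 0 1 (f q).
Proof.
  intros H p Hp eps Heps. destruct (H eps Heps) as [d [Hd K]]. exists d. split; auto.
  intros p' Hp' L. apply K; auto. now rewrite Rminus_diag, Rabs_R0.
Qed.

Lemma UC_diff f g : UC f -> UC g -> UC (fun q p => f q p - g q p).
Proof.
  intros H1 H2. intros eps Heps. destruct (H1 (eps/2) ltac:(lra)) as [d1 [Hd1 K1]].
  destruct (H2 (eps/2) ltac:(lra)) as [d2 [Hd2 K2]].
  exists (Rmin d1 d2). split. now apply Rmin_pos. intros q p q' p' Hp Hp' L1 L2.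
  pose proof (Rmin_l d1 d2). pose proof (Rmin_r d1 d2).
  specialize (K1 q p q' p' Hp Hp' ltac:(lra) ltac:(lra)).
  specialize (K2 q p q' p' Hp Hp' ltac:(lra) ltac:(lra)).
  apply Rabs_def2 in K1. apply Rabs_def2 in K2. apply Rabs_def1; lra.
Qed.

(** Class C^1 up to the boundary of the strip. The gradient is required in the open strip; at
    [p = 0] and [p = 1] the functions [fq], [fp] are its continuous extensions. Uniformity in [q]
    stands in for compactness of translates. *)
Record C1s (f fq fp : fun2) : Prop := {
  C1_D : D1 f fq fp; C1_f : UCB f; C1_q : UCB fq; C1_p : UCB fp }.

Lemma C1s_ext f fq fp g gq gp : C1s f fq fp ->
  (forall q p, 0 <= p <= 1 -> f q p = g q p /\ fq q p = gq q p /\ fp q p = gp q p) -> C1s g gq gp.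
Proof.
  intros [D Hf Hq Hp] E. split.
  - intros q p H. destruct (E q p ltac:(lra)) as [_ [<- <-]].
    apply grad_ext with f; auto. intros; now apply E.
  - apply UCB_ext with f; auto. intros; now apply E.
  - apply UCB_ext with fq; auto. intros; now apply E.
  - apply UCB_ext with fp; auto. intros; now apply E.
Qed.

Lemma C1s_plus f fq fp g gq gp : C1s f fq fp -> C1s g gq gp ->
  C1s (fun q p => f q p + g q p) (fun q p => fq q p + gq q p) (fun q p => fp q p + gp q p).
Proof.
  intros [D1' ? ? ?] [D2' ? ? ?]. split; try (now apply UCB_plus).
  intros q p H. apply grad_plus; auto.
Qed.

Lemma C1s_mult f fq fp g gq gp : C1s f fq fp -> C1s g gq gp ->
  C1s (fun q p => f q p * g q p) (fun q p => fq q p * g q p + f q p * gq q p)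
      (fun q p => fp q p * g q p + f q p * gp q p).
Proof.
  intros [D1' ? ? ?] [D2' ? ? ?]. split; try (repeat first [apply UCB_plus | apply UCB_mult]; assumption).
  intros q p H. apply grad_mult; auto.
Qed.

Lemma C1s_inv f fq fp c : 0 < c -> (forall q p, 0 <= p <= 1 -> c <= f q p) -> C1s f fq fp ->
  C1s (fun q p => / f q p) (fun q p => - fq q p / f q p ^ 2) (fun q p => - fp q p / f q p ^ 2).
Proof.
  intros Hc Hf [D ? ? ?].
  assert (HI : UCB (fun q p => / f q p)) by (now apply UCB_inv with c).
  split; auto.
  - intros q p H. apply grad_inv; auto. specialize (Hf q p ltac:(lra)). lra.
  - apply UCB_ext with (fun q p => (-1) * fq q p * (/ f q p * / f q p)).
    + intros q p Hp. specialize (Hf q p Hp). field. lra.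
    + repeat apply UCB_mult; auto. apply UCB_const.
  - apply UCB_ext with (fun q p => (-1) * fp q p * (/ f q p * / f q p)).
    + intros q p Hp. specialize (Hf q p Hp). field. lra.
    + repeat apply UCB_mult; auto. apply UCB_const.
Qed.

Lemma C1s_p (f f' : R -> R) : cont_in 0 1 f -> cont_in 0 1 f' ->
  (forall p, 0 < p < 1 -> is_derive f p (f' p)) -> C1s (fun _ p => f p) (fun _ _ => 0) (fun _ p => f' p).
Proof.
  intros H1 H2 H3. split; try (now apply UCB_p). intros q p Hp. apply grad_p; auto. apply UCB_const.
Qed.

Lemma C1s_const c : C1s (fun _ _ => c) (fun _ _ => 0) (fun _ _ => 0).
Proof. split; try apply UCB_const. intros q p _. apply grad_const. Qed.

Lemma C1s_reflect f fq fp lam : C1s f fq fp ->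
  C1s (fun q p => f (2 * lam - q) p) (fun q p => - fq (2 * lam - q) p) (fun q p => fp (2 * lam - q) p).
Proof.
  intros [D ? ? ?]. split; try (now apply UCB_reflect).
  - intros q p Hp. apply grad_reflect. now apply D.
  - apply UCB_ext with (fun q p => (-1) * fq (2 * lam - q) p). intros; ring.
    apply UCB_mult. apply UCB_const. now apply UCB_reflect.
Qed.

Lemma C1s_scal f fq fp c : C1s f fq fp ->
  C1s (fun q p => c * f q p) (fun q p => c * fq q p) (fun q p => c * fp q p).
Proof.
  intros H. eapply C1s_ext. apply C1s_mult. apply (C1s_const c). exact H. simpl. intros. repeat split; ring.
Qed.

Lemma C1s_minus f fq fp g gq gp : C1s f fq fp -> C1s g gq gp ->
  C1s (fun q p => f q p - g q p) (fun q p => fq q p - gq q p) (fun q p => fp q p - gp q p).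
Proof.
  intros H1 H2. eapply C1s_ext. apply C1s_plus. exact H1. apply (C1s_scal _ _ _ (-1) H2).
  simpl. intros. repeat split; ring.
Qed.

(** On interior lines the mean value theorem gives a bound [eps / 2 * |s|] for the first-order
    remainder, with a step independent of [p]; the bound passes to the closure in [p], so tangential
    derivatives exist on the boundary lines too. *)
Lemma C1s_dq (f fq fp : fun2) (q p : R) : C1s f fq fp -> 0 <= p <= 1 -> is_derive (fun x => f x p) q (fq q p).
Proof.
  intros [D [Hf _] [Hq _] _] Hp. apply is_derive_Reals. intros eps Heps.
  destruct (Hq (eps/2) ltac:(lra)) as [d [Hd K]].
  exists (mkposreal d Hd). simpl. intros s Hs0 Hs.
  assert (Hb : Rabs (f (q + s) p - f q p - s * fq q p) <= eps / 2 * Rabs s).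
  { apply le_closure with (F := fun p => Rabs (f (q + s) p - f q p - s * fq q p)); auto.
    - apply (cont_in_comp 0 1 (fun p => f (q + s) p - f q p - s * fq q p) Rabs). lra.
      + repeat apply cont_in_minus; try lra; try (now apply UC_cont_in).
        apply cont_in_mult. lra. apply cont_in_const. now apply UC_cont_in.
      + intros. apply continuous_Rabs.
    - intros p' Hp'.
      destruct (MVT_gen (fun x => f x p') q (q + s) (fun x => fq x p')) as [c [Hc E]].
      + intros x _. exact (D1_dq f fq fp x p' D Hp').
      + intros x _. exact (is_derive_continuity_pt _ _ _ (D1_dq f fq fp x p' D Hp')).
      + replace (f (q + s) p' - f q p' - s * fq q p') with ((fq c p' - fq q p') * s) by nra.
        rewrite Rabs_mult. apply Rmult_le_compat_r. apply Rabs_pos. left. apply K; try lra.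
        * eapply Rle_lt_trans; [|exact Hs]. revert Hc. unfold Rmin, Rmax, Rabs.
          repeat destruct Rle_dec; repeat destruct Rcase_abs; lra.
        * now rewrite Rminus_diag, Rabs_R0. }
  replace ((f (q + s) p - f q p) / s - fq q p) with ((f (q + s) p - f q p - s * fq q p) / s) by (field; auto).
  unfold Rdiv. rewrite Rabs_mult, Rabs_inv. assert (0 < Rabs s) by (now apply Rabs_pos_lt).
  apply Rmult_lt_reg_r with (Rabs s); auto. rewrite Rmult_assoc, Rinv_l, Rmult_1_r by lra.
  eapply Rle_lt_trans. apply Hb. apply Rmult_lt_compat_r; lra.
Qed.

Lemma C1s_MVTq f fq fp q q' p : C1s f fq fp -> 0 <= p <= 1 ->
  exists c, Rmin q q' <= c <= Rmax q q' /\ f q' p - f q p = fq c p * (q' - q).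
Proof.
  intros H Hp. apply (MVT_gen (fun x => f x p) q q' (fun x => fq x p)).
  - intros x _. exact (C1s_dq f fq fp x p H Hp).
  - intros x _. exact (is_derive_continuity_pt _ _ _ (C1s_dq f fq fp x p H Hp)).
Qed.

Lemma C1s_MVTp f fq fp q p p' : C1s f fq fp -> 0 <= p <= 1 -> 0 <= p' <= 1 ->
  exists c, Rmin p p' <= c <= Rmax p p' /\ f q p' - f q p = fp q c * (p' - p).
Proof.
  intros [D [Hf _] _ _] Hp Hp'.
  destruct (Rtotal_order p p') as [L|[->|L]].
  - destruct (MVT_closed (f q) (fp q) p p' L) as [c [Hc E]].
    + intros x Hx. apply (D1_dp f fq fp); auto; lra.
    + apply cont_in_sub with 0 1; try lra. now apply UC_cont_in.
    + exists c. rewrite Rmin_left, Rmax_right by lra. split; lra.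
  - exists p'. rewrite Rmin_left, Rmax_right by lra. split; lra.
  - destruct (MVT_closed (f q) (fp q) p' p L) as [c [Hc E]].
    + intros x Hx. apply (D1_dp f fq fp); auto; lra.
    + apply cont_in_sub with 0 1; try lra. now apply UC_cont_in.
    + exists c. rewrite Rmin_right, Rmax_left by lra. split; lra.
Qed.

Lemma between_abs a b c : Rmin a b <= c <= Rmax a b -> Rabs (c - a) <= Rabs (b - a).
Proof. unfold Rmin, Rmax, Rabs. repeat destruct Rle_dec; repeat destruct Rcase_abs; lra. Qed.

Lemma between_in a b c l u : l <= a <= u -> l <= b <= u -> Rmin a b <= c <= Rmax a b -> l <= c <= u.
Proof. unfold Rmin, Rmax. repeat destruct Rle_dec; lra. Qed.

Lemma C1s_Lip f fq fp : C1s f fq fp -> Lip f.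
Proof.
  intros H. destruct (BD_pos fq (proj2 (C1_q _ _ _ H))) as [M1 [P1 B1]].
  destruct (BD_pos fp (proj2 (C1_p _ _ _ H))) as [M2 [P2 B2]].
  exists (M1 + M2). split. lra. intros q p q' p' Hp Hp'.
  destruct (C1s_MVTq f fq fp q q' p' H Hp') as [c [_ E1]].
  destruct (C1s_MVTp f fq fp q p p' H Hp Hp') as [c' [Hc' E2]].
  replace (f q' p' - f q p) with ((f q' p' - f q p') + (f q p' - f q p)) by ring.
  rewrite E1, E2. eapply Rle_trans. apply Rabs_triang. rewrite !Rabs_mult.
  specialize (B1 c p' Hp'). specialize (B2 q c' (between_in _ _ _ _ _ Hp Hp' Hc')).
  pose proof (Rabs_pos (q' - q)). pose proof (Rabs_pos (p' - p)).
  pose proof (Rabs_pos (fq c p')). pose proof (Rabs_pos (fp q c')). nra.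
Qed.

(** One constant serves the whole closed strip. This quadratic remainder is what converts barrier
    estimates for values into bounds for boundary derivatives. *)
Lemma C1s_taylor f fq fp : C1s f fq fp -> Lip fq -> Lip fp -> exists M, 0 < M /\
  forall q p q' p', 0 <= p <= 1 -> 0 <= p' <= 1 ->
    Rabs (f q' p' - f q p - fq q p * (q' - q) - fp q p * (p' - p))
      <= M * (Rabs (q' - q) + Rabs (p' - p)) ^ 2.
Proof.
  intros H [M1 [P1 L1]] [M2 [P2 L2]]. exists (M1 + M2). split. lra. intros q p q' p' Hp Hp'.
  destruct (C1s_MVTq f fq fp q q' p' H Hp') as [c [Hc E1]].
  destruct (C1s_MVTp f fq fp q p p' H Hp Hp') as [c' [Hc' E2]].
  pose proof (between_in _ _ _ _ _ Hp Hp' Hc') as I'.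
  replace (f q' p' - f q p - fq q p * (q' - q) - fp q p * (p' - p))
    with ((fq c p' - fq q p) * (q' - q) + (fp q c' - fp q p) * (p' - p)) by nra.
  eapply Rle_trans. apply Rabs_triang. rewrite !Rabs_mult.
  specialize (L1 q p c p' Hp Hp'). specialize (L2 q p q c' Hp I').
  apply between_abs in Hc. apply between_abs in Hc'.
  rewrite Rminus_diag, Rabs_R0 in L2.
  set (X := Rabs (q' - q)) in *. set (Y := Rabs (p' - p)) in *.
  assert (0 <= X) by apply Rabs_pos. assert (0 <= Y) by apply Rabs_pos.
  assert (Rabs (fq c p' - fq q p) <= M1 * (X + Y)) by (eapply Rle_trans; [apply L1|]; apply Rmult_le_compat_l; lra).
  assert (Rabs (fp q c' - fp q p) <= M2 * (X + Y)).
  { eapply Rle_trans; [apply L2|]; apply Rmult_le_compat_l; lra. }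
  apply Rle_trans with (M1 * (X + Y) * X + M2 * (X + Y) * Y).
  apply Rplus_le_compat; apply Rmult_le_compat_r; auto.
  assert (0 <= M1 * (X + Y) * Y) by (apply Rmult_le_pos; auto; apply Rmult_le_pos; lra).
  assert (0 <= M2 * (X + Y) * X) by (apply Rmult_le_pos; auto; apply Rmult_le_pos; lra). nra.
Qed.

(** At a minimum the second derivatives in the directions [(1, B)] and [(0, 1)] are nonnegative; the
    first plus [A - B^2] times the second is the elliptic operator. *)
Lemma interior_min f fq fp fqq fqp fpq fpp q p d A B :
  D1 f fq fp -> D1 fq fqq fqp -> D1 fp fpq fpp -> 0 < p < 1 -> 0 < d ->
  (forall q' p', Rabs (q' - q) < d -> Rabs (p' - p) < d -> f q p <= f q' p') -> B ^ 2 <= A ->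
  fq q p = 0 /\ fp q p = 0 /\ 0 <= fqq q p + B * (fqp q p + fpq q p) + A * fpp q p.
Proof.
  intros H0 H1 H2 Hp Hd Hmin HAB.
  assert (Key : forall a b, a * fq q p + b * fp q p = 0 /\
     0 <= a * (a * fqq q p + b * fqp q p) + b * (a * fpq q p + b * fpp q p)).
  { intros a b.
    set (e := Rmin d (Rmin p (1 - p)) / (1 + Rabs a + Rabs b)).
    pose proof (Rabs_pos a). pose proof (Rabs_pos b).
    assert (He0 : 0 < Rmin d (Rmin p (1 - p))) by (repeat apply Rmin_pos; lra).
    assert (He : 0 < e) by (apply Rdiv_lt_0_compat; lra).
    assert (Hsm : forall t, Rabs t < e -> Rabs (t * a) < Rmin d (Rmin p (1 - p)) /\ Rabs (t * b) < Rmin d (Rmin p (1 - p))).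
    { intros t Ht.
      assert (Rabs t * (1 + Rabs a + Rabs b) < Rmin d (Rmin p (1 - p))).
      { apply Rlt_le_trans with (e * (1 + Rabs a + Rabs b)). apply Rmult_lt_compat_r; lra.
        unfold e. right. field. lra. }
      rewrite !Rabs_mult. pose proof (Rabs_pos t). split; nra. }
    pose proof (Rmin_l d (Rmin p (1 - p))). pose proof (Rmin_r d (Rmin p (1 - p))).
    pose proof (Rmin_l p (1 - p)). pose proof (Rmin_r p (1 - p)).
    destruct (second_derivative_min (fun t => f (q + t * a) (p + t * b))
      (fun t => a * fq (q + t * a) (p + t * b) + b * fp (q + t * a) (p + t * b))
      (a * (a * fqq q p + b * fqp q p) + b * (a * fpq q p + b * fpp q p)) 0) as [K1 K2].
    - exists e. split; auto. split.
      + intros y Hy. rewrite Rminus_0_r in Hy. apply D1_line; auto.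
        destruct (Hsm y Hy) as [_ Hb]. apply Rabs_def2 in Hb. lra.
      + intros y Hy. rewrite Rminus_0_r in Hy. rewrite at_line.
        destruct (Hsm y Hy) as [Ha Hb]. apply Hmin.
        replace (q + y * a - q) with (y * a) by ring. lra.
        replace (p + y * b - p) with (y * b) by ring. lra.
    - apply (is_derive_plus (V := R_NormedModule)
        (fun t => a * fq (q + t * a) (p + t * b)) (fun t => b * fp (q + t * a) (p + t * b))).
      + apply is_derive_scal. now apply H1.
      + apply is_derive_scal. now apply H2.
    - rewrite !at_line in K1. auto. }
  destruct (Key 1 0) as [K1 _]. destruct (Key 0 1) as [K2 K3]. destruct (Key 1 B) as [_ K4].
  repeat split; try lra. nra.
Qed.

(** * Elliptic differential inequalities and comparison with explicit barriers *)

Definition coef (A B : fun2) (c0 A1 : R) : Prop :=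
  0 < c0 /\ forall q p, 0 < p < 1 -> c0 <= A q p - B q p ^ 2 /\ A q p <= A1.

(** Only the gradient stands on the right: constants satisfy the inequality, [g] and [- g] satisfy
    it together, and comparison requires no sign of a zero-order coefficient. *)
Definition ell (g A B : fun2) (K : R) : Prop :=
  0 <= K /\ UC g /\ exists gq gp gqq gqp gpq gpp, D1 g gq gp /\ D1 gq gqq gqp /\ D1 gp gpq gpp /\
  forall q p, 0 < p < 1 ->
    Rabs (gqq q p + B q p * (gqp q p + gpq q p) + A q p * gpp q p) <= K * (Rabs (gq q p) + Rabs (gp q p)).

Lemma ell_opp g A B K : ell g A B K -> ell (fun q p => - g q p) A B K.
Proof.
  intros [HK [HU [gq [gp [gqq [gqp [gpq [gpp [H1 [H2 [H3 H4]]]]]]]]]]].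
  assert (HN : forall f fq fp, D1 f fq fp -> D1 (fun q p => - f q p) (fun q p => - fq q p) (fun q p => - fp q p)).
  { intros f fq fp H q p Hp a b. apply is_derive_eq with (opp (a * fq q p + b * fp q p)).
    apply (is_derive_opp (V := R_NormedModule)). now apply H. unfold opp; simpl; ring. }
  split; auto. split.
  - apply UC_ext with (fun q p => 0 - g q p). intros; ring.
    apply UC_diff; auto. apply UCB_const.
  - do 6 eexists. split; [apply HN, H1|split; [apply HN, H2|split; [apply HN, H3|]]].
    intros q p Hp. simpl. rewrite !Rabs_Ropp. specialize (H4 q p Hp).
    rewrite <- Rabs_Ropp in H4. eapply Rle_trans; [|exact H4]. right. f_equal. ring.
Qed.

(** At a negative interior minimum of [g] minus the barrier the two gradients agree, so the bound in
    [ell], evaluated with the gradient of the barrier, contradicts the strict inequality assumed of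
    it. The form F(q) G(p) + P(q) covers all the barriers below. *)
Lemma rect_cmp g A B c0 A1 K q1 q2 p1 p2 (F F1 F2 G G1 G2 P P1 P2 : R -> R) :
  coef A B c0 A1 -> ell g A B K -> q1 < q2 -> 0 <= p1 -> p1 < p2 -> p2 <= 1 ->
  (forall q, is_derive F q (F1 q) /\ is_derive F1 q (F2 q) /\ is_derive P q (P1 q) /\ is_derive P1 q (P2 q)) ->
  (forall p, is_derive G p (G1 p) /\ is_derive G1 p (G2 p)) ->
  (forall q p, q1 < q < q2 -> p1 < p < p2 ->
     K * (Rabs (F1 q * G p + P1 q) + Rabs (F q * G1 p))
       < F2 q * G p + 2 * B q p * (F1 q * G1 p) + A q p * (F q * G2 p) + P2 q) ->
  (forall q, q1 <= q <= q2 -> F q * G p1 + P q <= g q p1 /\ F q * G p2 + P q <= g q p2) ->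
  (forall p, p1 <= p <= p2 -> F q1 * G p + P q1 <= g q1 p /\ F q2 * G p + P q2 <= g q2 p) ->
  forall q p, q1 <= q <= q2 -> p1 <= p <= p2 -> F q * G p + P q <= g q p.
Proof.
  intros [Hc0 HC] [HK [HU [gq [gp [gqq [gqp [gpq [gpp [H1 [H2 [H3 H4]]]]]]]]]]] Hq Hp1 Hp12 Hp2 HF HG HS HB1 HB2.
  assert (ZD : forall q p, grad_at (fun q p => F q * G p + P q) q p (F1 q * G p + P1 q) (F q * G1 p)).
  { intros q p. destruct (HF q) as [a1 [a2 [a3 a4]]]. destruct (HG p) as [b1 b2].
    eapply grad_eq. exact (grad_plus _ _ _ _ _ _ _ _ (grad_mult _ _ _ _ _ _ _ _ (grad_q F q p _ a1) (grad_p G q p _ b1)) (grad_q P q p _ a3)).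
    simpl; ring. simpl; ring. }
  assert (ZD1 : forall q p, grad_at (fun q p => F1 q * G p + P1 q) q p (F2 q * G p + P2 q) (F1 q * G1 p)).
  { intros q p. destruct (HF q) as [a1 [a2 [a3 a4]]]. destruct (HG p) as [b1 b2].
    eapply grad_eq. exact (grad_plus _ _ _ _ _ _ _ _ (grad_mult _ _ _ _ _ _ _ _ (grad_q F1 q p _ a2) (grad_p G q p _ b1)) (grad_q P1 q p _ a4)).
    simpl; ring. simpl; ring. }
  assert (ZD2 : forall q p, grad_at (fun q p => F q * G1 p) q p (F1 q * G1 p) (F q * G2 p)).
  { intros q p. destruct (HF q) as [a1 [a2 [a3 a4]]]. destruct (HG p) as [b1 b2].
    eapply grad_eq. exact (grad_mult _ _ _ _ _ _ _ _ (grad_q F q p _ a1) (grad_p G1 q p _ b2)).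
    simpl; ring. simpl; ring. }
  assert (sub : forall f fq fp z zq zp q p, grad_at f q p fq fp -> grad_at z q p zq zp ->
     grad_at (fun q p => f q p - z q p) q p (fq - zq) (fp - zp)).
  { intros f fq fp z zq zp q p K1 K2 a b. eapply is_derive_eq.
    apply (is_derive_minus (V := R_NormedModule) _ _ _ _ _ (K1 a b) (K2 a b)).
    unfold minus, plus, opp; simpl; ring. }
  set (f := fun q p => g q p - (F q * G p + P q)).
  intros q p Hqq Hpp. apply Rnot_lt_le. intros Hneg.
  destruct (min_rect f q1 q2 p1 p2) as [x0 [y0 [Hx0 [Hy0 Hmin]]]]; try lra.
  { intros x y Hx Hy eps Heps.
    assert (CF : continuous F x) by (destruct (HF x) as [a1 [a2 [a3 a4]]]; eapply is_derive_cont; eassumption).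
    assert (CP : continuous P x) by (destruct (HF x) as [a1 [a2 [a3 a4]]]; eapply is_derive_cont; eassumption).
    assert (CG : continuous G y) by (destruct (HG y) as [b1 b2]; eapply is_derive_cont; eassumption).
    destruct (HU (eps/4) ltac:(lra)) as [d1 [Hd1 K1]].
    destruct (epsd_continuous P x CP (eps/4) ltac:(lra)) as [d2 [Hd2 K2]].
    assert (0 < eps / (4 * (1 + Rabs (G y) + Rabs (F x)))).
    { apply Rdiv_lt_0_compat; auto. pose proof (Rabs_pos (G y)). pose proof (Rabs_pos (F x)). lra. }
    set (e1 := Rmin 1 (eps / (4 * (1 + Rabs (G y) + Rabs (F x))))).
    assert (He1 : 0 < e1) by (apply Rmin_pos; lra).
    destruct (epsd_continuous F x CF e1 He1) as [d3 [Hd3 K3]].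
    destruct (epsd_continuous G y CG e1 He1) as [d4 [Hd4 K4]].
    exists (Rmin (Rmin d1 d2) (Rmin d3 d4)). split. repeat apply Rmin_pos; auto.
    intros x' y' Hx' Hy' L1 L2.
    pose proof (Rmin_l (Rmin d1 d2) (Rmin d3 d4)). pose proof (Rmin_r (Rmin d1 d2) (Rmin d3 d4)).
    pose proof (Rmin_l d1 d2). pose proof (Rmin_r d1 d2). pose proof (Rmin_l d3 d4). pose proof (Rmin_r d3 d4).
    specialize (K1 x y x' y' ltac:(lra) ltac:(lra) ltac:(lra) ltac:(lra)).
    specialize (K2 x' ltac:(lra)). specialize (K3 x' ltac:(lra)). specialize (K4 y' ltac:(lra)).
    assert (KF : Rabs (F x' * G y' - F x * G y) <= e1 * (1 + Rabs (G y) + Rabs (F x))).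
    { replace (F x' * G y' - F x * G y) with
        ((F x' - F x) * (G y' - G y) + (F x' - F x) * G y + F x * (G y' - G y)) by ring.
      eapply Rle_trans. apply Rabs_triang. eapply Rle_trans. apply Rplus_le_compat_r. apply Rabs_triang.
      rewrite !Rabs_mult.
      assert (e1 <= 1) by apply Rmin_l.
      pose proof (Rabs_pos (F x' - F x)). pose proof (Rabs_pos (G y' - G y)).
      pose proof (Rabs_pos (F x)). pose proof (Rabs_pos (G y)). nra. }
    assert (KF' : e1 * (1 + Rabs (G y) + Rabs (F x)) <= eps / 4).
    { assert (e1 <= eps / (4 * (1 + Rabs (G y) + Rabs (F x)))) by apply Rmin_r.
      pose proof (Rabs_pos (F x)). pose proof (Rabs_pos (G y)).
      apply Rle_trans with (eps / (4 * (1 + Rabs (G y) + Rabs (F x))) * (1 + Rabs (G y) + Rabs (F x))).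
      apply Rmult_le_compat_r; lra. right. field. lra. }
    assert (KF2 : Rabs (F x' * G y' - F x * G y) < eps / 2) by lra.
    unfold f. apply Rabs_def2 in K1. apply Rabs_def2 in K2. apply Rabs_def2 in KF2. apply Rabs_def1; lra. }
  assert (Hf0 : f x0 y0 < 0). { eapply Rle_lt_trans. apply (Hmin q p Hqq Hpp). unfold f. lra. }
  assert (I1 : q1 < x0 < q2).
  { split; apply Rnot_le_lt; intros L; unfold f in Hf0.
    replace x0 with q1 in Hf0 by lra. pose proof (proj1 (HB2 y0 Hy0)). lra.
    replace x0 with q2 in Hf0 by lra. pose proof (proj2 (HB2 y0 Hy0)). lra. }
  assert (I2 : p1 < y0 < p2).
  { split; apply Rnot_le_lt; intros L; unfold f in Hf0.
    replace y0 with p1 in Hf0 by lra. pose proof (proj1 (HB1 x0 Hx0)). lra.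
    replace y0 with p2 in Hf0 by lra. pose proof (proj2 (HB1 x0 Hx0)). lra. }
  set (d := Rmin (Rmin (x0 - q1) (q2 - x0)) (Rmin (y0 - p1) (p2 - y0))).
  assert (Hd : 0 < d) by (repeat apply Rmin_pos; lra).
  assert (Hdd : d <= x0 - q1 /\ d <= q2 - x0 /\ d <= y0 - p1 /\ d <= p2 - y0).
  { unfold d. pose proof (Rmin_l (Rmin (x0 - q1) (q2 - x0)) (Rmin (y0 - p1) (p2 - y0))).
    pose proof (Rmin_r (Rmin (x0 - q1) (q2 - x0)) (Rmin (y0 - p1) (p2 - y0))).
    pose proof (Rmin_l (x0 - q1) (q2 - x0)). pose proof (Rmin_r (x0 - q1) (q2 - x0)).
    pose proof (Rmin_l (y0 - p1) (p2 - y0)). pose proof (Rmin_r (y0 - p1) (p2 - y0)). lra. }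
  destruct (HC x0 y0 ltac:(lra)) as [HC1 _].
  destruct (interior_min f (fun q p => gq q p - (F1 q * G p + P1 q)) (fun q p => gp q p - F q * G1 p)
    (fun q p => gqq q p - (F2 q * G p + P2 q)) (fun q p => gqp q p - F1 q * G1 p)
    (fun q p => gpq q p - F1 q * G1 p) (fun q p => gpp q p - F q * G2 p) x0 y0 d (A x0 y0) (B x0 y0))
    as [E1 [E2 E3]]; try lra.
  - intros x y Hy. now apply sub; auto.
  - intros x y Hy. apply (sub gq _ _ (fun q p => F1 q * G p + P1 q)); auto.
  - intros x y Hy. apply (sub gp _ _ (fun q p => F q * G1 p)); auto.
  - intros x y Lx Ly. apply Rabs_def2 in Lx. apply Rabs_def2 in Ly. apply Hmin; lra.
  - specialize (H4 x0 y0 ltac:(lra)). specialize (HS x0 y0 I1 I2).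
    replace (gq x0 y0) with (F1 x0 * G y0 + P1 x0) in H4 by lra.
    replace (gp x0 y0) with (F x0 * G1 y0) in H4 by lra.
    apply Rabs_le_between in H4. nra.
Qed.

(** * Barriers *)

Lemma exp_le x y : x <= y -> exp x <= exp y.
Proof. intros [H| ->]. left. now apply exp_increasing. right; auto. Qed.

Lemma coef_A A B c0 A1 q p : coef A B c0 A1 -> 0 < p < 1 -> 0 < c0 /\ c0 <= A q p /\ A q p <= A1.
Proof.
  intros [Hc H] Hp. destruct (H q p Hp) as [H1 H2]. pose proof (pow2_ge_0 (B q p)). lra.
Qed.

(* The quadratic term in [q] vanishes on the column of interest and forces the comparison on
   the far vertical sides. *)
Lemma strip_cmp g A B c0 A1 K p0 a b al :
  coef A B c0 A1 -> ell g A B K -> BD g -> 0 < p0 <= 1 -> K < c0 * Rabs al -> 0 < b ->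
  (forall q, a + b <= g q 0) -> (forall q, a + b * exp (al * p0) <= g q p0) ->
  forall q p, 0 <= p <= p0 -> a + b * exp (al * p) <= g q p.
Proof.
  intros HC HE HB Hp0 Hal Hb H0 H1 q0 p Hp.
  destruct (BD_pos g HB) as [M [HM HM']].
  assert (HK : 0 <= K) by apply HE.
  assert (Hc0 : 0 < c0) by apply HC.
  assert (Hal0 : 0 < Rabs al) by (apply Rnot_le_lt; intro; nra).
  assert (Hx : forall x, 0 <= x <= 1 -> exp (- Rabs al) <= exp (al * x) <= exp (Rabs al)).
  { intros x Hx. split; apply exp_le; unfold Rabs; destruct Rcase_abs; nra. }
  set (C := M + Rabs a + b * exp (Rabs al)).
  assert (HCp : 0 < C).
  { unfold C. pose proof (Rabs_pos a). pose proof (exp_pos (Rabs al)).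
    assert (0 < b * exp (Rabs al)) by (now apply Rmult_lt_0_compat). lra. }
  (* [mu] is the margin by which [a + b * exp (al * p)] is a strict subsolution. The quadratic term
     with [k = C / N^2] costs at most [(2 * K * C + 2 * C) / N], less than [mu] for this [N], while
     at distance [N] from [q0] it subtracts [C] and brings the barrier below [- M]. *)
  set (mu := b * Rabs al * exp (- Rabs al) * (c0 * Rabs al - K)).
  assert (Hmu : 0 < mu).
  { unfold mu. repeat apply Rmult_lt_0_compat; auto. apply exp_pos. lra. }
  set (N := 1 + (2 * K * C + 2 * C) / mu).
  assert (HN1 : 1 <= N).
  { unfold N. assert (0 <= (2 * K * C + 2 * C) / mu). apply Rdiv_le_0_compat; nra. lra. }
  assert (HN2 : (2 * K * C + 2 * C) / N < mu).
  { apply Rmult_lt_reg_r with N. lra. unfold Rdiv. rewrite Rmult_assoc, Rinv_l, Rmult_1_r by lra.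
    unfold N. replace (mu * (1 + (2 * K * C + 2 * C) / mu)) with (mu + (2 * K * C + 2 * C)) by (field; lra). lra. }
  set (k := C / N ^ 2).
  assert (HNN : 0 < N ^ 2) by (apply pow_lt; lra).
  assert (Hk : 0 < k) by (apply Rdiv_lt_0_compat; lra).
  assert (Hkk : k * N ^ 2 = C) by (unfold k; field; lra).
  assert (Hk1 : k <= C / N).
  { unfold k, Rdiv. apply Rmult_le_compat_l. lra. apply Rinv_le_contravar; nra. }
  assert (HkN : k * N = C / N) by (unfold k; field; lra).
  cut (1 * (a + b * exp (al * p)) + - k * (q0 - q0) ^ 2 <= g q0 p).
  { intros L. eapply Rle_trans; [|exact L]. right. ring. }
  apply (rect_cmp g A B c0 A1 K (q0 - N) (q0 + N) 0 p0 (fun _ => 1) (fun _ => 0) (fun _ => 0)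
    (fun p => a + b * exp (al * p)) (fun p => b * (al * exp (al * p))) (fun p => b * (al * (al * exp (al * p))))
    (fun q => - k * (q - q0) ^ 2) (fun q => - k * (2 * (q - q0))) (fun q => - k * 2)); auto; try lra.
  - intros q. refine (conj _ (conj _ (conj _ _))); auto_derive; auto; cbn [pow]; unfold Rminus; rewrite ?Rmult_1_r; ring.
  - intros x. split; auto_derive; auto; cbn [pow]; unfold Rminus; rewrite ?Rmult_1_r; ring.
  - intros q x Hq Hxx.
    destruct (coef_A A B c0 A1 q x HC ltac:(lra)) as [_ [HA _]].
    destruct (Hx x ltac:(lra)) as [Hx1 _].
    set (E := exp (al * x)) in *. assert (HE0 : 0 < E) by apply exp_pos.
    rewrite !Rmult_0_l, Rplus_0_l, Rmult_1_l, Rmult_1_l, !Rabs_mult, Rabs_Ropp.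
    rewrite (Rabs_pos_eq k), (Rabs_pos_eq b), (Rabs_pos_eq E), (Rabs_pos_eq 2) by lra.
    assert (Rabs (q - q0) <= N) by (apply Rabs_le; lra).
    assert (G1' : K * (k * (2 * Rabs (q - q0))) + k * 2 <= (2 * K * C + 2 * C) / N).
    { replace ((2 * K * C + 2 * C) / N) with (2 * K * (k * N) + 2 * (C / N)) by (rewrite HkN; field; lra).
      assert (k * Rabs (q - q0) <= k * N) by (apply Rmult_le_compat_l; lra).
      assert (K * (k * Rabs (q - q0)) <= K * (k * N)) by (apply Rmult_le_compat_l; lra).
      nra. }
    assert (G2' : mu <= b * Rabs al * E * (c0 * Rabs al - K)).
    { unfold mu. apply Rmult_le_compat_r. lra. apply Rmult_le_compat_l. nra. auto. }
    assert (G3 : c0 * (b * (Rabs al * Rabs al) * E) <= A q x * (b * (al * (al * E)))).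
    { replace (b * (al * (al * E))) with (b * (al * al) * E) by ring.
      rewrite <- (Rabs_pos_eq (al * al)), Rabs_mult by nra.
      apply Rmult_le_compat_r. apply Rmult_le_pos; nra. auto. }
    nra.
  - intros q Hq. simpl. rewrite Rmult_0_r, exp_0. pose proof (pow2_ge_0 (q - q0)) as Q. simpl in Q.
    specialize (H0 q). specialize (H1 q). split; nra.
  - intros x Hxx.
    assert (HH : a + b * exp (al * x) <= C - M).
    { unfold C. destruct (Hx x ltac:(lra)) as [_ Hx2]. pose proof (Rle_abs a). nra. }
    pose proof (HM' (q0 - N) x ltac:(lra)) as B1. pose proof (HM' (q0 + N) x ltac:(lra)) as B2.
    apply Rabs_le_between in B1. apply Rabs_le_between in B2.
    replace (q0 - N - q0) with (- N) by ring. replace (q0 + N - q0) with N by ring.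
    replace ((- N) ^ 2) with (N ^ 2) by ring. split; lra.
Qed.

(** Comparison with [l - eps + b * exp (al * p)], where [b] is so small that this stays below [l] on
    both boundary lines, and [eps] tending to 0. Boundedness of [g] is the growth condition at
    infinity. *)
Lemma weak_min g A B c0 A1 K p0 l : coef A B c0 A1 -> ell g A B K -> BD g -> 0 < p0 <= 1 ->
  (forall q, l <= g q 0) -> (forall q, l <= g q p0) -> forall q p, 0 <= p <= p0 -> l <= g q p.
Proof.
  intros HC HE HB Hp0 H0 H1 q p Hp.
  assert (HK : 0 <= K) by apply HE. assert (Hc0 : 0 < c0) by apply HC.
  set (al := (K + 1) / c0).
  assert (Hal : 0 < al) by (apply Rdiv_lt_0_compat; lra).
  apply le_epsilon. intros eps Heps.
  set (b := eps / exp al).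
  assert (Hb : 0 < b) by (apply Rdiv_lt_0_compat; auto; apply exp_pos).
  assert (E : b * exp al = eps) by (unfold b; field; apply Rgt_not_eq, exp_pos).
  assert (E1 : 1 <= exp al) by (rewrite <- exp_0; apply exp_le; lra).
  assert (E2 : exp (al * p0) <= exp al) by (apply exp_le; nra).
  pose proof (strip_cmp g A B c0 A1 K p0 (l - eps) b al HC HE HB Hp0) as S.
  assert (l - eps + b * exp (al * p) <= g q p).
  { apply S; auto.
    - rewrite Rabs_pos_eq by lra. unfold al. replace (c0 * ((K + 1) / c0)) with (K + 1) by (field; lra). lra.
    - intros q'. specialize (H0 q'). nra.
    - intros q'. specialize (H1 q'). nra. }
  pose proof (exp_pos (al * p)). nra.
Qed.

Lemma weak_max g A B c0 A1 K p0 l : coef A B c0 A1 -> ell g A B K -> BD g -> 0 < p0 <= 1 ->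
  (forall q, g q 0 <= l) -> (forall q, g q p0 <= l) -> forall q p, 0 <= p <= p0 -> g q p <= l.
Proof.
  intros HC HE [M HB] Hp0 H0 H1 q p Hp.
  cut (- l <= - g q p). lra.
  apply (weak_min (fun q p => - g q p) A B c0 A1 K p0); auto.
  - now apply ell_opp.
  - exists M. intros. rewrite Rabs_Ropp. auto.
  - intros q'. specialize (H0 q'). lra.
  - intros q'. specialize (H1 q'). lra.
Qed.

Lemma quad_lower X B A c0 : c0 <= A - B ^ 2 -> c0 <= X * X + 2 * B * X + A.
Proof. intros. pose proof (pow2_ge_0 (X + B)). nra. Qed.

(* Barrier with level sets the parabolas p = const - k (q - q0)^2. *)
Lemma propagate_up g A B c0 A1 K rho : coef A B c0 A1 -> ell g A B K -> 0 < rho ->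
  exists al, 0 < al /\ forall q0 p1 p2 e, 0 <= p1 -> p1 < p2 -> p2 <= 1 -> 0 < e ->
    (forall q p, q0 - rho <= q <= q0 + rho -> p1 <= p <= p2 -> 0 <= g q p) ->
    (forall q, q0 - rho <= q <= q0 + rho -> e <= g q p1) ->
    forall p, p1 <= p <= p2 -> e * (exp (- al * (p - p1)) - exp (- al * (p2 - p1))) <= g q0 p.
Proof.
  intros HC HE Hr. assert (HK : 0 <= K) by apply HE. assert (Hc0 : 0 < c0) by apply HC.
  (* Since [k * rho^2 = 1 >= p2 - p1], the barrier is nonpositive on the vertical sides. [D] bounds
     the terms linear in [al], which the quadratic one, at least [c0 * al^2], has to beat. *)
  set (k := / (rho * rho)). set (D := 2 * k + K * (2 / rho + 1)).
  assert (Hk : 0 < k) by (apply Rinv_0_lt_compat; nra).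
  assert (Hr2 : 0 < 2 / rho) by (apply Rdiv_lt_0_compat; lra).
  assert (HD : 0 < D) by (unfold D; nra).
  set (al := (D + 1) / c0).
  assert (Hal : 0 < al) by (apply Rdiv_lt_0_compat; lra).
  assert (HalD : D < c0 * al) by (unfold al; replace (c0 * ((D + 1) / c0)) with (D + 1) by (field; lra); lra).
  exists al. split; auto. intros q0 p1 p2 e Hp1 Hp12 Hp2 He Hpos He1 p Hp.
  assert (Hkr : k * (rho * rho) = 1) by (unfold k; field; lra).
  assert (Hkr2 : 2 * k * rho = 2 / rho) by (unfold k; field; lra).
  cut (exp (- al * k * (q0 - q0) ^ 2) * (e * exp (- al * (p - p1))) + - (e * exp (- al * (p2 - p1))) <= g q0 p).
  { intros L. eapply Rle_trans; [|exact L]. replace (- al * k * (q0 - q0) ^ 2) with 0 by ring. rewrite exp_0. right. ring. }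
  apply (rect_cmp g A B c0 A1 K (q0 - rho) (q0 + rho) p1 p2
    (fun q => exp (- al * k * (q - q0) ^ 2))
    (fun q => (- al * k * (2 * (q - q0))) * exp (- al * k * (q - q0) ^ 2))
    (fun q => (- al * k * 2 + (- al * k * (2 * (q - q0))) ^ 2) * exp (- al * k * (q - q0) ^ 2))
    (fun p => e * exp (- al * (p - p1))) (fun p => - al * (e * exp (- al * (p - p1))))
    (fun p => al * al * (e * exp (- al * (p - p1))))
    (fun _ => - (e * exp (- al * (p2 - p1)))) (fun _ => 0) (fun _ => 0)); auto; try lra.
  - intros q. refine (conj _ (conj _ (conj _ _))); auto_derive; auto; cbn [pow]; unfold Rminus; rewrite ?Rmult_1_r; ring.
  - intros x. split; auto_derive; auto; cbn [pow]; unfold Rminus; rewrite ?Rmult_1_r; ring.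
  - intros q x Hq Hxx.
    destruct HC as [_ HC]. destruct (HC q x ltac:(lra)) as [HC1 _].
    set (E1 := exp (- al * k * (q - q0) ^ 2)). set (E2 := exp (- al * (x - p1))).
    assert (0 < E1) by apply exp_pos. assert (0 < E2) by apply exp_pos.
    set (X := 2 * k * (q - q0)).
    pose proof (quad_lower X (B q x) (A q x) c0 HC1) as QL.
    assert (HX : Rabs X <= 2 / rho).
    { rewrite <- Hkr2. unfold X. rewrite Rabs_mult, (Rabs_pos_eq (2 * k)) by lra.
      apply Rmult_le_compat_l. lra. apply Rabs_le. lra. }
    set (W := E1 * (e * E2)). assert (HW : 0 < W) by (unfold W; repeat apply Rmult_lt_0_compat; auto).
    replace (- al * k * (2 * (q - q0)) * E1 * (e * E2) + 0) with (- (al * X * W)) by (unfold X, W; ring).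
    replace (E1 * (- al * (e * E2))) with (- (al * W)) by (unfold W; ring).
    rewrite !Rabs_Ropp, !Rabs_mult, (Rabs_pos_eq al), (Rabs_pos_eq W) by lra.
    replace ((- al * k * 2 + (- al * k * (2 * (q - q0))) ^ 2) * E1 * (e * E2) +
      2 * B q x * (- al * k * (2 * (q - q0)) * E1 * (- al * (e * E2))) + A q x * (E1 * (al * al * (e * E2))) + 0)
      with (al * W * (al * (X * X + 2 * B q x * X + A q x) - 2 * k)) by (unfold X, W; ring).
    replace (K * (al * Rabs X * W + al * W)) with (al * W * (K * (Rabs X + 1))) by ring.
    apply Rmult_lt_compat_l. apply Rmult_lt_0_compat; auto.
    assert (al * c0 <= al * (X * X + 2 * B q x * X + A q x)) by (apply Rmult_le_compat_l; lra).
    assert (K * (Rabs X + 1) <= K * (2 / rho + 1)) by (apply Rmult_le_compat_l; lra).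
    unfold D in HalD. lra.
  - intros q Hq. replace (- al * (p1 - p1)) with 0 by ring. rewrite exp_0.
    set (E1 := exp (- al * k * (q - q0) ^ 2)). set (E2 := exp (- al * (p2 - p1))).
    assert (0 < E2) by apply exp_pos. assert (0 < E1) by apply exp_pos.
    assert (E1 <= 1). { rewrite <- exp_0. apply exp_le. pose proof (pow2_ge_0 (q - q0)).
      assert (0 <= al * k * (q - q0) ^ 2) by (apply Rmult_le_pos; [nra|assumption]).
      replace (- al * k * (q - q0) ^ 2) with (- (al * k * (q - q0) ^ 2)) by ring. lra. }
    split.
    + specialize (He1 q Hq). assert (0 < e * E2) by nra. nra.
    + specialize (Hpos q p2 Hq ltac:(lra)). assert (0 < e * E2) by nra. nra.
  - intros x Hx.
    assert (S : forall s, s ^ 2 = rho * rho -> exp (- al * k * s ^ 2) * (e * exp (- al * (x - p1))) +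
       - (e * exp (- al * (p2 - p1))) <= 0).
    { intros s Hs. replace (- al * k * s ^ 2) with (- al * (k * (rho * rho))) by (rewrite Hs; ring). rewrite Hkr.
      replace (exp (- al * 1) * (e * exp (- al * (x - p1)))) with (e * (exp (- al * 1) * exp (- al * (x - p1)))) by ring.
      rewrite <- exp_plus.
      assert (exp (- al * 1 + - al * (x - p1)) <= exp (- al * (p2 - p1))) by (apply exp_le; nra). nra. }
    split; eapply Rle_trans.
    + apply S. ring.
    + apply Hpos; lra.
    + apply S. ring.
    + apply Hpos; lra.
Qed.

(** Image of [propagate_up] under [p -> 1 - p], which changes the sign of [B] and preserves [coef]
    and [ell]. *)
Lemma propagate_down g A B c0 A1 K rho : coef A B c0 A1 -> ell g A B K -> 0 < rho ->
  exists al, 0 < al /\ forall q0 p1 p2 e, 0 <= p1 -> p1 < p2 -> p2 <= 1 -> 0 < e ->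
    (forall q p, q0 - rho <= q <= q0 + rho -> p1 <= p <= p2 -> 0 <= g q p) ->
    (forall q, q0 - rho <= q <= q0 + rho -> e <= g q p2) ->
    forall p, p1 <= p <= p2 -> e * (exp (- al * (p2 - p)) - exp (- al * (p2 - p1))) <= g q0 p.
Proof.
  intros HC HE Hr.
  assert (RE : forall f fq fp, D1 f fq fp ->
    D1 (fun q p => f q (1 - p)) (fun q p => fq q (1 - p)) (fun q p => - fp q (1 - p))).
  { intros f fq fp H q p Hp a b. apply is_derive_eq with (a * fq q (1 - p) + (- b) * fp q (1 - p)); [|ring].
    eapply is_derive_ext; [|exact (H q (1 - p) ltac:(lra) a (- b))]. intros t. simpl. f_equal; ring. }
  assert (HE' : ell (fun q p => g q (1 - p)) (fun q p => A q (1 - p)) (fun q p => - B q (1 - p)) K).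
  { destruct HE as [HK [HU [gq [gp [gqq [gqp [gpq [gpp [H1 [H2 [H3 H4]]]]]]]]]]].
    assert (RN : D1 (fun q p => - gp q (1 - p)) (fun q p => - gpq q (1 - p)) (fun q p => gpp q (1 - p))).
    { intros q p Hp a b. apply RE in H3. specialize (H3 q p Hp a b).
      apply is_derive_eq with (opp (a * gpq q (1 - p) + b * - gpp q (1 - p))).
      apply (is_derive_opp (V := R_NormedModule)). exact H3. unfold opp; simpl; ring. }
    split; auto. split.
    - intros eps Heps. destruct (HU eps Heps) as [d [Hd Hd']]. exists d. split; auto.
      intros q p q' p' Hp Hp' L1 L2. apply Hd'; auto; try lra.
      replace (1 - p' - (1 - p)) with (- (p' - p)) by ring. now rewrite Rabs_Ropp.
    - exists (fun q p => gq q (1 - p)), (fun q p => - gp q (1 - p)), (fun q p => gqq q (1 - p)),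
        (fun q p => - gqp q (1 - p)), (fun q p => - gpq q (1 - p)), (fun q p => gpp q (1 - p)).
      split; [exact (RE _ _ _ H1)|split; [exact (RE _ _ _ H2)|split; [exact RN|]]].
      intros q p Hp. specialize (H4 q (1 - p) ltac:(lra)). rewrite Rabs_Ropp.
      eapply Rle_trans; [|exact H4]. right. f_equal. ring. }
  assert (HC' : coef (fun q p => A q (1 - p)) (fun q p => - B q (1 - p)) c0 A1).
  { destruct HC as [Hc HC]. split; auto. intros q p Hp. destruct (HC q (1 - p) ltac:(lra)).
    replace ((- B q (1 - p)) ^ 2) with (B q (1 - p) ^ 2) by ring. auto. }
  destruct (propagate_up _ _ _ c0 A1 K rho HC' HE' Hr) as [al [Hal P]].
  exists al. split; auto. intros q0 p1 p2 e Hp1 Hp12 Hp2 He Hpos He1 p Hp.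
  specialize (P q0 (1 - p2) (1 - p1) e ltac:(lra) ltac:(lra) ltac:(lra) He).
  replace (p2 - p) with (1 - p - (1 - p2)) by ring.
  replace (p2 - p1) with (1 - p1 - (1 - p2)) by ring.
  replace p with (1 - (1 - p)) at 2 by ring. apply P; try lra.
  - intros q x Hq Hx. apply Hpos; lra.
  - intros q Hq. replace (1 - (1 - p2)) with p2 by ring. now apply He1.
Qed.

Lemma quad_lower2 X B A c0 A1 : 0 < c0 -> c0 <= A - B ^ 2 -> A <= A1 -> c0 / A1 <= 1 + 2 * B * X + A * (X * X).
Proof.
  intros H0 H1 H2. pose proof (pow2_ge_0 B).
  assert (HA : 0 < A) by lra.
  assert (E : 1 + 2 * B * X + A * (X * X) = ((A * X + B) ^ 2 + (A - B ^ 2)) / A) by (field; lra).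
  rewrite E. apply Rle_trans with (c0 / A).
  - unfold Rdiv. apply Rmult_le_compat_l. lra. apply Rinv_le_contravar; lra.
  - unfold Rdiv. apply Rmult_le_compat_r. left; now apply Rinv_0_lt_compat.
    pose proof (pow2_ge_0 (A * X + B)). lra.
Qed.

(** The parabolic barrier with [q] and [p] exchanged. Here [k * rho^2] is the length [l] of the box,
    which makes the barrier nonpositive on the horizontal sides and on the far end. The margin [del]
    puts [q2] strictly inside the box, where the barrier is still positive. *)
Lemma propagate_right g A B c0 A1 K q1 q2 p0 rho e : coef A B c0 A1 -> ell g A B K -> 0 < rho ->
  q1 < q2 -> 0 <= p0 - rho -> p0 + rho <= 1 -> 0 < e -> forall del, 0 < del ->
  (forall q p, q1 <= q <= q2 + del -> p0 - rho <= p <= p0 + rho -> 0 <= g q p) ->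
  (forall p, p0 - rho <= p <= p0 + rho -> e <= g q1 p) -> 0 < g q2 p0.
Proof.
  intros HC HE Hr Hq12 Hpa Hpb He del Hdel Hpos He1.
  assert (HK : 0 <= K) by apply HE. assert (Hc0 : 0 < c0) by apply HC.
  assert (HA1 : 0 < A1).
  { destruct (coef_A A B c0 A1 0 (1/2) HC ltac:(lra)). lra. }
  set (l := q2 + del - q1). assert (Hl : 0 < l) by (unfold l; lra).
  set (k := l / (rho * rho)). set (D := 2 * k * A1 + K * (1 + 2 * l / rho)).
  assert (Hk : 0 < k) by (apply Rdiv_lt_0_compat; nra).
  assert (Hr2 : 0 < 2 * l / rho) by (apply Rdiv_lt_0_compat; lra).
  assert (HD : 0 < D) by (unfold D; nra).
  set (al := (D + 1) * A1 / c0).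
  assert (Hal : 0 < al) by (apply Rdiv_lt_0_compat; nra).
  assert (HalD : D < al * (c0 / A1)) by (unfold al; replace ((D + 1) * A1 / c0 * (c0 / A1)) with (D + 1) by (field; lra); lra).
  assert (Hkr : k * (rho * rho) = l) by (unfold k; field; lra).
  assert (Hkr2 : 2 * k * rho = 2 * l / rho) by (unfold k; field; lra).
  cut (exp (- al * (q2 - q1)) * (e * exp (- al * k * (p0 - p0) ^ 2)) + - (e * exp (- al * l)) <= g q2 p0).
  { intros L. eapply Rlt_le_trans; [|exact L]. replace (- al * k * (p0 - p0) ^ 2) with 0 by ring. rewrite exp_0.
    assert (exp (- al * l) < exp (- al * (q2 - q1))) by (apply exp_increasing; unfold l; nra). nra. }
  apply (rect_cmp g A B c0 A1 K q1 (q2 + del) (p0 - rho) (p0 + rho)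
    (fun q => exp (- al * (q - q1))) (fun q => - al * exp (- al * (q - q1))) (fun q => al * al * exp (- al * (q - q1)))
    (fun p => e * exp (- al * k * (p - p0) ^ 2))
    (fun p => e * ((- al * k * (2 * (p - p0))) * exp (- al * k * (p - p0) ^ 2)))
    (fun p => e * ((- al * k * 2 + (- al * k * (2 * (p - p0))) ^ 2) * exp (- al * k * (p - p0) ^ 2)))
    (fun _ => - (e * exp (- al * l))) (fun _ => 0) (fun _ => 0)); auto; try lra.
  - intros q. refine (conj _ (conj _ (conj _ _))); auto_derive; auto; cbn [pow]; unfold Rminus; rewrite ?Rmult_1_r; ring.
  - intros x. split; auto_derive; auto; cbn [pow]; unfold Rminus; rewrite ?Rmult_1_r; ring.
  - intros q x Hq Hxx.
    destruct HC as [_ HC]. destruct (HC q x ltac:(lra)) as [HC1 HC2].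
    set (E2 := exp (- al * k * (x - p0) ^ 2)). set (E1 := exp (- al * (q - q1))).
    assert (0 < E1) by apply exp_pos. assert (0 < E2) by apply exp_pos.
    set (X := 2 * k * (x - p0)).
    pose proof (quad_lower2 X (B q x) (A q x) c0 A1 Hc0 HC1 HC2) as QL.
    assert (HX : Rabs X <= 2 * l / rho).
    { rewrite <- Hkr2. unfold X. rewrite Rabs_mult, (Rabs_pos_eq (2 * k)) by lra.
      apply Rmult_le_compat_l. lra. apply Rabs_le. lra. }
    set (W := E1 * (e * E2)). assert (HW : 0 < W) by (unfold W; repeat apply Rmult_lt_0_compat; auto).
    replace (- al * E1 * (e * E2) + 0) with (- (al * W)) by (unfold W; ring).
    replace (E1 * (e * (- al * k * (2 * (x - p0)) * E2))) with (- (al * X * W)) by (unfold W, X; ring).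
    rewrite !Rabs_Ropp, !Rabs_mult, (Rabs_pos_eq al), (Rabs_pos_eq W) by lra.
    replace (al * al * E1 * (e * E2) + 2 * B q x * (- al * E1 * (e * (- al * k * (2 * (x - p0)) * E2))) +
      A q x * (E1 * (e * ((- al * k * 2 + (- al * k * (2 * (x - p0))) ^ 2) * E2))) + 0)
      with (al * W * (al * (1 + 2 * B q x * X + A q x * (X * X)) - 2 * k * A q x)) by (unfold X, W; ring).
    replace (K * (al * W + al * Rabs X * W)) with (al * W * (K * (1 + Rabs X))) by ring.
    apply Rmult_lt_compat_l. apply Rmult_lt_0_compat; auto.
    assert (al * (c0 / A1) <= al * (1 + 2 * B q x * X + A q x * (X * X))) by (apply Rmult_le_compat_l; lra).
    assert (K * (1 + Rabs X) <= K * (1 + 2 * l / rho)) by (apply Rmult_le_compat_l; lra).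
    assert (2 * k * A q x <= 2 * k * A1) by (apply Rmult_le_compat_l; lra).
    unfold D in HalD. lra.
  - intros q Hq.
    assert (S : forall s, s ^ 2 = rho * rho -> exp (- al * (q - q1)) * (e * exp (- al * k * s ^ 2)) +
       - (e * exp (- al * l)) <= 0).
    { intros s Hs. replace (- al * k * s ^ 2) with (- al * (k * (rho * rho))) by (rewrite Hs; ring). rewrite Hkr.
      assert (exp (- al * (q - q1)) <= 1) by (rewrite <- exp_0; apply exp_le; nra).
      pose proof (exp_pos (- al * l)). assert (0 < e * exp (- al * l)) by (apply Rmult_lt_0_compat; auto).
      assert (exp (- al * (q - q1)) * (e * exp (- al * l)) <= 1 * (e * exp (- al * l))) by (apply Rmult_le_compat_r; lra). lra. }
    split; eapply Rle_trans.
    + apply S. ring.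
    + apply Hpos; lra.
    + apply S. ring.
    + apply Hpos; lra.
  - intros x Hx.
    set (E2 := exp (- al * k * (x - p0) ^ 2)).
    assert (0 < E2) by apply exp_pos.
    assert (E2 <= 1). { rewrite <- exp_0. apply exp_le. pose proof (pow2_ge_0 (x - p0)).
      assert (0 <= al * k * (x - p0) ^ 2) by (apply Rmult_le_pos; [nra|assumption]).
      replace (- al * k * (x - p0) ^ 2) with (- (al * k * (x - p0) ^ 2)) by ring. lra. }
    pose proof (exp_pos (- al * l)). split.
    + replace (- al * (q1 - q1)) with 0 by ring. rewrite exp_0.
      specialize (He1 x Hx). assert (0 < e * exp (- al * l)) by nra. nra.
    + specialize (Hpos (q2 + del) x ltac:(lra) Hx). fold l.
      assert (exp (- al * l) * (e * E2) <= exp (- al * l) * (e * 1)) by (apply Rmult_le_compat_l; [lra|apply Rmult_le_compat_l; lra]). lra.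
Qed.

Lemma propagate_left g A B c0 A1 K q1 q2 p0 rho e : coef A B c0 A1 -> ell g A B K -> 0 < rho ->
  q2 < q1 -> 0 <= p0 - rho -> p0 + rho <= 1 -> 0 < e -> forall del, 0 < del ->
  (forall q p, q2 - del <= q <= q1 -> p0 - rho <= p <= p0 + rho -> 0 <= g q p) ->
  (forall p, p0 - rho <= p <= p0 + rho -> e <= g q1 p) -> 0 < g q2 p0.
Proof.
  intros HC HE Hr Hq12 Hpa Hpb He del Hdel Hpos He1.
  assert (RE : forall f fq fp, D1 f fq fp ->
    D1 (fun q p => f (- q) p) (fun q p => - fq (- q) p) (fun q p => fp (- q) p)).
  { intros f fq fp H q p Hp a b. apply is_derive_eq with ((- a) * fq (- q) p + b * fp (- q) p); [|ring].
    eapply is_derive_ext; [|exact (H (- q) p Hp (- a) b)]. intros t. simpl. f_equal; ring. }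
  assert (HE' : ell (fun q p => g (- q) p) (fun q p => A (- q) p) (fun q p => - B (- q) p) K).
  { destruct HE as [HK [HU [gq [gp [gqq [gqp [gpq [gpp [H1 [H2 [H3 H4]]]]]]]]]]].
    assert (RN : D1 (fun q p => - gq (- q) p) (fun q p => gqq (- q) p) (fun q p => - gqp (- q) p)).
    { intros q p Hp a b. apply RE in H2. specialize (H2 q p Hp a b).
      apply is_derive_eq with (opp (a * - gqq (- q) p + b * gqp (- q) p)).
      apply (is_derive_opp (V := R_NormedModule)). exact H2. unfold opp; simpl; ring. }
    split; auto. split.
    - intros eps Heps. destruct (HU eps Heps) as [d [Hd Hd']]. exists d. split; auto.
      intros q p q' p' Hp Hp' L1 L2. apply Hd'; auto; try lra.
      replace (- q' - - q) with (- (q' - q)) by ring. now rewrite Rabs_Ropp.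
    - exists (fun q p => - gq (- q) p), (fun q p => gp (- q) p), (fun q p => gqq (- q) p),
        (fun q p => - gqp (- q) p), (fun q p => - gpq (- q) p), (fun q p => gpp (- q) p).
      split; [exact (RE _ _ _ H1)|split; [exact RN|split; [exact (RE _ _ _ H3)|]]].
      intros q p Hp. specialize (H4 (- q) p Hp). rewrite Rabs_Ropp.
      eapply Rle_trans; [|exact H4]. right. f_equal. ring. }
  assert (HC' : coef (fun q p => A (- q) p) (fun q p => - B (- q) p) c0 A1).
  { destruct HC as [Hc HC]. split; auto. intros q p Hp. destruct (HC (- q) p Hp).
    replace ((- B (- q) p) ^ 2) with (B (- q) p ^ 2) by ring. auto. }
  replace q2 with (- (- q2)) by ring.
  apply (propagate_right _ _ _ c0 A1 K (- q1) (- q2) p0 rho e HC' HE' Hr ltac:(lra) Hpa Hpb He del Hdel).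
  - intros q p Hq Hp. apply Hpos; lra.
  - intros p Hp. rewrite Ropp_involutive. now apply He1.
Qed.

(** * The wave in hodograph variables *)

Lemma differentiable_of_partials (f fx : fun2) (x y fy d : R) : 0 < d ->
  (forall x' y', Rabs (x' - x) < d -> Rabs (y' - y) < d -> is_derive (fun z => f z y') x' (fx x' y')) ->
  is_derive (fun z => f x z) y fy ->
  (forall eps, 0 < eps -> exists e, 0 < e /\ forall x' y', Rabs (x' - x) < e -> Rabs (y' - y) < e ->
     Rabs (fx x' y' - fx x y) < eps) ->
  differentiable_pt_lim f x y (fx x y) fy.
Proof.
  intros Hd H1 H2 H3. apply filterdiff_differentiable_pt_lim.
  apply (is_derive_filterdiff f x y fx fy).
  - exists (mkposreal d Hd). intros [x' y'] [Hx Hy]. apply H1; auto.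
  - exact H2.
  - intros P [e He]. destruct (H3 e (cond_pos e)) as [k [Hk Hk']].
    exists (mkposreal k Hk). intros [x' y'] [Hx Hy]. apply He. apply Hk'; auto.
Qed.

Lemma grad_of_differentiable f q p fq fp : differentiable_pt_lim f q p fq fp -> grad_at f q p fq fp.
Proof.
  intros H a b. apply is_derive_Reals.
  replace (a * fq + b * fp) with (fq * a + fp * b) by ring.
  apply (derivable_pt_lim_comp_2d f (fun t => q + t * a) (fun t => p + t * b)).
  - now rewrite !Rmult_0_l, !Rplus_0_r.
  - apply is_derive_Reals. auto_derive; auto; ring.
  - apply is_derive_Reals. auto_derive; auto; ring.
Qed.

Lemma Lip_of_D1 f fq fp M : 0 < M -> D1 f fq fp ->
  (forall q p, 0 < p < 1 -> Rabs (fq q p) <= M /\ Rabs (fp q p) <= M) ->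
  (forall q, cont_in 0 1 (f q)) -> Lip f.
Proof.
  intros HM D HB HC. exists M. split; auto. intros q p q' p' Hp Hp'.
  assert (Hq : forall p, 0 <= p <= 1 -> Rabs (f q' p - f q p) <= M * Rabs (q' - q)).
  { apply (le_closure (fun p => Rabs (f q' p - f q p))).
    - apply (cont_in_comp 0 1 (fun p => f q' p - f q p) Rabs). lra.
      apply cont_in_minus; auto; lra. intros; apply continuous_Rabs.
    - intros x Hx. destruct (MVT_gen (fun z => f z x) q q' (fun z => fq z x)) as [c [_ E]].
      + intros z _. exact (D1_dq f fq fp z x D Hx).
      + intros z _. exact (is_derive_continuity_pt _ _ _ (D1_dq f fq fp z x D Hx)).
      + rewrite E, Rabs_mult. apply Rmult_le_compat_r. apply Rabs_pos. now apply HB. }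
  assert (Hpp : forall a b, 0 <= a <= 1 -> 0 <= b <= 1 -> a < b -> Rabs (f q b - f q a) <= M * (b - a)).
  { intros a b Ha Hb L. destruct (MVT_closed (f q) (fp q) a b L) as [c [Hc E]].
    - intros x Hx. apply (D1_dp f fq fp); auto; lra.
    - apply cont_in_sub with 0 1; auto; lra.
    - rewrite E, Rabs_mult, (Rabs_pos_eq (b - a)) by lra. apply Rmult_le_compat_r. lra. apply HB. lra. }
  assert (Hp2 : Rabs (f q p' - f q p) <= M * Rabs (p' - p)).
  { destruct (Rtotal_order p p') as [L|[->|L]].
    - rewrite (Rabs_pos_eq (p' - p)) by lra. auto.
    - rewrite !Rminus_diag, Rabs_R0. lra.
    - rewrite Rabs_minus_sym, (Rabs_minus_sym p'), (Rabs_pos_eq (p - p')) by lra. auto. }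
  replace (f q' p' - f q p) with ((f q' p' - f q p') + (f q p' - f q p)) by ring.
  eapply Rle_trans. apply Rabs_triang. specialize (Hq p' Hp'). lra.
Qed.

Lemma Lip_UC f : Lip f -> UC f.
Proof.
  intros [M [HM H]] eps Heps. exists (eps / (2 * M)).
  assert (0 < eps / (2 * M)) by (apply Rdiv_lt_0_compat; lra).
  split; auto. intros q p q' p' Hp Hp' L1 L2. eapply Rle_lt_trans. apply H; auto.
  apply Rlt_le_trans with (M * (eps / (2 * M) + eps / (2 * M))).
  apply Rmult_lt_compat_l; lra. right. field. lra.
Qed.

Lemma RInt_minusR (f g : R -> R) a b : ex_RInt f a b -> ex_RInt g a b ->
  RInt (fun x => f x - g x) a b = RInt f a b - RInt g a b.
Proof. exact (@RInt_minus R_CompleteNormedModule f g a b). Qed.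

Lemma RInt_plusR (f g : R -> R) a b : ex_RInt f a b -> ex_RInt g a b ->
  RInt (fun x => f x + g x) a b = RInt f a b + RInt g a b.
Proof. exact (@RInt_plus R_CompleteNormedModule f g a b). Qed.

Lemma RInt_scalR (f : R -> R) l a b : ex_RInt f a b -> RInt (fun x => l * f x) a b = l * RInt f a b.
Proof. exact (@RInt_scal R_CompleteNormedModule f a b l). Qed.

Lemma ex_RInt_minusR (f g : R -> R) a b : ex_RInt f a b -> ex_RInt g a b -> ex_RInt (fun x => f x - g x) a b.
Proof. exact (@ex_RInt_minus R_NormedModule f g a b). Qed.

Lemma ex_RInt_scalR (f : R -> R) l a b : ex_RInt f a b -> ex_RInt (fun x => l * f x) a b.
Proof. exact (@ex_RInt_scal R_NormedModule f a b l). Qed.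

(** Poincare lemma for the closed form [g2 dq + g1 dp]: differentiation under the integral gives the
    integral of the [p]-derivative of [g2], that is [g2] itself, because [g2] vanishes on the
    bottom. *)
Lemma C1s_prim g1 k1q k1p g2 k2q k2p : C1s g1 k1q k1p -> C1s g2 k2q k2p ->
  (forall q p, 0 < p < 1 -> k1q q p = k2p q p) -> (forall q, g2 q 0 = 0) ->
  C1s (fun q p => RInt (g1 q) 0 p) g2 g1.
Proof.
  intros H1 H2 E H0.
  destruct H1 as [HD1 [U1 B1] [U1q B1q] U1p]. assert (H1 : C1s g1 k1q k1p) by (split; auto; split; auto).
  pose proof (C1_f _ _ _ H2) as [U2 B2].
  set (G := fun q p => RInt (g1 q) 0 p).
  assert (ex1 : forall q p, 0 <= p <= 1 -> ex_RInt (g1 q) 0 p).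
  { intros q p Hp. apply cont_in_ex_RInt. lra. apply cont_in_sub with 0 1; try lra. now apply UC_cont_in. }
  assert (exk : forall q p, 0 <= p <= 1 -> ex_RInt (k1q q) 0 p).
  { intros q p Hp. apply cont_in_ex_RInt. lra. apply cont_in_sub with 0 1; try lra. now apply UC_cont_in. }
  assert (I : forall q p, 0 <= p <= 1 -> RInt (k1q q) 0 p = g2 q p).
  { intros q p Hp. rewrite (FTC_closed 0 p (k1q q) (g2 q)). rewrite H0; apply Rminus_0_r. lra.
    - apply cont_in_sub with 0 1; try lra. now apply UC_cont_in.
    - apply cont_in_sub with 0 1; try lra. now apply UC_cont_in.
    - intros x Hx. rewrite E by lra. apply (D1_dp g2 k2q k2p). apply H2. lra. }
  assert (Dq : forall q p, 0 <= p <= 1 -> is_derive (fun x => G x p) q (g2 q p)).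
  { intros q p Hp. apply is_derive_Reals. intros eps Heps.
    destruct (U1q (eps/2) ltac:(lra)) as [d [Hd K]].
    exists (mkposreal d Hd). simpl. intros s Hs0 Hs.
    assert (Hb : Rabs (G (q + s) p - G q p - s * g2 q p) <= eps / 2 * Rabs s).
    { rewrite <- I by auto. unfold G.
      rewrite <- RInt_scalR, <- RInt_minusR, <- RInt_minusR by auto using ex_RInt_minusR, ex_RInt_scalR.
      eapply Rle_trans. apply (abs_RInt_le_const _ 0 p (eps / 2 * Rabs s)). lra.
      - auto using ex_RInt_minusR, ex_RInt_scalR.
      - intros x Hx.
        destruct (C1s_MVTq g1 k1q k1p q (q + s) x H1 ltac:(lra)) as [c [Hc Ec]].
        change (Rabs (g1 (q + s) x - g1 q x - s * k1q q x) <= eps / 2 * Rabs s).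
        rewrite Ec. replace (k1q c x * (q + s - q) - s * k1q q x) with ((k1q c x - k1q q x) * s) by ring.
        rewrite Rabs_mult. apply Rmult_le_compat_r. apply Rabs_pos. left. apply K; try lra.
        + apply between_abs in Hc. replace (q + s - q) with s in Hc by ring. lra.
        + now rewrite Rminus_diag, Rabs_R0.
      - assert (0 <= eps / 2 * Rabs s) by (apply Rmult_le_pos; [lra|apply Rabs_pos]). nra. }
    replace ((G (q + s) p - G q p) / s - g2 q p) with ((G (q + s) p - G q p - s * g2 q p) / s) by (field; auto).
    unfold Rdiv at 1. rewrite Rabs_mult, Rabs_inv. assert (0 < Rabs s) by (now apply Rabs_pos_lt).
    apply Rmult_lt_reg_r with (Rabs s); auto. rewrite Rmult_assoc, Rinv_l, Rmult_1_r by lra.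
    eapply Rle_lt_trans. apply Hb. apply Rmult_lt_compat_r; lra. }
  assert (D : D1 G g2 g1).
  { intros q p Hp. apply grad_of_differentiable.
    apply differentiable_of_partials with (Rmin p (1 - p)). apply Rmin_pos; lra.
    - intros x' y' _ Hy. apply Dq. pose proof (Rmin_l p (1 - p)). pose proof (Rmin_r p (1 - p)).
      apply Rabs_def2 in Hy. lra.
    - apply (RInt_derive_in 0 1 (g1 q)); auto. now apply UC_cont_in.
    - intros eps Heps. destruct (U2 eps Heps) as [d [Hd K]].
      exists (Rmin d (Rmin p (1 - p))). split. repeat apply Rmin_pos; lra.
      intros x' y' Hx Hy. pose proof (Rmin_l d (Rmin p (1 - p))). pose proof (Rmin_r d (Rmin p (1 - p))).
      pose proof (Rmin_l p (1 - p)). pose proof (Rmin_r p (1 - p)).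
      apply K; try lra. apply Rabs_def2 in Hy. lra. }
  destruct (BD_pos g1 B1) as [M1 [P1 B1']]. destruct (BD_pos g2 B2) as [M2 [P2 B2']].
  split; auto.
  - split.
    + apply Lip_UC. apply Lip_of_D1 with g2 g1 (M1 + M2); auto. lra.
      * intros q p Hp. specialize (B1' q p ltac:(lra)). specialize (B2' q p ltac:(lra)). lra.
      * intros q. apply RInt_cont_in. lra. now apply UC_cont_in.
    + exists M1. intros q p Hp. eapply Rle_trans. apply (abs_RInt_le_const _ 0 p M1). lra. auto.
      intros; apply B1'; lra. nra.
  - split; auto.
  - split; auto.
Qed.

(* The wave in the partial hodograph variables [q = x], [p = psi]: height [fh], velocity
   components [fu = psi_x], [fv = psi_y] and the first derivatives of the latter in [(q, p)]. *)
Record flow := mkflow { fh : fun2; fu : fun2; fv : fun2; fuq : fun2; fup : fun2; fvq : fun2; fvp : fun2 }.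

(** With d/dx = d/dq + u d/dp and d/dy = v d/dp, [sol_E1] is the symmetry of the mixed derivatives
    of psi and [sol_E2] the equation for its Laplacian. The gradient of the height is (-u/v,
    1/v). *)
Record sol (om : R -> R) (f : flow) : Prop := {
  sol_c : exists c, 0 < c /\ forall q p, 0 <= p <= 1 -> c <= fv f q p;
  sol_h : C1s (fh f) (fun q p => - fu f q p / fv f q p) (fun q p => / fv f q p);
  sol_u : C1s (fu f) (fuq f) (fup f);
  sol_v : C1s (fv f) (fvq f) (fvp f);
  sol_E1 : forall q p, 0 <= p <= 1 -> fvq f q p + fu f q p * fvp f q p = fv f q p * fup f q p;
  sol_E2 : forall q p, 0 < p < 1 -> fuq f q p + fu f q p * fup f q p + fv f q p * fvp f q p + om p = 0;
  sol_h0 : forall q, fh f q 0 = 0;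
  sol_u0 : forall q, fu f q 0 = 0 }.

Lemma sol_hp om f : sol om f -> C1s (fun q p => / fv f q p)
  (fun q p => - fvq f q p / fv f q p ^ 2) (fun q p => - fvp f q p / fv f q p ^ 2).
Proof. intros H. destruct (sol_c _ _ H) as [c [Hc Hc']]. apply C1s_inv with c; auto. apply H. Qed.

Lemma sol_hq om f : sol om f -> C1s (fun q p => - fu f q p / fv f q p)
  (fun q p => - (fuq f q p * fv f q p - fu f q p * fvq f q p) / fv f q p ^ 2)
  (fun q p => - (fup f q p * fv f q p - fu f q p * fvp f q p) / fv f q p ^ 2).
Proof.
  intros H. destruct (sol_c _ _ H) as [c [Hc Hc']].
  eapply C1s_ext. exact (C1s_scal _ _ _ (-1) (C1s_mult _ _ _ _ _ _ (sol_u _ _ H) (sol_hp _ _ H))).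
  intros q p Hp. specialize (Hc' q p Hp). simpl. repeat split; field; lra.
Qed.

Lemma sol_pos om f q p : sol om f -> 0 <= p <= 1 -> 0 < fv f q p.
Proof. intros H Hp. destruct (sol_c _ _ H) as [c [Hc Hc']]. specialize (Hc' q p Hp). lra. Qed.

(** Since u = -h_q / h_p and v = 1 / h_p, this is the Dubreil-Jacotin height equation divided by
    h_p^2. Its right side [om p * h_p] contains the unknown only through the gradient. *)
Lemma height_eq om f q p : sol om f -> 0 < p < 1 ->
  - (fuq f q p * fv f q p - fu f q p * fvq f q p) / fv f q p ^ 2
  + fu f q p * (- (fup f q p * fv f q p - fu f q p * fvp f q p) / fv f q p ^ 2 + - fvq f q p / fv f q p ^ 2)
  + (fu f q p ^ 2 + fv f q p ^ 2) * (- fvp f q p / fv f q p ^ 2) = om p / fv f q p.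
Proof.
  intros H Hp. pose proof (sol_pos om f q p H ltac:(lra)).
  pose proof (sol_E1 _ _ H q p ltac:(lra)) as E1. pose proof (sol_E2 _ _ H q p Hp) as E2.
  replace (fvq f q p) with (fv f q p * fup f q p - fu f q p * fvp f q p) by lra.
  replace (fuq f q p) with (- om p - fu f q p * fup f q p - fv f q p * fvp f q p) by lra.
  field. lra.
Qed.

(** The difference of the equations is split symmetrically: mean coefficients times differences of
    second derivatives, plus differences of coefficients times mean second derivatives. For a flow
    and its reflection the mean of [u] then vanishes on the axis, which the corner barriers
    exploit. *)
Lemma diff_alg u v U W hqq hs hpp Hqq Hs Hpp o : v <> 0 -> W <> 0 ->
  hqq + u * hs + (u ^ 2 + v ^ 2) * hpp = o / v ->
  Hqq + U * Hs + (U ^ 2 + W ^ 2) * Hpp = o / W ->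
  (Hqq - hqq) + (u + U) / 2 * (Hs - hs) + ((u ^ 2 + v ^ 2 + U ^ 2 + W ^ 2) / 2) * (Hpp - hpp)
  = o * (/ W - / v) - / 2 * ((U - u) * (Hs + hs) + (U ^ 2 + W ^ 2 - u ^ 2 - v ^ 2) * (Hpp + hpp)).
Proof.
  intros Hv HW E1 E2. unfold Rdiv in E1, E2. replace (o * (/ W - / v)) with (o * / W - o * / v) by ring.
  rewrite <- E1, <- E2. field.
Qed.

(** With [X], [Y] the differences of h_q and h_p one has U - u = -W (u Y + X) and W - v = -v W Y, so
    differences of the coefficients are controlled by the gradient of the height difference. *)
Lemma diff_bound u v U W Hs Hpp o M : 0 < v -> 0 < W -> 1 <= M ->
  Rabs u <= M -> Rabs v <= M -> Rabs U <= M -> Rabs W <= M -> Rabs o <= M -> Rabs Hs <= M -> Rabs Hpp <= M ->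
  Rabs (o * (/ W - / v) - / 2 * ((U - u) * Hs + (U ^ 2 + W ^ 2 - u ^ 2 - v ^ 2) * Hpp))
  <= (M + M ^ 3 + 4 * M ^ 4) * (Rabs (- U / W - - u / v) + Rabs (/ W - / v)).
Proof.
  intros Hv HW HM Bu Bv BU BW Bo Bs Bp.
  set (X := - U / W - - u / v). set (Y := / W - / v).
  assert (EU : U - u = - (W * (u * Y + X))) by (unfold X, Y; field; lra).
  assert (EW : W - v = - (v * W * Y)) by (unfold Y; field; lra).
  replace (U ^ 2 + W ^ 2 - u ^ 2 - v ^ 2) with ((U - u) * (U + u) + (W - v) * (W + v)) by ring.
  pose proof (Rabs_pos X) as PX. pose proof (Rabs_pos Y) as PY.
  set (Z := Rabs X + Rabs Y). assert (0 <= Z) by (unfold Z; lra).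
  assert (mulb : forall a b A B, Rabs a <= A -> Rabs b <= B -> Rabs (a * b) <= A * B).
  { intros. rewrite Rabs_mult. apply Rmult_le_compat; auto; apply Rabs_pos. }
  assert (addb : forall a b A B, Rabs a <= A -> Rabs b <= B -> Rabs (a + b) <= A + B).
  { intros. eapply Rle_trans. apply Rabs_triang. lra. }
  assert (BY : Rabs Y <= Z) by (unfold Z; lra). assert (BX : Rabs X <= Z) by (unfold Z; lra).
  assert (B1 : Rabs (U - u) <= M * (M * Z + Z)).
  { rewrite EU, Rabs_Ropp. auto. }
  assert (B2 : Rabs (W - v) <= M * M * Z).
  { rewrite EW, Rabs_Ropp. auto. }
  assert (B1' : Rabs (U - u) <= 2 * M ^ 2 * Z).
  { eapply Rle_trans. apply B1. assert (M * Z <= M * M * Z) by (apply Rmult_le_compat_r; nra). nra. }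
  replace (o * Y - / 2 * ((U - u) * Hs + ((U - u) * (U + u) + (W - v) * (W + v)) * Hpp))
    with (o * Y + (- / 2) * ((U - u) * Hs + ((U - u) * (U + u) + (W - v) * (W + v)) * Hpp)) by ring.
  eapply Rle_trans. apply addb. apply mulb. exact Bo. exact BY.
  apply mulb. apply Req_le. rewrite Rabs_Ropp. apply Rabs_pos_eq. lra.
  apply addb. apply mulb. exact B1'. exact Bs. apply mulb. apply addb. apply mulb. exact B1'. apply addb; eassumption.
  apply mulb. exact B2. apply addb; eassumption. exact Bp.
  assert (0 <= M ^ 4) by (apply pow_le; lra). assert (0 <= M ^ 4 * Z) by (apply Rmult_le_pos; auto).
  nra.
Qed.

Definition avgA (f g : flow) : fun2 :=
  fun q p => (fu f q p ^ 2 + fv f q p ^ 2 + fu g q p ^ 2 + fv g q p ^ 2) / 2.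
Definition avgB (f g : flow) : fun2 := fun q p => (fu f q p + fu g q p) / 2.

Lemma coef_avg om f g : sol om f -> sol om g -> exists c0 A1, coef (avgA f g) (avgB f g) c0 A1.
Proof.
  intros Hf Hg. destruct (sol_c _ _ Hf) as [c [Hc Hc']]. destruct (sol_c _ _ Hg) as [d [Hd Hd']].
  destruct (BD_pos _ (proj2 (C1_f _ _ _ (sol_u _ _ Hf)))) as [M1 [P1 B1]].
  destruct (BD_pos _ (proj2 (C1_f _ _ _ (sol_v _ _ Hf)))) as [M2 [P2 B2]].
  destruct (BD_pos _ (proj2 (C1_f _ _ _ (sol_u _ _ Hg)))) as [M3 [P3 B3]].
  destruct (BD_pos _ (proj2 (C1_f _ _ _ (sol_v _ _ Hg)))) as [M4 [P4 B4]].
  exists ((c ^ 2 + d ^ 2) / 2), ((M1 ^ 2 + M2 ^ 2 + M3 ^ 2 + M4 ^ 2) / 2). split. nra.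
  intros q p Hp. unfold avgA, avgB.
  specialize (Hc' q p ltac:(lra)). specialize (Hd' q p ltac:(lra)). split.
  - assert (c ^ 2 <= fv f q p ^ 2) by (apply pow_incr; lra).
    assert (d ^ 2 <= fv g q p ^ 2) by (apply pow_incr; lra).
    pose proof (pow2_ge_0 (fu f q p - fu g q p)). nra.
  - assert (SQ : forall x M, Rabs x <= M -> x ^ 2 <= M ^ 2).
    { intros x M H. rewrite <- (pow2_abs x). apply pow_incr. split; auto. apply Rabs_pos. }
    pose proof (SQ _ _ (B1 q p ltac:(lra))). pose proof (SQ _ _ (B2 q p ltac:(lra))).
    pose proof (SQ _ _ (B3 q p ltac:(lra))). pose proof (SQ _ _ (B4 q p ltac:(lra))). lra.
Qed.

Lemma diff_ell om f g : cont_in 0 1 om -> sol om f -> sol om g ->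
  exists K, ell (fun q p => fh g q p - fh f q p) (avgA f g) (avgB f g) K.
Proof.
  intros Ho Hf Hg.
  pose proof (sol_hp _ _ Hf) as Fp. pose proof (sol_hq _ _ Hf) as Fq.
  pose proof (sol_hp _ _ Hg) as Gp. pose proof (sol_hq _ _ Hg) as Gq.
  destruct (BD_pos _ (proj2 (C1_f _ _ _ (sol_u _ _ Hf)))) as [M1 [P1 B1]].
  destruct (BD_pos _ (proj2 (C1_f _ _ _ (sol_v _ _ Hf)))) as [M2 [P2 B2]].
  destruct (BD_pos _ (proj2 (C1_f _ _ _ (sol_u _ _ Hg)))) as [M3 [P3 B3]].
  destruct (BD_pos _ (proj2 (C1_f _ _ _ (sol_v _ _ Hg)))) as [M4 [P4 B4]].
  destruct (BD_pos _ (proj2 (UCB_p om Ho))) as [M5 [P5 B5]].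
  destruct (BD_pos _ (proj2 (UCB_plus _ _ (UCB_plus _ _ (C1_p _ _ _ Fq) (C1_q _ _ _ Fp))
     (UCB_plus _ _ (C1_p _ _ _ Gq) (C1_q _ _ _ Gp))))) as [M6 [P6 B6]].
  destruct (BD_pos _ (proj2 (UCB_plus _ _ (C1_p _ _ _ Fp) (C1_p _ _ _ Gp)))) as [M7 [P7 B7]].
  set (M := 1 + M1 + M2 + M3 + M4 + M5 + M6 + M7).
  exists (M + M ^ 3 + 4 * M ^ 4). split.
  { assert (0 < M) by (unfold M; lra). pose proof (pow_lt M 3 H). pose proof (pow_lt M 4 H). lra. }
  split. apply UC_diff. apply (C1_f _ _ _ (sol_h _ _ Hg)). apply (C1_f _ _ _ (sol_h _ _ Hf)).
  pose proof (C1_D _ _ _ (C1s_minus _ _ _ _ _ _ (sol_h _ _ Hg) (sol_h _ _ Hf))) as D0.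
  pose proof (C1_D _ _ _ (C1s_minus _ _ _ _ _ _ Gq Fq)) as Dq.
  pose proof (C1_D _ _ _ (C1s_minus _ _ _ _ _ _ Gp Fp)) as Dp.
  do 6 eexists. split; [exact D0|split; [exact Dq|split; [exact Dp|]]].
  intros q p Hp. cbv beta. unfold avgA, avgB.
  pose proof (height_eq om f q p Hf Hp) as Ef. pose proof (height_eq om g q p Hg Hp) as Eg.
  pose proof (sol_pos om f q p Hf ltac:(lra)). pose proof (sol_pos om g q p Hg ltac:(lra)).
  specialize (B1 q p ltac:(lra)). specialize (B2 q p ltac:(lra)). specialize (B3 q p ltac:(lra)).
  specialize (B4 q p ltac:(lra)). specialize (B5 q p ltac:(lra)). specialize (B6 q p ltac:(lra)).
  specialize (B7 q p ltac:(lra)).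
  pose proof (diff_alg (fu f q p) (fv f q p) (fu g q p) (fv g q p) _ _ _ _ _ _ (om p) ltac:(lra) ltac:(lra) Ef Eg) as E.
  match type of E with _ = ?R => match goal with |- Rabs ?L <= _ => replace L with R end end.
  2: { rewrite <- E. field. lra. }
  apply diff_bound; auto; unfold M; try lra.
  - eapply Rle_trans; [|apply Rle_trans with M6; [exact B6|lra]]. right. f_equal. ring.
  - eapply Rle_trans; [|apply Rle_trans with M7; [exact B7|lra]]. right. f_equal. ring.
Qed.

(** [phip] and [phiq] are the hodograph derivatives of [Phi]. In physical variables they read Phi_x
    = u (v - m) and Phi_y = ((v - m)^2 - u^2) / 2, the imaginary and real parts of half the square
    of (v - m) + i u. *)
Definition phip (f : flow) (m : R -> R) : fun2 :=
  fun q p => ((fv f q p - m p) ^ 2 - fu f q p ^ 2) / (2 * fv f q p).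
Definition phiq (f : flow) (m : R -> R) : fun2 :=
  fun q p => fu f q p * (fv f q p - m p) - fu f q p * phip f m q p.

Lemma phip_C1s om f m : sol om f -> C1s (fun _ p => m p) (fun _ _ => 0) (fun _ p => - om p / m p) ->
  C1s (phip f m)
   (fun q p => ((fv f q p - m p) * fvq f q p - fu f q p * fuq f q p) / fv f q p - phip f m q p * fvq f q p / fv f q p)
   (fun q p => ((fv f q p - m p) * (fvp f q p - - om p / m p) - fu f q p * fup f q p) / fv f q p - phip f m q p * fvp f q p / fv f q p).
Proof.
  intros H Hm. pose proof (C1s_minus _ _ _ _ _ _ (sol_v _ _ H) Hm) as Ha.
  pose proof (C1s_minus _ _ _ _ _ _ (C1s_mult _ _ _ _ _ _ Ha Ha) (C1s_mult _ _ _ _ _ _ (sol_u _ _ H) (sol_u _ _ H))) as Hn.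
  eapply C1s_ext. exact (C1s_scal _ _ _ (/ 2) (C1s_mult _ _ _ _ _ _ Hn (sol_hp _ _ H))).
  intros q p Hp. pose proof (sol_pos om f q p H Hp). unfold phip. simpl. unfold Rdiv at 5.
  set (z := - om p / m p). repeat split; field; lra.
Qed.

Lemma phiq_C1s om f m : sol om f -> C1s (fun _ p => m p) (fun _ _ => 0) (fun _ p => - om p / m p) ->
  exists bq bp, C1s (phiq f m) bq bp /\ forall q p, 0 <= p <= 1 ->
    bq q p = fuq f q p * (fv f q p - m p) + fu f q p * fvq f q p
      - (fuq f q p * phip f m q p + fu f q p * (((fv f q p - m p) * fvq f q p - fu f q p * fuq f q p) / fv f q p - phip f m q p * fvq f q p / fv f q p)) /\
    bp q p = fup f q p * (fv f q p - m p) + fu f q p * (fvp f q p - - om p / m p)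
      - (fup f q p * phip f m q p + fu f q p * (((fv f q p - m p) * (fvp f q p - - om p / m p) - fu f q p * fup f q p) / fv f q p - phip f m q p * fvp f q p / fv f q p)).
Proof.
  intros H Hm. pose proof (C1s_minus _ _ _ _ _ _ (sol_v _ _ H) Hm) as Ha.
  do 2 eexists. split. exact (C1s_minus _ _ _ _ _ _ (C1s_mult _ _ _ _ _ _ (sol_u _ _ H) Ha)
    (C1s_mult _ _ _ _ _ _ (sol_u _ _ H) (phip_C1s om f m H Hm))).
  intros q p Hp. simpl. split; ring.
Qed.

(** The operator applied to [Phi] leaves [om / m] times (v - m)^2 + u^2, plus [om * Phi_p]. By the
    complex-square structure the quadratic factor is exactly twice the length of the physical
    gradient of [Phi], hence bounded linearly by its hodograph gradient. *)
Lemma phi_ell om f m mu Phi : cont_in 0 1 om -> sol om f -> 0 < mu -> (forall p, 0 <= p <= 1 -> mu <= m p) ->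
  C1s (fun _ p => m p) (fun _ _ => 0) (fun _ p => - om p / m p) -> C1s Phi (phiq f m) (phip f m) ->
  exists K, ell Phi (avgA f f) (avgB f f) K.
Proof.
  intros Ho H Hmu Hm Cm CP.
  pose proof (phip_C1s om f m H Cm) as Dp. destruct (phiq_C1s om f m H Cm) as [bq [bp [Dq Eb]]].
  destruct (BD_pos _ (proj2 (C1_f _ _ _ (sol_u _ _ H)))) as [M1 [P1 B1]].
  destruct (BD_pos _ (proj2 (C1_f _ _ _ (sol_v _ _ H)))) as [M2 [P2 B2]].
  destruct (BD_pos _ (proj2 (UCB_p om Ho))) as [M5 [P5 B5]].
  exists (M5 / mu * (2 * (1 + M1 + M2)) + M5). split.
  { assert (0 < M5 / mu) by (apply Rdiv_lt_0_compat; lra). nra. }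
  split. apply CP.
  do 6 eexists. split; [exact (C1_D _ _ _ CP)|split; [exact (C1_D _ _ _ Dq)|split; [exact (C1_D _ _ _ Dp)|]]].
  intros q p Hp. destruct (Eb q p ltac:(lra)) as [-> ->]. unfold avgA, avgB.
  pose proof (sol_pos om f q p H ltac:(lra)) as Hv. specialize (Hm p ltac:(lra)).
  pose proof (sol_E1 _ _ H q p ltac:(lra)) as E1. pose proof (sol_E2 _ _ H q p Hp) as E2.
  specialize (B1 q p ltac:(lra)). specialize (B2 q p ltac:(lra)). specialize (B5 q p ltac:(lra)).
  assert (Key : (fv f q p - m p) ^ 2 + fu f q p ^ 2 <= 2 * (1 + M1 + M2) * (Rabs (phiq f m q p) + Rabs (phip f m q p))).
  { set (px := phiq f m q p + fu f q p * phip f m q p). set (py := fv f q p * phip f m q p).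
    assert (Ex : px = fu f q p * (fv f q p - m p)) by (unfold px, phiq; ring).
    assert (Ey : py = ((fv f q p - m p) ^ 2 - fu f q p ^ 2) / 2) by (unfold py, phip; field; lra).
    assert (L1 : (fv f q p - m p) ^ 2 + fu f q p ^ 2 <= 2 * (Rabs px + Rabs py)).
    { apply Rsqr_incr_0_var; [|pose proof (Rabs_pos px); pose proof (Rabs_pos py); lra].
      unfold Rsqr. pose proof (Rabs_pos px). pose proof (Rabs_pos py).
      pose proof (pow2_abs px). pose proof (pow2_abs py).
      assert (0 <= Rabs px * Rabs py) by (now apply Rmult_le_pos).
      apply Rle_trans with (4 * (px ^ 2 + py ^ 2)). rewrite Ex, Ey. right. field. nra. }
    assert (L2 : Rabs px <= Rabs (phiq f m q p) + M1 * Rabs (phip f m q p)).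
    { unfold px. eapply Rle_trans. apply Rabs_triang. rewrite Rabs_mult.
      assert (Rabs (fu f q p) * Rabs (phip f m q p) <= M1 * Rabs (phip f m q p)) by (apply Rmult_le_compat_r; auto; apply Rabs_pos). lra. }
    assert (L3 : Rabs py <= M2 * Rabs (phip f m q p)).
    { unfold py. rewrite Rabs_mult. apply Rmult_le_compat_r; auto; apply Rabs_pos. }
    pose proof (Rabs_pos (phiq f m q p)). pose proof (Rabs_pos (phip f m q p)). nra. }
  match goal with |- Rabs ?L <= _ => replace L with (om p / m p * ((fv f q p - m p) ^ 2 + fu f q p ^ 2) + om p * phip f m q p) end.
  2: { unfold phip.
    replace (fvq f q p) with (fv f q p * fup f q p - fu f q p * fvp f q p) by lra.
    replace (fuq f q p) with (- om p - fu f q p * fup f q p - fv f q p * fvp f q p) by lra.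
    field. lra. }
  eapply Rle_trans. apply Rabs_triang. rewrite !Rabs_mult. rewrite Rmult_plus_distr_r.
  pose proof (pow2_ge_0 (fv f q p - m p)). pose proof (pow2_ge_0 (fu f q p)).
  apply Rplus_le_compat.
  - rewrite (Rabs_pos_eq (_ + _)) by lra. rewrite Rmult_assoc. apply Rmult_le_compat; auto. apply Rabs_pos. lra.
    unfold Rdiv. rewrite Rabs_mult. apply Rmult_le_compat; auto. apply Rabs_pos. apply Rabs_pos.
    rewrite Rabs_pos_eq. apply Rinv_le_contravar; lra. left. apply Rinv_0_lt_compat. lra.
  - apply Rmult_le_compat; auto; try apply Rabs_pos. pose proof (Rabs_pos (phiq f m q p)). lra.
Qed.

(** * Laminar flows *)

(* Laminar flows are parametrised by [t = s^2], in which the Bernoulli constant [Nt] is convex.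
   [kap] is the depth prescribed by the Bernoulli condition, so the flow [t] has Bernoulli constant
   [r] iff [dt t = kap t]. [St] extends the flow force in such a way that its derivative is
   [(dt - kap) / 2] (lemma [St_derive]). *)
Definition mt (om : R -> R) (t p : R) : R := sqrt (t - 2 * Omega om p).
Definition Ht (om : R -> R) (t p : R) : R := RInt (fun x => / mt om t x) 0 p.
Definition dt (om : R -> R) (t : R) : R := Ht om t 1.
Definition Mt (om : R -> R) (t p : R) : R := RInt (mt om t) 0 p.
Definition ct (om : R -> R) (t : R) : R := Mt om t 1.
Definition Nt (om : R -> R) (t : R) : R := t / 2 - Omega om 1 + dt om t.
Definition kap (om : R -> R) (r t : R) : R := r + Omega om 1 - t / 2.
Definition St (om : R -> R) (r t : R) : R := kap om r t ^ 2 / 2 + ct om t.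
(** The condition [t > 2 * max Omega], written with a uniform margin; for [t = s^2] it follows from
    [s > s0]. *)
Definition adm (om : R -> R) (t : R) : Prop :=
  exists mu, 0 < mu /\ forall p, 0 <= p <= 1 -> mu <= t - 2 * Omega om p.

Lemma adm_mono om t t' : adm om t -> t <= t' -> adm om t'.
Proof. intros [mu [H H']] L. exists mu. split; auto. intros p Hp. specialize (H' p Hp). lra. Qed.

Lemma Omega_cont om : cont_in 0 1 om -> cont_in 0 1 (Omega om).
Proof. intros. apply RInt_cont_in; auto; lra. Qed.

Lemma Omega_derive om p : cont_in 0 1 om -> 0 < p < 1 -> is_derive (Omega om) p (om p).
Proof. intros. now apply (RInt_derive_in 0 1 om). Qed.

Lemma Omega_0 om : Omega om 0 = 0.
Proof. unfold Omega. rewrite (@RInt_point R_CompleteNormedModule). reflexivity. Qed.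

Lemma mt_sqr om t p : adm om t -> 0 <= p <= 1 -> mt om t p * mt om t p = t - 2 * Omega om p.
Proof. intros [mu [H H']] Hp. specialize (H' p Hp). unfold mt. apply sqrt_sqrt. lra. Qed.

Lemma mt_pos om t p : adm om t -> 0 <= p <= 1 -> 0 < mt om t p.
Proof. intros [mu [H H']] Hp. specialize (H' p Hp). unfold mt. apply sqrt_lt_R0. lra. Qed.

Lemma mt_ge om t : adm om t -> exists nu, 0 < nu /\ forall p, 0 <= p <= 1 -> nu <= mt om t p.
Proof.
  intros [mu [H H']]. exists (sqrt mu). split. now apply sqrt_lt_R0. intros p Hp.
  specialize (H' p Hp). unfold mt. apply sqrt_le_1; lra.
Qed.

Lemma mt_cont om t : cont_in 0 1 om -> cont_in 0 1 (mt om t).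
Proof.
  intros Ho. apply (cont_in_comp 0 1 (fun p => t - 2 * Omega om p) sqrt). lra.
  - apply cont_in_minus. lra. apply cont_in_const. apply cont_in_mult. lra. apply cont_in_const. now apply Omega_cont.
  - intros. apply continuous_sqrt.
Qed.

Lemma mt_derive om t p : cont_in 0 1 om -> adm om t -> 0 < p < 1 -> is_derive (mt om t) p (- om p / mt om t p).
Proof.
  intros Ho Ha Hp. pose proof (mt_pos om t p Ha ltac:(lra)) as Hm.
  destruct Ha as [mu [H H']]. specialize (H' p ltac:(lra)).
  eapply is_derive_eq. apply (is_derive_sqrt (fun p => t - 2 * Omega om p) p (0 - 2 * om p)).
  - apply (is_derive_minus (V := R_NormedModule) (fun _ => t) (fun p => 2 * Omega om p)).
    apply (is_derive_const (V := R_NormedModule)). apply is_derive_scal. now apply Omega_derive.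
  - lra.
  - unfold mt in *. field. lra.
Qed.

Lemma mt_inv_cont om t : cont_in 0 1 om -> adm om t -> cont_in 0 1 (fun p => / mt om t p).
Proof.
  intros Ho Ha. apply cont_in_inv. lra. intros p Hp. pose proof (mt_pos om t p Ha Hp). lra. now apply mt_cont.
Qed.

Lemma mt_C1s om t : cont_in 0 1 om -> adm om t ->
  C1s (fun _ p => mt om t p) (fun _ _ => 0) (fun _ p => - om p / mt om t p).
Proof.
  intros Ho Ha. apply (C1s_p (mt om t) (fun p => - om p / mt om t p)).
  - now apply mt_cont.
  - apply cont_in_mult. lra. apply cont_in_opp; auto; lra. now apply mt_inv_cont.
  - intros. now apply mt_derive.
Qed.

Lemma Ht_C1s om t : cont_in 0 1 om -> adm om t ->
  C1s (fun _ p => Ht om t p) (fun _ _ => 0) (fun _ p => / mt om t p).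
Proof.
  intros Ho Ha. apply (C1s_p (Ht om t) (fun p => / mt om t p)).
  - apply RInt_cont_in. lra. now apply mt_inv_cont.
  - now apply mt_inv_cont.
  - intros p Hp. apply (RInt_derive_in 0 1 (fun p => / mt om t p)); auto. now apply mt_inv_cont.
Qed.

Lemma Mt_C1s om t : cont_in 0 1 om ->
  C1s (fun _ p => Mt om t p) (fun _ _ => 0) (fun _ p => mt om t p).
Proof.
  intros Ho. apply (C1s_p (Mt om t) (mt om t)).
  - apply RInt_cont_in. lra. now apply mt_cont.
  - now apply mt_cont.
  - intros p Hp. apply (RInt_derive_in 0 1 (mt om t)); auto. now apply mt_cont.
Qed.

Definition lam (om : R -> R) (t : R) : flow :=
  mkflow (fun _ p => Ht om t p) (fun _ _ => 0) (fun _ p => mt om t p)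
    (fun _ _ => 0) (fun _ _ => 0) (fun _ _ => 0) (fun _ p => - om p / mt om t p).

Lemma lam_sol om t : cont_in 0 1 om -> adm om t -> sol om (lam om t).
Proof.
  intros Ho Ha. split; simpl.
  - destruct (mt_ge om t Ha) as [nu [H H']]. exists nu. auto.
  - eapply C1s_ext. apply (Ht_C1s om t Ho Ha). intros q p Hp. pose proof (mt_pos om t p Ha Hp).
    repeat split; simpl; field; lra.
  - apply C1s_const.
  - now apply mt_C1s.
  - intros; ring.
  - intros q p Hp. pose proof (mt_pos om t p Ha ltac:(lra)). field. lra.
  - intros q. unfold Ht. apply (@RInt_point R_CompleteNormedModule).
  - auto.
Qed.

Definition g1 (om : R -> R) (f : flow) : fun2 :=
  fun q p => (fv f q p ^ 2 - fu f q p ^ 2) / (2 * fv f q p) - Omega om p / fv f q p.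
Definition g2 (om : R -> R) (f : flow) : fun2 :=
  fun q p => fu f q p / fv f q p * ((fu f q p ^ 2 + fv f q p ^ 2) / 2 + Omega om p).
(* [Gf] is a potential of the closed form expressing conservation of flow force; subtracting the
   same object for the laminar flow [t] gives [Phi], the flow force flux function, whose value at the
   top is governed by [Phi_top]. *)
Definition Gf (om : R -> R) (f : flow) : fun2 := fun q p => RInt (g1 om f q) 0 p.
Definition Phi (om : R -> R) (f : flow) (t : R) : fun2 :=
  fun q p => Gf om f q p + t / 2 * fh f q p - Mt om t p.

Lemma Gf_C1s om f : cont_in 0 1 om -> sol om f -> C1s (Gf om f) (g2 om f) (g1 om f).
Proof.
  intros Ho H.
  assert (CO : C1s (fun _ p => Omega om p) (fun _ _ => 0) (fun _ p => om p)).
  { apply C1s_p; auto. now apply Omega_cont. intros; now apply Omega_derive. }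
  pose proof (sol_u _ _ H) as Hu. pose proof (sol_v _ _ H) as Hv. pose proof (sol_hp _ _ H) as Hi.
  pose proof (C1s_mult _ _ _ _ _ _ Hu Hu) as Huu. pose proof (C1s_mult _ _ _ _ _ _ Hv Hv) as Hvv.
  pose proof (C1s_minus _ _ _ _ _ _ (C1s_scal _ _ _ (/ 2) (C1s_minus _ _ _ _ _ _ Hvv Huu)) CO) as N1.
  pose proof (C1s_mult _ _ _ _ _ _ N1 Hi) as K1.
  pose proof (C1s_plus _ _ _ _ _ _ (C1s_scal _ _ _ (/ 2) (C1s_plus _ _ _ _ _ _ Huu Hvv)) CO) as N2.
  pose proof (C1s_mult _ _ _ _ _ _ (C1s_mult _ _ _ _ _ _ Hu Hi) N2) as K2.
  eapply C1s_prim.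
  - eapply C1s_ext. exact K1. intros q p Hp. pose proof (sol_pos om f q p H Hp). unfold g1.
    split; [field; lra|]. split; reflexivity.
  - eapply C1s_ext. exact K2. intros q p Hp. pose proof (sol_pos om f q p H Hp). unfold g2.
    split; [field; lra|]. split; reflexivity.
  - intros q p Hp. pose proof (sol_pos om f q p H ltac:(lra)).
    pose proof (sol_E1 _ _ H q p ltac:(lra)) as E1. pose proof (sol_E2 _ _ H q p Hp) as E2.
    cbv beta.
    replace (fvq f q p) with (fv f q p * fup f q p - fu f q p * fvp f q p) by lra.
    replace (fuq f q p) with (- om p - fu f q p * fup f q p - fv f q p * fvp f q p) by lra.
    field. lra.
  - intros q. unfold g2. rewrite (sol_u0 _ _ H). unfold Rdiv. ring.
Qed.

(** Bernoulli's law of the laminar stream, [t / 2 = m^2 / 2 + Omega], eliminates [Omega] from [g1]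
    and [g2] and completes the square in v - m. *)
Lemma Phi_C1s om f t : cont_in 0 1 om -> sol om f -> adm om t ->
  C1s (Phi om f t) (phiq f (mt om t)) (phip f (mt om t)).
Proof.
  intros Ho H Ha. eapply C1s_ext.
  exact (C1s_minus _ _ _ _ _ _ (C1s_plus _ _ _ _ _ _ (Gf_C1s om f Ho H) (C1s_scal _ _ _ (t / 2) (sol_h _ _ H))) (Mt_C1s om t Ho)).
  intros q p Hp. pose proof (sol_pos om f q p H Hp).
  pose proof (mt_sqr om t p Ha Hp) as E. split; [reflexivity|]. unfold g1, g2, phiq, phip.
  set (m := mt om t p) in *. replace (t / 2) with ((m * m + 2 * Omega om p) / 2) by lra.
  split; field; lra.
Qed.

Lemma Phi_0 om f t q : sol om f -> Phi om f t q 0 = 0.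
Proof.
  intros H. unfold Phi, Gf, Mt. rewrite (sol_h0 _ _ H), !(@RInt_point R_CompleteNormedModule).
  unfold zero; simpl. ring.
Qed.

Lemma Phi_ell om f t : cont_in 0 1 om -> sol om f -> adm om t ->
  exists K, ell (Phi om f t) (avgA f f) (avgB f f) K.
Proof.
  intros Ho H Ha. destruct (mt_ge om t Ha) as [nu [Hn Hn']].
  apply phi_ell with om (mt om t) nu; auto. now apply mt_C1s. now apply Phi_C1s.
Qed.

Lemma RInt_le_in f g : cont_in 0 1 f -> cont_in 0 1 g -> (forall x, 0 <= x <= 1 -> f x <= g x) ->
  RInt f 0 1 <= RInt g 0 1.
Proof.
  intros. apply RInt_le; try lra; try (apply cont_in_ex_RInt; auto; lra). intros; apply H1; lra.
Qed.

Lemma RInt_lt_in f g : cont_in 0 1 f -> cont_in 0 1 g -> (forall x, 0 <= x <= 1 -> f x < g x) ->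
  RInt f 0 1 < RInt g 0 1.
Proof.
  intros Hf Hg H. destruct (cont_in_min 0 1 (fun x => g x - f x)) as [x0 [Hx0 Hm]]. lra.
  apply cont_in_minus; auto; lra.
  assert (RInt (fun _ => g x0 - f x0) 0 1 <= RInt (fun x => g x - f x) 0 1).
  { apply RInt_le_in; auto. apply cont_in_const. apply cont_in_minus; auto; lra. }
  rewrite RInt_const in H0. rewrite RInt_minusR in H0 by (apply cont_in_ex_RInt; auto; lra).
  unfold scal in H0; simpl in H0; unfold mult in H0; simpl in H0. specialize (H x0 Hx0). lra.
Qed.

(** Pointwise strict convexity of [t -> (t - 2 * Omega)^(-1/2)], integrated. The three-point form
    suffices to place [Nt] below [r] between its two solutions and above [r] outside them. *)
Lemma dt_convex om t1 t2 t3 : cont_in 0 1 om -> adm om t1 -> t1 < t2 < t3 ->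
  (t3 - t1) * dt om t2 < (t3 - t2) * dt om t1 + (t2 - t1) * dt om t3.
Proof.
  intros Ho Ha L. assert (Ha2 : adm om t2) by (apply adm_mono with t1; auto; lra).
  assert (Ha3 : adm om t3) by (apply adm_mono with t1; auto; lra).
  pose proof (mt_inv_cont om t1 Ho Ha) as C1. pose proof (mt_inv_cont om t2 Ho Ha2) as C2.
  pose proof (mt_inv_cont om t3 Ho Ha3) as C3.
  assert (S : forall c t, cont_in 0 1 (fun p => / mt om t p) -> cont_in 0 1 (fun p => c * / mt om t p)).
  { intros c t Hc. apply cont_in_mult; auto; try lra. apply cont_in_const. }
  unfold dt, Ht. rewrite <- !RInt_scalR, <- RInt_plusR by (apply cont_in_ex_RInt; auto; lra).
  apply RInt_lt_in; auto. apply cont_in_plus; auto; lra.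
  intros p Hp.
  pose proof (mt_pos om t1 p Ha Hp) as P1. pose proof (mt_pos om t2 p Ha2 Hp) as P2. pose proof (mt_pos om t3 p Ha3 Hp) as P3.
  pose proof (mt_sqr om t1 p Ha Hp) as Q1. pose proof (mt_sqr om t2 p Ha2 Hp) as Q2. pose proof (mt_sqr om t3 p Ha3 Hp) as Q3.
  set (x1 := mt om t1 p) in *. set (x2 := mt om t2 p) in *. set (x3 := mt om t3 p) in *.
  replace (t3 - t1) with (x3 * x3 - x1 * x1) by lra. replace (t3 - t2) with (x3 * x3 - x2 * x2) by lra.
  replace (t2 - t1) with (x2 * x2 - x1 * x1) by lra.
  assert (L1 : x1 < x2) by (apply Rsqr_incrst_0; unfold Rsqr; lra).
  assert (L2 : x2 < x3) by (apply Rsqr_incrst_0; unfold Rsqr; lra).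
  apply Rlt_0_minus.
  replace ((x3 * x3 - x2 * x2) * / x1 + (x2 * x2 - x1 * x1) * / x3 - (x3 * x3 - x1 * x1) * / x2)
    with ((x2 - x1) * (x3 - x2) * ((x3 + x2) * x3 - (x2 + x1) * x1) / (x1 * x2 * x3)) by (field; lra).
  apply Rdiv_lt_0_compat. repeat apply Rmult_lt_0_compat; nra. repeat apply Rmult_lt_0_compat; auto.
Qed.

(** * Conjugate laminar flows and the flow force as a function of the squared speed *)

Section conjugate.
Variables (om : R -> R) (r t1 t3 : R).
Hypotheses (Ho : cont_in 0 1 om) (Ha : adm om t1) (H13 : t1 < t3) (N1 : Nt om t1 = r) (N3 : Nt om t3 = r).

Lemma Nt_between t : t1 < t < t3 -> Nt om t < r.
Proof.
  intros Ht. pose proof (dt_convex om t1 t t3 Ho Ha Ht). unfold Nt in *. nra.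
Qed.

Lemma Nt_left t : adm om t -> t < t1 -> r < Nt om t.
Proof.
  intros Hat Ht. pose proof (dt_convex om t t1 t3 Ho Hat ltac:(lra)). unfold Nt in *. nra.
Qed.

Lemma Nt_right t : t3 < t -> r < Nt om t.
Proof.
  intros Ht. pose proof (dt_convex om t1 t3 t Ho Ha ltac:(lra)). unfold Nt in *. nra.
Qed.

Lemma kap_dt t : dt om t - kap om r t = Nt om t - r.
Proof. unfold kap, Nt. lra. Qed.

(** Concavity of the square root: the graph of [ct] lies below a line of slope [dt a / 2]. Applied
    with [a] and [b] exchanged as well, it squeezes the difference quotient in [ct_derive]. *)
Lemma ct_le a b : adm om a -> adm om b -> ct om b - ct om a <= (b - a) / 2 * dt om a.
Proof.
  intros Ha' Hb. unfold ct, dt, Mt, Ht.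
  pose proof (mt_inv_cont om a Ho Ha') as C1. pose proof (mt_cont om a Ho) as C2. pose proof (mt_cont om b Ho) as C3.
  rewrite <- RInt_scalR, <- RInt_minusR by (apply cont_in_ex_RInt; auto; lra).
  apply RInt_le_in. apply cont_in_minus; auto; lra. apply cont_in_mult; auto; try lra. apply cont_in_const.
  intros p Hp. pose proof (mt_pos om a p Ha' Hp). pose proof (mt_sqr om a p Ha' Hp). pose proof (mt_sqr om b p Hb Hp).
  set (x := mt om a p) in *. set (y := mt om b p) in *. replace (b - a) with (y * y - x * x) by lra.
  apply Rminus_le_0. replace ((y * y - x * x) / 2 * / x - (y - x)) with ((y - x) ^ 2 / (2 * x)) by (field; lra).
  apply Rdiv_le_0_compat. apply pow2_ge_0. lra.
Qed.

Lemma dt_lip a : adm om a -> exists C del, 0 < C /\ 0 < del /\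
  forall b, Rabs (b - a) < del -> adm om b /\ Rabs (dt om b - dt om a) <= C * Rabs (b - a).
Proof.
  intros [mu [Hmu Hmu']].
  assert (Haa : adm om a) by (exists mu; auto).
  set (nu := sqrt (mu / 2)). assert (Hnu : 0 < nu) by (apply sqrt_lt_R0; lra).
  exists (/ (2 * (nu * nu * nu))), (mu / 2).
  assert (Hn3 : 0 < nu * nu * nu) by (repeat apply Rmult_lt_0_compat; auto).
  split. apply Rinv_0_lt_compat. lra. split. lra. intros b Hb. apply Rabs_def2 in Hb.
  assert (Hab : adm om b).
  { exists (mu / 2). split. lra. intros p Hp. specialize (Hmu' p Hp). lra. }
  split; auto.
  pose proof (mt_inv_cont om a Ho Haa) as C1. pose proof (mt_inv_cont om b Ho Hab) as C2.
  unfold dt, Ht. rewrite <- RInt_minusR by (apply cont_in_ex_RInt; auto; lra).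
  eapply Rle_trans. apply (abs_RInt_le_const _ 0 1 (/ (2 * (nu * nu * nu)) * Rabs (b - a))). lra.
  - apply ex_RInt_minusR; apply cont_in_ex_RInt; auto; lra.
  - intros p Hp. pose proof (mt_sqr om a p Haa Hp). pose proof (mt_sqr om b p Hab Hp).
    assert (nu <= mt om a p) by (apply sqrt_le_1; specialize (Hmu' p Hp); lra).
    assert (nu <= mt om b p) by (apply sqrt_le_1; specialize (Hmu' p Hp); lra).
    set (x := mt om a p) in *. set (y := mt om b p) in *. replace (b - a) with (y * y - x * x) by lra.
    replace (/ y - / x) with (- ((y * y - x * x) * / (x * y * (x + y)))) by (field; lra).
    rewrite Rabs_Ropp, Rabs_mult, Rmult_comm. apply Rmult_le_compat_r. apply Rabs_pos.
    rewrite Rabs_pos_eq by (left; apply Rinv_0_lt_compat; repeat apply Rmult_lt_0_compat; lra).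
    apply Rinv_le_contravar. lra. 
    assert (nu * nu <= x * y) by (apply Rmult_le_compat; lra).
    replace (2 * (nu * nu * nu)) with ((nu * nu) * (2 * nu)) by ring. apply Rmult_le_compat; nra.
  - lra.
Qed.

Lemma ct_derive a : adm om a -> is_derive (ct om) a (dt om a / 2).
Proof.
  intros Haa. destruct (dt_lip a Haa) as [C [del [HC [Hdel HL]]]].
  apply is_derive_Reals. intros eps Heps.
  assert (Hd : 0 < Rmin del (eps / C)) by (apply Rmin_pos; auto; apply Rdiv_lt_0_compat; auto).
  exists (mkposreal _ Hd). simpl. intros h Hh0 Hh.
  destruct (HL (a + h)) as [Hab L].
  { replace (a + h - a) with h by ring. eapply Rlt_le_trans. apply Hh. apply Rmin_l. }
  replace (a + h - a) with h in L by ring.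
  pose proof (ct_le a (a + h) Haa Hab) as U1. pose proof (ct_le (a + h) a Hab Haa) as U2.
  assert (Hb : Rabs (ct om (a + h) - ct om a - h * (dt om a / 2)) <= / 2 * C * (Rabs h * Rabs h)).
  { assert (Rabs (h * (dt om (a + h) - dt om a)) <= C * (Rabs h * Rabs h)).
    { rewrite Rabs_mult. pose proof (Rabs_pos h). nra. }
    apply Rabs_le_between in H. replace (a + h - a) with h in U1 by ring. replace (a - (a + h)) with (- h) in U2 by ring.
    apply Rabs_le. nra. }
  replace ((ct om (a + h) - ct om a) / h - dt om a / 2) with ((ct om (a + h) - ct om a - h * (dt om a / 2)) / h) by (field; auto).
  unfold Rdiv at 1. rewrite Rabs_mult, Rabs_inv. assert (0 < Rabs h) by (now apply Rabs_pos_lt).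
  apply Rmult_lt_reg_r with (Rabs h); auto. rewrite Rmult_assoc, Rinv_l, Rmult_1_r by lra.
  eapply Rle_lt_trans. apply Hb.
  assert (C * Rabs h < eps).
  { apply Rlt_le_trans with (C * (eps / C)). apply Rmult_lt_compat_l; auto. eapply Rlt_le_trans. apply Hh. apply Rmin_r.
    right. field. lra. }
  nra.
Qed.

Lemma St_derive a : adm om a -> is_derive (St om r) a ((Nt om a - r) / 2).
Proof.
  intros Haa. eapply is_derive_eq.
  apply (is_derive_plus (V := R_NormedModule) (fun t => kap om r t ^ 2 / 2) (ct om)).
  2: now apply ct_derive.
  { unfold kap. eapply is_derive_eq with (l := - (kap om r a) / 2). auto_derive; auto. unfold kap. field. reflexivity. }
  rewrite <- kap_dt. unfold plus; simpl. field.
Qed.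

Lemma St_MVT a b : adm om a -> a < b -> exists c, a < c < b /\ St om r b - St om r a = (Nt om c - r) / 2 * (b - a).
Proof.
  intros Haa L. apply (MVT_closed (St om r) (fun c => (Nt om c - r) / 2)); auto.
  - intros x Hx. apply St_derive. apply adm_mono with a; auto. lra.
  - apply cont_in_continuous. intros x Hx. apply (is_derive_cont _ _ _ (St_derive x (adm_mono om a x Haa ltac:(lra)))).
Qed.

Lemma St_decr a b : t1 <= a -> a < b -> b <= t3 -> St om r b < St om r a.
Proof.
  intros H1 H2 H3. destruct (St_MVT a b) as [c [Hc E]]; auto. apply adm_mono with t1; auto.
  pose proof (Nt_between c ltac:(lra)). nra.
Qed.

Lemma St_incr a b : adm om a -> a < b -> b <= t1 -> St om r a < St om r b.
Proof.
  intros H1 H2 H3. destruct (St_MVT a b) as [c [Hc E]]; auto.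
  pose proof (Nt_left c (adm_mono om a c H1 ltac:(lra)) ltac:(lra)). nra.
Qed.

End conjugate.

(** This integral equals 1 at the critical speed, so it is below 1 at the supercritical one; in this
    form supercriticality enters the moving planes. *)
Lemma mt3_lt om a b : cont_in 0 1 om -> adm om a -> a < b ->
  RInt (fun p => / mt om b p ^ 3) 0 1 < RInt (fun p => / mt om a p ^ 3) 0 1.
Proof.
  intros Ho Ha L. assert (Hb : adm om b) by (apply adm_mono with a; auto; lra).
  assert (C : forall t, adm om t -> cont_in 0 1 (fun p => / mt om t p ^ 3)).
  { intros t Ht. apply cont_in_inv. lra. intros p Hp. pose proof (mt_pos om t p Ht Hp). apply pow_nonzero. lra.
    apply cont_in_ext with (fun p => mt om t p * (mt om t p * mt om t p)). intros; ring.
    repeat apply cont_in_mult; try lra; now apply mt_cont. }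
  apply RInt_lt_in; auto. intros p Hp.
  pose proof (mt_pos om a p Ha Hp). pose proof (mt_pos om b p Hb Hp).
  pose proof (mt_sqr om a p Ha Hp). pose proof (mt_sqr om b p Hb Hp).
  assert (mt om a p < mt om b p) by (apply Rsqr_incrst_0; unfold Rsqr; lra).
  apply Rinv_lt_contravar. apply Rmult_lt_0_compat; apply pow_lt; lra.
  set (x := mt om a p) in *. set (y := mt om b p) in *.
  assert (0 < x * x) by nra. simpl. nra.
Qed.

Lemma maxOmega_attained om : cont_in 0 1 om -> exists p0, 0 <= p0 <= 1 /\
  (forall p, 0 <= p <= 1 -> Omega om p <= Omega om p0) /\ maxOmega om = Omega om p0.
Proof.
  intros Ho. destruct (cont_in_min 0 1 (fun p => - Omega om p)) as [p0 [Hp0 Hm]]. lra.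
  apply cont_in_opp. lra. now apply Omega_cont.
  exists p0. split; auto. split.
  { intros p Hp. specialize (Hm p Hp). lra. }
  unfold maxOmega. rewrite (is_lub_Rbar_unique _ (Finite (Omega om p0))); auto. split.
  - intros x [p [Hp ->]]. simpl. specialize (Hm p Hp). lra.
  - intros b Hb. apply Hb. exists p0. auto.
Qed.

Lemma adm_of_s0 om s : cont_in 0 1 om -> s0 om < s -> adm om (s ^ 2) /\ 0 < s.
Proof.
  intros Ho Hs. destruct (maxOmega_attained om Ho) as [p0 [Hp0 [Hm E]]].
  unfold s0 in Hs. rewrite E in Hs.
  pose proof (Hm 0 ltac:(lra)) as H0. rewrite Omega_0 in H0.
  pose proof (sqrt_pos (2 * Omega om p0)). pose proof (sqrt_sqrt (2 * Omega om p0) ltac:(lra)).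
  split; [|lra]. exists (s ^ 2 - 2 * Omega om p0). split. nra. intros p Hp. specialize (Hm p Hp). lra.
Qed.

(** The integrand has the explicit antiderivative [F] below. At [p = 1] the Bernoulli condition
    identifies the depth with [kap], and [F 1] becomes [kap^2 / 2 + ct]. *)
Lemma sigmaF_St om s r : cont_in 0 1 om -> adm om (s ^ 2) -> Bern om s = r -> sigmaF om s r = St om r (s ^ 2).
Proof.
  intros Ho Ha HB.
  pose proof (mt_cont om (s ^ 2) Ho) as Cm. pose proof (mt_inv_cont om (s ^ 2) Ho Ha) as Ci.
  assert (CH : cont_in 0 1 (Ht om (s ^ 2))) by (apply RInt_cont_in; auto; lra).
  set (t := s ^ 2) in *. unfold sigmaF.
  change (Hp om s) with (fun p => / mt om t p). change (H om s) with (Ht om t).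
  set (F := fun p => Mt om t p - t / 2 * Ht om t p - Ht om t p ^ 2 / 2 + (Omega om 1 + r) * Ht om t p).
  assert (CO := Omega_cont om Ho).
  rewrite (FTC_closed 0 1 _ F).
  - unfold F, St, kap.
    assert (E0 : Ht om t 0 = 0) by apply (@RInt_point R_CompleteNormedModule).
    assert (E1 : Mt om t 0 = 0) by apply (@RInt_point R_CompleteNormedModule).
    assert (EB : t / 2 - Omega om 1 + Ht om t 1 = r) by exact HB.
    rewrite E0, E1. unfold ct. replace (r + Omega om 1 - t / 2) with (Ht om t 1) by lra. nra.
  - lra.
  - apply cont_in_mult; auto; try lra.
    apply cont_in_plus; try lra; [|apply cont_in_const].
    apply cont_in_plus; try lra; [|apply cont_in_const].
    apply cont_in_minus; auto; try lra. apply cont_in_minus; auto; try lra.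
    apply cont_in_ext with (fun p => / 2 * (mt om t p * mt om t p)).
    + intros p Hp. pose proof (mt_pos om t p Ha Hp). field. lra.
    + apply cont_in_mult; try lra. apply cont_in_const. apply cont_in_mult; auto; lra.
  - unfold F. assert (CM : cont_in 0 1 (Mt om t)) by (apply RInt_cont_in; auto; lra).
    apply cont_in_plus; try lra; [|apply cont_in_mult; auto; try lra; apply cont_in_const].
    apply cont_in_minus; try lra.
    + apply cont_in_minus; auto; try lra. apply cont_in_mult; auto; try lra; apply cont_in_const.
    + apply cont_in_mult; try lra; [|apply cont_in_const].
      apply cont_in_ext with (fun p => Ht om t p * Ht om t p). intros; ring. apply cont_in_mult; auto; lra.
  - intros p Hp. pose proof (mt_pos om t p Ha ltac:(lra)). pose proof (mt_sqr om t p Ha ltac:(lra)).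
    assert (DH : is_derive (Ht om t) p (/ mt om t p)) by (apply (RInt_derive_in 0 1 (fun p => / mt om t p)); auto).
    assert (DM : is_derive (Mt om t) p (mt om t p)) by (apply (RInt_derive_in 0 1 (mt om t)); auto).
    unfold F. eapply is_derive_eq.
    apply (is_derive_plus (V := R_NormedModule) (fun p => Mt om t p - t / 2 * Ht om t p - Ht om t p ^ 2 / 2) (fun p => (Omega om 1 + r) * Ht om t p)).
    apply (is_derive_minus (V := R_NormedModule) (fun p => Mt om t p - t / 2 * Ht om t p) (fun p => Ht om t p ^ 2 / 2)).
    apply (is_derive_minus (V := R_NormedModule) (Mt om t) (fun p => t / 2 * Ht om t p)). exact DM.
    apply is_derive_scal. exact DH.
    apply (is_derive_ext (fun p => / 2 * (Ht om t p ^ 2))). intros; unfold Rdiv; apply Rmult_comm.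
    apply is_derive_scal. apply is_derive_pow. exact DH.
    apply is_derive_scal. exact DH.
    unfold minus, plus, opp; simpl.
    set (m := mt om t p) in *. replace (t / 2) with ((m * m + 2 * Omega om p) / 2) by lra. field. lra.
Qed.

(** * Bounds on the flow force *)

Definition taylor (g gq gp : fun2) (M : R) : Prop := 0 < M /\
  forall q p q' p', 0 <= p <= 1 -> 0 <= p' <= 1 ->
    Rabs (g q' p' - g q p - gq q p * (q' - q) - gp q p * (p' - p)) <= M * (Rabs (q' - q) + Rabs (p' - p)) ^ 2.

Lemma taylor_p g gq gp M q p p' : taylor g gq gp M -> 0 <= p <= 1 -> 0 <= p' <= 1 ->
  Rabs (g q p' - g q p - gp q p * (p' - p)) <= M * (p' - p) ^ 2.
Proof.
  intros [_ H] Hp Hp'. specialize (H q p q p' Hp Hp').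
  rewrite Rminus_diag, Rabs_R0, Rmult_0_r, Rplus_0_l, pow2_abs, Rminus_0_r in H. exact H.
Qed.

Lemma taylor_q g gq gp M q q' p : taylor g gq gp M -> 0 <= p <= 1 ->
  Rabs (g q' p - g q p - gq q p * (q' - q)) <= M * (q' - q) ^ 2.
Proof.
  intros [_ H] Hp. specialize (H q p q' p Hp Hp).
  rewrite Rminus_diag, Rabs_R0, Rmult_0_r, Rplus_0_r, pow2_abs, Rminus_0_r in H. exact H.
Qed.

Lemma taylor_diff om f g : sol om f -> sol om g -> exists M,
  taylor (fun q p => fh g q p - fh f q p)
    (fun q p => - fu g q p / fv g q p - - fu f q p / fv f q p) (fun q p => / fv g q p - / fv f q p) M.
Proof.
  intros Hf Hg. apply C1s_taylor.
  - apply (C1s_minus _ _ _ _ _ _ (sol_h _ _ Hg) (sol_h _ _ Hf)).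
  - exact (C1s_Lip _ _ _ (C1s_minus _ _ _ _ _ _ (sol_hq _ _ Hg) (sol_hq _ _ Hf))).
  - exact (C1s_Lip _ _ _ (C1s_minus _ _ _ _ _ _ (sol_hp _ _ Hg) (sol_hp _ _ Hf))).
Qed.

Lemma taylor_Phi om f t : cont_in 0 1 om -> sol om f -> adm om t -> exists M,
  taylor (Phi om f t) (phiq f (mt om t)) (phip f (mt om t)) M.
Proof.
  intros Ho Hf Ha. apply C1s_taylor.
  - now apply Phi_C1s.
  - destruct (phiq_C1s om f (mt om t) Hf (mt_C1s om t Ho Ha)) as [bq [bp [H _]]]. exact (C1s_Lip _ _ _ H).
  - exact (C1s_Lip _ _ _ (phip_C1s om f (mt om t) Hf (mt_C1s om t Ho Ha))).
Qed.

Lemma slope_nonpos (a M tau0 : R) : 0 < tau0 -> 0 < M -> (forall tau, 0 < tau <= tau0 -> a * tau <= M * tau ^ 2) -> a <= 0.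
Proof.
  intros H0 HM H. apply Rnot_lt_le. intros Ha.
  set (tau := Rmin tau0 (a / (2 * M))).
  assert (0 < a / (2 * M)) by (apply Rdiv_lt_0_compat; lra).
  assert (Ht : 0 < tau) by (apply Rmin_pos; lra).
  assert (tau <= tau0) by apply Rmin_l. assert (Hl : tau <= a / (2 * M)) by apply Rmin_r.
  specialize (H tau ltac:(lra)).
  assert (M * tau <= a / 2).
  { apply Rle_trans with (M * (a / (2 * M))). apply Rmult_le_compat_l; lra. right. field. lra. }
  nra.
Qed.

Lemma exp_gap al p : 0 < al -> 0 <= p <= 1 -> al * exp (- al) * (1 - p) <= exp (- al * p) - exp (- al).
Proof.
  intros Hal Hp. replace (- al * p) with (- al + al * (1 - p)) by ring. rewrite exp_plus.
  pose proof (exp_ineq1_le (al * (1 - p))). pose proof (exp_pos (- al)). nra.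
Qed.

(** A Hopf lemma at almost-minima. The exponential barrier yields [- e + mu * (1 - p) <= g] on the
    whole strip; where [g q 1] is within [del] of [- e], the Taylor bound at depth [tau] leaves at
    least half of this slope. *)
Lemma top_slope g gq gp A B c0 A1 K M e : coef A B c0 A1 -> ell g A B K -> BD g -> taylor g gq gp M -> 0 < e ->
  (forall q, 0 <= g q 0) -> (forall q, - e <= g q 1) ->
  exists mu del, 0 < mu /\ 0 < del /\ forall q, g q 1 < - e + del -> gp q 1 <= - mu.
Proof.
  intros HC HE HB HT He H0 H1.
  assert (HK : 0 <= K) by apply HE. assert (Hc0 : 0 < c0) by apply HC. assert (HM : 0 < M) by apply HT.
  set (al := (K + 1) / c0). assert (Hal : 0 < al) by (apply Rdiv_lt_0_compat; lra).
  set (mu := e * (al * exp (- al))).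
  pose proof (exp_pos (- al)) as Hexp.
  assert (Hmu : 0 < mu) by (unfold mu; apply Rmult_lt_0_compat; [auto|apply Rmult_lt_0_compat; auto]).
  assert (LB : forall q p, 0 <= p <= 1 -> - e + mu * (1 - p) <= g q p).
  { intros q p Hp. eapply Rle_trans; [|apply (strip_cmp g A B c0 A1 K 1 (- e - e * exp (- al)) e (- al) HC HE HB)]; auto; try lra.
    - pose proof (exp_gap al p Hal Hp). unfold mu. nra.
    - rewrite Rabs_Ropp, Rabs_pos_eq by lra. unfold al. replace (c0 * ((K + 1) / c0)) with (K + 1) by (field; lra). lra.
    - intros q'. specialize (H0 q'). nra.
    - intros q'. specialize (H1 q'). replace (- al * 1) with (- al) by ring. lra. }
  set (tau := Rmin 1 (mu / (4 * M))).
  assert (0 < mu / (4 * M)) by (apply Rdiv_lt_0_compat; lra).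
  assert (Ht : 0 < tau) by (apply Rmin_pos; lra).
  assert (Ht1 : tau <= 1) by apply Rmin_l. assert (Ht2 : tau <= mu / (4 * M)) by apply Rmin_r.
  assert (Ht3 : M * tau <= mu / 4).
  { apply Rle_trans with (M * (mu / (4 * M))). apply Rmult_le_compat_l; lra. right. field. lra. }
  exists (mu / 2), (mu * tau / 4). split. lra. split. nra.
  intros q Hq. specialize (LB q (1 - tau) ltac:(lra)).
  pose proof (taylor_p g gq gp M q 1 (1 - tau) HT ltac:(lra) ltac:(lra)) as T.
  apply Rabs_le_between in T. replace (1 - tau - 1) with (- tau) in T by ring.
  replace (1 - (1 - tau)) with tau in LB by ring.
  assert (gp q 1 * tau <= - (mu / 2) * tau) by nra.
  apply Rmult_le_reg_r with tau; auto.
Qed.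

Lemma bottom_slope g gq gp A B c0 A1 K M e : coef A B c0 A1 -> ell g A B K -> BD g -> taylor g gq gp M -> 0 < e ->
  (forall q, g q 0 = 0) -> (forall q, e <= g q 1) -> forall q, 0 < gp q 0.
Proof.
  intros HC HE HB HT He H0 H1 q.
  assert (HK : 0 <= K) by apply HE. assert (Hc0 : 0 < c0) by apply HC. assert (HM : 0 < M) by apply HT.
  set (al := (K + 1) / c0). assert (Hal : 0 < al) by (apply Rdiv_lt_0_compat; lra).
  pose proof (exp_pos al) as Hexp.
  set (b := e / exp al). assert (Hb : 0 < b) by (apply Rdiv_lt_0_compat; auto).
  assert (Eb : b * exp al = e) by (unfold b; field; lra).
  assert (LB : forall p, 0 <= p <= 1 -> b * al * p <= g q p).
  { intros p Hp. eapply Rle_trans; [|apply (strip_cmp g A B c0 A1 K 1 (- b) b al HC HE HB)]; auto; try lra.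
    - pose proof (exp_ineq1_le (al * p)). nra.
    - rewrite Rabs_pos_eq by lra. unfold al. replace (c0 * ((K + 1) / c0)) with (K + 1) by (field; lra). lra.
    - intros q'. rewrite H0. lra.
    - intros q'. specialize (H1 q'). rewrite Rmult_1_r. lra. }
  apply Rlt_le_trans with (b * al). nra.
  cut (b * al - gp q 0 <= 0). lra.
  apply slope_nonpos with M 1; try lra. intros tau Ht.
  specialize (LB tau ltac:(lra)).
  pose proof (taylor_p g gq gp M q 0 tau HT ltac:(lra) ltac:(lra)) as T.
  rewrite H0, !Rminus_0_r in T. apply Rabs_le_between in T. nra.
Qed.

Lemma UC_pos_nbhd g q p : UC g -> 0 <= p <= 1 -> 0 < g q p ->
  exists rho, 0 < rho /\ forall q' p', 0 <= p' <= 1 -> Rabs (q' - q) < rho -> Rabs (p' - p) < rho -> g q p / 2 <= g q' p'.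
Proof.
  intros H Hp Hg. destruct (H (g q p / 2) ltac:(lra)) as [d [Hd K]]. exists d. split; auto.
  intros q' p' Hp' L1 L2. specialize (K q p q' p' Hp Hp' L1 L2). apply Rabs_def2 in K. lra.
Qed.

(** Strong maximum principle along a single line [p = p1]. The half strip [lo <= q] is the domain
    met in the moving planes; vertical spreading is left to the Hopf lemmas. *)
Lemma strong_pos g A B c0 A1 K lo q0 q1 p1 : coef A B c0 A1 -> ell g A B K -> lo < q0 -> lo < q1 -> 0 < p1 < 1 ->
  (forall q p, lo <= q -> 0 <= p <= 1 -> 0 <= g q p) -> 0 < g q1 p1 -> 0 < g q0 p1.
Proof.
  intros HC HE L0 L1 Hp1 Hpos Hg.
  destruct (UC_pos_nbhd g q1 p1 ltac:(apply HE) ltac:(lra) Hg) as [d [Hd Hd']].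
  set (rho := Rmin (d / 2) (Rmin p1 (1 - p1))).
  assert (Hr : 0 < rho) by (repeat apply Rmin_pos; lra).
  assert (rho <= d / 2) by apply Rmin_l.
  assert (rho <= p1 /\ rho <= 1 - p1).
  { unfold rho. pose proof (Rmin_r (d / 2) (Rmin p1 (1 - p1))). pose proof (Rmin_l p1 (1 - p1)). pose proof (Rmin_r p1 (1 - p1)). lra. }
  assert (Hn : forall p, p1 - rho <= p <= p1 + rho -> g q1 p1 / 2 <= g q1 p).
  { intros p Hp. apply Hd'. lra. rewrite Rminus_diag, Rabs_R0. lra. apply Rabs_def1; lra. }
  destruct (Rtotal_order q0 q1) as [L|[->|L]]; auto.
  - apply (propagate_left g A B c0 A1 K q1 q0 p1 rho (g q1 p1 / 2) HC HE Hr L ltac:(lra) ltac:(lra) ltac:(lra) (q0 - lo) ltac:(lra)); auto.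
    intros q p Hq Hp. apply Hpos; lra.
  - apply (propagate_right g A B c0 A1 K q1 q0 p1 rho (g q1 p1 / 2) HC HE Hr L ltac:(lra) ltac:(lra) ltac:(lra) 1 ltac:(lra)); auto.
    intros q p Hq Hp. apply Hpos; lra.
Qed.

(** Continuity makes [g] at least [e] on a short segment through [(q0, p1)]; the parabolic barrier
    carries this upwards and gives growth of order [e * E * al * tau] at distance [tau] below the
    top. *)
Lemma hopf_top g gq gp A B c0 A1 K M lo q0 p1 : coef A B c0 A1 -> ell g A B K -> taylor g gq gp M -> lo < q0 -> 0 < p1 < 1 ->
  (forall q p, lo <= q -> 0 <= p <= 1 -> 0 <= g q p) -> 0 < g q0 p1 -> g q0 1 = 0 -> gp q0 1 < 0.
Proof.
  intros HC HE HT L0 Hp1 Hpos Hg H1. assert (HM : 0 < M) by apply HT.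
  destruct (UC_pos_nbhd g q0 p1 ltac:(apply HE) ltac:(lra) Hg) as [d [Hd Hd']].
  set (rho := Rmin (d / 2) (q0 - lo)). assert (Hr : 0 < rho) by (apply Rmin_pos; lra).
  assert (rho <= d / 2) by apply Rmin_l. assert (rho <= q0 - lo) by apply Rmin_r.
  destruct (propagate_up g A B c0 A1 K rho HC HE Hr) as [al [Hal P]].
  set (e := g q0 p1 / 2) in *.
  assert (LB : forall p, p1 <= p <= 1 -> e * (exp (- al * (p - p1)) - exp (- al * (1 - p1))) <= g q0 p).
  { intros p Hp. apply P; auto; try (unfold e; lra).
    intros q x Hq Hx. apply Hpos; lra.
    intros q Hq. apply Hd'. lra. apply Rabs_def1; lra. rewrite Rminus_diag, Rabs_R0. lra. }
  set (E := exp (- al * (1 - p1))). assert (HE0 : 0 < E) by apply exp_pos.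
  assert (He : 0 < e) by (unfold e; lra).
  assert (Hb : 0 < e * E * al) by (apply Rmult_lt_0_compat; [apply Rmult_lt_0_compat; auto|auto]).
  cut (gp q0 1 + e * E * al <= 0). lra.
  apply slope_nonpos with M (1 - p1); try lra. intros tau Ht.
  specialize (LB (1 - tau) ltac:(lra)).
  replace (- al * (1 - tau - p1)) with (- al * (1 - p1) + al * tau) in LB by ring. rewrite exp_plus in LB. fold E in LB.
  pose proof (exp_ineq1_le (al * tau)).
  pose proof (taylor_p g gq gp M q0 1 (1 - tau) HT ltac:(lra) ltac:(lra)) as T.
  rewrite H1 in T. replace (1 - tau - 1) with (- tau) in T by ring. apply Rabs_le_between in T.
  assert (e * E * (al * tau) <= e * (E * exp (al * tau) - E)).
  { replace (e * (E * exp (al * tau) - E)) with (e * E * (exp (al * tau) - 1)) by ring. apply Rmult_le_compat_l; nra. }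
  nra.
Qed.

Lemma hopf_bottom g gq gp A B c0 A1 K M lo q0 p1 : coef A B c0 A1 -> ell g A B K -> taylor g gq gp M -> lo < q0 -> 0 < p1 < 1 ->
  (forall q p, lo <= q -> 0 <= p <= 1 -> 0 <= g q p) -> 0 < g q0 p1 -> g q0 0 = 0 -> 0 < gp q0 0.
Proof.
  intros HC HE HT L0 Hp1 Hpos Hg H1. assert (HM : 0 < M) by apply HT.
  destruct (UC_pos_nbhd g q0 p1 ltac:(apply HE) ltac:(lra) Hg) as [d [Hd Hd']].
  set (rho := Rmin (d / 2) (q0 - lo)). assert (Hr : 0 < rho) by (apply Rmin_pos; lra).
  assert (rho <= d / 2) by apply Rmin_l. assert (rho <= q0 - lo) by apply Rmin_r.
  destruct (propagate_down g A B c0 A1 K rho HC HE Hr) as [al [Hal P]].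
  set (e := g q0 p1 / 2) in *.
  assert (LB : forall p, 0 <= p <= p1 -> e * (exp (- al * (p1 - p)) - exp (- al * (p1 - 0))) <= g q0 p).
  { intros p Hp. apply P; auto; try (unfold e; lra).
    intros q x Hq Hx. apply Hpos; lra.
    intros q Hq. apply Hd'. lra. apply Rabs_def1; lra. rewrite Rminus_diag, Rabs_R0. lra. }
  set (E := exp (- al * (p1 - 0))). assert (HE0 : 0 < E) by apply exp_pos.
  assert (He : 0 < e) by (unfold e; lra).
  assert (Hb : 0 < e * E * al) by (apply Rmult_lt_0_compat; [apply Rmult_lt_0_compat; auto|auto]).
  cut (e * E * al - gp q0 0 <= 0). lra.
  apply slope_nonpos with M p1; try lra. intros tau Ht.
  specialize (LB tau ltac:(lra)).
  replace (- al * (p1 - tau)) with (- al * (p1 - 0) + al * tau) in LB by ring. rewrite exp_plus in LB. fold E in LB.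
  pose proof (exp_ineq1_le (al * tau)).
  pose proof (taylor_p g gq gp M q0 0 tau HT ltac:(lra) ltac:(lra)) as T.
  rewrite H1, !Rminus_0_r in T. apply Rabs_le_between in T.
  assert (e * E * (al * tau) <= e * (E * exp (al * tau) - E)).
  { replace (e * (E * exp (al * tau) - E)) with (e * E * (exp (al * tau) - 1)) by ring. apply Rmult_le_compat_l; nra. }
  nra.
Qed.

Lemma sup_exists (E : R -> Prop) M x : E x -> (forall y, E y -> y <= M) ->
  exists l, (forall y, E y -> y <= l) /\ forall eps, 0 < eps -> exists y, E y /\ l - eps < y.
Proof.
  intros Hx HM. destruct (completeness E) as [l [H1 H2]]. exists M. exact HM. exists x; auto.
  exists l. split; auto. intros eps Heps. apply NNPP. intros Hn.
  assert (l <= l - eps). { apply H2. intros y Hy. apply Rnot_lt_le. intros L. apply Hn. exists y. auto. } lra.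
Qed.

(** * Waves under Bernoulli's law, compared with laminar flows *)

Definition top_bc (f : flow) (r : R) : Prop :=
  forall q, (fu f q 1 ^ 2 + fv f q 1 ^ 2) / 2 + fh f q 1 = r.
(** The flow force after the change of variable p = psi; [hodo_flowforce] identifies it with
    [flowforce]. *)
Definition FF (om : R -> R) (f : flow) (r q : R) : R :=
  Gf om f q 1 - fh f q 1 ^ 2 / 2 + (Omega om 1 + r) * fh f q 1.
Definition is_inf (l : R) (eta : R -> R) : Prop :=
  (forall q, l <= eta q) /\ forall eps, 0 < eps -> exists q, eta q < l + eps.

Section waves.
Variables (om : R -> R) (f : flow) (r : R).
Hypotheses (Ho : cont_in 0 1 om) (Hs : sol om f) (HT : top_bc f r).

Let eta q := fh f q 1.
Let w t : fun2 := fun q p => fh f q p - Ht om t p.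
Let wp t : fun2 := fun q p => / fv f q p - / mt om t p.

(** The surface slope is -u/v, and Bernoulli's law turns [g2] on the surface into minus that slope
    times [r - eta + Omega 1]; this cancels the derivative of the other two terms. *)
Lemma FF_const q q' : FF om f r q = FF om f r q'.
Proof.
  assert (D : forall x, is_derive (FF om f r) x 0).
  { intros x. pose proof (C1s_dq _ _ _ x 1 (Gf_C1s om f Ho Hs) ltac:(lra)) as D1'.
    pose proof (C1s_dq _ _ _ x 1 (sol_h _ _ Hs) ltac:(lra)) as D2'.
    unfold FF. eapply is_derive_eq.
    apply (is_derive_plus (V := R_NormedModule) (fun q => Gf om f q 1 - fh f q 1 ^ 2 / 2) (fun q => (Omega om 1 + r) * fh f q 1)).
    apply (is_derive_minus (V := R_NormedModule) (fun q => Gf om f q 1) (fun q => fh f q 1 ^ 2 / 2)). exact D1'.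
    apply (is_derive_ext (fun q => / 2 * fh f q 1 ^ 2)). intros; unfold Rdiv; apply Rmult_comm.
    apply is_derive_scal. apply is_derive_pow. exact D2'. apply is_derive_scal. exact D2'.
    unfold minus, plus, opp; simpl. unfold g2. pose proof (sol_pos om f x 1 Hs ltac:(lra)).
    rewrite <- (HT x) at 1. field. lra. }
  destruct (MVT_gen (FF om f r) q q' (fun _ => 0)) as [c [_ E]].
  intros; apply D. intros x _. exact (is_derive_continuity_pt _ _ _ (D x)). lra.
Qed.

(** The boundary value is a constant plus a square, and the constant is the difference of flow
    forces: if it is negative, [Phi] is near its lower bound exactly where [eta] is near [kap]; if
    it is positive, so is [Phi] on the surface. *)
Lemma Phi_top t q : Phi om f t q 1 = FF om f r 0 - St om r t + (eta q - kap om r t) ^ 2 / 2.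
Proof.
  rewrite (FF_const 0 q). unfold Phi, FF, St, kap, ct, eta. field.
Qed.

Lemma w_ell t : adm om t -> exists K, ell (w t) (avgA (lam om t) f) (avgB (lam om t) f) K.
Proof. intros Ha. exact (diff_ell om (lam om t) f Ho (lam_sol om t Ho Ha) Hs). Qed.

Lemma w_taylor t : adm om t -> exists wq M, taylor (w t) wq (wp t) M.
Proof. intros Ha. eexists. exact (taylor_diff om (lam om t) f (lam_sol om t Ho Ha) Hs). Qed.

Lemma w_coef t : adm om t -> exists c0 A1, coef (avgA (lam om t) f) (avgB (lam om t) f) c0 A1.
Proof. intros Ha. exact (coef_avg om (lam om t) f (lam_sol om t Ho Ha) Hs). Qed.

Lemma w_BD t : adm om t -> BD (w t).
Proof. intros Ha. apply (C1_f _ _ _ (C1s_minus _ _ _ _ _ _ (sol_h _ _ Hs) (Ht_C1s om t Ho Ha))). Qed.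

Lemma w_0 t q : w t q 0 = 0.
Proof. unfold w, Ht. rewrite (sol_h0 _ _ Hs), (@RInt_point R_CompleteNormedModule). unfold zero; simpl. ring. Qed.

Lemma w_1 t q : w t q 1 = eta q - dt om t.
Proof. reflexivity. Qed.

Lemma inv_le_inv x y : 0 < x -> 0 < y -> / x <= / y -> y <= x.
Proof. intros Hx Hy H. rewrite <- (Rinv_inv x), <- (Rinv_inv y). apply Rinv_le_contravar; auto. now apply Rinv_0_lt_compat. Qed.

Lemma w_nonneg t : adm om t -> (forall q, dt om t <= eta q) -> forall q p, 0 <= p <= 1 -> 0 <= w t q p.
Proof.
  intros Ha H q p Hp. destruct (w_ell t Ha) as [K HE]. destruct (w_coef t Ha) as [c0 [A1 HC]].
  apply (weak_min _ _ _ c0 A1 K 1 0 HC HE (w_BD t Ha)); auto; try lra.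
  intros; rewrite w_0; lra. intros q'. rewrite w_1. specialize (H q'). lra.
Qed.

Lemma bottom_speed_le t : adm om t -> (forall q, dt om t <= eta q) -> forall q, fv f q 0 <= mt om t 0.
Proof.
  intros Ha H q. destruct (w_taylor t Ha) as [wq [M TT]].
  assert (wp t q 0 >= 0).
  { apply Rle_ge. cut (- wp t q 0 <= 0). lra. apply slope_nonpos with M 1; try lra. apply TT.
    intros tau Ht. pose proof (taylor_p _ _ _ M q 0 tau TT ltac:(lra) ltac:(lra)) as T.
    rewrite w_0, !Rminus_0_r in T. apply Rabs_le_between in T.
    pose proof (w_nonneg t Ha H q tau ltac:(lra)). lra. }
  apply inv_le_inv. apply mt_pos; auto; lra. apply (sol_pos om); auto; lra. unfold wp in H0. lra.
Qed.

(** Near the threshold [t = 2 * max Omega] the laminar speed at the maximum point [p0] of [Omega] is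
    at most [c / 2], half the lower bound for the wave, so the height difference [w] has slope at
    most [- / c] on [p = p0]. A positive supremum on that line would contradict the maximum
    principle just below it, where [w] would be larger. Hence [w <= 0] below [p0], and the slopes at
    the bottom compare the speeds. For [p0 = 0] the comparison is direct. *)
Lemma bottom_speed_ge : exists t, adm om t /\ forall t', adm om t' -> t' <= t -> forall q, mt om t' 0 <= fv f q 0.
Proof.
  destruct (maxOmega_attained om Ho) as [p0 [Hp0 [Hmax _]]].
  destruct (sol_c _ _ Hs) as [c [Hc Hc']].
  exists (2 * Omega om p0 + c ^ 2 / 4). split.
  { exists (c ^ 2 / 4). split. nra. intros p Hp. specialize (Hmax p Hp). lra. }
  intros t Ha Htt.
  assert (Hm0 : mt om t p0 <= c / 2).
  { unfold mt. rewrite <- (sqrt_Rsqr (c / 2)) by lra. apply sqrt_le_1_alt. unfold Rsqr. lra. }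
  destruct (Req_dec p0 0) as [->|Hne].
  { intros q. specialize (Hc' q 0 ltac:(lra)). lra. }
  assert (Hp0' : 0 < p0 <= 1) by lra.
  destruct (w_taylor t Ha) as [wq [M TT]]. destruct (w_ell t Ha) as [K HE]. destruct (w_coef t Ha) as [c0 [A1 HC]].
  assert (HM : 0 < M) by apply TT.
  assert (Hw : forall q, wp t q p0 <= - / c).
  { intros q. unfold wp. specialize (Hc' q p0 Hp0). pose proof (mt_pos om t p0 Ha Hp0).
    assert (/ fv f q p0 <= / c) by (apply Rinv_le_contravar; lra).
    assert (/ (c / 2) <= / mt om t p0) by (apply Rinv_le_contravar; lra).
    replace (/ (c / 2)) with (/ c + / c) in H1 by (field; lra). lra. }
  assert (Hic : 0 < / c) by (now apply Rinv_0_lt_compat).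
  assert (Hneg : forall q, w t q p0 <= 0).
  { intros q. apply Rnot_lt_le. intros Hq.
    destruct (w_BD t Ha) as [MM HMM].
    destruct (sup_exists (fun y => exists q, y = w t q p0) MM (w t q p0)) as [l [Hl1 Hl2]].
    { exists q; auto. }
    { intros y [q' ->]. specialize (HMM q' p0 Hp0). apply Rabs_le_between in HMM. lra. }
    assert (Hl0 : 0 < l) by (eapply Rlt_le_trans; [exact Hq|apply Hl1; exists q; auto]).
    assert (HU : forall q p, 0 <= p <= p0 -> w t q p <= l).
    { apply (weak_max _ _ _ c0 A1 K p0 l HC HE (w_BD t Ha) Hp0').
      intros; rewrite w_0; lra. intros q'. apply Hl1. exists q'; auto. }
    set (tau := Rmin p0 (/ c / (2 * M))).
    assert (0 < / c / (2 * M)) by (apply Rdiv_lt_0_compat; lra).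
    assert (Ht : 0 < tau) by (apply Rmin_pos; lra).
    assert (Ht1 : tau <= p0) by apply Rmin_l. assert (Ht2 : tau <= / c / (2 * M)) by apply Rmin_r.
    assert (Ht3 : M * tau <= / c / 2).
    { apply Rle_trans with (M * (/ c / (2 * M))). apply Rmult_le_compat_l; lra. right. field. lra. }
    destruct (Hl2 (tau * / c / 4)) as [y [[q1 ->] Hq1]]. nra.
    specialize (HU q1 (p0 - tau) ltac:(lra)). specialize (Hw q1).
    pose proof (taylor_p _ _ _ M q1 p0 (p0 - tau) TT ltac:(lra) ltac:(lra)) as T.
    replace (p0 - tau - p0) with (- tau) in T by ring. apply Rabs_le_between in T. nra. }
  intros q.
  assert (HU : forall q p, 0 <= p <= p0 -> w t q p <= 0).
  { apply (weak_max _ _ _ c0 A1 K p0 0 HC HE (w_BD t Ha) Hp0'); auto. intros; rewrite w_0; lra. }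
  assert (wp t q 0 <= 0).
  { apply slope_nonpos with M p0; try lra.
    intros tau Ht. pose proof (taylor_p _ _ _ M q 0 tau TT ltac:(lra) ltac:(lra)) as T.
    rewrite w_0, !Rminus_0_r in T. apply Rabs_le_between in T. specialize (HU q tau ltac:(lra)). lra. }
  apply inv_le_inv. apply (sol_pos om); auto; lra. apply mt_pos; auto; lra. unfold wp in H. lra.
Qed.

Lemma mt_1 t : adm om t -> mt om t 1 * mt om t 1 = 2 * (r - kap om r t).
Proof. intros Ha. rewrite mt_sqr by (auto; lra). unfold kap. lra. Qed.

(** Near the infimum of [eta] the almost-minimum Hopf lemma gives [wp < 0], so the wave is faster
    there than the laminar surface; by Bernoulli's law a faster surface lies below [kap]. *)
Lemma inf_kap l t : is_inf l eta -> adm om t -> l < dt om t -> l < kap om r t.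
Proof.
  intros [Hl1 Hl2] Ha Hd.
  destruct (w_taylor t Ha) as [wq [M TT]]. destruct (w_ell t Ha) as [K HE]. destruct (w_coef t Ha) as [c0 [A1 HC]].
  destruct (top_slope _ _ _ _ _ c0 A1 K M (dt om t - l) HC HE (w_BD t Ha) TT) as [mu [del [Hmu [Hdel H]]]].
  lra. intros; rewrite w_0; lra. intros q. rewrite w_1. specialize (Hl1 q). lra.
  destruct (Hl2 del Hdel) as [q Hq]. specialize (H q). rewrite w_1 in H. specialize (H ltac:(lra)).
  pose proof (sol_pos om f q 1 Hs ltac:(lra)) as Hv. pose proof (mt_pos om t 1 Ha ltac:(lra)) as Hm.
  unfold wp in H. assert (L : / fv f q 1 < / mt om t 1) by lra.
  assert (L2 : mt om t 1 < fv f q 1).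
  { rewrite <- (Rinv_inv (mt om t 1)), <- (Rinv_inv (fv f q 1)). apply Rinv_lt_contravar; auto.
    apply Rmult_lt_0_compat; now apply Rinv_0_lt_compat. }
  pose proof (mt_1 t Ha) as E. pose proof (HT q) as B. fold (eta q) in B. specialize (Hl1 q).
  pose proof (pow2_ge_0 (fu f q 1)). nra.
Qed.

(** The flow with [kap = L] makes [Phi] almost minimal on the surface wherever [eta] is near [L], so
    [phip <= - mu] there. But [phip >= - u^2 / (2 v)], which forces [u^2] to be at least
    [2 * c * mu]. *)
Lemma no_critical L : adm om (2 * (r + Omega om 1 - L)) -> FF om f r 0 < St om r (2 * (r + Omega om 1 - L)) ->
  exists del, 0 < del /\ forall q, Rabs (eta q - L) < del -> Rabs (fu f q 1) < del -> False.
Proof.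
  set (t := 2 * (r + Omega om 1 - L)). intros Ha HF.
  assert (EL : kap om r t = L) by (unfold kap, t; field).
  destruct (taylor_Phi om f t Ho Hs Ha) as [M TT]. destruct (Phi_ell om f t Ho Hs Ha) as [K HE].
  destruct (coef_avg om f f Hs Hs) as [c0 [A1 HC]].
  destruct (sol_c _ _ Hs) as [c [Hc Hc']].
  destruct (top_slope _ _ _ _ _ c0 A1 K M (St om r t - FF om f r 0) HC HE (proj2 (C1_f _ _ _ (Phi_C1s om f t Ho Hs Ha))) TT) as [mu [del [Hmu [Hdel H]]]].
  lra. intros; rewrite Phi_0; auto; lra.
  intros q. rewrite Phi_top. pose proof (pow2_ge_0 (eta q - kap om r t)). lra.
  set (d := Rmin 1 (Rmin del (c * mu))).
  assert (Hcm : 0 < c * mu) by nra.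
  assert (Hd : 0 < d) by (repeat apply Rmin_pos; lra).
  assert (Hd1 : d <= 1) by apply Rmin_l.
  assert (Hd2 : d <= del /\ d <= c * mu).
  { unfold d. pose proof (Rmin_r 1 (Rmin del (c * mu))). pose proof (Rmin_l del (c * mu)). pose proof (Rmin_r del (c * mu)). lra. }
  exists d. split; auto. intros q Hq Hu.
  assert (SQ : forall x, Rabs x < d -> x ^ 2 < d). { intros x Hx. rewrite <- pow2_abs. pose proof (Rabs_pos x). nra. }
  apply SQ in Hq. apply SQ in Hu.
  specialize (H q). rewrite Phi_top, EL in H. specialize (H ltac:(lra)). unfold phip in H.
  specialize (Hc' q 1 ltac:(lra)). set (v := fv f q 1) in *. set (u := fu f q 1) in *.
  pose proof (pow2_ge_0 (v - mt om t 1)).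
  assert (((v - mt om t 1) ^ 2 - u ^ 2) / (2 * v) * (2 * v) <= - mu * (2 * v)) by (apply Rmult_le_compat_r; lra).
  replace (((v - mt om t 1) ^ 2 - u ^ 2) / (2 * v) * (2 * v)) with ((v - mt om t 1) ^ 2 - u ^ 2) in H1 by (field; lra). nra.
Qed.

Lemma top_dq q : is_derive eta q (- fu f q 1 / fv f q 1).
Proof. exact (C1s_dq _ _ _ q 1 (sol_h _ _ Hs) ltac:(lra)). Qed.

(** A function bounded below with quadratic Taylor remainder has small slope where it is close to
    its bound: test the remainder at the minimising step [- gq / (2 * M)]. *)
Lemma small_slope_sq (g gq gp : fun2) M q p : taylor g gq gp M -> 0 <= p <= 1 -> forall l, (forall q, l <= g q p) ->
  gq q p ^ 2 <= 4 * M * (g q p - l).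
Proof.
  intros TT Hp l Hl. assert (HM : 0 < M) by apply TT.
  set (s := - gq q p / (2 * M)).
  pose proof (taylor_q _ _ _ M q (q + s) p TT Hp) as T. replace (q + s - q) with s in T by ring.
  apply Rabs_le_between in T. specialize (Hl (q + s)).
  assert (E : gq q p * s + M * s ^ 2 = - gq q p ^ 2 / (4 * M)) by (unfold s; field; lra).
  assert (gq q p ^ 2 / (4 * M) <= g q p - l) by (unfold Rdiv in *; lra).
  apply Rmult_le_reg_r with (/ (4 * M)). apply Rinv_0_lt_compat; lra.
  replace (4 * M * (g q p - l) * / (4 * M)) with (g q p - l) by (field; lra). exact H.
Qed.

Lemma inf_slope l : is_inf l eta -> forall del, 0 < del -> exists q, Rabs (eta q - l) < del /\ Rabs (fu f q 1) < del.
Proof.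
  intros [Hl1 Hl2] del Hdel.
  destruct (C1s_taylor _ _ _ (sol_h _ _ Hs) (C1s_Lip _ _ _ (sol_hq _ _ Hs)) (C1s_Lip _ _ _ (sol_hp _ _ Hs))) as [M TT].
  destruct (BD_pos _ (proj2 (C1_f _ _ _ (sol_v _ _ Hs)))) as [M2 [P2 B2]].
  assert (HM : 0 < M) by apply TT.
  set (e := Rmin del (del ^ 2 / (8 * M * M2 ^ 2))).
  assert (0 < M2 ^ 2) by (apply pow_lt; auto). assert (0 < del ^ 2) by (apply pow_lt; auto).
  assert (0 < 8 * M * M2 ^ 2) by (apply Rmult_lt_0_compat; lra).
  assert (He : 0 < e) by (apply Rmin_pos; auto; apply Rdiv_lt_0_compat; auto).
  assert (He1 : e <= del) by apply Rmin_l. assert (He2 : e <= del ^ 2 / (8 * M * M2 ^ 2)) by apply Rmin_r.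
  destruct (Hl2 e He) as [q Hq]. exists q. specialize (Hl1 q) as L. split. apply Rabs_def1; lra.
  pose proof (small_slope_sq _ _ _ M q 1 TT ltac:(lra) l Hl1) as S. cbv beta in S.
  pose proof (sol_pos om f q 1 Hs ltac:(lra)) as Hv. specialize (B2 q 1 ltac:(lra)). rewrite Rabs_pos_eq in B2 by lra.
  fold (eta q) in S.
  assert (fu f q 1 ^ 2 <= M2 ^ 2 * (4 * M * e)).
  { replace (fu f q 1 ^ 2) with (fv f q 1 ^ 2 * (- fu f q 1 / fv f q 1) ^ 2) by (field; lra).
    apply Rmult_le_compat; try apply pow2_ge_0. apply pow_incr; lra. nra. }
  assert (M2 ^ 2 * (4 * M * e) <= del ^ 2 / 2).
  { apply Rle_trans with (M2 ^ 2 * (4 * M * (del ^ 2 / (8 * M * M2 ^ 2)))).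
    apply Rmult_le_compat_l. lra. apply Rmult_le_compat_l; lra. right. field. split; lra. }
  rewrite <- pow2_abs in H2. pose proof (Rabs_pos (fu f q 1)). nra.
Qed.

(** * Range of the infimum, flow force bounds and the cases of equality *)

Section bounds.
Variables (tm tp : R).
Hypotheses (Ha : adm om tm) (Hmp : tm < tp) (Nm : Nt om tm = r) (Np : Nt om tp = r).

Let Hap : adm om tp. Proof. apply adm_mono with tm; auto; lra. Qed.

Lemma kap_dt_m : kap om r tm = dt om tm.
Proof. pose proof (kap_dt om r tm). lra. Qed.

Lemma kap_dt_p : kap om r tp = dt om tp.
Proof. pose proof (kap_dt om r tp). lra. Qed.

(** For the flow [t] with [kap = l], [inf_kap] excludes [dt > kap], that is [Nt t > r]; convexity of
    [Nt] then places [t] between the two conjugate values. *)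
Lemma inf_range l : is_inf l eta -> tm <= 2 * (r + Omega om 1 - l) <= tp.
Proof.
  intros Hl. set (t := 2 * (r + Omega om 1 - l)).
  assert (El : kap om r t = l) by (unfold kap, t; field).
  assert (Hat : adm om t).
  (* If [t] were not admissible, [kap] would be below [l] for every admissible flow, so all of these
     would have depth at most [l]. The bottom speed would then be at most that of [t2] and at least
     that of [t1], although [t2 < t1]. *)
  { apply NNPP. intros Hn. destruct bottom_speed_ge as [t1 [Ha1 Ht1]].
    destruct (maxOmega_attained om Ho) as [p0 [Hp0 [Hmax _]]].
    assert (Htt : t <= 2 * Omega om p0).
    { apply Rnot_lt_le. intros L. apply Hn. exists (t - 2 * Omega om p0). split. lra.
      intros p Hp. specialize (Hmax p Hp). lra. }
    assert (Hd : forall t', adm om t' -> dt om t' <= l).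
    { intros t' Ha'. apply Rnot_lt_le. intros L. pose proof (inf_kap l t' Hl Ha' L).
      destruct Ha' as [mu [Hmu Hmu']]. specialize (Hmu' p0 Hp0). unfold kap in *. lra. }
    assert (G1' : 2 * Omega om p0 < t1) by (destruct Ha1 as [mu [Hmu Hmu']]; specialize (Hmu' p0 Hp0); lra).
    set (t2 := (2 * Omega om p0 + t1) / 2).
    assert (Ha2 : adm om t2).
    { exists (t2 - 2 * Omega om p0). unfold t2. split. lra. intros p Hp. specialize (Hmax p Hp). lra. }
    pose proof (Ht1 t1 Ha1 ltac:(lra) 0) as K1.
    pose proof (bottom_speed_le t2 Ha2 (fun q => Rle_trans _ _ _ (Hd t2 Ha2) (proj1 Hl q)) 0) as K2.
    pose proof (mt_sqr om t1 0 Ha1 ltac:(lra)). pose proof (mt_sqr om t2 0 Ha2 ltac:(lra)).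
    pose proof (mt_pos om t1 0 Ha1 ltac:(lra)). pose proof (mt_pos om t2 0 Ha2 ltac:(lra)).
    assert (mt om t1 0 <= mt om t2 0) by lra. unfold t2 in *. nra. }
  assert (Hd : dt om t <= kap om r t).
  { rewrite El. apply Rnot_lt_le. intros L. pose proof (inf_kap l t Hl Hat L). lra. }
  pose proof (kap_dt om r t). split; apply Rnot_lt_le; intros L.
  - pose proof (Nt_left om r tm tp Ho Hmp Nm Np t Hat L). lra.
  - pose proof (Nt_right om r tm tp Ho Ha Hmp Nm Np t L). lra.
Qed.

Lemma FF_lower l : is_inf l eta -> St om r (2 * (r + Omega om 1 - l)) <= FF om f r 0.
Proof.
  intros Hl. apply Rnot_lt_le. intros L. pose proof (inf_range l Hl).
  destruct (no_critical l) as [del [Hdel H1]]; auto. apply adm_mono with tm; auto; lra.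
  destruct (inf_slope l Hl del Hdel) as [q [K1 K2]]. eauto.
Qed.

Lemma inf_ge l : is_inf l eta -> dt om tp <= l.
Proof. intros Hl. pose proof (inf_range l Hl). rewrite <- kap_dt_p. unfold kap. lra. Qed.

Lemma inf_ex : exists l, is_inf l eta.
Proof.
  destruct (BD_pos _ (proj2 (C1_f _ _ _ (sol_h _ _ Hs)))) as [M2 [P2 B2]].
  destruct (sup_exists (fun y => exists q, y = - eta q) M2 (- eta 0)) as [l [H1 H2]].
  exists 0; auto. intros y [q ->]. specialize (B2 q 1 ltac:(lra)). apply Rabs_le_between in B2. unfold eta. lra.
  exists (- l). split. intros q. specialize (H1 (- eta q) ltac:(exists q; auto)). lra.
  intros eps Heps. destruct (H2 eps Heps) as [y [[q ->] K]]. exists q. lra.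
Qed.

Lemma eta_ge q : dt om tp <= eta q.
Proof. destruct inf_ex as [l Hl]. pose proof (inf_ge l Hl). destruct Hl as [H1 _]. specialize (H1 q). lra. Qed.

Lemma lower_bound : St om r tp <= FF om f r 0.
Proof.
  destruct inf_ex as [l Hl]. pose proof (FF_lower l Hl). pose proof (inf_range l Hl) as [L1 L2].
  destruct (Req_dec (2 * (r + Omega om 1 - l)) tp) as [E|E]. rewrite <- E; auto.
  pose proof (St_decr om r tm tp Ho Ha Nm Np (2 * (r + Omega om 1 - l)) tp L1 ltac:(lra) ltac:(lra)). lra.
Qed.

Lemma lower_eq : FF om f r 0 = St om r tp -> is_inf (dt om tp) eta.
Proof.
  intros E. destruct inf_ex as [l Hl]. pose proof (FF_lower l Hl). pose proof (inf_range l Hl) as [L1 L2].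
  replace (dt om tp) with l; auto.
  destruct (Req_dec (2 * (r + Omega om 1 - l)) tp) as [E'|E'].
  - rewrite <- kap_dt_p, <- E'. unfold kap. field.
  - pose proof (St_decr om r tm tp Ho Ha Nm Np (2 * (r + Omega om 1 - l)) tp L1 ltac:(lra) ltac:(lra)). lra.
Qed.

(** Admissibility comes from [bottom_speed_ge] and [tau <= tp] from comparison with the
    supercritical flow. At the bottom [u = 0], so [phip] is (v - m)^2 / (2 v), which vanishes at the
    chosen point; a positive [Phi] on the surface would make it positive. *)
Lemma tau_facts : let tau := fv f 0 0 * fv f 0 0 in
  adm om tau /\ tau <= tp /\ mt om tau 0 = fv f 0 0 /\ FF om f r 0 <= St om r tau.
Proof.
  intros tau. destruct bottom_speed_ge as [t1 [Ha1 Ht1]].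
  pose proof (sol_pos om f 0 0 Hs ltac:(lra)) as Hv.
  assert (Em : mt om tau 0 = fv f 0 0).
  { unfold mt. rewrite Omega_0. replace (tau - 2 * 0) with tau by ring. apply sqrt_square. lra. }
  assert (Hat : adm om tau).
  { pose proof (Ht1 t1 Ha1 ltac:(lra) 0). pose proof (mt_sqr om t1 0 Ha1 ltac:(lra)). pose proof (mt_pos om t1 0 Ha1 ltac:(lra)).
    rewrite Omega_0 in *. apply adm_mono with t1; auto. unfold tau. nra. }
  assert (Htp : tau <= tp).
  { pose proof (bottom_speed_le tp Hap eta_ge 0). pose proof (mt_sqr om tp 0 Hap ltac:(lra)). rewrite Omega_0 in *. unfold tau. nra. }
  repeat split; auto.
  apply Rnot_lt_le. intros L.
  destruct (taylor_Phi om f tau Ho Hs Hat) as [M TT]. destruct (Phi_ell om f tau Ho Hs Hat) as [K HE].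
  destruct (coef_avg om f f Hs Hs) as [c0 [A1 HC]].
  pose proof (bottom_slope _ _ _ _ _ c0 A1 K M (FF om f r 0 - St om r tau) HC HE (proj2 (C1_f _ _ _ (Phi_C1s om f tau Ho Hs Hat))) TT ltac:(lra)) as B.
  specialize (B (fun q => Phi_0 om f tau q Hs)).
  assert (0 < phip f (mt om tau) 0 0).
  { apply B. intros q. rewrite Phi_top. pose proof (pow2_ge_0 (eta q - kap om r tau)). lra. }
  unfold phip in H. rewrite Em, (sol_u0 _ _ Hs) in H. unfold Rdiv in H. simpl in H. ring_simplify in H. lra.
Qed.

Lemma St_max t : adm om t -> t <= tp -> St om r t <= St om r tm /\ (St om r t = St om r tm -> t = tm).
Proof.
  intros Hat Htp. destruct (Rtotal_order t tm) as [L|[->|L]].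
  - pose proof (St_incr om r tm tp Ho Hmp Nm Np t tm Hat L ltac:(lra)). lra.
  - lra.
  - pose proof (St_decr om r tm tp Ho Ha Nm Np tm t ltac:(lra) L ltac:(lra)). lra.
Qed.

Lemma upper_bound : FF om f r 0 <= St om r tm.
Proof. destruct tau_facts as [H1 [H2 [_ H3]]]. pose proof (proj1 (St_max _ H1 H2)). lra. Qed.

Lemma height_of_speed t : adm om t -> (forall q p, 0 < p < 1 -> fv f q p = mt om t p) ->
  forall q p, 0 <= p <= 1 -> fh f q p = Ht om t p.
Proof.
  intros Hat Hv q p Hp.
  assert (C : C1s (w t) (fun q p => - fu f q p / fv f q p - 0) (wp t)).
  { exact (C1s_minus _ _ _ _ _ _ (sol_h _ _ Hs) (Ht_C1s om t Ho Hat)). }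
  destruct (Req_dec p 0) as [->|Hne]. pose proof (w_0 t q) as W. unfold w in W. lra.
  destruct (MVT_closed (w t q) (wp t q) 0 p) as [x [Hx E]]. lra.
  - intros x Hx. apply (D1_dp _ _ _ q x (C1_D _ _ _ C)). lra.
  - apply cont_in_sub with 0 1; try lra. apply UC_cont_in. apply C.
  - rewrite w_0 in E. unfold wp in E. rewrite Hv in E by lra. unfold w in E. lra.
Qed.

(** Equality forces [tau = tm], so [Phi >= 0] with zero slope at a bottom point; by the Hopf lemma
    [Phi] vanishes identically. Its gradient being half a complex square, v = m follows, and the
    height is recovered by integration. *)
Lemma upper_eq : FF om f r 0 = St om r tm -> forall q p, 0 <= p <= 1 -> fh f q p = Ht om tm p.
Proof.
  intros E. destruct tau_facts as [H1 [H2 [H3 H4]]]. set (tau := fv f 0 0 * fv f 0 0) in *.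
  destruct (St_max _ H1 H2) as [K1 K2]. assert (Et : tau = tm) by (apply K2; lra). rewrite Et in *.
  destruct (taylor_Phi om f tm Ho Hs Ha) as [M TT]. destruct (Phi_ell om f tm Ho Hs Ha) as [K HE].
  destruct (coef_avg om f f Hs Hs) as [c0 [A1 HC]].
  assert (Hpos : forall q p, 0 <= p <= 1 -> 0 <= Phi om f tm q p).
  { apply (weak_min _ _ _ c0 A1 K 1 0 HC HE (proj2 (C1_f _ _ _ (Phi_C1s om f tm Ho Hs Ha)))); try lra.
    intros; rewrite Phi_0; auto; lra.
    intros q. rewrite Phi_top. pose proof (pow2_ge_0 (eta q - kap om r tm)). lra. }
  assert (Hz : forall q p, 0 < p < 1 -> Phi om f tm q p = 0).
  { intros q p Hp. apply NNPP. intros Hn. specialize (Hpos q p ltac:(lra)) as L.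
    assert (L2 : 0 < Phi om f tm 0 p).
    { apply (strong_pos _ _ _ c0 A1 K (Rmin q 0 - 1) 0 q p HC HE); auto; try lra.
      pose proof (Rmin_r q 0); lra. pose proof (Rmin_l q 0); lra. }
    pose proof (hopf_bottom _ _ _ _ _ c0 A1 K M (-1) 0 p HC HE TT ltac:(lra) Hp (fun q p _ => Hpos q p) L2 (Phi_0 om f tm 0 Hs)) as HB.
    unfold phip in HB. rewrite H3, (sol_u0 _ _ Hs) in HB. unfold Rdiv in HB. simpl in HB. ring_simplify in HB. lra. }
  apply height_of_speed; auto. intros q p Hp.
  assert (C : D1 (Phi om f tm) (phiq f (mt om tm)) (phip f (mt om tm))) by apply (Phi_C1s om f tm Ho Hs Ha).
  assert (Eq : phiq f (mt om tm) q p = 0).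
  { pose proof (is_derive_unique _ _ _ (D1_dq _ _ _ q p C Hp)) as U. rewrite <- U.
    rewrite (Derive_ext _ (fun _ => 0)) by (intros; now apply Hz). apply Derive_const. }
  assert (Ep : phip f (mt om tm) q p = 0).
  { pose proof (is_derive_unique _ _ _ (D1_dp _ _ _ q p C Hp)) as U. rewrite <- U.
    rewrite (Derive_ext_loc _ (fun _ => 0)). apply Derive_const.
    assert (Hd : 0 < Rmin p (1 - p)) by (apply Rmin_pos; lra). exists (mkposreal _ Hd). intros y Hy.
    change (Rabs (y - p) < Rmin p (1 - p)) in Hy. apply Rabs_def2 in Hy.
    pose proof (Rmin_l p (1 - p)). pose proof (Rmin_r p (1 - p)). apply Hz. lra. }
  unfold phiq in Eq. rewrite Ep in Eq. unfold phip in Ep.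
  pose proof (sol_pos om f q p Hs ltac:(lra)) as Hv.
  assert (E2 : (fv f q p - mt om tm p) ^ 2 - fu f q p ^ 2 = 0).
  { replace ((fv f q p - mt om tm p) ^ 2 - fu f q p ^ 2) with (((fv f q p - mt om tm p) ^ 2 - fu f q p ^ 2) / (2 * fv f q p) * (2 * fv f q p)) by (field; lra).
    rewrite Ep. ring. }
  assert (E3 : fu f q p * (fv f q p - mt om tm p) = 0) by lra.
  apply Rmult_integral in E3. destruct E3 as [E3|E3]; [rewrite E3 in E2|]; nra.
Qed.

(** At a contact point the surface slope is zero and Bernoulli's law fixes the speed to the laminar
    one, so [wp = 0]; the Hopf lemma excludes this unless [w] vanishes identically. *)
Lemma touch_eq q0 : FF om f r 0 = St om r tp -> eta q0 = dt om tp -> forall q p, 0 <= p <= 1 -> fh f q p = Ht om tp p.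
Proof.
  intros E E0.
  destruct (w_taylor tp Hap) as [wq [M TT]]. destruct (w_ell tp Hap) as [K HE]. destruct (w_coef tp Hap) as [c0 [A1 HC]].
  pose proof (w_nonneg tp Hap eta_ge) as Hpos.
  assert (U0 : fu f q0 1 = 0).
  { assert (D : - fu f q0 1 / fv f q0 1 = 0).
    { assert (pr : derivable_pt eta q0) by (eexists; apply is_derive_Reals; apply top_dq).
      rewrite <- (derive_pt_eq_0 eta q0 _ pr (proj1 (is_derive_Reals _ _ _) (top_dq q0))).
      apply deriv_minimum with (q0 - 1) (q0 + 1); try lra. intros x _ _. rewrite E0. apply eta_ge. }
    pose proof (sol_pos om f q0 1 Hs ltac:(lra)).
    replace (fu f q0 1) with (- (- fu f q0 1 / fv f q0 1) * fv f q0 1) by (field; lra). rewrite D. ring. }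
  assert (V0 : fv f q0 1 = mt om tp 1).
  { pose proof (HT q0) as B. fold (eta q0) in B. rewrite U0, E0 in B. pose proof (mt_1 tp Hap). rewrite kap_dt_p in H.
    pose proof (sol_pos om f q0 1 Hs ltac:(lra)). pose proof (mt_pos om tp 1 Hap ltac:(lra)). nra. }
  assert (Hz : forall q p, 0 < p < 1 -> w tp q p = 0).
  { intros q p Hp. apply NNPP. intros Hn. specialize (Hpos q p ltac:(lra)) as L.
    assert (L2 : 0 < w tp q0 p).
    { apply (strong_pos _ _ _ c0 A1 K (Rmin q q0 - 1) q0 q p HC HE); auto; try lra.
      pose proof (Rmin_r q q0); lra. pose proof (Rmin_l q q0); lra. }
    pose proof (hopf_top _ _ _ _ _ c0 A1 K M (q0 - 1) q0 p HC HE TT ltac:(lra) Hp (fun q p _ => Hpos q p) L2) as HB.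
    rewrite w_1, E0 in HB. specialize (HB ltac:(lra)). unfold wp in HB. rewrite V0 in HB. lra. }
  intros q p Hp.
  assert (C : UC (w tp)) by apply HE.
  assert (w tp q p <= 0) by (apply (le_closure (w tp q)); auto; [now apply UC_cont_in|intros; rewrite Hz; auto; lra]).
  pose proof (Hpos q p Hp). unfold w in *. lra.
Qed.

End bounds.
End waves.

(** * Reflections and the corner barrier *)

Definition refl (f : flow) (lam : R) : flow :=
  mkflow (fun q p => fh f (2 * lam - q) p) (fun q p => - fu f (2 * lam - q) p) (fun q p => fv f (2 * lam - q) p)
    (fun q p => fuq f (2 * lam - q) p) (fun q p => - fup f (2 * lam - q) p)
    (fun q p => - fvq f (2 * lam - q) p) (fun q p => fvp f (2 * lam - q) p).

Lemma refl_sol om f lam : sol om f -> sol om (refl f lam).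
Proof.
  intros H. split; simpl.
  - destruct (sol_c _ _ H) as [c [Hc Hc']]. exists c. split; auto.
  - eapply C1s_ext. exact (C1s_reflect _ _ _ lam (sol_h _ _ H)). intros q p Hp.
    pose proof (sol_pos om f (2 * lam - q) p H Hp). repeat split; field; lra.
  - eapply C1s_ext. exact (C1s_scal _ _ _ (-1) (C1s_reflect _ _ _ lam (sol_u _ _ H))). intros q p Hp.
    repeat split; ring.
  - exact (C1s_reflect _ _ _ lam (sol_v _ _ H)).
  - intros q p Hp. pose proof (sol_E1 _ _ H (2 * lam - q) p Hp). lra.
  - intros q p Hp. pose proof (sol_E2 _ _ H (2 * lam - q) p Hp). lra.
  - intros q. apply H.
  - intros q. rewrite (sol_u0 _ _ H). ring.
Qed.

Lemma refl_top f lam r : top_bc f r -> top_bc (refl f lam) r.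
Proof. intros H q. simpl. rewrite <- (H (2 * lam - q)). field. Qed.

Lemma exp_1_bounds : 2 <= exp 1 <= 3.
Proof. split. pose proof (exp_ineq1_le 1). lra. apply exp_le_3. Qed.

Lemma exp_m1 be s : 0 < be -> 0 <= s <= / be ->
  be * s <= exp (be * s) - 1 /\ 1 <= exp (be * s) <= 3 /\ exp (be * s) - 1 <= 3 * (be * s).
Proof.
  intros Hb Hs.
  assert (H1 : 0 <= be * s <= 1).
  { split. apply Rmult_le_pos; lra. apply Rle_trans with (be * / be). apply Rmult_le_compat_l; lra. right. field. lra. }
  pose proof (exp_ineq1_le (be * s)). pose proof exp_1_bounds.
  assert (exp (be * s) <= exp 1) by (apply exp_le; lra).
  assert (exp (be * s) - 1 <= be * s * exp (be * s)).
  { pose proof (exp_ineq1_le (- (be * s))). pose proof (exp_pos (be * s)).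
    assert (exp (be * s) * exp (- (be * s)) = 1) by (rewrite <- exp_plus; replace (be * s + - (be * s)) with 0 by ring; apply exp_0). nra. }
  split. lra. split. lra. nra.
Qed.

(* The factor in [p] vanishes at both ends and is strongly convex near them; where it is concave
   it is bounded below, and the second derivative of the factor in [q] dominates. *)
Lemma corner_barrier_sides g A B c0 A1 K C lam : coef A B c0 A1 -> ell g A B K -> 0 <= C ->
  (forall q p, lam < q -> 0 < p < 1 -> Rabs (B q p) <= C * (q - lam)) ->
  exists al be, 0 < al /\ 0 < be /\ forall c, 0 < c ->
    (forall q p, lam <= q <= lam + / be -> 0 <= p <= 1 -> 0 <= g q p) ->
    (forall p, 0 <= p <= 1 -> c * p <= g (lam + / be) p) ->
    forall s p, 0 <= s <= / be -> 0 <= p <= 1 ->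
      c / (2 * al) * (exp (be * s) - 1) * (exp (- al * (p - / 2) ^ 2) - exp (- al / 4)) <= g (lam + s) p.
Proof.
  intros HC HE HC0 HB. assert (HK : 0 <= K) by apply HE. assert (Hc0 : 0 < c0) by apply HC.
  assert (HA1 : 0 < A1). { destruct (coef_A A B c0 A1 0 (1/2) HC ltac:(lra)). lra. }
  (* For [|p - 1/2| >= 1/4] the second derivative of the [p] factor is at least [al * (al / 4 - 2)]
     times it up to the additive constant, and this [al] lets it dominate. For [|p - 1/2| <= 1/4]
     the factor is at least [g0], and [be] is chosen to dominate there. *)
  set (al := 8 + 4 * (6 * C + K + 1) / c0).
  assert (Hal0 : 0 < 4 * (6 * C + K + 1) / c0) by (apply Rdiv_lt_0_compat; lra).
  assert (Hal : 8 < al) by (unfold al; lra).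
  assert (HalC : 6 * C + K < c0 * (al / 4 - 2)).
  { unfold al. replace (c0 * ((8 + 4 * (6 * C + K + 1) / c0) / 4 - 2)) with (6 * C + K + 1) by (field; lra). lra. }
  clearbody al.
  set (g0 := exp (- al / 16) - exp (- al / 4)).
  assert (Hg0 : 0 < g0) by (unfold g0; assert (exp (- al / 4) < exp (- al / 16)) by (apply exp_increasing; lra); lra).
  assert (Hgd : g0 = exp (- al / 16) - exp (- al / 4)) by reflexivity.
  set (Z := 3 * C * al + A1 * (al ^ 2 + 2 * al) + K * al).
  assert (HZ : 0 <= Z) by (unfold Z; nra).
  set (be := K + 1 + (Z + 1) / g0).
  assert (Hbe1 : 0 < (Z + 1) / g0) by (apply Rdiv_lt_0_compat; lra).
  assert (Hbe : 1 < be) by (unfold be; lra).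
  assert (HbeK : K + 1 <= be) by (unfold be; lra).
  assert (HbeZ : Z < (be - K) * g0).
  { unfold be. replace ((K + 1 + (Z + 1) / g0 - K) * g0) with (g0 + Z + 1) by (field; lra). lra. }
  clearbody be. clearbody g0.
  exists al, be. split. lra. split. lra. intros c Hc Hpos Hcol.
  assert (Hib : 0 < / be) by (apply Rinv_0_lt_compat; lra).
  set (ep := c / (2 * al)). assert (Hep : 0 < ep) by (apply Rdiv_lt_0_compat; lra).
  assert (Eep : ep * (2 * al) = c) by (unfold ep; field; lra). clearbody ep.
  assert (GG : forall p, 0 <= p <= 1 -> 0 <= exp (- al * (p - / 2) ^ 2) - exp (- al / 4) <= al * p).
  { intros p Hp. split.
    - apply (proj1 (Rminus_le_0 _ _)). apply exp_le.
      assert (Q : (p - / 2) ^ 2 <= / 4) by (replace ((p - / 2) ^ 2) with (/ 4 - p * (1 - p)) by field; nra).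
      apply Rmult_le_compat_l with (r := al) in Q; lra.
    - set (y := al * (p - p ^ 2)). assert (0 <= y) by (unfold y; apply Rmult_le_pos; nra).
      assert (E : exp (- al / 4) = exp (- al * (p - / 2) ^ 2) * exp (- y)).
      { rewrite <- exp_plus. f_equal. unfold y. field. }
      rewrite E. pose proof (exp_ineq1_le (- y)).
      assert (exp (- al * (p - / 2) ^ 2) <= 1) by (rewrite <- exp_0; apply exp_le; pose proof (Rmult_le_pos al _ ltac:(lra) (pow2_ge_0 (p - / 2))); lra).
      pose proof (exp_pos (- al * (p - / 2) ^ 2)).
      assert (exp (- al * (p - / 2) ^ 2) * (1 - exp (- y)) <= y).
      { destruct (Rle_dec (exp (- y)) 1) as [L|L]. nra. assert (exp (- y) <= 1) by (rewrite <- exp_0; apply exp_le; lra). lra. }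
      assert (y <= al * p) by (unfold y; apply Rmult_le_compat_l; nra). lra. }
  intros s p Hs Hp.
  cut (ep * (exp (be * (lam + s - lam)) - 1) * (exp (- al * (p - / 2) ^ 2) - exp (- al / 4)) + 0 <= g (lam + s) p).
  { intros L. replace (lam + s - lam) with s in L by ring. lra. }
  apply (rect_cmp g A B c0 A1 K lam (lam + / be) 0 1
    (fun q => ep * (exp (be * (q - lam)) - 1)) (fun q => ep * (be * exp (be * (q - lam))))
    (fun q => ep * (be * (be * exp (be * (q - lam)))))
    (fun p => exp (- al * (p - / 2) ^ 2) - exp (- al / 4))
    (fun p => - al * (2 * (p - / 2)) * exp (- al * (p - / 2) ^ 2))
    (fun p => (- al * 2 + (- al * (2 * (p - / 2))) ^ 2) * exp (- al * (p - / 2) ^ 2))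
    (fun _ => 0) (fun _ => 0) (fun _ => 0)); auto; try lra.
  - intros q. refine (conj _ (conj _ (conj _ _))); auto_derive; auto; cbn [pow]; unfold Rminus; rewrite ?Rmult_1_r; ring.
  - intros x. split; auto_derive; auto; cbn [pow]; unfold Rminus; rewrite ?Rmult_1_r; ring.
  - clear s p Hs Hp. intros q p Hq Hp.
    set (s := q - lam). assert (Hs : 0 < s < / be) by (unfold s; lra).
    destruct (exp_m1 be s ltac:(lra) ltac:(lra)) as [X1 [X2 X3]].
    specialize (HB q p ltac:(lra) Hp). fold s in HB.
    destruct (coef_A A B c0 A1 q p HC Hp) as [_ [HA HA']].
    specialize (GG p ltac:(lra)).
    set (Y := exp (be * s)) in *.
    set (E := exp (- al * (p - / 2) ^ 2)) in *. set (E0 := exp (- al / 4)) in *. set (x := p - / 2) in *.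
    assert (HE0 : 0 < E) by apply exp_pos.
    set (b := B q p) in *. set (a := A q p) in *.
    assert (HF : 0 < Y - 1) by (assert (0 < be * s) by (apply Rmult_lt_0_compat; lra); lra).
    rewrite !Rplus_0_r.
    assert (HbB : Rabs (2 * b * (ep * (be * Y) * (- al * (2 * x) * E))) <= ep * (6 * C * (Y - 1) * Rabs (al * (2 * x) * E))).
    { replace (2 * b * (ep * (be * Y) * (- al * (2 * x) * E))) with (- (ep * (be * Y) * 2 * (b * (al * (2 * x) * E)))) by ring.
      rewrite Rabs_Ropp, !Rabs_mult. rewrite (Rabs_pos_eq ep), (Rabs_pos_eq be), (Rabs_pos_eq Y), (Rabs_pos_eq 2), (Rabs_pos_eq al), (Rabs_pos_eq E) by lra.
      assert (HX : 0 <= al * (2 * Rabs x) * E) by (repeat apply Rmult_le_pos; try lra; apply Rabs_pos).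
      set (W := al * (2 * Rabs x) * E) in *.
      assert (be * Y * 2 * Rabs b <= 6 * C * (Y - 1)).
      { apply Rle_trans with (be * Y * 2 * (C * s)). apply Rmult_le_compat_l; nra.
        apply Rle_trans with (be * 3 * 2 * (C * s)). apply Rmult_le_compat_r; nra. 
        assert (C * (be * s) <= C * (Y - 1)) by (apply Rmult_le_compat_l; lra). nra. }
      replace (ep * (be * Y) * 2 * (Rabs b * W)) with (ep * ((be * Y * 2 * Rabs b) * W)) by ring.
      apply Rmult_le_compat_l. lra. apply Rmult_le_compat_r; auto. }
    apply Rabs_le_between in HbB.
    rewrite (Rabs_pos_eq (ep * (be * Y) * (E - E0))) by (repeat apply Rmult_le_pos; lra).
    assert (EA : Rabs (ep * (Y - 1) * (- al * (2 * x) * E)) = ep * ((Y - 1) * Rabs (al * (2 * x) * E))).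
    { replace (ep * (Y - 1) * (- al * (2 * x) * E)) with (- (ep * (Y - 1) * (al * (2 * x) * E))) by ring.
      rewrite Rabs_Ropp, Rabs_mult, (Rabs_pos_eq (ep * (Y - 1))) by (apply Rmult_le_pos; lra). ring. }
    rewrite EA.
    assert (EX : Rabs (al * (2 * x) * E) = al * (2 * Rabs x) * E).
    { rewrite !Rabs_mult, (Rabs_pos_eq 2), (Rabs_pos_eq al), (Rabs_pos_eq E) by lra. ring. }
    rewrite EX in *.
    assert (Hx2 : x ^ 2 = Rabs x * Rabs x) by (rewrite <- pow2_abs; ring).
    assert (Hxl : Rabs x <= / 2) by (apply Rabs_le; unfold x; lra).
    pose proof (Rabs_pos x) as Hx0. set (ax := Rabs x) in *.
    cut (K * (be * Y * (E - E0) + (Y - 1) * (al * (2 * ax) * E)) <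
      be * (be * Y) * (E - E0) - 6 * C * (Y - 1) * (al * (2 * ax) * E) + a * ((Y - 1) * ((- al * 2 + (- al * (2 * x)) ^ 2) * E))).
    { intros L. apply Rmult_lt_compat_l with (r := ep) in L; auto. lra. }
    replace ((- al * (2 * x)) ^ 2) with (4 * al ^ 2 * (ax * ax)) by (rewrite <- Hx2; ring).
    destruct (Rle_dec (/ 4) ax) as [Hax|Hax].
    + assert (T1 : 0 <= (be - K) * (be * Y * (E - E0))) by (apply Rmult_le_pos; [lra|apply Rmult_le_pos; nra]).
      assert (T2 : (6 * C + K) * al * E < c0 * ((- al * 2 + 4 * al ^ 2 * (ax * ax)) * E)).
      { assert (/ 16 <= ax * ax) by nra.
        assert (al ^ 2 / 4 <= 4 * al ^ 2 * (ax * ax)). { assert (0 <= al ^ 2) by (apply pow2_ge_0). nra. }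
        assert ((6 * C + K) * al < c0 * (- al * 2 + 4 * al ^ 2 * (ax * ax))).
        { apply Rlt_le_trans with (c0 * (al / 4 - 2) * al). apply Rmult_lt_compat_r; lra.
          rewrite Rmult_assoc. apply Rmult_le_compat_l; nra. }
        nra. }
      assert (T3 : c0 * ((- al * 2 + 4 * al ^ 2 * (ax * ax)) * E) <= a * ((- al * 2 + 4 * al ^ 2 * (ax * ax)) * E)).
      { apply Rmult_le_compat_r; auto. apply Rmult_le_pos; [|lra]. assert (/ 16 <= ax * ax) by nra. nra. }
      assert (T4 : (6 * C + K) * (al * (2 * ax) * E) <= (6 * C + K) * al * E).
      { assert (al * (2 * ax) * E <= al * E) by (apply Rmult_le_compat_r; nra).
        replace ((6 * C + K) * al * E) with ((6 * C + K) * (al * E)) by ring. apply Rmult_le_compat_l; lra. }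
      assert (T5 : (Y - 1) * ((6 * C + K) * (al * (2 * ax) * E)) < (Y - 1) * (a * ((- al * 2 + 4 * al ^ 2 * (ax * ax)) * E))).
      { apply Rmult_lt_compat_l; lra. }
      lra.
    + apply Rnot_le_lt in Hax.
      assert (HE1 : E <= 1) by (unfold E; rewrite <- exp_0; apply exp_le; pose proof (pow2_ge_0 x); nra).
      assert (Hg1 : g0 <= E - E0).
      { rewrite Hgd. fold E0. assert (exp (- al / 16) <= E); [|lra]. unfold E. apply exp_le. rewrite Hx2.
        assert (Q : ax * ax <= / 16) by nra. apply Rmult_le_compat_l with (r := al) in Q; lra. }
      set (F' := be * Y). assert (HF' : 0 < F') by (unfold F'; nra).
      assert (HYF : Y - 1 <= F') by (unfold F'; nra).
      assert (T1 : Z * F' < (be - K) * (E - E0) * F').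
      { apply Rmult_lt_compat_r; auto. apply Rlt_le_trans with ((be - K) * g0); auto. apply Rmult_le_compat_l; lra. }
      set (X := al * (2 * ax) * E).
      assert (HX : 0 <= X <= al / 2).
      { unfold X. split. apply Rmult_le_pos; [nra|lra]. apply Rle_trans with (al * (2 * ax) * 1). apply Rmult_le_compat_l; nra. nra. }
      assert (T2 : (6 * C + K) * ((Y - 1) * X) <= (6 * C + K) * (F' * (al / 2))).
      { apply Rmult_le_compat_l. lra. apply Rmult_le_compat; lra. }
      set (Q := (- al * 2 + 4 * al ^ 2 * (ax * ax)) * E).
      assert (HQ : - (2 * al) <= Q).
      { unfold Q. assert (0 <= al ^ 2 * (ax * ax)) by (apply Rmult_le_pos; nra). 
        assert (0 <= al ^ 2 * (ax * ax) * E) by (apply Rmult_le_pos; lra). nra. }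
      assert (T3 : - (A1 * (F' * (2 * al))) <= a * ((Y - 1) * Q)).
      { assert (0 <= a * (Y - 1) <= A1 * F') by (split; [apply Rmult_le_pos; lra|apply Rmult_le_compat; lra]).
        assert (a * (Y - 1) * - (2 * al) <= a * (Y - 1) * Q) by (apply Rmult_le_compat_l; lra). nra. }
      assert (HZF : (6 * C + K) * (F' * (al / 2)) + A1 * (F' * (2 * al)) <= Z * F').
      { replace ((6 * C + K) * (F' * (al / 2)) + A1 * (F' * (2 * al))) with ((3 * C * al + A1 * (2 * al) + K * (al / 2)) * F') by field.
        apply Rmult_le_compat_r. lra. unfold Z. assert (0 <= A1 * al ^ 2) by (apply Rmult_le_pos; [lra|apply pow2_ge_0]). nra. }
      nra.
  - intros q Hq. replace ((0 - / 2) ^ 2) with (/ 4) by field. replace ((1 - / 2) ^ 2) with (/ 4) by field.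
    replace (- al * / 4) with (- al / 4) by field. rewrite Rminus_diag, Rmult_0_r, Rplus_0_l. split; apply Hpos; lra.
  - intros x Hx. rewrite Rminus_diag, Rmult_0_r, exp_0, Rminus_diag, Rmult_0_r, Rmult_0_l, Rplus_0_l. split.
    + apply Hpos; lra.
    + replace (be * (lam + / be - lam)) with 1 by (field; lra). rewrite Rplus_0_r.
      specialize (GG x Hx). pose proof exp_1_bounds. eapply Rle_trans; [|apply Hcol; auto].
      set (Gx := exp (- al * (x - / 2) ^ 2) - exp (- al / 4)) in *.
      apply Rle_trans with (ep * 2 * (al * x)).
      * apply Rmult_le_compat; try lra. apply Rmult_le_pos; lra. apply Rmult_le_compat_l; lra.
      * rewrite <- Eep. right. ring.
Qed.

(** A product of two exponentials minus one vanishes on [q = lam] and [p = 0] like [s * p]. The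
    dangerous term is the mixed derivative, which does not vanish at the corner; the bound
    [|B| <= C * (q - lam)] makes its contribution comparable to the [q] factor, so that the second
    derivative in [p] absorbs it. *)
Lemma corner_barrier g A B c0 A1 K C lam : coef A B c0 A1 -> ell g A B K -> 0 <= C ->
  (forall q p, lam < q -> 0 < p < 1 -> Rabs (B q p) <= C * (q - lam)) ->
  exists al, 0 < al /\ forall c, 0 < c ->
    (forall q p, lam <= q <= lam + / al -> 0 <= p <= 1 -> 0 <= g q p) ->
    (forall p, 0 <= p <= 1 -> c * p <= g (lam + / al) p) ->
    (forall s, 0 <= s <= / al -> c * s <= g (lam + s) 1) ->
    exists c', 0 < c' /\ forall s p, 0 <= s <= / al -> 0 <= p <= 1 -> c' * (s * p) <= g (lam + s) p.
Proof.
  intros HC HE HC0 HB. assert (HK : 0 <= K) by apply HE. assert (Hc0 : 0 < c0) by apply HC.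
  set (al := 1 + K + (6 * C + K + 1) / c0).
  assert (Hal0 : 0 < (6 * C + K + 1) / c0) by (apply Rdiv_lt_0_compat; lra).
  assert (Hal1 : 1 + K <= al) by (unfold al; lra).
  assert (HalC : 6 * C + K < c0 * al).
  { unfold al. replace (c0 * (1 + K + (6 * C + K + 1) / c0)) with (c0 * (1 + K) + (6 * C + K + 1)) by (field; lra). nra. }
  clearbody al.
  exists al. split. lra. intros c Hc Hpos Hcol Htop.
  assert (Hib : 0 < / al) by (apply Rinv_0_lt_compat; lra).
  pose proof (exp_pos al) as Hea.
  assert (Hea1 : 1 <= exp al) by (rewrite <- exp_0; apply exp_le; lra).
  set (ep := c / (3 * al * exp al)).
  assert (H3 : 0 < 3 * al * exp al) by (apply Rmult_lt_0_compat; lra).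
  assert (Hep : 0 < ep) by (apply Rdiv_lt_0_compat; lra).
  assert (Eep : ep * (3 * al * exp al) = c) by (unfold ep; field; lra).
  clearbody ep.
  exists (ep * (al * al)). split. repeat apply Rmult_lt_0_compat; lra.
  assert (HG : forall p, 0 <= p <= 1 -> al * p <= exp (al * p) - 1 <= al * p * exp al).
  { intros p Hp. pose proof (exp_ineq1_le (al * p)). split. lra.
    pose proof (exp_ineq1_le (- (al * p))). pose proof (exp_pos (al * p)).
    assert (exp (al * p) * exp (- (al * p)) = 1) by (rewrite <- exp_plus; replace (al * p + - (al * p)) with 0 by ring; apply exp_0).
    assert (exp (al * p) <= exp al) by (apply exp_le; nra).
    assert (exp (al * p) - 1 <= al * p * exp (al * p)) by nra. 
    assert (al * p * exp (al * p) <= al * p * exp al) by (apply Rmult_le_compat_l; nra). lra. }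
  intros s p Hs Hp.
  apply Rle_trans with (ep * (exp (al * s) - 1) * (exp (al * p) - 1)).
  { destruct (exp_m1 al s ltac:(lra) Hs) as [X1 _]. destruct (HG p Hp) as [G1' _].
    replace (ep * (al * al) * (s * p)) with (ep * (al * s) * (al * p)) by ring.
    apply Rmult_le_compat; [apply Rmult_le_pos; nra|nra|apply Rmult_le_compat_l; lra|lra]. }
  cut (ep * (exp (al * (lam + s - lam)) - 1) * (exp (al * p) - 1) + 0 <= g (lam + s) p).
  { intros L. replace (lam + s - lam) with s in L by ring. lra. }
  apply (rect_cmp g A B c0 A1 K lam (lam + / al) 0 1
    (fun q => ep * (exp (al * (q - lam)) - 1)) (fun q => ep * (al * exp (al * (q - lam))))
    (fun q => ep * (al * (al * exp (al * (q - lam)))))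
    (fun p => exp (al * p) - 1) (fun p => al * exp (al * p)) (fun p => al * (al * exp (al * p)))
    (fun _ => 0) (fun _ => 0) (fun _ => 0)); auto; try lra.
  - intros q. refine (conj _ (conj _ (conj _ _))); auto_derive; auto; unfold Rminus; rewrite ?Rmult_1_r; ring.
  - intros x. split; auto_derive; auto; ring.
  - clear s p Hs Hp. intros q p Hq Hp.
    set (s := q - lam). assert (Hs : 0 < s < / al) by (unfold s; lra).
    destruct (exp_m1 al s ltac:(lra) ltac:(lra)) as [X1 [X2 X3]].
    specialize (HB q p ltac:(lra) Hp). fold s in HB.
    destruct (coef_A A B c0 A1 q p HC Hp) as [_ [HA HA']]. destruct (HG p ltac:(lra)) as [G1' _].
    set (Y := exp (al * s)) in *. set (P := exp (al * p)) in *.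
    set (b := B q p) in *. set (a := A q p) in *.
    assert (0 < al * s) by (apply Rmult_lt_0_compat; lra). assert (0 < al * p) by (apply Rmult_lt_0_compat; lra).
    assert (HYP : 0 < (Y - 1) * P) by (apply Rmult_lt_0_compat; lra).
    rewrite !Rplus_0_r.
    rewrite (Rabs_pos_eq (ep * (al * Y) * (P - 1))) by (repeat apply Rmult_le_pos; lra).
    rewrite (Rabs_pos_eq (ep * (Y - 1) * (al * P))) by (repeat apply Rmult_le_pos; lra).
    assert (HbB : - (6 * C * (Y - 1)) <= 2 * b * (al * Y)).
    { assert (Rabs (2 * b * (al * Y)) <= 6 * C * (Y - 1)).
      { rewrite !Rabs_mult, (Rabs_pos_eq 2), (Rabs_pos_eq al), (Rabs_pos_eq Y) by lra.
        apply Rle_trans with (2 * (C * s) * (al * 3)).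
        apply Rmult_le_compat; try nra. pose proof (Rabs_pos b); lra.
        assert (C * (al * s) <= C * (Y - 1)) by (apply Rmult_le_compat_l; lra). nra. }
      apply Rabs_le_between in H1. lra. }
    cut (K * (al * Y * (P - 1) + (Y - 1) * (al * P)) < al * (al * Y) * (P - 1) + 2 * b * (al * Y) * (al * P) + a * ((Y - 1) * (al * (al * P)))).
    { intros L. apply Rmult_lt_compat_l with (r := ep) in L; auto. lra. }
    assert (T1 : 0 <= (al - K) * (al * Y * (P - 1))) by (repeat apply Rmult_le_pos; lra).
    assert (T2 : - (6 * C * (Y - 1)) * (al * P) <= 2 * b * (al * Y) * (al * P)) by (apply Rmult_le_compat_r; [nra|auto]).
    assert (T3 : c0 * al * ((Y - 1) * P * al) <= a * ((Y - 1) * (al * (al * P)))).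
    { replace (a * ((Y - 1) * (al * (al * P)))) with (a * al * ((Y - 1) * P * al)) by ring.
      apply Rmult_le_compat_r. nra. apply Rmult_le_compat_r; lra. }
    assert (T4 : (6 * C + K) * ((Y - 1) * P * al) < c0 * al * ((Y - 1) * P * al)).
    { apply Rmult_lt_compat_r; auto. apply Rmult_lt_0_compat; lra. }
    nra.
  - intros q Hq. rewrite Rmult_0_r, exp_0, Rminus_diag, Rmult_0_r, Rplus_0_l, Rmult_1_r, Rplus_0_r. split.
    apply Hpos; lra.
    destruct (exp_m1 al (q - lam) ltac:(lra) ltac:(lra)) as [_ [_ X3]].
    specialize (Htop (q - lam) ltac:(lra)). replace (lam + (q - lam)) with q in Htop by ring.
    eapply Rle_trans; [|exact Htop]. rewrite <- Eep.
    replace (ep * (3 * al * exp al) * (q - lam)) with (ep * (3 * (al * (q - lam))) * exp al) by ring.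
    assert (0 <= al * (q - lam)) by (apply Rmult_le_pos; lra).
    assert (0 <= exp (al * (q - lam)) - 1). { pose proof (exp_ineq1_le (al * (q - lam))). lra. }
    apply Rmult_le_compat; try lra. apply Rmult_le_pos; lra. apply Rmult_le_compat_l; lra.
  - intros x Hx. rewrite Rminus_diag, Rmult_0_r, exp_0, Rminus_diag, Rmult_0_r, Rmult_0_l, Rplus_0_l. split.
    + apply Hpos; lra.
    + replace (al * (lam + / al - lam)) with 1 by (field; lra). rewrite Rplus_0_r.
      destruct (HG x Hx) as [G1' G2']. pose proof exp_1_bounds. eapply Rle_trans; [|apply Hcol; auto].
      rewrite <- Eep. apply Rle_trans with (ep * 2 * (al * x * exp al)).
      * assert (0 <= al * x) by (apply Rmult_le_pos; lra). apply Rmult_le_compat; try lra. apply Rmult_le_pos; lra. apply Rmult_le_compat_l; lra.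
      * assert (0 <= ep * (al * x * exp al)) by (repeat apply Rmult_le_pos; lra). nra.
Qed.

(** * Moving planes *)

Lemma min_deriv0 (g : R -> R) (x l d : R) : is_derive g x l -> 0 < d ->
  (forall y, Rabs (y - x) < d -> g x <= g y) -> l = 0.
Proof.
  intros D Hd H.
  assert (pr : derivable_pt g x) by (exists l; now apply is_derive_Reals).
  rewrite <- (derive_pt_eq_0 g x l pr (proj1 (is_derive_Reals _ _ _) D)).
  apply deriv_minimum with (x - d) (x + d); try lra. intros y H1 H2. apply H. apply Rabs_def1; lra.
Qed.

(** Interpolation on a single column: smallness of [F] gives a point of small [Fp] within distance
    [rho], and the modulus of continuity of [Fp] does the rest. *)
Lemma interp_p F Fq Fp eps : C1s F Fq Fp -> 0 < eps -> exists del, 0 < del /\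
  forall q, (forall p, 0 <= p <= 1 -> Rabs (F q p) <= del) -> forall p, 0 <= p <= 1 -> Rabs (Fp q p) <= eps.
Proof.
  intros H Heps. destruct (proj1 (C1_p _ _ _ H) (eps / 2) ltac:(lra)) as [d [Hd K]].
  set (rho := Rmin (d / 2) (/ 2)). assert (Hr : 0 < rho) by (apply Rmin_pos; lra).
  assert (Hr1 : rho <= d / 2) by apply Rmin_l. assert (Hr2 : rho <= / 2) by apply Rmin_r.
  exists (eps * rho / 4). split. nra. intros q HF p Hp.
  assert (HP : exists p', 0 <= p' <= 1 /\ Rabs (p' - p) = rho).
  { destruct (Rle_dec p (/ 2)).
    exists (p + rho). split. lra. replace (p + rho - p) with rho by ring. apply Rabs_pos_eq; lra.
    exists (p - rho). split. lra. replace (p - rho - p) with (- rho) by ring. rewrite Rabs_Ropp. apply Rabs_pos_eq; lra. }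
  destruct HP as [p' [Hp' Er]].
  destruct (C1s_MVTp F Fq Fp q p p' H Hp Hp') as [c [Hc E]].
  pose proof (between_abs _ _ _ Hc) as Hb. pose proof (between_in _ _ _ _ _ Hp Hp' Hc) as Hi.
  assert (B1 : Rabs (Fp q c) * rho <= eps * rho / 2).
  { rewrite <- Er at 1. rewrite <- Rabs_mult, <- E. pose proof (HF p Hp). pose proof (HF p' Hp').
    eapply Rle_trans. apply Rabs_triang. rewrite Rabs_Ropp. lra. }
  assert (B2 : Rabs (Fp q c) <= eps / 2) by (apply Rmult_le_reg_r with rho; lra).
  specialize (K q c q p Hi Hp). rewrite Rminus_diag, Rabs_R0, Rabs_minus_sym in K. specialize (K ltac:(lra) ltac:(lra)).
  replace (Fp q p) with ((Fp q p - Fp q c) + Fp q c) by ring. eapply Rle_trans. apply Rabs_triang. lra.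
Qed.

(** * Smallness on columns close to the laminar flow *)

Section near.
Variable S : R -> R -> Prop.
Hypothesis S_mono : forall d d' q, d <= d' -> S d q -> S d' q.

(** Here [S del q] singles out columns that are [del]-close to the laminar one: [small] means
    convergence to 0 as [del -> 0], uniformly in [p], and [near] the same for expressions in two
    independent columns with limit [F0]. Two columns occur because a point and its mirror image are
    compared. *)
Definition small (F : fun2) : Prop := forall eps, 0 < eps -> exists del, 0 < del /\
  forall q, S del q -> forall p, 0 <= p <= 1 -> Rabs (F q p) <= eps.

Definition near (F : R -> R -> R -> R) (F0 : R -> R) : Prop :=
  (exists M, 0 < M /\ forall p, 0 <= p <= 1 -> Rabs (F0 p) <= M) /\
  forall eps, 0 < eps -> exists del, 0 < del /\
  forall q q', S del q -> S del q' -> forall p, 0 <= p <= 1 -> Rabs (F q q' p - F0 p) <= eps.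

Lemma small_interp F Fq Fp : C1s F Fq Fp -> small F -> small Fp.
Proof.
  intros H HF eps Heps. destruct (interp_p F Fq Fp eps H Heps) as [d [Hd K]].
  destruct (HF d Hd) as [del [Hdel K']]. exists del. split; auto.
Qed.

Lemma small_bound F G M : 0 < M -> small F -> (forall q p, 0 <= p <= 1 -> Rabs (G q p) <= M * Rabs (F q p)) -> small G.
Proof.
  intros HM HF H eps Heps. destruct (HF (eps / M)) as [del [Hdel K]]. apply Rdiv_lt_0_compat; auto.
  exists del. split; auto. intros q Hq p Hp. eapply Rle_trans. apply H; auto.
  specialize (K q Hq p Hp). apply Rle_trans with (M * (eps / M)). apply Rmult_le_compat_l; lra. right. field. lra.
Qed.

Lemma small_plus F G : small F -> small G -> small (fun q p => F q p + G q p).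
Proof.
  intros HF HG eps Heps. destruct (HF (eps/2) ltac:(lra)) as [d1 [Hd1 K1]]. destruct (HG (eps/2) ltac:(lra)) as [d2 [Hd2 K2]].
  exists (Rmin d1 d2). split. now apply Rmin_pos. intros q Hq p Hp.
  specialize (K1 q (S_mono _ _ _ (Rmin_l _ _) Hq) p Hp). specialize (K2 q (S_mono _ _ _ (Rmin_r _ _) Hq) p Hp).
  eapply Rle_trans. apply Rabs_triang. lra.
Qed.

Lemma small_near_l F F0 : (exists M, 0 < M /\ forall p, 0 <= p <= 1 -> Rabs (F0 p) <= M) ->
  small (fun q p => F q p - F0 p) -> near (fun q _ p => F q p) F0.
Proof. intros HB H. split; auto. intros eps Heps. destruct (H eps Heps) as [d [Hd K]]. exists d. split; auto. Qed.

Lemma small_near_r F F0 : (exists M, 0 < M /\ forall p, 0 <= p <= 1 -> Rabs (F0 p) <= M) ->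
  small (fun q p => F q p - F0 p) -> near (fun _ q p => F q p) F0.
Proof. intros HB H. split; auto. intros eps Heps. destruct (H eps Heps) as [d [Hd K]]. exists d. split; auto. Qed.

Lemma near_ext F G F0 G0 : near F F0 -> (forall q q' p, 0 <= p <= 1 -> F q q' p = G q q' p) ->
  (forall p, 0 <= p <= 1 -> F0 p = G0 p) -> near G G0.
Proof.
  intros [[M [HM HB]] H] E E0. split. exists M. split; auto. intros p Hp. rewrite <- E0; auto.
  intros eps Heps. destruct (H eps Heps) as [d [Hd K]]. exists d. split; auto.
  intros q q' Hq Hq' p Hp. rewrite <- E, <- E0; auto.
Qed.

Lemma near_p F0 : (exists M, 0 < M /\ forall p, 0 <= p <= 1 -> Rabs (F0 p) <= M) -> near (fun _ _ p => F0 p) F0.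
Proof.
  intros HB. split; auto. intros eps Heps. exists 1. split. lra. intros. rewrite Rminus_diag, Rabs_R0. lra.
Qed.

Lemma near_plus F G F0 G0 : near F F0 -> near G G0 -> near (fun q q' p => F q q' p + G q q' p) (fun p => F0 p + G0 p).
Proof.
  intros [[M1 [P1 B1]] HF] [[M2 [P2 B2]] HG]. split.
  - exists (M1 + M2). split. lra. intros p Hp. eapply Rle_trans. apply Rabs_triang. specialize (B1 p Hp). specialize (B2 p Hp). lra.
  - intros eps Heps. destruct (HF (eps/2) ltac:(lra)) as [d1 [Hd1 K1]]. destruct (HG (eps/2) ltac:(lra)) as [d2 [Hd2 K2]].
    exists (Rmin d1 d2). split. now apply Rmin_pos. intros q q' Hq Hq' p Hp.
    specialize (K1 q q' (S_mono _ _ _ (Rmin_l _ _) Hq) (S_mono _ _ _ (Rmin_l _ _) Hq') p Hp).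
    specialize (K2 q q' (S_mono _ _ _ (Rmin_r _ _) Hq) (S_mono _ _ _ (Rmin_r _ _) Hq') p Hp).
    replace (F q q' p + G q q' p - (F0 p + G0 p)) with ((F q q' p - F0 p) + (G q q' p - G0 p)) by ring.
    eapply Rle_trans. apply Rabs_triang. lra.
Qed.

Lemma near_mult F G F0 G0 : near F F0 -> near G G0 -> near (fun q q' p => F q q' p * G q q' p) (fun p => F0 p * G0 p).
Proof.
  intros [[M1 [P1 B1]] HF] [[M2 [P2 B2]] HG]. split.
  - exists (M1 * M2). split. nra. intros p Hp. rewrite Rabs_mult. apply Rmult_le_compat; auto; apply Rabs_pos.
  - intros eps Heps. set (e := Rmin 1 (eps / (1 + M1 + M2))).
    assert (0 < eps / (1 + M1 + M2)) by (apply Rdiv_lt_0_compat; lra).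
    assert (He : 0 < e) by (apply Rmin_pos; lra).
    assert (He1 : e <= 1) by apply Rmin_l.
    assert (He2 : e * (1 + M1 + M2) <= eps).
    { apply Rle_trans with (eps / (1 + M1 + M2) * (1 + M1 + M2)). apply Rmult_le_compat_r. lra. apply Rmin_r. right. field. lra. }
    destruct (HF e He) as [d1 [Hd1 K1]]. destruct (HG e He) as [d2 [Hd2 K2]].
    exists (Rmin d1 d2). split. now apply Rmin_pos. intros q q' Hq Hq' p Hp.
    specialize (K1 q q' (S_mono _ _ _ (Rmin_l _ _) Hq) (S_mono _ _ _ (Rmin_l _ _) Hq') p Hp).
    specialize (K2 q q' (S_mono _ _ _ (Rmin_r _ _) Hq) (S_mono _ _ _ (Rmin_r _ _) Hq') p Hp).
    specialize (B1 p Hp). specialize (B2 p Hp).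
    set (x := F q q' p - F0 p) in *. set (y := G q q' p - G0 p) in *.
    replace (F q q' p * G q q' p - F0 p * G0 p) with (x * y + x * G0 p + F0 p * y) by (unfold x, y; ring).
    eapply Rle_trans. apply Rabs_triang. eapply Rle_trans. apply Rplus_le_compat_r. apply Rabs_triang.
    rewrite !Rabs_mult. pose proof (Rabs_pos x). pose proof (Rabs_pos y). pose proof (Rabs_pos (F0 p)). pose proof (Rabs_pos (G0 p)).
    assert (Rabs x * Rabs y <= e * 1) by (apply Rmult_le_compat; lra).
    assert (Rabs x * Rabs (G0 p) <= e * M2) by (apply Rmult_le_compat; lra).
    assert (Rabs (F0 p) * Rabs y <= M1 * e) by (apply Rmult_le_compat; lra). nra.
Qed.

Lemma near_const c : near (fun _ _ _ => c) (fun _ => c).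
Proof. apply (near_p (fun _ => c)). exists (Rabs c + 1). split. pose proof (Rabs_pos c); lra. intros; lra. Qed.

Lemma near_minus F G F0 G0 : near F F0 -> near G G0 -> near (fun q q' p => F q q' p - G q q' p) (fun p => F0 p - G0 p).
Proof.
  intros HF HG. eapply near_ext. exact (near_plus _ _ _ _ HF (near_mult _ _ _ _ (near_const (-1)) HG)).
  intros; simpl; ring. intros; simpl; ring.
Qed.

Lemma near_inv F F0 c : 0 < c -> (forall q q' p, 0 <= p <= 1 -> c <= F q q' p) -> (forall p, 0 <= p <= 1 -> c <= F0 p) ->
  near F F0 -> near (fun q q' p => / F q q' p) (fun p => / F0 p).
Proof.
  intros Hc HF HF0 [[M [P B]] H]. split.
  - exists (/ c). split. now apply Rinv_0_lt_compat. intros p Hp. specialize (HF0 p Hp). rewrite Rabs_pos_eq.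
    apply Rinv_le_contravar; lra. left. apply Rinv_0_lt_compat. lra.
  - intros eps Heps. destruct (H (eps * (c * c))) as [d [Hd K]]. { repeat apply Rmult_lt_0_compat; auto. } exists d. split; auto.
    intros q q' Hq Hq' p Hp. specialize (K q q' Hq Hq' p Hp). specialize (HF q q' p Hp). specialize (HF0 p Hp).
    replace (/ F q q' p - / F0 p) with (- (F q q' p - F0 p) * / (F q q' p * F0 p)) by (field; lra).
    assert (0 < F q q' p * F0 p) by nra.
    rewrite Rabs_mult, Rabs_Ropp, (Rabs_pos_eq (/ _)) by (left; now apply Rinv_0_lt_compat).
    apply Rmult_le_reg_r with (F q q' p * F0 p); auto. rewrite Rmult_assoc, Rinv_l, Rmult_1_r by lra.
    eapply Rle_trans. apply K. apply Rmult_le_compat_l. lra. apply Rmult_le_compat; lra.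
Qed.
End near.

(** * Behaviour of the tail and the supersolution *)

Section planes.
(** In the application [T] is the squared speed of the supercritical stream and [d2] the subcritical
    depth. The flow is the wave or its mirror image, so that [Htail] may always refer to the right
    end. *)
Variables (om : R -> R) (f : flow) (r T d2 : R).
Hypotheses (Ho : cont_in 0 1 om) (Hs : sol om f) (HT : top_bc f r) (Ha : adm om T).
Let d := dt om T.
Let eta q := fh f q 1.
Let w : fun2 := fun q p => fh f q p - Ht om T p.
Let wp : fun2 := fun q p => / fv f q p - / mt om T p.
Let m := mt om T.
Hypotheses (Hkap : kap om r T = d) (Hd2 : d < d2) (Hpos : forall q, d < eta q).
Hypothesis Hsup : RInt (fun p => / mt om T p ^ 3) 0 1 < 1.
Hypothesis Hcrit : forall L, d < L <= d2 -> exists del, 0 < del /\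
  forall q, Rabs (eta q - L) < del -> Rabs (fu f q 1) < del -> False.
Hypothesis Hconj : forall t, adm om t -> dt om t = kap om r t -> dt om t = d \/ dt om t = d2.
Hypothesis Htail : forall N eps, 0 < eps -> exists q, N < q /\ eta q < d + eps.

Lemma no_crit_pt q : eta q <= d2 -> fu f q 1 <> 0.
Proof.
  intros H E. destruct (Hcrit (eta q)) as [del [Hd K]]. specialize (Hpos q); lra.
  apply (K q). now rewrite Rminus_diag, Rabs_R0. now rewrite E, Rabs_R0.
Qed.

(** Choose [qa < qb] in the tail with [eta qb < eta qa < d2]. On [[qa, q2]] with [q2 >= qb] the
    minimum is not at [qa], and an interior one would be a critical point of height at most [d2];
    hence it is at [q2]. *)
Lemma eta_decr : exists N, (forall q q', N <= q -> q <= q' -> eta q' <= eta q) /\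
  (forall eps, 0 < eps -> exists N', forall q, N' <= q -> eta q < d + eps).
Proof.
  destruct (Htail 0 (d2 - d) ltac:(lra)) as [qa [_ Ha1]].
  destruct (Htail qa (eta qa - d)) as [qb [Hab Hb1]]. specialize (Hpos qa); lra.
  assert (Key : forall q2, qb <= q2 -> forall q, qa <= q <= q2 -> eta q2 <= eta q).
  { intros q2 Hq2. destruct (cont_in_min qa q2 eta) as [x [Hx Hm]]. lra.
    { apply cont_in_continuous. intros y _. exact (is_derive_cont _ _ _ (top_dq om f Hs y)). }
    assert (Hxb : eta x <= eta qb) by (apply Hm; lra).
    assert (x <> qa) by (intros ->; unfold eta in *; lra).
    destruct (Req_dec x q2) as [->|Hne]; auto. exfalso.
    assert (D : - fu f x 1 / fv f x 1 = 0).
    { apply (min_deriv0 eta x _ (Rmin (x - qa) (q2 - x))). exact (top_dq om f Hs x). apply Rmin_pos; lra.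
      intros y Hy. apply Rabs_def2 in Hy. pose proof (Rmin_l (x - qa) (q2 - x)). pose proof (Rmin_r (x - qa) (q2 - x)). apply Hm. lra. }
    apply (no_crit_pt x). unfold eta in *; lra.
    pose proof (sol_pos om f x 1 Hs ltac:(lra)).
    replace (fu f x 1) with (- (- fu f x 1 / fv f x 1) * fv f x 1) by (field; lra). rewrite D. ring. }
  exists qb. split. intros q q' H1 H2. apply Key; lra.
  intros eps Heps. destruct (Htail qb eps Heps) as [q1 [H1 H2]]. exists q1. intros q Hq.
  eapply Rle_lt_trans; [|exact H2]. apply Key; lra.
Qed.

Let w_pos : forall q p, 0 <= p <= 1 -> 0 <= w q p.
Proof. apply (w_nonneg om f Ho Hs T Ha). intros q. left. apply Hpos. Qed.

Let wC1 : C1s w (fun q p => - fu f q p / fv f q p - 0) wp := C1s_minus _ _ _ _ _ _ (sol_h _ _ Hs) (Ht_C1s om T Ho Ha).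

Lemma speed_le q : fv f q 1 <= m 1.
Proof.
  pose proof (HT q) as B. fold (eta q) in B. pose proof (mt_1 om r T Ha) as E. rewrite Hkap in E.
  pose proof (mt_pos om T 1 Ha ltac:(lra)). specialize (Hpos q). pose proof (pow2_ge_0 (fu f q 1)). unfold m. nra.
Qed.

Definition Scol (del q : R) : Prop := eta q < d + del.

Lemma Scol_mono : forall a b q, a <= b -> Scol a q -> Scol b q.
Proof. unfold Scol. intros. lra. Qed.

(** If [w > eps] somewhere on a column, the Lipschitz bound makes [w] large on a segment and the
    parabolic barrier gives [w >= nu * tau] at distance [tau] below the surface. Where [eta] is near
    [d] this contradicts the Taylor bound, since Bernoulli's law makes [wp] nonnegative at the
    surface. *)
Lemma small_w : small Scol w.
Proof.
  intros eps Heps.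
  destruct (C1s_Lip _ _ _ wC1) as [L [HL HLip]].
  destruct (w_taylor om f Ho Hs T Ha) as [wq [M TT]]. destruct (w_ell om f Ho Hs T Ha) as [K HE]. destruct (w_coef om f Ho Hs T Ha) as [c0 [A1 HC]].
  assert (HM : 0 < M) by apply TT.
  set (rho := eps / (2 * L)). assert (Hr : 0 < rho) by (apply Rdiv_lt_0_compat; lra).
  assert (HrL : L * rho = eps / 2) by (unfold rho; field; lra). clearbody rho.
  destruct (propagate_up _ _ _ c0 A1 K rho HC HE Hr) as [al [Hal P]].
  set (e := eps / 2) in *. assert (He : 0 < e) by (unfold e; lra). assert (Ee : e = eps / 2) by reflexivity.
  set (nu := e * (al * exp (- al))). pose proof (exp_pos (- al)) as Hexp.
  assert (Hnu : 0 < nu) by (unfold nu; apply Rmult_lt_0_compat; [auto|apply Rmult_lt_0_compat; auto]).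
  set (tau := Rmin rho (nu / (2 * M))).
  assert (0 < nu / (2 * M)) by (apply Rdiv_lt_0_compat; lra).
  assert (Ht : 0 < tau) by (apply Rmin_pos; lra).
  assert (Ht1 : tau <= rho) by apply Rmin_l. assert (Ht2 : tau <= nu / (2 * M)) by apply Rmin_r.
  assert (Ht3 : M * tau <= nu / 2).
  { apply Rle_trans with (M * (nu / (2 * M))). apply Rmult_le_compat_l; lra. right. field. lra. }
  exists (Rmin e (nu * tau / 2)). split. apply Rmin_pos; nra.
  intros q Hq p Hp. unfold Scol in Hq. pose proof (Rmin_l e (nu * tau / 2)). pose proof (Rmin_r e (nu * tau / 2)).
  rewrite Rabs_pos_eq by auto. apply Rnot_lt_le. intros Hgt.
  assert (W1 : w q 1 = eta q - d) by reflexivity.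
  assert (Hp1 : rho < 1 - p).
  { pose proof (HLip q p q 1 Hp ltac:(lra)) as B. rewrite Rminus_diag, Rabs_R0, Rplus_0_l, (Rabs_pos_eq (1 - p)) in B by lra.
    apply Rabs_le_between in B. assert (L * rho < L * (1 - p)) by lra. apply Rmult_lt_reg_l with L; auto. }
  assert (LB : forall x, p <= x <= 1 -> e * (exp (- al * (x - p)) - exp (- al * (1 - p))) <= w q x).
  { intros x Hx. apply P; auto; try lra.
    - intros q' p' _ Hp'. apply w_pos. lra.
    - intros q' Hq'. pose proof (HLip q p q' p Hp Hp) as B. rewrite Rminus_diag, Rabs_R0, Rplus_0_r in B.
      assert (Rabs (q' - q) <= rho) by (apply Rabs_le; lra).
      assert (L * Rabs (q' - q) <= L * rho) by (apply Rmult_le_compat_l; lra).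
      apply Rabs_le_between in B. change (e <= w q' p). lra. }
  specialize (LB (1 - tau) ltac:(lra)).
  assert (G : al * exp (- al) * tau <= exp (- al * (1 - tau - p)) - exp (- al * (1 - p))).
  { replace (- al * (1 - tau - p)) with (- al * (1 - p) + al * tau) by ring. rewrite exp_plus.
    pose proof (exp_ineq1_le (al * tau)).
    assert (exp (- al) <= exp (- al * (1 - p))) by (apply exp_le; nra).
    assert (exp (- al) * (al * tau) <= exp (- al * (1 - p)) * (exp (al * tau) - 1)) by (apply Rmult_le_compat; nra). nra. }
  pose proof (taylor_p _ _ _ M q 1 (1 - tau) TT ltac:(lra) ltac:(lra)) as TY. cbv beta in TY.
  fold (w q (1 - tau)) (w q 1) in TY. replace (1 - tau - 1) with (- tau) in TY by ring. apply Rabs_le_between in TY.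
  assert (HWP : 0 <= / fv f q 1 - / mt om T 1).
  { pose proof (speed_le q). pose proof (sol_pos om f q 1 Hs ltac:(lra)).
    assert (/ m 1 <= / fv f q 1) by (apply Rinv_le_contravar; lra). unfold m in *. lra. }
  assert (nu * tau <= w q (1 - tau)).
  { eapply Rle_trans; [|exact LB]. unfold nu. rewrite Rmult_assoc. apply Rmult_le_compat_l; lra. }
  nra.
Qed.

Lemma big_w del : 0 < del -> exists c, 0 < c /\ forall q, d + del <= eta q -> forall p, 0 <= p <= 1 -> c * p <= w q p.
Proof.
  intros Hdel.
  destruct (C1s_Lip _ _ _ wC1) as [L [HL HLip]].
  destruct (w_ell om f Ho Hs T Ha) as [K HE]. destruct (w_coef om f Ho Hs T Ha) as [c0 [A1 HC]].
  set (rho := del / (2 * L)). assert (Hr : 0 < rho) by (apply Rdiv_lt_0_compat; lra).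
  assert (HrL : L * rho = del / 2) by (unfold rho; field; lra). clearbody rho.
  destruct (propagate_down _ _ _ c0 A1 K rho HC HE Hr) as [al [Hal P]].
  pose proof (exp_pos (- al)) as Hexp.
  exists (del / 2 * (al * exp (- al))). split. apply Rmult_lt_0_compat; [lra|apply Rmult_lt_0_compat; auto].
  intros q Hq p Hp.
  apply Rle_trans with (del / 2 * (exp (- al * (1 - p)) - exp (- al * (1 - 0)))).
  - rewrite Rmult_assoc. apply Rmult_le_compat_l. lra.
    replace (- al * (1 - p)) with (- al + al * p) by ring. replace (- al * (1 - 0)) with (- al) by ring. rewrite exp_plus.
    pose proof (exp_ineq1_le (al * p)). nra.
  - apply P; try lra. intros; apply w_pos; auto.
    intros q' Hq'. pose proof (HLip q 1 q' 1 ltac:(lra) ltac:(lra)) as B. rewrite Rminus_diag, Rabs_R0, Rplus_0_r in B.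
    assert (Rabs (q' - q) <= rho) by (apply Rabs_le; lra).
    assert (L * Rabs (q' - q) <= L * rho) by (apply Rmult_le_compat_l; lra).
    apply Rabs_le_between in B. assert (W1 : w q 1 = eta q - d) by reflexivity. change (del / 2 <= w q' 1). lra.
Qed.

(** Smallness passes from [w] to the derivatives: to those in [p] by interpolation, to [u] through
    [w >= 0] and [small_slope_sq], and to [fvq] through [sol_E1]. *)
Lemma small_wp : small Scol wp.
Proof. exact (small_interp Scol _ _ _ wC1 small_w). Qed.

Lemma small_v : small Scol (fun q p => fv f q p - m p).
Proof.
  destruct (BD_pos _ (proj2 (C1_f _ _ _ (sol_v _ _ Hs)))) as [M1 [P1 B1]].
  destruct (BD_pos _ (proj2 (C1_f _ _ _ (mt_C1s om T Ho Ha)))) as [M2 [P2 B2]].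
  apply small_bound with wp (M1 * M2). nra. exact small_wp.
  intros q p Hp. pose proof (sol_pos om f q p Hs Hp). pose proof (mt_pos om T p Ha Hp).
  specialize (B1 q p Hp). specialize (B2 q p Hp).
  unfold m, wp. replace (fv f q p - mt om T p) with (- ((fv f q p * mt om T p) * (/ fv f q p - / mt om T p))) by (field; lra).
  rewrite Rabs_Ropp, Rabs_mult. apply Rmult_le_compat_r. apply Rabs_pos. rewrite Rabs_mult. apply Rmult_le_compat; auto; apply Rabs_pos.
Qed.

Lemma small_vp : small Scol (fun q p => fvp f q p - - om p / m p).
Proof. exact (small_interp Scol _ _ _ (C1s_minus _ _ _ _ _ _ (sol_v _ _ Hs) (mt_C1s om T Ho Ha)) small_v). Qed.

Lemma small_u : small Scol (fu f).
Proof.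
  destruct (taylor_diff om (lam om T) f (lam_sol om T Ho Ha) Hs) as [M TT].
  assert (HM : 0 < M) by apply TT.
  destruct (BD_pos _ (proj2 (C1_f _ _ _ (sol_v _ _ Hs)))) as [M1 [P1 B1]].
  intros eps Heps. set (e := eps ^ 2 / (4 * M * M1 ^ 2)).
  assert (0 < M1 ^ 2) by (apply pow_lt; auto). assert (0 < eps ^ 2) by (apply pow_lt; auto).
  assert (0 < 4 * M * M1 ^ 2) by (apply Rmult_lt_0_compat; lra).
  assert (He : 0 < e) by (apply Rdiv_lt_0_compat; auto).
  destruct (small_w e He) as [del [Hdel K]]. exists del. split; auto. intros q Hq p Hp.
  specialize (K q Hq p Hp). rewrite Rabs_pos_eq in K by auto.
  pose proof (small_slope_sq _ _ _ M q p TT Hp 0 (fun q => w_pos q p Hp)) as S. cbv beta in S. simpl fu in S. simpl fv in S.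
  change (fh f q p - fh (lam om T) q p) with (w q p) in S.
  pose proof (sol_pos om f q p Hs Hp) as Hv. pose proof (mt_pos om T p Ha Hp) as Hm. specialize (B1 q p Hp). rewrite Rabs_pos_eq in B1 by lra.
  assert (E : - fu f q p / fv f q p - - 0 / mt om T p = - fu f q p / fv f q p) by (field; lra). rewrite E in S.
  assert (fu f q p ^ 2 <= eps ^ 2).
  { replace (fu f q p ^ 2) with (fv f q p ^ 2 * (- fu f q p / fv f q p) ^ 2) by (field; lra).
    apply Rle_trans with (M1 ^ 2 * (4 * M * e)).
    apply Rmult_le_compat; try apply pow2_ge_0. apply pow_incr; lra. nra.
    unfold e. right. field. split; lra. }
  rewrite <- (pow2_abs (fu f q p)) in H2. apply Rsqr_incr_0_var; [|lra]. unfold Rsqr. lra.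
Qed.

Lemma small_vq : small Scol (fvq f).
Proof.
  pose proof (small_interp Scol _ _ _ (sol_u _ _ Hs) small_u) as Su.
  destruct (BD_pos _ (proj2 (C1_f _ _ _ (sol_v _ _ Hs)))) as [M1 [P1 B1]].
  destruct (BD_pos _ (proj2 (C1_p _ _ _ (sol_v _ _ Hs)))) as [M2 [P2 B2]].
  assert (S1 : small Scol (fun q p => fv f q p * fup f q p)).
  { apply small_bound with (fup f) M1; auto. intros q p Hp. rewrite Rabs_mult. apply Rmult_le_compat_r; auto; apply Rabs_pos. }
  assert (S2 : small Scol (fun q p => - (fu f q p * fvp f q p))).
  { apply small_bound with (fu f) M2; auto. exact small_u. intros q p Hp. rewrite Rabs_Ropp, Rabs_mult, Rmult_comm. apply Rmult_le_compat_r; auto; apply Rabs_pos. }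
  apply small_bound with (fun q p => fv f q p * fup f q p + - (fu f q p * fvp f q p)) 1. lra.
  apply small_plus; auto. exact Scol_mono.
  intros q p Hp. right. rewrite Rmult_1_l. f_equal. pose proof (sol_E1 _ _ Hs q p Hp). lra.
Qed.

Let bm : exists M, 0 < M /\ forall p, 0 <= p <= 1 -> Rabs (m p) <= M.
Proof. destruct (BD_pos _ (proj2 (UCB_p m (mt_cont om T Ho)))) as [M [P B]]. exists M. split; [exact P|intros p Hp; apply (B 0 p Hp)]. Qed.
Let bom : exists M, 0 < M /\ forall p, 0 <= p <= 1 -> Rabs (om p) <= M.
Proof. destruct (BD_pos _ (proj2 (UCB_p om Ho))) as [M [P B]]. exists M. split; [exact P|intros p Hp; apply (B 0 p Hp)]. Qed.
Let b0 : exists M, 0 < M /\ forall p, 0 <= p <= 1 -> Rabs 0 <= M.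
Proof. exists 1. rewrite Rabs_R0. split; intros; lra. Qed.

Let small0 F : small Scol F -> small Scol (fun q p => F q p - 0).
Proof. intros H. apply small_bound with F 1; auto. lra. intros. rewrite Rminus_0_r. lra. Qed.

(* [T2 q q' p] is half the difference quotient of the squared speed when the slopes agree;
   [E1 q q' p] measures the defect of the linearised equation for the two columns [q], [q'];
   the second column belongs to the reflected flow, hence the signs. *)
Definition T2 (q q' p : R) : R :=
  (fu f q p * fv f q' p * (- fu f q' p + fu f q p) + fv f q p * fv f q' p * (fv f q p + fv f q' p)) / 2.
Definition E1 (q q' p : R) : R :=
  (fu f q p ^ 2 + fv f q p ^ 2) * (3 * om p / m p ^ 2)
  - (om p + fu f q p * fv f q' p * (2 * (fvq f q' p / fv f q' p ^ 2)) + 2 * T2 q q' p * (- fvp f q' p / fv f q' p ^ 2)).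

Lemma near_T2 : near Scol T2 (fun p => m p ^ 3).
Proof.
  pose proof (small_near_l Scol (fv f) m bm small_v) as Vl. pose proof (small_near_r Scol (fv f) m bm small_v) as Vr.
  pose proof (small_near_l Scol (fu f) (fun _ => 0) b0 (small0 _ small_u)) as Ul. pose proof (small_near_r Scol (fu f) (fun _ => 0) b0 (small0 _ small_u)) as Ur.
  pose proof (near_mult _ Scol_mono) as NM. pose proof (near_plus _ Scol_mono) as NP. pose proof (near_minus _ Scol_mono) as NS.
  eapply near_ext.
  exact (NM _ _ _ _ (NP _ _ _ _ (NM _ _ _ _ (NM _ _ _ _ Ul Vr) (NS _ _ _ _ Ul Ur)) (NM _ _ _ _ (NM _ _ _ _ Vl Vr) (NP _ _ _ _ Vl Vr))) (near_const Scol (/ 2))).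
  - intros q q' p Hp. unfold T2. cbv beta. field.
  - intros p Hp. cbv beta. field.
Qed.

(** On the laminar column [T2 = m^3] and the terms reduce to 3 om - om - 2 om = 0; this is the
    linearised height equation with its homogeneous solution of derivative [m^(-3)]. *)
Lemma near_E1 : near Scol E1 (fun _ => 0).
Proof.
  pose proof (small_near_l Scol (fv f) m bm small_v) as Vl. pose proof (small_near_r Scol (fv f) m bm small_v) as Vr.
  pose proof (small_near_l Scol (fu f) (fun _ => 0) b0 (small0 _ small_u)) as Ul.
  pose proof (small_near_r Scol (fvq f) (fun _ => 0) b0 (small0 _ small_vq)) as Qr.
  pose proof (near_p Scol om bom) as No. pose proof (near_p Scol m bm) as Nm.
  pose proof (near_mult _ Scol_mono) as NM. pose proof (near_plus _ Scol_mono) as NP. pose proof (near_minus _ Scol_mono) as NS.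
  destruct (mt_ge om T Ha) as [nu [Hn Hn']]. destruct (sol_c _ _ Hs) as [c [Hc Hc']].
  assert (Hmin : 0 < Rmin nu c) by (now apply Rmin_pos).
  assert (Im : near Scol (fun _ _ p => / m p) (fun p => / m p)) by (apply near_inv with nu; auto).
  assert (Iv : near Scol (fun _ q' p => / fv f q' p) (fun p => / m p)).
  { apply (near_inv Scol (fun _ q' p => fv f q' p) m (Rmin nu c)); auto.
    intros q q' p Hp. specialize (Hc' q' p Hp). pose proof (Rmin_r nu c). lra.
    intros p Hp. specialize (Hn' p Hp). pose proof (Rmin_l nu c). unfold m. lra. }
  assert (Pr : near Scol (fun _ q' p => fvp f q' p) (fun p => - om p / m p)).
  { apply (small_near_r Scol (fvp f)); [|exact small_vp].
    destruct bom as [M1 [P1 B1]]. exists (M1 * / nu). split. apply Rmult_lt_0_compat; auto. now apply Rinv_0_lt_compat.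
    intros p Hp. unfold Rdiv. rewrite Rabs_mult, Rabs_Ropp. specialize (Hn' p Hp). apply Rmult_le_compat; auto; try apply Rabs_pos.
    unfold m. rewrite Rabs_pos_eq. apply Rinv_le_contravar; lra. left. apply Rinv_0_lt_compat. lra. }
  eapply near_ext.
  exact (NS _ _ _ _ (NM _ _ _ _ (NP _ _ _ _ (NM _ _ _ _ Ul Ul) (NM _ _ _ _ Vl Vl)) (NM _ _ _ _ (NM _ _ _ _ (near_const Scol 3) No) (NM _ _ _ _ Im Im)))
     (NP _ _ _ _ (NP _ _ _ _ No (NM _ _ _ _ (NM _ _ _ _ Ul Vr) (NM _ _ _ _ (near_const Scol 2) (NM _ _ _ _ Qr (NM _ _ _ _ Iv Iv)))))
       (NM _ _ _ _ (NM _ _ _ _ (near_const Scol (-2)) near_T2) (NM _ _ _ _ Pr (NM _ _ _ _ Iv Iv))))).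
  - intros q q' p Hp. unfold E1. cbv beta. assert (0 < m p) by (now apply mt_pos). pose proof (sol_pos om f q' p Hs Hp). field. split; lra.
  - intros p Hp. cbv beta. assert (0 < m p) by (now apply mt_pos). field. lra.
Qed.

(* [ph] is a strict supersolution of the linearisation at the laminar flow, also at the top boundary;
   it exists because the flow is supercritical, that is [I3 < 1]. *)
Let I3 := RInt (fun p => / mt om T p ^ 3) 0 1.
Let ka := (1 - I3) / 4.
Let ph1 (p : R) : R := exp (- ka * p) / m p ^ 3.
Let ph2 (p : R) : R := ph1 p * (- ka + 3 * om p / m p ^ 2).
Let ph (p : R) : R := ka + RInt ph1 0 p.

Let ka_pos : 0 < ka.
Proof. unfold ka, I3. lra. Qed.

Let m_pos p : 0 <= p <= 1 -> 0 < m p.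
Proof. intros Hp. now apply mt_pos. Qed.

Lemma m3_cont : cont_in 0 1 (fun p => / m p ^ 3).
Proof.
  apply cont_in_inv. lra. intros p Hp. apply pow_nonzero. specialize (m_pos p Hp). lra.
  apply cont_in_ext with (fun p => m p * (m p * m p)). intros; ring.
  repeat apply cont_in_mult; try lra; now apply mt_cont.
Qed.

Lemma ph1_cont : cont_in 0 1 ph1.
Proof.
  apply cont_in_mult. lra.
  - apply cont_in_continuous. intros x _. apply (is_derive_cont _ x (- ka * exp (- ka * x))). auto_derive; auto; ring.
  - exact m3_cont.
Qed.

Lemma ph_C1s : C1s (fun _ p => ph p) (fun _ _ => 0) (fun _ p => ph1 p).
Proof.
  pose proof ph1_cont as C. apply C1s_p; auto.
  - apply cont_in_plus. lra. apply cont_in_const. now apply RInt_cont_in; auto; lra.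
  - intros p Hp. apply is_derive_eq with (0 + ph1 p); [|ring].
    apply (is_derive_plus (V := R_NormedModule) (fun _ => ka) (fun p => RInt ph1 0 p)).
    apply (is_derive_const (V := R_NormedModule)). now apply (RInt_derive_in 0 1).
Qed.

Lemma ph1_C1s : C1s (fun _ p => ph1 p) (fun _ _ => 0) (fun _ p => ph2 p).
Proof.
  apply C1s_p. exact ph1_cont.
  - apply cont_in_mult. lra. exact ph1_cont. apply cont_in_plus. lra. apply cont_in_const.
    apply cont_in_mult. lra. apply cont_in_mult; auto; try lra. apply cont_in_const.
    apply cont_in_inv. lra. intros p Hp. apply pow_nonzero. specialize (m_pos p Hp). lra.
    apply cont_in_ext with (fun p => m p * m p). intros; ring. apply cont_in_mult; try lra; now apply mt_cont.
  - intros p Hp. pose proof (m_pos p ltac:(lra)) as Hm.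
    pose proof (mt_derive om T p Ho Ha Hp) as Dm. fold m in Dm.
    assert (D1' : is_derive (fun p => exp (- ka * p)) p (- ka * exp (- ka * p))) by (auto_derive; auto; ring).
    pose proof (is_derive_pow m 3 p _ Dm) as Dm3.
    pose proof (is_derive_inv _ p _ Dm3 ltac:(apply pow_nonzero; lra)) as Di.
    eapply is_derive_eq. apply (is_derive_mult (K := R_AbsRing) _ _ _ _ _ D1' Di). intros; apply Rmult_comm.
    unfold plus, mult; simpl. unfold ph2, ph1. field. lra.
Qed.

Lemma ph1_pos p : 0 <= p <= 1 -> 0 < ph1 p.
Proof. intros Hp. apply Rdiv_lt_0_compat. apply exp_pos. apply pow_lt. auto. Qed.

Lemma ph_ge p : 0 <= p <= 1 -> ka <= ph p.
Proof.
  intros Hp. unfold ph. assert (0 <= RInt ph1 0 p); [|lra]. apply RInt_ge_0. lra.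
  apply cont_in_ex_RInt. lra. apply cont_in_sub with 0 1; try lra. exact ph1_cont.
  intros x Hx. left. apply ph1_pos. lra.
Qed.

(** The gap [1 - I3 = 4 * ka] is shared out: the added constant in [ph] costs one [ka], the factor
    [exp (- ka)] another, and the linearised surface condition keeps the margin [2 * ka]. *)
Lemma ph_top : ph 1 <= 1 - 3 * ka /\ ph1 1 * m 1 ^ 3 >= 1 - ka.
Proof.
  split.
  - unfold ph. assert (RInt ph1 0 1 <= I3).
    { apply RInt_le_in. exact ph1_cont. exact m3_cont. intros x Hx. unfold ph1. change (exp (- ka * x) / m x ^ 3 <= / m x ^ 3).
      rewrite <- (Rmult_1_l (/ m x ^ 3)). unfold Rdiv. apply Rmult_le_compat_r. left. apply Rinv_0_lt_compat. apply pow_lt; auto.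
      rewrite <- exp_0. apply exp_le. pose proof ka_pos. nra. }
    unfold ka in *. lra.
  - unfold ph1. replace (exp (- ka * 1) / m 1 ^ 3 * m 1 ^ 3) with (exp (- ka)).
    apply Rle_ge. pose proof (exp_ineq1_le (- ka)). lra.
    rewrite Rmult_1_r. field. pose proof (m_pos 1 ltac:(lra)). lra.
Qed.

(** * Differences with reflected waves *)

Definition V (la : R) : fun2 := fun q p => fh f (2 * la - q) p - fh f q p.

Lemma V_w la q p : V la q p = w (2 * la - q) p - w q p.
Proof. unfold V, w. ring. Qed.

(** Equal slopes mean equal quotients u/v, so both velocity jumps are multiples of the jump [Vp] of
    h_p; Bernoulli's law then ties the height jump to [Vp]. *)
Lemma touch_top u v U W Vp k a b : 0 < v -> 0 < W -> - U / W - - u / v = 0 -> / W - / v = Vp ->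
  (U ^ 2 + W ^ 2) / 2 + a = (u ^ 2 + v ^ 2) / 2 + b -> a - b = - k ->
  k = - Vp * ((u * W * (U + u) + v * W * (v + W)) / 2).
Proof.
  intros Hv HW E0 E1' E2 E3.
  assert (EU : U - u = - (u * W * Vp)).
  { assert (EU0 : U = u * W / v).
    { replace U with (- (- U / W - - u / v) * W + u * W / v) at 1 by (field; lra). rewrite E0. ring. }
    rewrite <- E1', EU0. field. lra. }
  assert (EW : W - v = - (v * W * Vp)) by (rewrite <- E1'; field; lra).
  assert (k = ((U - u) * (U + u) + (W - v) * (W + v)) / 2) by lra.
  rewrite H, EU, EW. field.
Qed.

(** With the same substitution the difference of the height equations becomes an exact multiple of
    [Vp]. The bound in [ell] would be too coarse here: the coefficient has to be compared with that
    of the linearisation. *)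
Lemma touch_int u v U W hqq hs hpp Hqq Hs' Hpp o Vp : 0 < v -> 0 < W -> - U / W - - u / v = 0 -> / W - / v = Vp ->
  hqq + u * hs + (u ^ 2 + v ^ 2) * hpp = o / v ->
  Hqq + U * Hs' + (U ^ 2 + W ^ 2) * Hpp = o / W ->
  (Hqq - hqq) + u * (Hs' - hs) + (u ^ 2 + v ^ 2) * (Hpp - hpp)
   = Vp * (o + u * W * Hs' + (u * W * (U + u) + v * W * (v + W)) * Hpp).
Proof.
  intros Hv HW E0 E1' E2 E3.
  assert (EU : U = u - u * W * Vp).
  { rewrite <- E1'. replace (u - u * W * (/ W - / v)) with (u * W / v) by (field; lra).
    replace U with (- (- U / W - - u / v) * W + u * W / v) at 1 by (field; lra). rewrite E0. ring. }
  assert (EW : W = v - v * W * Vp) by (rewrite <- E1'; field; lra).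
  assert (L1 : Hqq + u * Hs' + (u ^ 2 + v ^ 2) * Hpp = o / W - (U - u) * Hs' - ((U - u) * (U + u) + (W - v) * (W + v)) * Hpp) by nra.
  assert (L2 : o / W - o / v = o * Vp) by (rewrite <- E1'; unfold Rdiv; ring).
  assert (L3 : (Hqq - hqq) + u * (Hs' - hs) + (u ^ 2 + v ^ 2) * (Hpp - hpp)
    = o * Vp - (U - u) * Hs' - ((U - u) * (U + u) + (W - v) * (W + v)) * Hpp) by nra.
  rewrite L3. replace (U - u) with (- (u * W * Vp)) by lra. replace (W - v) with (- (v * W * Vp)) by lra. ring.
Qed.

Let VC1 la : C1s (V la) (fun q p => - fu (refl f la) q p / fv (refl f la) q p - - fu f q p / fv f q p)
   (fun q p => / fv (refl f la) q p - / fv f q p) :=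
  C1s_minus _ _ _ _ _ _ (sol_h _ _ (refl_sol om f la Hs)) (sol_h _ _ Hs).

Let Vtaylor la : exists M, taylor (V la) (fun q p => - fu (refl f la) q p / fv (refl f la) q p - - fu f q p / fv f q p)
   (fun q p => / fv (refl f la) q p - / fv f q p) M := taylor_diff om f (refl f la) Hs (refl_sol om f la Hs).

(** At a contact of [V] with [- k * ph], the surface case gives [k * ph 1 = - Vp * T2 >= k * ph1 1 *
    T2 >= k * (1 - 2 * ka)], against [ph 1 <= 1 - 3 * ka]. In the interior the second-order
    condition reads [0 <= k * ph1 * (E1 - ka * c1)], and [E1] is small on columns near the laminar
    flow. *)
Lemma touch_false : exists del, 0 < del /\ forall la q0 p0 k, 0 < k -> la < q0 -> 0 < p0 <= 1 ->
  Scol del q0 -> Scol del (2 * la - q0) ->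
  (forall q p, la <= q -> 0 <= p <= 1 -> 0 <= V la q p + k * ph p) -> V la q0 p0 + k * ph p0 = 0 -> False.
Proof.
  destruct (sol_c _ _ Hs) as [c [Hc Hc']]. pose proof ka_pos as Hka.
  pose proof (ph1_pos 1 ltac:(lra)) as Hph1.
  destruct (proj2 near_E1 (ka * c ^ 2 / 2)) as [de1 [Hde1 K1]]. { assert (0 < c ^ 2) by (apply pow_lt; auto). nra. }
  destruct (proj2 near_T2 (ka / ph1 1)) as [de2 [Hde2 K2]]. { now apply Rdiv_lt_0_compat. }
  exists (Rmin de1 de2). split. now apply Rmin_pos. intros la q0 p0 k Hk Hq0 Hp0 Sq Sq' Hge Htouch.
  set (g := refl f la). pose proof (refl_sol om f la Hs) as Hg. fold g in Hg.
  destruct (Req_dec p0 1) as [->|Hne].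
  - specialize (K2 q0 (2 * la - q0) (Scol_mono _ _ _ (Rmin_r _ _) Sq) (Scol_mono _ _ _ (Rmin_r _ _) Sq') 1 ltac:(lra)).
    assert (E0 : - fu g q0 1 / fv g q0 1 - - fu f q0 1 / fv f q0 1 = 0).
    { apply (min_deriv0 (fun q => V la q 1) q0 _ (q0 - la)).
      - exact (C1s_dq _ _ _ q0 1 (VC1 la) ltac:(lra)).
      - lra.
      - intros y Hy. apply Rabs_def2 in Hy. specialize (Hge y 1 ltac:(lra) ltac:(lra)). lra. }
    set (Vp := / fv g q0 1 - / fv f q0 1).
    assert (EV : Vp + k * ph1 1 <= 0).
    { destruct (Vtaylor la) as [M1 T1'].
      destruct (C1s_taylor _ _ _ ph_C1s (C1s_Lip _ _ _ (C1s_const 0)) (C1s_Lip _ _ _ ph1_C1s)) as [M2 T2'].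
      assert (0 < M1) by apply T1'. assert (0 < M2) by apply T2'.
      apply slope_nonpos with (M1 + k * M2) 1; try nra. intros tau Ht.
      pose proof (taylor_p _ _ _ M1 q0 1 (1 - tau) T1' ltac:(lra) ltac:(lra)) as A1'. cbv beta in A1'.
      pose proof (taylor_p _ _ _ M2 q0 1 (1 - tau) T2' ltac:(lra) ltac:(lra)) as A2'. cbv beta in A2'.
      fold g in A1'. fold Vp in A1'. replace (1 - tau - 1) with (- tau) in * by ring.
      apply Rabs_le_between in A1'. apply Rabs_le_between in A2'.
      specialize (Hge q0 (1 - tau) ltac:(lra) ltac:(lra)).
      assert (k * ph (1 - tau) <= k * (ph 1 - ph1 1 * tau + M2 * (- tau) ^ 2)) by (apply Rmult_le_compat_l; lra).
      nra. }
    pose proof (touch_top (fu f q0 1) (fv f q0 1) (fu g q0 1) (fv g q0 1) Vp (k * ph 1) (fh g q0 1) (fh f q0 1)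
      (sol_pos om f q0 1 Hs ltac:(lra)) (sol_pos om g q0 1 Hg ltac:(lra)) E0 eq_refl) as TT.
    specialize (TT (eq_trans (refl_top f la r HT q0) (eq_sym (HT q0)))).
    assert (E3 : fh g q0 1 - fh f q0 1 = - (k * ph 1)) by (change (V la q0 1 = - (k * ph 1)); lra).
    specialize (TT E3). change ((fu f q0 1 * fv g q0 1 * (fu g q0 1 + fu f q0 1) + fv f q0 1 * fv g q0 1 * (fv f q0 1 + fv g q0 1)) / 2)
      with (T2 q0 (2 * la - q0) 1) in TT.
    destruct ph_top as [P1 P2]. apply Rabs_le_between in K2.
    assert (P3 : 1 - 2 * ka <= ph1 1 * T2 q0 (2 * la - q0) 1).
    { assert (ph1 1 * (m 1 ^ 3 - ka / ph1 1) <= ph1 1 * T2 q0 (2 * la - q0) 1) by (apply Rmult_le_compat_l; lra).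
      assert (ph1 1 * (m 1 ^ 3 - ka / ph1 1) = ph1 1 * m 1 ^ 3 - ka) by (field; lra). lra. }
    pose proof (ph_ge 1 ltac:(lra)).
    assert (HT2 : 0 < T2 q0 (2 * la - q0) 1).
    { apply Rmult_lt_reg_l with (ph1 1); auto. lra. }
    assert (k * ph1 1 * T2 q0 (2 * la - q0) 1 <= - Vp * T2 q0 (2 * la - q0) 1) by (apply Rmult_le_compat_r; lra).
    assert (k * (1 - 2 * ka) <= k * (ph1 1 * T2 q0 (2 * la - q0) 1)) by (apply Rmult_le_compat_l; lra).
    assert (k * ph 1 <= k * (1 - 3 * ka)) by (apply Rmult_le_compat_l; lra). nra.
  - assert (Hp : 0 < p0 < 1) by lra.
    specialize (K1 q0 (2 * la - q0) (Scol_mono _ _ _ (Rmin_l _ _) Sq) (Scol_mono _ _ _ (Rmin_l _ _) Sq') p0 ltac:(lra)).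
    pose proof (C1s_plus _ _ _ _ _ _ (VC1 la) (C1s_scal _ _ _ k ph_C1s)) as C0.
    pose proof (C1s_plus _ _ _ _ _ _ (C1s_minus _ _ _ _ _ _ (sol_hq _ _ Hg) (sol_hq _ _ Hs)) (C1s_scal _ _ _ k (C1s_const 0))) as Cq.
    pose proof (C1s_plus _ _ _ _ _ _ (C1s_minus _ _ _ _ _ _ (sol_hp _ _ Hg) (sol_hp _ _ Hs)) (C1s_scal _ _ _ k ph1_C1s)) as Cp.
    set (dd := Rmin (q0 - la) (Rmin p0 (1 - p0))).
    destruct (interior_min _ _ _ _ _ _ _ q0 p0 dd (fu f q0 p0 ^ 2 + fv f q0 p0 ^ 2) (fu f q0 p0)
      (C1_D _ _ _ C0) (C1_D _ _ _ Cq) (C1_D _ _ _ Cp) Hp) as [Z1 [Z2 Z3]].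
    + unfold dd. repeat apply Rmin_pos; lra.
    + intros q' p' Lq Lp. cbv beta. rewrite Htouch. apply Rabs_def2 in Lq. apply Rabs_def2 in Lp.
      assert (dd <= q0 - la) by apply Rmin_l.
      assert (dd <= p0 /\ dd <= 1 - p0).
      { unfold dd. pose proof (Rmin_r (q0 - la) (Rmin p0 (1 - p0))). pose proof (Rmin_l p0 (1 - p0)). pose proof (Rmin_r p0 (1 - p0)). lra. }
      apply Hge; lra.
    + pose proof (pow2_ge_0 (fv f q0 p0)). lra.
    + cbv beta in Z1, Z2, Z3. fold g in Z1, Z2.
      pose proof (height_eq om f q0 p0 Hs Hp) as Ef. pose proof (height_eq om g q0 p0 Hg Hp) as Eg.
      pose proof (sol_pos om f q0 p0 Hs ltac:(lra)) as Hv. pose proof (sol_pos om g q0 p0 Hg ltac:(lra)) as HW.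
      pose proof (touch_int (fu f q0 p0) (fv f q0 p0) (fu g q0 p0) (fv g q0 p0) _ _ _ _ _ _ (om p0) (- (k * ph1 p0)) Hv HW ltac:(lra) ltac:(lra) Ef Eg) as TI.
      assert (EH : - (fup g q0 p0 * fv g q0 p0 - fu g q0 p0 * fvp g q0 p0) / fv g q0 p0 ^ 2 = - fvq g q0 p0 / fv g q0 p0 ^ 2).
      { f_equal. pose proof (sol_E1 _ _ Hg q0 p0 ltac:(lra)). lra. }
      set (c1 := (fu f q0 p0 ^ 2 + fv f q0 p0 ^ 2)) in *.
      match type of TI with ?LL = ?RR => assert (Z4 : 0 <= RR + c1 * (k * ph2 p0)) by (rewrite <- TI; lra) end.
      rewrite EH in Z4. unfold ph2 in Z4.
      assert (EE : - (k * ph1 p0) * (om p0 + fu f q0 p0 * fv g q0 p0 * (- fvq g q0 p0 / fv g q0 p0 ^ 2 + - fvq g q0 p0 / fv g q0 p0 ^ 2) +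
         (fu f q0 p0 * fv g q0 p0 * (fu g q0 p0 + fu f q0 p0) + fv f q0 p0 * fv g q0 p0 * (fv f q0 p0 + fv g q0 p0)) * (- fvp g q0 p0 / fv g q0 p0 ^ 2))
         + c1 * (k * (ph1 p0 * (- ka + 3 * om p0 / m p0 ^ 2))) = k * ph1 p0 * (E1 q0 (2 * la - q0) p0 - ka * c1)).
      { unfold E1, T2, c1. simpl fu. simpl fv. simpl fvq. simpl fvp. field. 
        pose proof (m_pos p0 ltac:(lra)). simpl fv in HW. split; lra. }
      rewrite EE in Z4.
      pose proof (ph1_pos p0 ltac:(lra)) as Hph.
      assert (c ^ 2 <= c1).
      { unfold c1. specialize (Hc' q0 p0 ltac:(lra)). assert (c ^ 2 <= fv f q0 p0 ^ 2) by (apply pow_incr; lra). pose proof (pow2_ge_0 (fu f q0 p0)). lra. }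
      apply Rabs_le_between in K1. rewrite Rminus_0_r in K1.
      assert (0 < c ^ 2) by (apply pow_lt; auto).
      assert (ka * c ^ 2 <= ka * c1) by (apply Rmult_le_compat_l; lra).
      assert (0 < ka * c ^ 2) by (apply Rmult_lt_0_compat; auto).
      assert (k * ph1 p0 * (E1 q0 (2 * la - q0) p0 - ka * c1) < k * ph1 p0 * 0).
      { apply Rmult_lt_compat_l. apply Rmult_lt_0_compat; auto. lra. }
      lra.
Qed.

Lemma V_side la p : V la la p = 0.
Proof. unfold V. replace (2 * la - la) with la by ring. ring. Qed.

Lemma V_bot la q : V la q 0 = 0.
Proof. unfold V. rewrite !(sol_h0 _ _ Hs). ring. Qed.

Lemma w_bot q : w q 0 = 0.
Proof. exact (w_0 om f Hs T q). Qed.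

Definition Vpos la : Prop := forall q p, la <= q -> 0 <= p <= 1 -> 0 <= V la q p.

Lemma tail_small F : small Scol F -> forall eps, 0 < eps -> exists N, forall q, N <= q -> forall p, 0 <= p <= 1 -> Rabs (F q p) <= eps.
Proof.
  intros H eps Heps. destruct (H eps Heps) as [del [Hdel K]]. destruct eta_decr as [_ [_ Hl]].
  destruct (Hl del Hdel) as [N HN]. exists N. intros q Hq. apply K. now apply HN.
Qed.

(** The quotient [V / ph] attains its negative minimum because [V >= - w] and [w] is small far to
    the right. To the right of [N] such a minimum is impossible: if the mirrored surface point is
    high, [big_w] makes [V] positive; otherwise both columns are nearly laminar and [touch_false]
    applies. That [N] is independent of [la] both starts the planes and confines negativity to a
    bounded region later. *)
Lemma neg_point : exists N, forall la, ~ Vpos la -> exists q0 p0, la < q0 < N /\ 0 < p0 <= 1 /\ V la q0 p0 < 0.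
Proof.
  destruct touch_false as [del [Hdel Htf]]. destruct (big_w del Hdel) as [c [Hc Hbig]].
  destruct eta_decr as [_ [_ Hl]]. destruct (Hl del Hdel) as [N1 HN1].
  destruct (tail_small wp small_wp (c / 2) ltac:(lra)) as [N2 HN2].
  exists (Rmax N1 N2). intros la Hn.
  assert (Hn' : exists q p, la <= q /\ 0 <= p <= 1 /\ V la q p < 0).
  { apply NNPP. intros Hx. apply Hn. intros q p Hq Hp. apply Rnot_lt_le. intros L. apply Hx. exists q, p. auto. }
  destruct Hn' as [q1 [p1 [Hq1 [Hp1 Hv1]]]]. pose proof ka_pos as Hka.
  assert (UP : UCB (fun q p => V la q p * / ph p)).
  { apply UCB_mult. apply (C1_f _ _ _ (VC1 la)). apply (UCB_inv (fun _ p => ph p) ka); auto. intros; now apply ph_ge. apply (C1_f _ _ _ ph_C1s). }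
  set (vs := V la q1 p1 * / ph p1).
  assert (Hvs : vs < 0).
  { unfold vs. assert (0 < / ph p1) by (apply Rinv_0_lt_compat; pose proof (ph_ge p1 Hp1); lra). nra. }
  destruct (tail_small w small_w (- vs * ka / 2) ltac:(nra)) as [N3 HN3].
  set (N4 := Rmax q1 N3). assert (q1 <= N4) by apply Rmax_l. assert (N3 <= N4) by apply Rmax_r.
  destruct (min_rect (fun q p => V la q p * / ph p) la N4 0 1) as [q0 [p0 [Hq0 [Hp0 Hmin]]]]; try lra.
  { intros x y Hx Hy eps Heps. destruct (proj1 UP eps Heps) as [e [He K]]. exists e. split; auto. }
  set (k := - (V la q0 p0 * / ph p0)).
  assert (Hk : - vs <= k) by (unfold k; specialize (Hmin q1 p1 ltac:(lra) Hp1); unfold vs; lra).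
  assert (Hph : forall p, 0 <= p <= 1 -> 0 < ph p) by (intros p Hp; pose proof (ph_ge p Hp); lra).
  assert (Hge : forall q p, la <= q -> 0 <= p <= 1 -> 0 <= V la q p + k * ph p).
  { intros q p Hq Hp. specialize (Hph p Hp). destruct (Rle_dec q N4) as [L|L].
    - specialize (Hmin q p ltac:(lra) Hp).
      assert (- k * ph p <= V la q p * / ph p * ph p) by (apply Rmult_le_compat_r; unfold k; lra).
      replace (V la q p * / ph p * ph p) with (V la q p) in H1 by (field; lra). lra.
    - specialize (HN3 q ltac:(lra) p Hp). rewrite Rabs_pos_eq in HN3 by auto. rewrite V_w.
      pose proof (w_pos (2 * la - q) p Hp). pose proof (ph_ge p Hp). nra. }
  assert (Ht : V la q0 p0 + k * ph p0 = 0).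
  { unfold k. field. specialize (Hph p0 Hp0). lra. }
  assert (Hneg : V la q0 p0 < 0) by (specialize (Hph p0 Hp0); nra).
  assert (Hq0' : la < q0). { destruct Hq0 as [[L|L] _]; auto. subst q0. rewrite V_side in Hneg. lra. }
  assert (Hp0' : 0 < p0 <= 1). { split; [|lra]. destruct Hp0 as [[L|L] _]; auto. subst p0. rewrite V_bot in Hneg. lra. }
  exists q0, p0. split; [|split; auto]. split; auto. apply Rnot_le_lt. intros HL.
  pose proof (Rmax_l N1 N2). pose proof (Rmax_r N1 N2).
  destruct (Rle_or_lt (d + del) (eta (2 * la - q0))) as [Lb|Lb].
  - specialize (Hbig _ Lb p0 ltac:(lra)).
    destruct (C1s_MVTp _ _ _ q0 0 p0 wC1 ltac:(lra) ltac:(lra)) as [x [Hx Ex]]. rewrite w_bot in Ex.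
    pose proof (between_in 0 p0 x 0 1 ltac:(lra) ltac:(lra) Hx) as Hx1.
    specialize (HN2 q0 ltac:(lra) x Hx1). apply Rabs_le_between in HN2.
    assert (w q0 p0 <= c / 2 * p0) by nra. rewrite V_w in Hneg. nra.
  - apply (Htf la q0 p0 k); auto; try lra. unfold Scol. apply HN1. lra.
Qed.

(** All reflections being favourable, heights decrease in [q], and the column mean [J] is monotone
    and bounded. A slope below [- eps] persists on a square of side [rho] and would make [J] change
    by at least [ga], which is impossible where [J] is within [ga] of its supremum. *)
Lemma dq_small_left : (forall la, Vpos la) -> forall eps, 0 < eps -> exists Q, forall q, q <= Q -> forall p, 0 <= p <= 1 ->
  Rabs (- fu f q p / fv f q p) <= eps.
Proof.
  intros HV eps Heps.
  assert (Mono : forall q q' p, q <= q' -> 0 <= p <= 1 -> fh f q' p <= fh f q p).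
  { intros q q' p Hq Hp. specialize (HV ((q + q') / 2) q' p ltac:(lra) Hp). unfold V in HV.
    replace (2 * ((q + q') / 2) - q') with q in HV by field. lra. }
  destruct (C1s_Lip _ _ _ (sol_hq _ _ Hs)) as [L [HL HLip]]. cbv beta in HLip.
  set (hq := fun q p => - fu f q p / fv f q p) in *.
  destruct (BD_pos _ (proj2 (C1_f _ _ _ (sol_h _ _ Hs)))) as [M [HM HB]].
  assert (ch : forall q, cont_in 0 1 (fh f q)) by (intros q; apply UC_cont_in; apply (C1_f _ _ _ (sol_h _ _ Hs))).
  set (J := fun q => RInt (fh f q) 0 1).
  destruct (sup_exists (fun y => exists q, y = J q) M (J 0)) as [l [Hl1 Hl2]]. exists 0; auto.
  { intros y [q ->]. unfold J. pose proof (abs_RInt_le_const (fh f q) 0 1 M ltac:(lra) (cont_in_ex_RInt 0 1 _ ltac:(lra) (ch q)) (fun t Ht => HB q t Ht)) as B.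
    apply Rabs_le_between in B. lra. }
  set (rho := Rmin (/ 2) (eps / (4 * L))).
  assert (0 < eps / (4 * L)) by (apply Rdiv_lt_0_compat; lra).
  assert (Hr : 0 < rho) by (apply Rmin_pos; lra).
  assert (Hr1 : rho <= / 2) by apply Rmin_l. assert (Hr2 : rho <= eps / (4 * L)) by apply Rmin_r.
  assert (HrL : L * (rho + rho) <= eps / 2).
  { apply Rle_trans with (L * (eps / (4 * L) + eps / (4 * L))). apply Rmult_le_compat_l; lra. right. field. lra. }
  set (ga := rho * (eps / 2) * rho). assert (Hga : 0 < ga) by (unfold ga; repeat apply Rmult_lt_0_compat; lra).
  destruct (Hl2 ga Hga) as [y [[Q ->] HQ]].
  assert (JM : forall q q', q <= q' -> J q' <= J q).
  { intros q q' Hq. apply RInt_le_in; auto. }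
  exists Q. intros q0 Hq0 p0 Hp0. apply Rnot_lt_le. intros Hgt.
  assert (hq0 : forall q p, 0 <= p <= 1 -> hq q p <= 0).
  { intros q p Hp. pose proof (C1s_dq _ _ _ q p (sol_h _ _ Hs) Hp) as D.
    apply is_derive_Reals in D. apply Rnot_lt_le. intros Lq. destruct (D (hq q p / 2)) as [e He]. unfold hq; unfold hq in Lq; lra.
    specialize (He (e / 2)). pose proof (cond_pos e).
    specialize (He ltac:(lra)). rewrite Rabs_pos_eq in He by lra. specialize (He ltac:(lra)). fold (hq q p) in He.
    pose proof (Mono q (q + e / 2) p ltac:(lra) Hp).
    assert ((fh f (q + e / 2) p - fh f q p) / (e / 2) <= 0).
    { unfold Rdiv at 1. rewrite <- (Rmult_0_l (/ (e / 2))). apply Rmult_le_compat_r. left. apply Rinv_0_lt_compat. lra. lra. }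
    apply Rabs_def2 in He. lra. }
  assert (Hq0n : hq q0 p0 < - eps).
  { specialize (hq0 q0 p0 Hp0). fold (hq q0 p0) in Hgt. rewrite Rabs_left1 in Hgt by auto. lra. }
  assert (Hab : exists a b, 0 <= a /\ a < b /\ b <= 1 /\ b - a = rho /\ forall x, a <= x <= b -> Rabs (x - p0) <= rho).
  { destruct (Rle_dec p0 (/ 2)).
    exists p0, (p0 + rho). repeat split; try lra. intros x Hx. apply Rabs_le; lra.
    exists (p0 - rho), p0. repeat split; try lra. intros x Hx. apply Rabs_le; lra. }
  destruct Hab as [a [b [Ha1 [Ha2 [Ha3 [Ha4 Hx]]]]]].
  assert (Hdrop : forall p, a <= p <= b -> rho * (eps / 2) <= fh f (q0 - rho) p - fh f q0 p).
  { intros p Hp. destruct (C1s_MVTq _ _ _ q0 (q0 - rho) p (sol_h _ _ Hs) ltac:(lra)) as [x [Hxx Ex]]. fold (hq x p) in Ex. rewrite Ex.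
    pose proof (between_abs _ _ _ Hxx) as Bx. replace (q0 - rho - q0) with (- rho) in * by ring. rewrite Rabs_Ropp, (Rabs_pos_eq rho) in Bx by lra.
    pose proof (HLip q0 p0 x p Hp0 ltac:(lra)) as BL. fold (hq q0 p0) (hq x p) in BL. specialize (Hx p Hp).
    assert (L * (Rabs (x - q0) + Rabs (p - p0)) <= L * (rho + rho)) by (apply Rmult_le_compat_l; lra).
    apply Rabs_le_between in BL. nra. }
  assert (HI : ga <= J (q0 - rho) - J q0).
  { unfold J. set (D := fun p => fh f (q0 - rho) p - fh f q0 p).
    assert (cD : cont_in 0 1 D) by (apply cont_in_minus; auto; lra).
    rewrite <- RInt_minusR by (apply cont_in_ex_RInt; auto; lra). fold D.
    assert (HD0 : forall p, 0 <= p <= 1 -> 0 <= D p) by (intros p Hp; unfold D; pose proof (Mono (q0 - rho) q0 p ltac:(lra) Hp); lra).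
    assert (ex : forall x y, 0 <= x -> x <= y -> y <= 1 -> ex_RInt D x y).
    { intros x y ? ? ?. apply cont_in_ex_RInt; auto. apply cont_in_sub with 0 1; auto. }
    rewrite <- (@RInt_Chasles R_CompleteNormedModule D 0 a 1) by (apply ex; lra).
    rewrite <- (@RInt_Chasles R_CompleteNormedModule D a b 1) by (apply ex; lra).
    assert (0 <= RInt D 0 a) by (apply RInt_ge_0; [lra|apply ex; lra|intros; apply HD0; lra]).
    assert (0 <= RInt D b 1) by (apply RInt_ge_0; [lra|apply ex; lra|intros; apply HD0; lra]).
    assert (ga <= RInt D a b).
    { apply Rle_trans with (RInt (fun _ => rho * (eps / 2)) a b).
      rewrite RInt_const. change (ga <= (b - a) * (rho * (eps / 2))). rewrite Ha4. unfold ga. lra.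
      apply RInt_le. lra. apply (@ex_RInt_const R_NormedModule). apply ex; lra. intros x Hx'. apply Hdrop. lra. }
    change (ga <= RInt D 0 a + (RInt D a b + RInt D b 1)). lra. }
  assert (J (q0 - rho) <= l) by (apply Hl1; eexists; reflexivity).
  pose proof (JM q0 Q Hq0). lra.
Qed.

Lemma uq_small_left : (forall la, Vpos la) -> forall eps, 0 < eps -> exists Q, forall q, q <= Q -> forall p, 0 <= p <= 1 ->
  Rabs (fu f q p) <= eps /\ Rabs (fuq f q p) <= eps.
Proof.
  intros HV eps Heps.
  destruct (BD_pos _ (proj2 (C1_f _ _ _ (sol_v _ _ Hs)))) as [M [HM HB]].
  assert (U : forall e, 0 < e -> exists Q, forall q, q <= Q -> forall p, 0 <= p <= 1 -> Rabs (fu f q p) <= e).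
  { intros e He. destruct (dq_small_left HV (e / M)) as [Q HQ]. apply Rdiv_lt_0_compat; auto. exists Q. intros q Hq p Hp.
    specialize (HQ q Hq p Hp). specialize (HB q p Hp). pose proof (sol_pos om f q p Hs Hp).
    replace (fu f q p) with (- (fv f q p * (- fu f q p / fv f q p))) by (field; lra).
    rewrite Rabs_Ropp, Rabs_mult. apply Rle_trans with (M * (e / M)). apply Rmult_le_compat; auto; apply Rabs_pos. right. field. lra. }
  destruct (proj1 (C1_q _ _ _ (sol_u _ _ Hs)) (eps / 2) ltac:(lra)) as [rho [Hr K]].
  set (s := rho / 2). assert (Hs0 : 0 < s) by (unfold s; lra).
  destruct (U (Rmin eps (eps * s / 4))) as [Q HQ]. apply Rmin_pos; nra.
  pose proof (Rmin_l eps (eps * s / 4)). pose proof (Rmin_r eps (eps * s / 4)).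
  exists Q. intros q Hq p Hp. split. specialize (HQ q Hq p Hp). lra.
  destruct (C1s_MVTq _ _ _ q (q - s) p (sol_u _ _ Hs) Hp) as [x [Hx Ex]].
  pose proof (between_abs _ _ _ Hx) as Bx. replace (q - s - q) with (- s) in * by ring. rewrite Rabs_Ropp, (Rabs_pos_eq s) in Bx by lra.
  pose proof (HQ q Hq p Hp) as B1. pose proof (HQ (q - s) ltac:(lra) p Hp) as B2.
  assert (Rabs (fuq f x p) * s <= eps / 2 * s).
  { rewrite <- (Rabs_pos_eq s) at 1 by lra. rewrite <- (Rabs_Ropp s), <- Rabs_mult, <- Ex.
    eapply Rle_trans. apply Rabs_triang. rewrite Rabs_Ropp. lra. }
  assert (Rabs (fuq f x p) <= eps / 2) by (apply Rmult_le_reg_r with s; auto).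
  specialize (K x p q p Hp Hp). rewrite Rminus_diag, Rabs_R0, Rabs_minus_sym in K. specialize (K ltac:(unfold s in *; lra) Hr).
  replace (fuq f q p) with ((fuq f q p - fuq f x p) + fuq f x p) by ring. eapply Rle_trans. apply Rabs_triang. lra.
Qed.

(** A monotone wave approaches, far to the left, a laminar flow of depth [L = sup eta] obeying
    Bernoulli's law. As [L > d], conjugacy gives [L = d2], but the slopes tend to zero there,
    contrary to [Hcrit]. *)
Lemma mono_contra : ~ (forall la, Vpos la).
Proof.
  intros HV.
  assert (Mono : forall q q', q <= q' -> eta q' <= eta q).
  { intros q q' Hq. specialize (HV ((q + q') / 2) q' 1 ltac:(lra) ltac:(lra)). unfold V in HV.
    replace (2 * ((q + q') / 2) - q') with q in HV by field. unfold eta. lra. }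
  destruct (BD_pos _ (proj2 (C1_f _ _ _ (sol_h _ _ Hs)))) as [M [HM HB]].
  destruct (sup_exists (fun y => exists q, y = eta q) M (eta 0)) as [L [HL1 HL2]]. exists 0; auto.
  { intros y [q ->]. specialize (HB q 1 ltac:(lra)). apply Rabs_le_between in HB. unfold eta. lra. }
  set (t := 2 * (r + Omega om 1 - L)).
  assert (HkL : kap om r t = L) by (unfold kap, t; field).
  destruct (sol_c _ _ Hs) as [c [Hc Hc']].
  (* far to the left the squared speed is close to that of the laminar flow of depth [L] *)
  assert (Hv2 : forall eps, 0 < eps -> exists Q, forall q, q <= Q -> L - eps < eta q /\ Rabs (fu f q 1) <= eps /\
     forall p, 0 <= p <= 1 -> Rabs (fv f q p ^ 2 - (t - 2 * Omega om p)) <= eps).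
  { intros eps Heps. set (e := Rmin 1 (eps / 8)). assert (He : 0 < e) by (apply Rmin_pos; lra).
    assert (He1 : e <= 1) by apply Rmin_l. assert (He2 : e <= eps / 8) by apply Rmin_r.
    destruct (uq_small_left HV e He) as [Q1 HQ1]. destruct (HL2 e He) as [y [[Q2 ->] HQ2]].
    exists (Rmin Q1 Q2). intros q Hq. pose proof (Rmin_l Q1 Q2). pose proof (Rmin_r Q1 Q2).
    pose proof (Mono q Q2 ltac:(lra)) as Hm. assert (Hm2 : eta q <= L) by (apply HL1; exists q; auto).
    split. lra. split. pose proof (proj1 (HQ1 q ltac:(lra) 1 ltac:(lra))). lra.
    intros p Hp.
    pose proof (C1s_plus _ _ _ _ _ _ (C1s_mult _ _ _ _ _ _ (sol_u _ _ Hs) (sol_u _ _ Hs)) (C1s_mult _ _ _ _ _ _ (sol_v _ _ Hs) (sol_v _ _ Hs))) as CC.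
    (* By [sol_E2] the derivative of [G] in [p] is [- 2 * fuq], hence small: [G] is nearly constant
       on the column, and Bernoulli's law gives its value at the top. *)
    set (G := fun p => fu f q p * fu f q p + fv f q p * fv f q p + 2 * Omega om p).
    assert (GB : Rabs (G 1 - G p) <= 2 * e).
    { destruct (Req_dec p 1) as [->|Hne]. rewrite Rminus_diag, Rabs_R0. lra.
      destruct (MVT_closed G (fun p => - 2 * fuq f q p) p 1) as [x [Hx Ex]]. lra.
      - intros x Hx. eapply is_derive_eq. apply (is_derive_plus (V := R_NormedModule) (fun p => fu f q p * fu f q p + fv f q p * fv f q p) (fun p => 2 * Omega om p)).
        apply (D1_dp _ _ _ q x (C1_D _ _ _ CC)). lra. apply is_derive_scal. apply Omega_derive; auto. lra.
        unfold plus; simpl. pose proof (sol_E2 _ _ Hs q x ltac:(lra)). lra.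
      - apply cont_in_plus. lra. apply cont_in_sub with 0 1; try lra. apply (UC_cont_in _ q (proj1 (C1_f _ _ _ CC))).
        apply cont_in_mult. lra. apply cont_in_const. apply cont_in_sub with 0 1; try lra. now apply Omega_cont.
      - rewrite Ex, Rabs_mult, (Rabs_pos_eq (1 - p)) by lra.
        replace (-2 * fuq f q x) with (- (2 * fuq f q x)) by ring. rewrite Rabs_Ropp, Rabs_mult, (Rabs_pos_eq 2) by lra.
        pose proof (proj2 (HQ1 q ltac:(lra) x ltac:(lra))). pose proof (Rabs_pos (fuq f q x)). nra. }
    pose proof (HT q) as BC. fold (eta q) in BC. unfold G in GB.
    pose proof (proj1 (HQ1 q ltac:(lra) p Hp)) as Bu.
    assert (Bu2 : fu f q p ^ 2 <= e). { rewrite <- pow2_abs. pose proof (Rabs_pos (fu f q p)). nra. }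
    pose proof (pow2_ge_0 (fu f q p)). apply Rabs_le_between in GB. apply Rabs_le. unfold t. nra. }
  assert (Hat : adm om t).
  { exists (c ^ 2 / 2). split. nra. intros p Hp. destruct (Hv2 (c ^ 2 / 2) ltac:(nra)) as [Q HQ].
    destruct (HQ Q ltac:(lra)) as [_ [_ B]]. specialize (B p Hp). apply Rabs_le_between in B. specialize (Hc' Q p Hp).
    assert (c ^ 2 <= fv f Q p ^ 2) by (apply pow_incr; lra). lra. }
  destruct (mt_ge om t Hat) as [nu [Hnu Hnu']].
  assert (HdL : dt om t = L).
  { apply NNPP. intros Hne. set (e := Rabs (dt om t - L)). assert (He : 0 < e) by (apply Rabs_pos_lt; lra).
    set (z := Rmin (e / 4) (e / 4 * (nu * c * (nu + c)))).
    assert (0 < nu * c * (nu + c)) by (repeat apply Rmult_lt_0_compat; lra).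
    assert (Hz : 0 < z) by (apply Rmin_pos; nra).
    assert (Hz1 : z <= e / 4) by apply Rmin_l. assert (Hz2 : z <= e / 4 * (nu * c * (nu + c))) by apply Rmin_r.
    destruct (Hv2 z Hz) as [Q HQ]. destruct (HQ Q ltac:(lra)) as [B1 [_ B2]].
    assert (B3 : eta Q <= L) by (apply HL1; exists Q; auto).
    pose proof (C1s_minus _ _ _ _ _ _ (sol_h _ _ Hs) (Ht_C1s om t Ho Hat)) as Cw.
    destruct (C1s_MVTp _ _ _ Q 0 1 Cw ltac:(lra) ltac:(lra)) as [x [Hx Ex]]. cbv beta in Ex.
    rewrite Rmin_left, Rmax_right in Hx by lra.
    pose proof (w_0 om f Hs t Q) as W0. rewrite W0, !Rminus_0_r, Rmult_1_r in Ex. fold (eta Q) (dt om t) in Ex.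
    specialize (B2 x Hx). rewrite <- (mt_sqr om t x Hat Hx) in B2. specialize (Hc' Q x Hx). specialize (Hnu' x Hx).
    set (v := fv f Q x) in *. set (mm := mt om t x) in *.
    assert (Bd : Rabs (/ v - / mm) <= e / 4).
    { replace (/ v - / mm) with (- (v ^ 2 - mm * mm) * / (v * mm * (v + mm))) by (field; lra).
      assert (HH : nu * c * (nu + c) <= v * mm * (v + mm)).
      { apply Rmult_le_compat; try nra. }
      rewrite Rabs_mult, Rabs_Ropp, (Rabs_pos_eq (/ _)) by (left; apply Rinv_0_lt_compat; lra).
      apply Rmult_le_reg_r with (v * mm * (v + mm)). lra. rewrite Rmult_assoc, Rinv_l, Rmult_1_r by lra.
      eapply Rle_trans. exact B2. eapply Rle_trans. exact Hz2. apply Rmult_le_compat_l; lra. }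
    rewrite <- Ex in Bd.
    assert (e <= e / 4 + e / 4); [|lra]. unfold e at 1. replace (dt om t - L) with (- (eta Q - dt om t) + (eta Q - L)) by ring.
    eapply Rle_trans. apply Rabs_triang. rewrite Rabs_Ropp. apply Rplus_le_compat; auto. apply Rabs_le. lra. }
  assert (HLd : d < L) by (apply Rlt_le_trans with (eta 0); [apply Hpos|apply HL1; exists 0; auto]).
  destruct (Hconj t Hat) as [E|E]. lra. lra.
  rewrite HdL in E. destruct (Hcrit L ltac:(lra)) as [del [Hdel HK]].
  destruct (Hv2 (del / 2) ltac:(lra)) as [Q HQ]. destruct (HQ Q ltac:(lra)) as [B1 [B2 _]].
  assert (B3 : eta Q <= L) by (apply HL1; exists Q; auto).
  apply (HK Q). apply Rabs_def1; lra. lra.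
Qed.

(** The infimum of the positions beyond which every plane is favourable is finite by [mono_contra];
    positivity passes to the limit plane by the Lipschitz bound. *)
Lemma critical_plane : exists la0, Vpos la0 /\ forall eps, 0 < eps -> exists la, la0 - eps < la < la0 /\ ~ Vpos la.
Proof.
  destruct neg_point as [N HN].
  assert (HP : forall la, N <= la -> Vpos la).
  { intros la Hla. apply NNPP. intros Hn. destruct (HN la Hn) as [q0 [p0 [Hq _]]]. lra. }
  assert (Hbad : exists lb, ~ Vpos lb).
  { apply NNPP. intros Hn. apply mono_contra. intros la. apply NNPP. intros H. apply Hn. exists la; auto. }
  destruct Hbad as [lb Hlb].
  set (P := fun la => forall mu, la <= mu -> Vpos mu).
  destruct (sup_exists (fun y => exists la, y = - la /\ P la) (- lb) (- N)) as [l [H1 H2]].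
  { exists N. split; auto. }
  { intros y [la [-> HPl]]. apply Rnot_lt_le. intros L. apply Hlb. apply HPl. lra. }
  assert (Hgt : forall la, - l < la -> Vpos la).
  { intros la Hla. destruct (H2 (la + l) ltac:(lra)) as [y [[la' [-> HPl]] Hy]]. apply HPl. lra. }
  exists (- l).
  assert (H0 : Vpos (- l)).
  { intros q p Hq Hp. apply Rnot_lt_le. intros L.
    destruct (C1s_Lip _ _ _ (sol_h _ _ Hs)) as [K [HK HLip]].
    set (e := - V (- l) q p / (4 * K)). assert (He : 0 < e) by (apply Rdiv_lt_0_compat; lra).
    assert (HeK : 4 * K * e = - V (- l) q p) by (unfold e; field; lra).
    specialize (Hgt (- l + e) ltac:(lra) (q + e) p ltac:(lra) Hp). unfold V in *.
    replace (2 * (- l + e) - (q + e)) with (2 * - l - q + e) in Hgt by ring.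
    pose proof (HLip (2 * - l - q) p (2 * - l - q + e) p Hp Hp) as B1. pose proof (HLip q p (q + e) p Hp Hp) as B2.
    rewrite Rminus_diag, Rabs_R0, Rplus_0_r in B1, B2.
    replace (2 * - l - q + e - (2 * - l - q)) with e in B1 by ring. replace (q + e - q) with e in B2 by ring.
    rewrite (Rabs_pos_eq e) in B1, B2 by lra. apply Rabs_le_between in B1. apply Rabs_le_between in B2. nra. }
  split; auto. intros eps Heps. apply NNPP. intros Hn.
  assert (HPl : P (- l - eps / 2)).
  { intros mu Hmu. destruct (Rtotal_order mu (- l)) as [L|[->|L]]; auto.
    apply NNPP. intros Hx. apply Hn. exists mu. split; auto. lra. }
  specialize (H1 (l + eps / 2)). assert (l + eps / 2 <= l); [|lra]. apply H1. exists (- l - eps / 2). split; auto. ring.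
Qed.

(** [V] vanishes for [s = 0] and for [p = 0], so its change under a displacement of the plane is a
    double integral of the change of the mixed derivative of the height, which is uniformly
    continuous. Hence the weight [s * p], matching [V_lower]. *)
Lemma V_perturb la0 eps : 0 < eps -> exists del, 0 < del /\ forall la, Rabs (la - la0) < del ->
  forall s p, 0 <= s -> 0 <= p <= 1 -> Rabs (V la (la + s) p - V la0 (la0 + s) p) <= eps * (s * p).
Proof.
  intros Heps. pose proof (sol_hq _ _ Hs) as Cq.
  destruct (proj1 (C1_p _ _ _ Cq) (eps / 2) ltac:(lra)) as [del [Hdel K]]. exists del. split; auto. intros la Hla.
  set (hq := fun q p => - fu f q p / fv f q p) in *.
  set (hqp := fun q p => - (fup f q p * fv f q p - fu f q p * fvp f q p) / fv f q p ^ 2) in *.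
  assert (Z0 : forall x, hq x 0 = 0) by (intros x; unfold hq; rewrite (sol_u0 _ _ Hs); unfold Rdiv; ring).
  assert (A : forall x x' p, Rabs (x - x') < del -> 0 <= p <= 1 -> Rabs (hq x p - hq x' p) <= eps / 2 * p).
  { intros x x' p Hx Hp. destruct (Req_dec p 0) as [->|Hne]. rewrite !Z0, Rminus_diag, Rabs_R0. lra.
    destruct (MVT_closed (fun p => hq x p - hq x' p) (fun p => hqp x p - hqp x' p) 0 p) as [c [Hc E]]. lra.
    - intros y Hy. apply (is_derive_minus (V := R_NormedModule)); apply (D1_dp _ _ _ _ y (C1_D _ _ _ Cq)); lra.
    - apply cont_in_sub with 0 1; try lra. apply cont_in_minus; try lra; apply (UC_cont_in _ _ (proj1 (C1_f _ _ _ Cq))).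
    - rewrite !Z0, Rminus_diag, !Rminus_0_r in E. rewrite E, Rabs_mult, (Rabs_pos_eq p) by lra.
      apply Rmult_le_compat_r. lra. left. apply K; try lra. rewrite Rminus_diag, Rabs_R0. lra. }
  intros s p Hs0 Hp.
  destruct (MVT_gen (fun s => V la (la + s) p - V la0 (la0 + s) p) 0 s
    (fun s => - (hq (la - s) p - hq (la0 - s) p) - (hq (la + s) p - hq (la0 + s) p))) as [c [Hc E]].
  { intros x _.
    assert (D : forall l0, is_derive (fun s => V l0 (l0 + s) p) x (- hq (l0 - x) p - hq (l0 + x) p)).
    { intros l0. apply (is_derive_ext (fun s => fh f (l0 - s) p - fh f (l0 + s) p)).
      { intros y. unfold V. replace (2 * l0 - (l0 + y)) with (l0 - y) by ring. reflexivity. }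
      pose proof (C1s_dq _ _ _ (l0 - x) p (sol_h _ _ Hs) Hp) as E1'. pose proof (C1s_dq _ _ _ (l0 + x) p (sol_h _ _ Hs) Hp) as E2'.
      eapply is_derive_eq. apply (is_derive_minus (V := R_NormedModule) (fun s => fh f (l0 - s) p) (fun s => fh f (l0 + s) p)).
      apply (is_derive_comp (fun y => fh f y p) (fun s => l0 - s) x _ (-1) E1'). auto_derive; auto; ring.
      apply (is_derive_comp (fun y => fh f y p) (fun s => l0 + s) x _ 1 E2'). auto_derive; auto; ring.
      unfold minus, plus, opp, scal; simpl; unfold mult; simpl. unfold hq. ring. }
    eapply is_derive_eq. apply (is_derive_minus (V := R_NormedModule) _ _ _ _ _ (D la) (D la0)). unfold minus, plus, opp; simpl. ring. }
  { intros x _. apply continuity_pt_filterlim.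
    assert (CV : forall l0, continuous (fun s => V l0 (l0 + s) p) x).
    { intros l0. apply (continuous_comp (fun s => l0 + s) (fun y => V l0 y p)).
      apply (is_derive_cont _ x 1). auto_derive; auto; ring.
      apply (is_derive_cont _ _ _ (C1s_dq _ _ _ (l0 + x) p (VC1 l0) Hp)). }
    apply (continuous_minus (fun s => V la (la + s) p) (fun s => V la0 (la0 + s) p)); auto. }
  cbv beta in E. rewrite !Rplus_0_r, !V_side, !Rminus_0_r in E. rewrite E, Rabs_mult, (Rabs_pos_eq s) by lra.
  pose proof (A (la - c) (la0 - c) p) as B1. replace (la - c - (la0 - c)) with (la - la0) in B1 by ring. specialize (B1 Hla Hp).
  pose proof (A (la + c) (la0 + c) p) as B2. replace (la + c - (la0 + c)) with (la - la0) in B2 by ring. specialize (B2 Hla Hp).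
  replace (eps * (s * p)) with ((eps * p) * s) by ring. apply Rmult_le_compat_r. lra.
  eapply Rle_trans. apply Rabs_triang. rewrite !Rabs_Ropp. lra.
Qed.

(** * Strict positivity at the limiting plane, including the corners *)

Section at_plane.
Variables (la0 : R).
Hypotheses (HV : Vpos la0) (Hns : exists q1, la0 < q1 /\ V la0 q1 1 <> 0).

Let Vell : exists K, ell (V la0) (avgA f (refl f la0)) (avgB f (refl f la0)) K := diff_ell om f (refl f la0) Ho Hs (refl_sol om f la0 Hs).
Let Vcoef : exists c0 A1, coef (avgA f (refl f la0)) (avgB f (refl f la0)) c0 A1 := coef_avg om f (refl f la0) Hs (refl_sol om f la0 Hs).

(** A zero on the surface would be a minimum with equal slopes; Bernoulli's law with [k = 0] then
    says that [Vp] times a positive factor vanishes, while the Hopf lemma gives [Vp < 0]. *)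
Lemma V_top_pos q : la0 < q -> 0 < V la0 q 1.
Proof.
  intros Hq. destruct Vell as [K HE]. destruct Vcoef as [c0 [A1 HC]]. destruct (Vtaylor la0) as [M TT].
  destruct Hns as [q1 [Hq1 Hne]]. pose proof (HV q1 1 ltac:(lra) ltac:(lra)) as H1.
  destruct (UC_pos_nbhd (V la0) q1 1 ltac:(apply HE) ltac:(lra) ltac:(lra)) as [rho [Hr Hr']].
  set (p1 := 1 - Rmin (rho / 2) (/ 2)).
  assert (Hp1 : 0 < Rmin (rho / 2) (/ 2)) by (apply Rmin_pos; lra). pose proof (Rmin_l (rho / 2) (/ 2)). pose proof (Rmin_r (rho / 2) (/ 2)).
  assert (Hpp : 0 < p1 < 1) by (unfold p1; lra).
  assert (H2 : 0 < V la0 q1 p1).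
  { apply Rlt_le_trans with (V la0 q1 1 / 2). lra. apply Hr'. lra. rewrite Rminus_diag, Rabs_R0. lra.
    unfold p1. apply Rabs_def1; lra. }
  pose proof (strong_pos _ _ _ c0 A1 K la0 q q1 p1 HC HE Hq Hq1 Hpp HV H2) as H3.
  apply Rnot_le_lt. intros Hle. pose proof (HV q 1 ltac:(lra) ltac:(lra)). assert (E : V la0 q 1 = 0) by lra.
  pose proof (hopf_top _ _ _ _ _ c0 A1 K M la0 q p1 HC HE TT Hq Hpp HV H3 E) as HH. cbv beta in HH.
  set (g := refl f la0) in *. pose proof (refl_sol om f la0 Hs) as Hg. fold g in Hg.
  assert (E0 : - fu g q 1 / fv g q 1 - - fu f q 1 / fv f q 1 = 0).
  { apply (min_deriv0 (fun q => V la0 q 1) q _ (q - la0)).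
    - exact (C1s_dq _ _ _ q 1 (VC1 la0) ltac:(lra)).
    - lra.
    - intros y Hy. apply Rabs_def2 in Hy. rewrite E. apply HV; lra. }
  pose proof (sol_pos om f q 1 Hs ltac:(lra)) as Pv. pose proof (sol_pos om g q 1 Hg ltac:(lra)) as PW.
  pose proof (touch_top (fu f q 1) (fv f q 1) (fu g q 1) (fv g q 1) _ 0 (fh g q 1) (fh f q 1) Pv PW E0 eq_refl
    (eq_trans (refl_top f la0 r HT q) (eq_sym (HT q)))) as TT'.
  assert (E3 : fh g q 1 - fh f q 1 = - 0) by (change (V la0 q 1 = - 0); lra). specialize (TT' E3).
  (* equal slopes and equal speeds force equal velocities *)
  assert (EU : fu g q 1 = fu f q 1 * fv g q 1 / fv f q 1).
  { replace (fu g q 1) with (- (- fu g q 1 / fv g q 1 - - fu f q 1 / fv f q 1) * fv g q 1 + fu f q 1 * fv g q 1 / fv f q 1) at 1 by (field; lra). rewrite E0. ring. }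
  assert (HX : 0 < fu f q 1 * fv g q 1 * (fu g q 1 + fu f q 1) + fv f q 1 * fv g q 1 * (fv f q 1 + fv g q 1)).
  { rewrite EU. replace (fu f q 1 * fv g q 1 * (fu f q 1 * fv g q 1 / fv f q 1 + fu f q 1)) with (fu f q 1 ^ 2 * (fv g q 1 * (fv g q 1 / fv f q 1 + 1))) by (field; lra).
    assert (0 < fv g q 1 / fv f q 1) by (now apply Rdiv_lt_0_compat).
    assert (0 <= fu f q 1 ^ 2 * (fv g q 1 * (fv g q 1 / fv f q 1 + 1))) by (apply Rmult_le_pos; [apply pow2_ge_0|nra]).
    assert (0 < fv f q 1 * fv g q 1 * (fv f q 1 + fv g q 1)) by (repeat apply Rmult_lt_0_compat; lra). lra. }
  nra.
Qed.

Lemma V_column a b : 0 < a -> a <= b -> exists c, 0 < c /\ forall s, a <= s <= b -> forall p, 0 <= p <= 1 -> c * p <= V la0 (la0 + s) p.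
Proof.
  intros Ha0 Hab. destruct Vell as [K HE]. destruct Vcoef as [c0 [A1 HC]].
  destruct (cont_in_min (a / 2) (b + a / 2) (fun s => V la0 (la0 + s) 1)) as [s0 [Hs0 Hmin]]. lra.
  { apply cont_in_continuous. intros x _. apply (continuous_comp (fun s => la0 + s) (fun y => V la0 y 1)).
    apply (is_derive_cont _ x 1). auto_derive; auto; ring.
    apply (is_derive_cont _ _ _ (C1s_dq _ _ _ (la0 + x) 1 (VC1 la0) ltac:(lra))). }
  set (e := V la0 (la0 + s0) 1) in *. assert (He : 0 < e) by (apply V_top_pos; lra).
  destruct (propagate_down _ _ _ c0 A1 K (a / 2) HC HE ltac:(lra)) as [al [Hal P]].
  pose proof (exp_pos (- al)) as Hexp.
  exists (e * (al * exp (- al))). split. apply Rmult_lt_0_compat; [auto|apply Rmult_lt_0_compat; auto].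
  intros s Hs1 p Hp.
  apply Rle_trans with (e * (exp (- al * (1 - p)) - exp (- al * (1 - 0)))).
  - rewrite Rmult_assoc. apply Rmult_le_compat_l. lra.
    replace (- al * (1 - p)) with (- al + al * p) by ring. replace (- al * (1 - 0)) with (- al) by ring. rewrite exp_plus.
    pose proof (exp_ineq1_le (al * p)). nra.
  - apply P; try lra.
    + intros q x Hq Hx. apply HV; lra.
    + intros q Hq. specialize (Hmin (q - la0) ltac:(lra)). replace (la0 + (q - la0)) with q in Hmin by ring. exact Hmin.
Qed.

Lemma avgB_small : exists C, 0 <= C /\ forall q p, la0 < q -> 0 < p < 1 -> Rabs (avgB f (refl f la0) q p) <= C * (q - la0).
Proof.
  destruct (C1s_Lip _ _ _ (sol_u _ _ Hs)) as [L [HL HLip]]. exists L. split. lra. intros q p Hq Hp. unfold avgB. simpl.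
  pose proof (HLip (2 * la0 - q) p q p ltac:(lra) ltac:(lra)) as B. rewrite Rminus_diag, Rabs_R0, Rplus_0_r in B.
  replace (q - (2 * la0 - q)) with (2 * (q - la0)) in B by ring. rewrite (Rabs_pos_eq (2 * (q - la0))) in B by lra.
  replace ((fu f q p + - fu f (2 * la0 - q) p) / 2) with (/ 2 * (fu f q p - fu f (2 * la0 - q) p)) by field.
  rewrite Rabs_mult, (Rabs_pos_eq (/ 2)) by lra. lra.
Qed.

Lemma Vq_side p : 0 <= p <= 1 -> - fu (refl f la0) la0 p / fv (refl f la0) la0 p - - fu f la0 p / fv f la0 p = 2 * (fu f la0 p / fv f la0 p).
Proof.
  intros Hp. simpl. replace (2 * la0 - la0) with la0 by ring. pose proof (sol_pos om f la0 p Hs Hp). field. lra.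
Qed.

(** The barrier vanishing at both ends gives a bound of order [tau] from below for [V_q = 2 u / v]
    on the axis at depth [tau], so [u >= 0] at the top. If [u] vanished there, the surface slope
    would be zero, Bernoulli's law differentiated along the surface would give [v_q = 0], and
    [sol_E1] then [u_p = 0]; [u] would be o(tau), a contradiction. *)
Lemma crest_slope : 0 < fu f la0 1.
Proof.
  destruct Vell as [K HE]. destruct Vcoef as [c0 [A1 HC]]. destruct (Vtaylor la0) as [M TT]. destruct avgB_small as [C [HC0 HB]].
  assert (HM : 0 < M) by apply TT.
  destruct (corner_barrier_sides _ _ _ c0 A1 K C la0 HC HE HC0 HB) as [al [be [Hal [Hbe Hcb]]]].
  assert (Hib : 0 < / be) by (now apply Rinv_0_lt_compat).
  destruct (V_column (/ be) (/ be) Hib ltac:(lra)) as [c [Hc Hcol]].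
  specialize (Hcb c Hc (fun q p Hq => HV q p (proj1 Hq)) (Hcol (/ be) ltac:(lra))).
  assert (Hlow : forall tau, 0 <= tau <= / 2 -> c / (2 * al) * be * (exp (- al / 4) * (al * tau / 2)) <= 2 * (fu f la0 (1 - tau) / fv f la0 (1 - tau))).
  { intros tau Ht. set (p := 1 - tau). assert (Hp : 0 <= p <= 1) by (unfold p; lra).
    set (G := exp (- al * (p - / 2) ^ 2) - exp (- al / 4)).
    assert (HG : exp (- al / 4) * (al * tau / 2) <= G).
    { unfold G. replace (- al * (p - / 2) ^ 2) with (- al / 4 + al * (tau * (1 - tau))) by (unfold p; field). rewrite exp_plus.
      pose proof (exp_ineq1_le (al * (tau * (1 - tau)))). pose proof (exp_pos (- al / 4)).
      assert (tau / 2 <= tau * (1 - tau)) by nra. assert (al * (tau / 2) <= al * (tau * (1 - tau))) by (apply Rmult_le_compat_l; lra).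
      assert (exp (- al / 4) * (al * tau / 2) <= exp (- al / 4) * (exp (al * (tau * (1 - tau))) - 1)) by (apply Rmult_le_compat_l; lra). lra. }
    assert (Hc2 : 0 < c / (2 * al)) by (apply Rdiv_lt_0_compat; lra).
    assert (HG0 : 0 <= G). { eapply Rle_trans; [|exact HG]. apply Rmult_le_pos. left; apply exp_pos. assert (0 <= al * tau) by (apply Rmult_le_pos; lra). lra. }
    apply Rle_trans with (c / (2 * al) * be * G).
    { apply Rmult_le_compat_l; auto. apply Rmult_le_pos; lra. }
    rewrite <- Vq_side by auto.
    set (X := - fu (refl f la0) la0 p / fv (refl f la0) la0 p - - fu f la0 p / fv f la0 p).
    cut (c / (2 * al) * be * G - X <= 0). lra.
    apply slope_nonpos with M (/ be); auto. intros s Hs1.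
    specialize (Hcb s p ltac:(lra) Hp). fold G in Hcb.
    destruct (exp_m1 be s Hbe ltac:(lra)) as [X1 _].
    pose proof (taylor_q _ _ _ M la0 (la0 + s) p TT Hp) as TQ. cbv beta in TQ. fold X in TQ. rewrite V_side in TQ.
    replace (la0 + s - la0) with s in TQ by ring. apply Rabs_le_between in TQ.
    assert (c / (2 * al) * (be * s) * G <= c / (2 * al) * (exp (be * s) - 1) * G).
    { apply Rmult_le_compat_r; auto. apply Rmult_le_compat_l; lra. }
    nra. }
  pose proof (sol_pos om f la0 1 Hs ltac:(lra)) as Hv.
  assert (H0 : 0 <= fu f la0 1).
  { specialize (Hlow 0 ltac:(lra)). rewrite Rminus_0_r in Hlow. replace (c / (2 * al) * be * (exp (- al / 4) * (al * 0 / 2))) with 0 in Hlow by (field; lra).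
    replace (fu f la0 1) with (fu f la0 1 / fv f la0 1 * fv f la0 1) by (field; lra). apply Rmult_le_pos; lra. }
  destruct H0 as [H0|H0]; auto. exfalso. symmetry in H0.
  assert (Vq0 : fvq f la0 1 = 0).
  { assert (DD : is_derive (fun q => / 2 * (fu f q 1 * fu f q 1 + fv f q 1 * fv f q 1) + fh f q 1) la0 0).
    { apply (is_derive_ext (fun _ => r)). intros t. rewrite <- (HT t). simpl. field. apply (is_derive_const (V := R_NormedModule)). }
    pose proof (C1s_dq _ _ _ la0 1 (C1s_plus _ _ _ _ _ _ (C1s_scal _ _ _ (/ 2) (C1s_plus _ _ _ _ _ _ (C1s_mult _ _ _ _ _ _ (sol_u _ _ Hs) (sol_u _ _ Hs)) (C1s_mult _ _ _ _ _ _ (sol_v _ _ Hs) (sol_v _ _ Hs)))) (sol_h _ _ Hs)) ltac:(lra)) as D2.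
    pose proof (eq_trans (eq_sym (is_derive_unique _ _ _ DD)) (is_derive_unique _ _ _ D2)) as E2. cbv beta in E2. rewrite H0 in E2.
    assert (E : fv f la0 1 * fvq f la0 1 = 0).
    { replace (- 0 / fv f la0 1) with 0 in E2 by (field; lra). lra. }
    apply Rmult_integral in E. destruct E; lra. }
  assert (Up0 : fup f la0 1 = 0).
  { pose proof (sol_E1 _ _ Hs la0 1 ltac:(lra)) as E. rewrite Vq0, H0 in E.
    assert (E' : fv f la0 1 * fup f la0 1 = 0) by lra. apply Rmult_integral in E'. destruct E'; lra. }
  destruct (sol_c _ _ Hs) as [cv [Hcv Hcv']].
  set (ka' := c / (2 * al) * be * (exp (- al / 4) * (al / 2))).
  assert (Hka' : 0 < ka').
  { unfold ka'. assert (0 < c / (2 * al)) by (apply Rdiv_lt_0_compat; lra). pose proof (exp_pos (- al / 4)).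
    apply Rmult_lt_0_compat; [apply Rmult_lt_0_compat; auto|apply Rmult_lt_0_compat; lra]. }
  destruct (proj1 (C1_p _ _ _ (sol_u _ _ Hs)) (cv * ka' / 4)) as [de [Hde KU]]. { assert (0 < cv * ka') by (now apply Rmult_lt_0_compat). lra. }
  set (tau := Rmin (/ 2) (de / 2)). assert (Ht : 0 < tau) by (apply Rmin_pos; lra).
  assert (Ht1 : tau <= / 2) by apply Rmin_l. assert (Ht2 : tau <= de / 2) by apply Rmin_r.
  specialize (Hlow tau ltac:(lra)).
  destruct (C1s_MVTp _ _ _ la0 1 (1 - tau) (sol_u _ _ Hs) ltac:(lra) ltac:(lra)) as [x [Hx Ex]].
  pose proof (between_in 1 (1 - tau) x 0 1 ltac:(lra) ltac:(lra) Hx) as Hx1. apply between_abs in Hx.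
  replace (1 - tau - 1) with (- tau) in * by ring. rewrite Rabs_Ropp, (Rabs_pos_eq tau) in Hx by lra.
  specialize (KU la0 1 la0 x ltac:(lra) Hx1). rewrite Rminus_diag, Rabs_R0, Up0, Rminus_0_r in KU. specialize (KU Hde ltac:(lra)).
  rewrite H0, Rminus_0_r in Ex.
  assert (Hu : fu f la0 (1 - tau) <= cv * ka' / 4 * tau). { rewrite Ex. apply Rabs_def2 in KU. nra. }
  specialize (Hcv' la0 (1 - tau) ltac:(lra)).
  assert (Hdiv : fu f la0 (1 - tau) / fv f la0 (1 - tau) <= ka' / 4 * tau).
  { apply Rmult_le_reg_r with (fv f la0 (1 - tau)). lra. unfold Rdiv at 1. rewrite Rmult_assoc, Rinv_l, Rmult_1_r by lra.
    eapply Rle_trans. exact Hu. replace (cv * ka' / 4 * tau) with (ka' / 4 * tau * cv) by field. apply Rmult_le_compat_l; nra. }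
  replace (c / (2 * al) * be * (exp (- al / 4) * (al * tau / 2))) with (ka' * tau) in Hlow by (unfold ka'; field; lra).
  nra.
Qed.

(** Near the plane [corner_barrier] applies, its surface hypothesis coming from [crest_slope] for
    small [s] and from [V_column] otherwise; at larger [s] the column estimate alone suffices. The
    weight [s * p] covers both corners at once. *)
Lemma V_lower S0 : 0 < S0 -> exists c, 0 < c /\ forall s p, 0 <= s <= S0 -> 0 <= p <= 1 -> c * (s * p) <= V la0 (la0 + s) p.
Proof.
  intros HS0.
  destruct Vell as [K HE]. destruct Vcoef as [c0 [A1 HC]]. destruct (Vtaylor la0) as [M TT]. destruct avgB_small as [C [HC0 HB]].
  assert (HM : 0 < M) by apply TT.
  destruct (corner_barrier _ _ _ c0 A1 K C la0 HC HE HC0 HB) as [al [Hal Hcb]].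
  assert (Hib : 0 < / al) by (now apply Rinv_0_lt_compat).
  destruct (V_column (/ al) (/ al + S0) Hib ltac:(lra)) as [c1 [Hc1 Hcol]].
  pose proof crest_slope as Hu. pose proof (sol_pos om f la0 1 Hs ltac:(lra)) as Hv.
  set (X := 2 * (fu f la0 1 / fv f la0 1)). assert (HX : 0 < X) by (unfold X; assert (0 < fu f la0 1 / fv f la0 1) by (now apply Rdiv_lt_0_compat); lra).
  set (s1 := Rmin (/ al) (X / (2 * M))).
  assert (0 < X / (2 * M)) by (apply Rdiv_lt_0_compat; lra).
  assert (Hs1 : 0 < s1) by (apply Rmin_pos; lra). assert (Hs1a : s1 <= / al) by apply Rmin_l. assert (Hs1b : s1 <= X / (2 * M)) by apply Rmin_r.
  assert (HsM : M * s1 <= X / 2).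
  { apply Rle_trans with (M * (X / (2 * M))). apply Rmult_le_compat_l; lra. right. field. lra. }
  destruct (V_column s1 (/ al) Hs1 Hs1a) as [c2 [Hc2 Hcol2]].
  set (c := Rmin c1 (Rmin (X / 2) (c2 * al))).
  assert (Hc2a : 0 < c2 * al) by (now apply Rmult_lt_0_compat).
  assert (Hc : 0 < c) by (repeat apply Rmin_pos; lra).
  assert (Hcc : c <= c1 /\ c <= X / 2 /\ c <= c2 * al).
  { unfold c. pose proof (Rmin_l c1 (Rmin (X / 2) (c2 * al))). pose proof (Rmin_r c1 (Rmin (X / 2) (c2 * al))).
    pose proof (Rmin_l (X / 2) (c2 * al)). pose proof (Rmin_r (X / 2) (c2 * al)). lra. }
  assert (Htop : forall s, 0 <= s <= / al -> c * s <= V la0 (la0 + s) 1).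
  { intros s Hs0. destruct (Rle_dec s s1) as [L|L].
    - pose proof (taylor_q _ _ _ M la0 (la0 + s) 1 TT ltac:(lra)) as TQ. cbv beta in TQ. rewrite V_side, Vq_side in TQ by lra. fold X in TQ.
      replace (la0 + s - la0) with s in TQ by ring. apply Rabs_le_between in TQ.
      assert (M * s ^ 2 <= X / 2 * s). { replace (M * s ^ 2) with (M * s * s) by ring. apply Rmult_le_compat_r. lra. apply Rle_trans with (M * s1); auto. apply Rmult_le_compat_l; lra. }
      assert (c * s <= X / 2 * s) by (apply Rmult_le_compat_r; lra). lra.
    - specialize (Hcol2 s ltac:(lra) 1 ltac:(lra)).
      assert (c * s <= c2 * al * / al) by (apply Rmult_le_compat; lra).
      replace (c2 * al * / al) with c2 in H0 by (field; lra). lra. }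
  destruct (Hcb c Hc (fun q p Hq => HV q p (proj1 Hq))) as [c' [Hc' Hlow]]; auto.
  { intros p Hp. eapply Rle_trans; [|apply (Hcol (/ al)); [lra|auto]]. apply Rmult_le_compat_r; lra. }
  exists (Rmin c' (c1 / (/ al + S0))).
  assert (0 < c1 / (/ al + S0)) by (apply Rdiv_lt_0_compat; lra).
  split. now apply Rmin_pos. intros s p Hs0 Hp.
  pose proof (Rmin_l c' (c1 / (/ al + S0))). pose proof (Rmin_r c' (c1 / (/ al + S0))).
  assert (0 <= s * p) by (apply Rmult_le_pos; lra).
  destruct (Rle_dec s (/ al)) as [L|L].
  - eapply Rle_trans; [|apply Hlow; lra]. apply Rmult_le_compat_r; lra.
  - eapply Rle_trans; [|apply Hcol; lra]. apply Rle_trans with (c1 / (/ al + S0) * (s * p)). apply Rmult_le_compat_r; lra.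
    replace (c1 / (/ al + S0) * (s * p)) with (c1 / (/ al + S0) * s * p) by ring. apply Rmult_le_compat_r. lra.
    apply Rle_trans with (c1 / (/ al + S0) * (/ al + S0)). apply Rmult_le_compat_l; lra. right. unfold Rdiv. rewrite Rmult_assoc, Rinv_l, Rmult_1_r; lra.
Qed.

End at_plane.

(** Were the reflected surface different at the limiting plane, [V_lower] would beat [V_perturb] for
    planes slightly to the left, on the whole bounded region to which [neg_point] confines a
    negative value; but arbitrarily close planes fail. *)
Lemma symmetric : exists x0, forall x, eta (x0 + x) = eta (x0 - x).
Proof.
  destruct critical_plane as [la0 [HV Hbad]]. exists la0.
  assert (Hz : forall q, la0 < q -> V la0 q 1 = 0).
  { apply NNPP. intros Hn.
    assert (Hns : exists q1, la0 < q1 /\ V la0 q1 1 <> 0).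
    { apply NNPP. intros Hx. apply Hn. intros q Hq. apply NNPP. intros Hy. apply Hx. exists q; auto. }
    destruct neg_point as [N HN].
    destruct (V_lower la0 HV Hns (Rmax 1 (N - la0 + 1))) as [c [Hc Hlow]]. pose proof (Rmax_l 1 (N - la0 + 1)); lra.
    destruct (V_perturb la0 (c / 2) ltac:(lra)) as [de [Hde Hpert]].
    destruct (Hbad (Rmin 1 de)) as [la [Hla Hnv]]. apply Rmin_pos; lra.
    pose proof (Rmin_l 1 de). pose proof (Rmin_r 1 de). pose proof (Rmax_r 1 (N - la0 + 1)).
    destruct (HN la Hnv) as [q0 [p0 [Hq0 [Hp0 Hneg]]]].
    specialize (Hpert la ltac:(apply Rabs_def1; lra) (q0 - la) p0 ltac:(lra) ltac:(lra)).
    specialize (Hlow (q0 - la) p0 ltac:(lra) ltac:(lra)). replace (la + (q0 - la)) with q0 in Hpert by ring.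
    assert (0 < (q0 - la) * p0) by (apply Rmult_lt_0_compat; lra).
    apply Rabs_le_between in Hpert. nra. }
  assert (Hp' : forall x, 0 < x -> eta (la0 + x) = eta (la0 - x)).
  { intros x Hx. specialize (Hz (la0 + x) ltac:(lra)). unfold V in Hz. replace (2 * la0 - (la0 + x)) with (la0 - x) in Hz by ring. unfold eta. lra. }
  intros x. destruct (Rtotal_order x 0) as [L|[->|L]].
  - specialize (Hp' (- x) ltac:(lra)). replace (la0 + - x) with (la0 - x) in Hp' by ring. replace (la0 - - x) with (la0 + x) in Hp' by ring. auto.
  - f_equal; ring.
  - auto.
Qed.

Lemma tail_limit eps : 0 < eps -> exists N, forall q, N <= q -> eta q < d + eps.
Proof. intros H. destruct eta_decr as [_ [_ Hl]]. auto. Qed.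
End planes.

(** * The partial hodograph transform *)

Lemma dist2_le x y x' y' : dist2 x y x' y' <= Rabs (x - x') + Rabs (y - y').
Proof.
  unfold dist2. pose proof (Rabs_pos (x - x')). pose proof (Rabs_pos (y - y')).
  rewrite <- (sqrt_Rsqr (Rabs (x - x') + Rabs (y - y'))) by lra. apply sqrt_le_1_alt. unfold Rsqr.
  rewrite <- (pow2_abs (x - x')), <- (pow2_abs (y - y')). nra.
Qed.

Lemma dist2_pos x y x' y' : (x, y) <> (x', y') -> 0 < dist2 x y x' y'.
Proof.
  intros H. unfold dist2. apply sqrt_lt_R0.
  pose proof (pow2_ge_0 (x - x')). pose proof (pow2_ge_0 (y - y')).
  destruct (Req_dec x x') as [->|Hx].
  - destruct (Req_dec y y') as [->|Hy]. congruence.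
    assert (0 < (y - y') ^ 2) by (apply pow2_gt_0; lra). lra.
  - assert (0 < (x - x') ^ 2) by (apply pow2_gt_0; lra). lra.
Qed.

Lemma cont_in_comp_in a b c d f g : cont_in a b f -> (forall x, a <= x <= b -> c <= f x <= d) ->
  cont_in c d g -> cont_in a b (fun x => g (f x)).
Proof.
  intros Hf Hr Hg p Hp eps Heps. destruct (Hg (f p) (Hr p Hp) eps Heps) as [d1 [Hd1 K1]].
  destruct (Hf p Hp d1 Hd1) as [d2 [Hd2 K2]]. exists d2. split; [auto|intros q Hq L; apply K1; auto].
Qed.

Section hodograph.
Variables (gamma : R) (om : R -> R) (r : R) (eta : R -> R) (psi psix psiy psixx psixy psiyy : fun2) (c : R).
Hypotheses (Hgam : 0 < gamma < 1) (Ho : cont_in 0 1 om) (Heta0 : forall x, 0 < eta x) (Heta : C2g_R gamma eta)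
  (Hpsi : C2g_Dbar gamma eta psi psix psiy psixx psixy psiyy)
  (Hpde : forall x y, Dom eta x y -> psixx x y + psiyy x y + om (psi x y) = 0)
  (Hber : forall x, / 2 * (psix x (eta x) ^ 2 + psiy x (eta x) ^ 2) + eta x = r)
  (Htop : forall x, psi x (eta x) = 1) (Hbot : forall x, psi x 0 = 0)
  (Hc : 0 < c) (Hc' : forall x y, Dom eta x y -> c <= psiy x y).

Let L6 := psi :: psix :: psiy :: psixx :: psixy :: psiyy :: nil.

Lemma vert_cont F x : In F L6 -> cont_in 0 (eta x) (F x).
Proof.
  intros HF y Hy eps Heps. destruct Hpsi as [_ [HC _]]. destruct (HC F HF) as [H1 _].
  destruct (H1 x y Hy eps Heps) as [de [Hde K]]. exists de. split; auto. intros z Hz L. apply K. exact Hz.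
  eapply Rle_lt_trans. apply dist2_le. rewrite Rminus_diag, Rabs_R0. lra.
Qed.

Lemma psiy_ge x y : Dbar eta x y -> c <= psiy x y.
Proof.
  intros Hy. cut (- psiy x y <= - c). lra.
  apply (le_closure_ab 0 (eta x) (fun y => - psiy x y)); auto.
  apply cont_in_opp. specialize (Heta0 x); lra. apply vert_cont. simpl; tauto.
  intros z Hz. specialize (Hc' x z Hz). lra.
Qed.

Lemma psi_incr x y1 y2 : 0 <= y1 -> y1 <= y2 -> y2 <= eta x -> c * (y2 - y1) <= psi x y2 - psi x y1.
Proof.
  intros H1 H2 H3. destruct H2 as [H2| ->]; [|lra].
  destruct (MVT_closed (psi x) (psiy x) y1 y2 H2) as [z [Hz E]].
  - intros z Hz. apply Hpsi. unfold Dom. lra.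
  - apply cont_in_sub with 0 (eta x); auto. apply vert_cont. simpl; tauto.
  - rewrite E. apply Rmult_le_compat_r. lra. apply Hc'. unfold Dom. lra.
Qed.

Lemma height_ex : exists h : fun2, forall q p, 0 <= p <= 1 -> 0 <= h q p <= eta q /\ psi q (h q p) = p.
Proof.
  apply (choice2 R (fun q p y => 0 <= p <= 1 -> 0 <= y <= eta q /\ psi q y = p)).
  intros q p. destruct (classic (0 <= p <= 1)) as [Hp|Hp]; [|exists 0; tauto].
  specialize (Heta0 q) as He.
  destruct (IVT_gen (fun y => psi q (clamp 0 (eta q) y)) 0 (eta q) p) as [y [Hy E]].
  - intros y. apply continuity_pt_clamp. lra. apply vert_cont. simpl; tauto.
  - rewrite !clamp_id by lra. rewrite Hbot, Htop, Rmin_left, Rmax_right by lra. exact Hp.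
  - rewrite Rmin_left, Rmax_right in Hy by lra. exists y. intros _. rewrite clamp_id in E; auto.
Qed.

Section with_height.
Variable h : fun2.
Hypothesis Hh : forall q p, 0 <= p <= 1 -> 0 <= h q p <= eta q /\ psi q (h q p) = p.

Lemma h_unique q y : 0 <= y <= eta q -> 0 <= psi q y <= 1 /\ h q (psi q y) = y.
Proof.
  intros Hy.
  assert (Hr : 0 <= psi q y <= 1).
  { pose proof (psi_incr q 0 y ltac:(lra) ltac:(lra) ltac:(lra)). pose proof (psi_incr q y (eta q) ltac:(lra) ltac:(lra) ltac:(lra)).
    rewrite Hbot in *. rewrite Htop in *. nra. }
  split; auto. destruct (Hh q (psi q y) Hr) as [H1 H2].
  destruct (Rtotal_order (h q (psi q y)) y) as [L|[E|L]]; auto; exfalso.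
  - pose proof (psi_incr q (h q (psi q y)) y (proj1 H1) ltac:(lra) (proj2 Hy)). nra.
  - pose proof (psi_incr q y (h q (psi q y)) (proj1 Hy) ltac:(lra) (proj2 H1)). nra.
Qed.

Lemma h_0 q : h q 0 = 0.
Proof. pose proof (proj2 (h_unique q 0 ltac:(specialize (Heta0 q); lra))) as E. now rewrite Hbot in E. Qed.

Lemma h_1 q : h q 1 = eta q.
Proof. pose proof (proj2 (h_unique q (eta q) ltac:(specialize (Heta0 q); lra))) as E. now rewrite Htop in E. Qed.

Lemma h_mono q p p' : 0 <= p -> p <= p' -> p' <= 1 -> 0 <= h q p' - h q p <= (p' - p) / c.
Proof.
  intros H1 H2 H3. destruct (Hh q p ltac:(lra)) as [A1 A2]. destruct (Hh q p' ltac:(lra)) as [B1 B2].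
  destruct (Rle_dec (h q p) (h q p')) as [L|L].
  - pose proof (psi_incr q _ _ (proj1 A1) L (proj2 B1)). split. lra.
    apply Rmult_le_reg_l with c; auto. replace (c * ((p' - p) / c)) with (p' - p) by (field; lra). lra.
  - pose proof (psi_incr q (h q p') (h q p) (proj1 B1) ltac:(lra) (proj2 A1)). nra.
Qed.

Lemma h_dom q p : 0 < p < 1 -> Dom eta q (h q p).
Proof.
  intros Hp. destruct (Hh q p ltac:(lra)) as [A1 A2]. unfold Dom.
  split; apply Rnot_le_lt; intros L.
  - replace (h q p) with 0 in A2 by lra. rewrite Hbot in A2. lra.
  - replace (h q p) with (eta q) in A2 by lra. rewrite Htop in A2. lra.
Qed.

Lemma h_cont_p q : cont_in 0 1 (h q).
Proof.
  intros p Hp eps Heps. exists (eps * c). split. nra. intros p' Hp' L.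
  assert (Rabs (h q p' - h q p) <= Rabs (p' - p) / c).
  { destruct (Rle_dec p p').
    - pose proof (h_mono q p p' ltac:(lra) ltac:(lra) ltac:(lra)). rewrite !Rabs_pos_eq by lra. lra.
    - pose proof (h_mono q p' p ltac:(lra) ltac:(lra) ltac:(lra)).
      rewrite (Rabs_minus_sym (h q p')), (Rabs_minus_sym p'), !Rabs_pos_eq by lra. lra. }
  eapply Rle_lt_trans. apply H. apply Rmult_lt_reg_r with c; auto. unfold Rdiv. rewrite Rmult_assoc, Rinv_l by lra. lra.
Qed.

Lemma eta_cont x : continuous eta x.
Proof. destruct Heta as [H _]. apply (ex_derive_continuous (V := R_NormedModule)). apply H. Qed.

Lemma dom_box x y : Dom eta x y -> exists d, 0 < d /\ forall x' y', Rabs (x' - x) < d -> Rabs (y' - y) < d -> Dom eta x' y'.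
Proof.
  intros [H1 H2]. destruct (epsd_continuous eta x (eta_cont x) ((eta x - y) / 2) ltac:(lra)) as [d [Hd K]].
  exists (Rmin d (Rmin y ((eta x - y) / 2))). split. repeat apply Rmin_pos; lra.
  intros x' y' Lx Ly. pose proof (Rmin_l d (Rmin y ((eta x - y) / 2))). pose proof (Rmin_r d (Rmin y ((eta x - y) / 2))).
  pose proof (Rmin_l y ((eta x - y) / 2)). pose proof (Rmin_r y ((eta x - y) / 2)).
  specialize (K x' ltac:(lra)). apply Rabs_def2 in K. apply Rabs_def2 in Ly. unfold Dom. lra.
Qed.

Lemma dom_cont F x y eps : In F L6 -> Dom eta x y -> 0 < eps -> exists d, 0 < d /\
  forall x' y', Rabs (x' - x) < d -> Rabs (y' - y) < d -> Rabs (F x' y' - F x y) < eps.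
Proof.
  intros HF HD Heps. destruct (dom_box x y HD) as [d1 [Hd1 K1]].
  destruct Hpsi as [_ [HC _]]. destruct (HC F HF) as [H1 _].
  destruct (H1 x y ltac:(destruct HD; unfold Dbar; lra) eps Heps) as [d2 [Hd2 K2]].
  exists (Rmin d1 (d2 / 2)). split. apply Rmin_pos; lra. intros x' y' Lx Ly.
  pose proof (Rmin_l d1 (d2 / 2)). pose proof (Rmin_r d1 (d2 / 2)).
  apply K2. destruct (K1 x' y' ltac:(lra) ltac:(lra)); unfold Dbar; lra.
  eapply Rle_lt_trans. apply dist2_le. lra.
Qed.

Lemma dom_diff F Fx Fy x y : In Fx L6 -> Dom eta x y ->
  (forall x y, Dom eta x y -> is_derive (fun t => F t y) x (Fx x y) /\ is_derive (fun t => F x t) y (Fy x y)) ->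
  differentiable_pt_lim F x y (Fx x y) (Fy x y).
Proof.
  intros HF HD H. destruct (dom_box x y HD) as [d1 [Hd1 K1]].
  apply differentiable_of_partials with d1; auto.
  - intros x' y' Lx Ly. apply H. now apply K1.
  - apply H; auto.
  - intros eps Heps. now apply dom_cont.
Qed.

Lemma psi_diff x y : Dom eta x y -> differentiable_pt_lim psi x y (psix x y) (psiy x y).
Proof.
  intros HD. apply (dom_diff psi psix psiy); auto. simpl; tauto.
  intros x' y' H. destruct Hpsi as [HP _]. destruct (HP x' y' H) as [A1 [A2 _]]. split; auto.
Qed.

Lemma psix_diff x y : Dom eta x y -> differentiable_pt_lim psix x y (psixx x y) (psixy x y).
Proof.
  intros HD. apply (dom_diff psix psixx psixy); auto. simpl; tauto.
  intros x' y' H. destruct Hpsi as [HP _]. destruct (HP x' y' H) as [A1 [A2 [A3 [A4 _]]]]. split; auto.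
Qed.

Lemma psiy_diff x y : Dom eta x y -> differentiable_pt_lim psiy x y (psixy x y) (psiyy x y).
Proof.
  intros HD. apply (dom_diff psiy psixy psiyy); auto. simpl; tauto.
  intros x' y' H. destruct Hpsi as [HP _]. destruct (HP x' y' H) as [A1 [A2 [A3 [A4 [A5 A6]]]]]. split; auto.
Qed.

(** The height is trapped: the strict inequalities between [p0] and psi at [y0 - e] and [y0 + e]
    persist nearby, and psi increases in [y]. *)
Lemma h_cont q0 p0 eps : 0 < p0 < 1 -> 0 < eps -> exists d, 0 < d /\
  forall q p, Rabs (q - q0) < d -> Rabs (p - p0) < d -> 0 < p < 1 /\ Rabs (h q p - h q0 p0) < eps.
Proof.
  intros Hp0 Heps. pose proof (h_dom q0 p0 Hp0) as HD. set (y0 := h q0 p0) in *.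
  destruct (dom_box q0 y0 HD) as [d1 [Hd1 K1]].
  set (e := Rmin (eps / 2) (d1 / 2)). assert (He : 0 < e) by (apply Rmin_pos; lra).
  assert (He1 : e <= eps / 2) by apply Rmin_l. assert (He2 : e <= d1 / 2) by apply Rmin_r.
  assert (Hup : Dom eta q0 (y0 + e)). { apply K1. rewrite Rminus_diag, Rabs_R0; auto. replace (y0 + e - y0) with e by ring. rewrite Rabs_pos_eq; lra. }
  assert (Hdn : Dom eta q0 (y0 - e)). { apply K1. rewrite Rminus_diag, Rabs_R0; auto. replace (y0 - e - y0) with (- e) by ring. rewrite Rabs_Ropp, Rabs_pos_eq; lra. }
  assert (Hce : 0 < c * e / 2) by (assert (0 < c * e) by (now apply Rmult_lt_0_compat); lra).
  destruct (dom_cont psi q0 (y0 + e) (c * e / 2) ltac:(simpl; tauto) Hup Hce) as [d2 [Hd2 K2]].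
  destruct (dom_cont psi q0 (y0 - e) (c * e / 2) ltac:(simpl; tauto) Hdn Hce) as [d3 [Hd3 K3]].
  set (d := Rmin (Rmin d1 (Rmin d2 d3)) (Rmin (c * e / 2) (Rmin p0 (1 - p0)))).
  assert (Hd : 0 < d) by (repeat apply Rmin_pos; lra).
  assert (Hdd : d <= d1 /\ d <= d2 /\ d <= d3 /\ d <= c * e / 2 /\ d <= p0 /\ d <= 1 - p0).
  { unfold d. set (X := Rmin d1 (Rmin d2 d3)). set (Y := Rmin (c * e / 2) (Rmin p0 (1 - p0))).
    pose proof (Rmin_l X Y). pose proof (Rmin_r X Y).
    pose proof (Rmin_l d1 (Rmin d2 d3)). pose proof (Rmin_r d1 (Rmin d2 d3)). pose proof (Rmin_l d2 d3). pose proof (Rmin_r d2 d3).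
    pose proof (Rmin_l (c * e / 2) (Rmin p0 (1 - p0))). pose proof (Rmin_r (c * e / 2) (Rmin p0 (1 - p0))).
    pose proof (Rmin_l p0 (1 - p0)). pose proof (Rmin_r p0 (1 - p0)). unfold X, Y in *. lra. }
  clearbody d. exists d. split; auto. intros q p Lq Lp.
  assert (Hp : 0 < p < 1) by (apply Rabs_def2 in Lp; lra). split; auto.
  destruct (Hh q p ltac:(lra)) as [B1 B2]. destruct (Hh q0 p0 ltac:(lra)) as [C1 C2]. fold y0 in C1, C2.
  pose proof (psi_incr q0 y0 (y0 + e) ltac:(destruct HD; lra) ltac:(lra) ltac:(destruct Hup; lra)) as I1.
  pose proof (psi_incr q0 (y0 - e) y0 ltac:(destruct Hdn; lra) ltac:(lra) ltac:(destruct HD; lra)) as I2.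
  specialize (K2 q (y0 + e) ltac:(lra)). rewrite Rminus_diag, Rabs_R0 in K2. specialize (K2 Hd2).
  specialize (K3 q (y0 - e) ltac:(lra)). rewrite Rminus_diag, Rabs_R0 in K3. specialize (K3 Hd3).
  apply Rabs_def2 in K2. apply Rabs_def2 in K3. apply Rabs_def2 in Lp.
  assert (DU : Dom eta q (y0 + e)). { apply K1. lra. replace (y0 + e - y0) with e by ring. rewrite Rabs_pos_eq; lra. }
  assert (DD : Dom eta q (y0 - e)). { apply K1. lra. replace (y0 - e - y0) with (- e) by ring. rewrite Rabs_Ropp, Rabs_pos_eq; lra. }
  destruct DU as [DU1 DU2]. destruct DD as [DD1 DD2].
  assert (h q p < y0 + e).
  { apply Rnot_le_lt. intros L. pose proof (psi_incr q (y0 + e) (h q p) ltac:(lra) L ltac:(lra)). nra. }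
  assert (y0 - e < h q p).
  { apply Rnot_le_lt. intros L. pose proof (psi_incr q (h q p) (y0 - e) ltac:(lra) L ltac:(lra)). nra. }
  apply Rabs_def1; lra.
Qed.

(** Implicit differentiation of psi(q, h) = p. Differentiability of psi bounds the error by a small
    multiple of [|t * a| + |De|], with [De] the height increment; as [e1 <= py / 2], the part
    containing the error itself is absorbed on the left. *)
Lemma h_grad q p : 0 < p < 1 -> grad_at h q p (- psix q (h q p) / psiy q (h q p)) (/ psiy q (h q p)).
Proof.
  intros Hp a b. apply is_derive_Reals. pose proof (h_dom q p Hp) as HD. set (y0 := h q p) in *.
  pose proof (psi_diff q y0 HD) as Df. set (px := psix q y0) in *. set (py := psiy q y0) in *.
  assert (Hpy : 0 < py) by (specialize (Hc' q y0 HD); unfold py; lra).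
  set (S := Rabs a + Rabs ((b - px * a) / py) + 1).
  assert (HS : 0 < S) by (unfold S; pose proof (Rabs_pos a); pose proof (Rabs_pos ((b - px * a) / py)); lra).
  intros eps Heps.
  set (e1 := Rmin (py / 2) (eps * py / (4 * S))).
  assert (He1 : 0 < e1). { apply Rmin_pos; [lra|]. apply Rdiv_lt_0_compat; nra. }
  destruct (Df (mkposreal e1 He1)) as [d1 Hd1]. simpl in Hd1.
  destruct (h_cont q p d1 Hp (cond_pos d1)) as [d2 [Hd2 Kh]]. fold y0 in Kh.
  set (d := Rmin d1 d2 / (1 + Rabs a + Rabs b)).
  pose proof (Rabs_pos a) as Pa. pose proof (Rabs_pos b) as Pb.
  assert (Hd0 : 0 < Rmin d1 d2) by (apply Rmin_pos; [apply cond_pos|auto]).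
  assert (Hd : 0 < d) by (apply Rdiv_lt_0_compat; lra).
  exists (mkposreal d Hd). simpl. intros t Ht0 Ht.
  assert (Hsm : Rabs t * (1 + Rabs a + Rabs b) < Rmin d1 d2).
  { apply Rlt_le_trans with (d * (1 + Rabs a + Rabs b)). apply Rmult_lt_compat_r; lra. unfold d. right. field. lra. }
  assert (Pt : 0 < Rabs t) by (now apply Rabs_pos_lt).
  pose proof (Rmin_l d1 d2). pose proof (Rmin_r d1 d2).
  assert (La : Rabs (q + (0 + t) * a - q) < Rmin d1 d2) by (replace (q + (0 + t) * a - q) with (t * a) by ring; rewrite Rabs_mult; nra).
  assert (Lb : Rabs (p + (0 + t) * b - p) < Rmin d1 d2) by (replace (p + (0 + t) * b - p) with (t * b) by ring; rewrite Rabs_mult; nra).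
  destruct (Kh (q + (0 + t) * a) (p + (0 + t) * b) ltac:(lra) ltac:(lra)) as [Hp1 Hy1].
  rewrite Rplus_0_l in *. rewrite !Rmult_0_l, !Rplus_0_r. fold y0.
  set (y1 := h (q + t * a) (p + t * b)) in *.
  specialize (Hd1 (q + t * a) y1 ltac:(lra) Hy1).
  destruct (Hh (q + t * a) (p + t * b) ltac:(lra)) as [_ E1']. fold y1 in E1'. destruct (Hh q p ltac:(lra)) as [_ E2']. fold y0 in E2'.
  rewrite E1', E2' in Hd1. replace (q + t * a - q) with (t * a) in Hd1 by ring.
  set (De := y1 - y0) in *. set (De0 := t * ((b - px * a) / py)).
  assert (HX : py * Rabs (De - De0) <= e1 * (Rabs (t * a) + Rabs De)).
  { replace (py * Rabs (De - De0)) with (Rabs (p + t * b - p - (px * (t * a) + py * De))).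
    eapply Rle_trans. exact Hd1. apply Rmult_le_compat_l. lra. apply Rmax_lub; pose proof (Rabs_pos (t * a)); pose proof (Rabs_pos De); lra.
    rewrite <- (Rabs_pos_eq py) at 2 by lra. rewrite <- Rabs_mult, <- Rabs_Ropp. f_equal. unfold De0. field. lra. }
  assert (HD2 : Rabs De <= Rabs (De - De0) + Rabs De0). { replace De with ((De - De0) + De0) at 1 by ring. apply Rabs_triang. }
  assert (HD3 : Rabs De0 = Rabs t * Rabs ((b - px * a) / py)) by (unfold De0; apply Rabs_mult).
  assert (He2 : e1 <= py / 2) by apply Rmin_l. assert (He3 : e1 <= eps * py / (4 * S)) by apply Rmin_r.
  pose proof (Rabs_pos (De - De0)) as PD.
  assert (HY : Rabs (De - De0) <= eps / 2 * Rabs t).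
  { rewrite Rabs_mult in HX.
    assert (A1 : e1 * (Rabs t * Rabs a + Rabs De) <= e1 * (Rabs t * S) + e1 * Rabs (De - De0)).
    { rewrite <- Rmult_plus_distr_l. apply Rmult_le_compat_l. lra. unfold S. rewrite HD3 in HD2. nra. }
    assert (A2 : e1 * Rabs (De - De0) <= py / 2 * Rabs (De - De0)) by (apply Rmult_le_compat_r; lra).
    assert (A3 : e1 * (Rabs t * S) <= eps * py / (4 * S) * (Rabs t * S)) by (apply Rmult_le_compat_r; nra).
    replace (eps * py / (4 * S) * (Rabs t * S)) with (py / 2 * (eps / 2 * Rabs t)) in A3 by (field; lra).
    apply Rmult_le_reg_l with (py / 2). lra. lra. }
  replace (De / t - (a * (- px / py) + b * / py)) with ((De - De0) / t) by (unfold De0; field; split; lra).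
  unfold Rdiv. rewrite Rabs_mult, Rabs_inv. apply Rmult_lt_reg_r with (Rabs t); auto.
  rewrite Rmult_assoc, Rinv_l, Rmult_1_r by lra. nra.
Qed.

Lemma comp_grad F Fx Fy q p : 0 < p < 1 -> (forall x y, Dom eta x y -> differentiable_pt_lim F x y (Fx x y) (Fy x y)) ->
  let y := h q p in
  grad_at (fun q p => F q (h q p)) q p (Fx q y + Fy q y * (- psix q y / psiy q y)) (Fy q y * / psiy q y).
Proof.
  intros Hp HF y a b. apply is_derive_Reals.
  replace (a * (Fx q y + Fy q y * (- psix q y / psiy q y)) + b * (Fy q y * / psiy q y))
    with (Fx q y * a + Fy q y * (a * (- psix q y / psiy q y) + b * / psiy q y)) by ring.
  apply (derivable_pt_lim_comp_2d F (fun t => q + t * a) (fun t => h (q + t * a) (p + t * b))).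
  - rewrite !Rmult_0_l, !Rplus_0_r. apply HF. now apply h_dom.
  - apply is_derive_Reals. auto_derive; auto; ring.
  - apply is_derive_Reals. exact (h_grad q p Hp a b).
Qed.

Lemma comp_BD F : In F L6 -> BD (fun q p => F q (h q p)).
Proof.
  intros HF. destruct Hpsi as [_ [HC _]]. destruct (HC F HF) as [_ [M HM]]. exists M. intros q p Hp. apply HM.
  unfold Dbar. now apply Hh.
Qed.

Lemma comp_cont_p F q : In F L6 -> cont_in 0 1 (fun p => F q (h q p)).
Proof.
  intros HF. apply (cont_in_comp_in 0 1 0 (eta q)). apply h_cont_p. intros p Hp. now apply Hh. now apply vert_cont.
Qed.

Lemma h_BD : BD h.
Proof.
  destruct Heta as [_ [[M HM] _]]. exists M. intros q p Hp. destruct (Hh q p Hp) as [A1 _]. specialize (HM q).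
  rewrite Rabs_pos_eq in * by (specialize (Heta0 q); lra). lra.
Qed.

Lemma speed_ge q p : 0 <= p <= 1 -> c <= psiy q (h q p).
Proof. intros Hp. apply psiy_ge. unfold Dbar. now apply Hh. Qed.

Lemma BD_mult f g : BD f -> BD g -> BD (fun q p => f q p * g q p).
Proof.
  intros [M1 B1] [M2 B2]. exists (M1 * M2). intros q p Hp. rewrite Rabs_mult. apply Rmult_le_compat; auto; apply Rabs_pos.
Qed.

Lemma BD_plus f g : BD f -> BD g -> BD (fun q p => f q p + g q p).
Proof.
  intros [M1 B1] [M2 B2]. exists (M1 + M2). intros q p Hp. eapply Rle_trans. apply Rabs_triang. specialize (B1 q p Hp). specialize (B2 q p Hp). lra.
Qed.

Lemma BD_opp f : BD f -> BD (fun q p => - f q p).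
Proof. intros [M B]. exists M. intros. rewrite Rabs_Ropp. auto. Qed.

Lemma inv_BD : BD (fun q p => / psiy q (h q p)).
Proof.
  exists (/ c). intros q p Hp. pose proof (speed_ge q p Hp). rewrite Rabs_pos_eq. apply Rinv_le_contravar; lra.
  left. apply Rinv_0_lt_compat. lra.
Qed.

Lemma Lip_of_BD f fq fp : D1 f fq fp -> BD fq -> BD fp -> (forall q, cont_in 0 1 (f q)) -> Lip f.
Proof.
  intros D B1 B2 HC. destruct (BD_pos fq B1) as [M1 [P1 B1']]. destruct (BD_pos fp B2) as [M2 [P2 B2']].
  apply Lip_of_D1 with fq fp (M1 + M2); auto. lra. intros q p Hp. specialize (B1' q p ltac:(lra)). specialize (B2' q p ltac:(lra)). lra.
Qed.

Lemma h_Lip : Lip h.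
Proof.
  apply Lip_of_BD with (fun q p => - psix q (h q p) * / psiy q (h q p)) (fun q p => / psiy q (h q p)).
  - intros q p Hp. exact (h_grad q p Hp).
  - apply BD_mult. apply BD_opp. apply comp_BD. simpl; tauto. apply inv_BD.
  - apply inv_BD.
  - apply h_cont_p.
Qed.

(** Continuity on the unbounded closure would not be uniform; the Hoelder bound makes it so, and the
    Lipschitz height carries it to the strip. [de] is the inverse of the Hoelder modulus at
    [eps / C']. *)
Lemma comp_UCB_holder F : In F L6 -> holder2 (Dbar eta) gamma F -> UCB (fun q p => F q (h q p)).
Proof.
  intros HF [C HC]. split; [|now apply comp_BD]. destruct h_Lip as [L [HL HLip]].
  intros eps Heps. set (C' := Rabs C + 1). assert (HC' : 0 < C') by (unfold C'; pose proof (Rabs_pos C); lra).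
  assert (He : 0 < eps / C') by (now apply Rdiv_lt_0_compat).
  set (de := Rpower (eps / C') (/ gamma)). assert (Hde : 0 < de) by (unfold de, Rpower; apply exp_pos).
  exists (de / (2 * (1 + 2 * L))). assert (H2L : 0 < 2 * (1 + 2 * L)) by lra. split. now apply Rdiv_lt_0_compat.
  intros q p q' p' Hp Hp' L1 L2.
  destruct (classic ((q', h q' p') = (q, h q p))) as [E|Hne].
  - inversion E. rewrite Rminus_diag, Rabs_R0. auto.
  - specialize (HC q' (h q' p') q (h q p) (proj1 (Hh q' p' Hp')) (proj1 (Hh q p Hp)) Hne).
    pose proof (dist2_pos _ _ _ _ Hne) as Dp. pose proof (dist2_le q' (h q' p') q (h q p)) as Dl.
    specialize (HLip q p q' p' Hp Hp').
    set (z := de / (2 * (1 + 2 * L))) in *.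
    assert (Hz : z * (1 + 2 * L) = de / 2) by (unfold z; field; lra).
    assert (Dd : dist2 q' (h q' p') q (h q p) < de).
    { assert (L * (Rabs (q' - q) + Rabs (p' - p)) <= L * (z + z)) by (apply Rmult_le_compat_l; lra). nra. }
    assert (RP : Rpower (dist2 q' (h q' p') q (h q p)) gamma < eps / C').
    { replace (eps / C') with (Rpower de gamma). apply Rlt_Rpower_l; lra.
      unfold de. rewrite Rpower_mult, Rinv_l, Rpower_1; auto. lra. }
    set (R' := Rpower (dist2 q' (h q' p') q (h q p)) gamma) in *. assert (0 < R') by (unfold R', Rpower; apply exp_pos).
    eapply Rle_lt_trans. exact HC. apply Rle_lt_trans with (C' * R').
    apply Rmult_le_compat_r. lra. unfold C'. pose proof (Rle_abs C). lra.
    apply Rlt_le_trans with (C' * (eps / C')). apply Rmult_lt_compat_l; auto. right. field. lra.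
Qed.

Let xx : fun2 := fun q p => psixx q (h q p).
Let xy : fun2 := fun q p => psixy q (h q p).
Let yy : fun2 := fun q p => psiyy q (h q p).
Let u : fun2 := fun q p => psix q (h q p).
Let v : fun2 := fun q p => psiy q (h q p).

Definition hodo : flow := mkflow h u v
  (fun q p => xx q p + xy q p * (- u q p / v q p)) (fun q p => xy q p * / v q p)
  (fun q p => xy q p + yy q p * (- u q p / v q p)) (fun q p => yy q p * / v q p).

Lemma hodo_sol : sol om hodo.
Proof.
  assert (Uxx : UCB xx) by (apply comp_UCB_holder; [simpl; tauto|apply Hpsi; simpl; tauto]).
  assert (Uxy : UCB xy) by (apply comp_UCB_holder; [simpl; tauto|apply Hpsi; simpl; tauto]).
  assert (Uyy : UCB yy) by (apply comp_UCB_holder; [simpl; tauto|apply Hpsi; simpl; tauto]).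
  assert (Bu : BD u) by (apply comp_BD; simpl; tauto). assert (Bv : BD v) by (apply comp_BD; simpl; tauto).
  assert (Bi : BD (fun q p => / v q p)) by apply inv_BD.
  assert (Br : BD (fun q p => - u q p / v q p)) by (apply BD_mult; auto; now apply BD_opp).
  assert (Du : D1 u (fun q p => xx q p + xy q p * (- u q p / v q p)) (fun q p => xy q p * / v q p)).
  { intros q p Hp. exact (comp_grad psix psixx psixy q p Hp psix_diff). }
  assert (Dv : D1 v (fun q p => xy q p + yy q p * (- u q p / v q p)) (fun q p => yy q p * / v q p)).
  { intros q p Hp. exact (comp_grad psiy psixy psiyy q p Hp psiy_diff). }
  assert (Uu : UCB u).
  { split; auto. apply Lip_UC. eapply Lip_of_BD. exact Du. apply BD_plus. apply Uxx. apply BD_mult; auto. apply Uxy.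
    apply BD_mult; auto. apply Uxy. intros q. apply comp_cont_p. simpl; tauto. }
  assert (Uv : UCB v).
  { split; auto. apply Lip_UC. eapply Lip_of_BD. exact Dv. apply BD_plus. apply Uxy. apply BD_mult; auto. apply Uyy.
    apply BD_mult; auto. apply Uyy. intros q. apply comp_cont_p. simpl; tauto. }
  assert (Hv : forall q p, 0 <= p <= 1 -> c <= v q p) by (intros; now apply speed_ge).
  assert (Ui : UCB (fun q p => / v q p)) by (now apply UCB_inv with c).
  assert (Ur : UCB (fun q p => - u q p / v q p)).
  { apply UCB_ext with (fun q p => (-1) * (u q p * / v q p)). intros q p Hp. specialize (Hv q p Hp). field. lra.
    apply UCB_mult. apply UCB_const. now apply UCB_mult. }
  assert (Ch : C1s h (fun q p => - u q p / v q p) (fun q p => / v q p)).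
  { split; auto. intros q p Hp. exact (h_grad q p Hp). split. apply Lip_UC, h_Lip. exact h_BD. }
  split; simpl.
  - exists c. auto.
  - exact Ch.
  - split; auto. apply UCB_plus; auto. now apply UCB_mult. now apply UCB_mult.
  - split; auto. apply UCB_plus; auto. now apply UCB_mult. now apply UCB_mult.
  - intros q p Hp. specialize (Hv q p Hp). field. lra.
  - intros q p Hp. specialize (Hv q p ltac:(lra)). pose proof (Hpde q (h q p) (h_dom q p Hp)) as E.
    rewrite (proj2 (Hh q p ltac:(lra))) in E. fold (xx q p) (yy q p) in E.
    replace (xx q p) with (- yy q p - om p) by lra. field. lra.
  - exact h_0.
  (* The bottom is the streamline of height 0, so h_q = -u/v vanishes there. *)
  - intros q. pose proof (C1s_dq _ _ _ q 0 Ch ltac:(lra)) as D. specialize (Hv q 0 ltac:(lra)).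
    apply is_derive_unique in D. rewrite (Derive_ext _ (fun _ => 0)) in D by (intros; apply h_0). rewrite Derive_const in D.
    replace (u q 0) with (- (- u q 0 / v q 0) * v q 0) by (field; lra). rewrite <- D. ring.
Qed.

Lemma hodo_top : top_bc hodo r.
Proof. intros q. simpl. unfold u, v. rewrite h_1. rewrite <- (Hber q). field. Qed.

(** In the variable [y] the integrand has the antiderivative Gf(x, psi(x, y)) - y^2 / 2 + (Omega 1 +
    r) y, because psi_y times [g1] is (v^2 - u^2) / 2 - Omega(psi). *)
Lemma hodo_flowforce x : flowforce om r eta psi psix psiy x = FF om hodo r x.
Proof.
  unfold flowforce, FF. specialize (Heta0 x) as He.
  pose proof (Gf_C1s om hodo Ho hodo_sol) as CG.
  assert (Cpsi : cont_in 0 (eta x) (psi x)) by (apply vert_cont; simpl; tauto).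
  assert (Rpsi : forall y, 0 <= y <= eta x -> 0 <= psi x y <= 1) by (intros y Hy; now apply h_unique).
  rewrite (FTC_closed 0 (eta x) _ (fun y => Gf om hodo x (psi x y) - / 2 * (y * y) + (Omega om 1 + r) * y)).
  - cbn [fh hodo]. rewrite h_1, Htop, Hbot. replace (Gf om hodo x 0) with 0. field.
    unfold Gf. now rewrite (@RInt_point R_CompleteNormedModule).
  - lra.
  - assert (Cx : cont_in 0 (eta x) (psix x)) by (apply vert_cont; simpl; tauto).
    assert (Cy : cont_in 0 (eta x) (psiy x)) by (apply vert_cont; simpl; tauto).
    assert (sq : forall f, cont_in 0 (eta x) f -> cont_in 0 (eta x) (fun y => f y ^ 2)).
    { intros f Hf. apply cont_in_ext with (fun y => f y * f y). intros; ring. apply cont_in_mult; auto; lra. }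
    apply cont_in_plus; [lra| |apply cont_in_const].
    apply cont_in_minus; [lra| |apply (cont_in_comp_in 0 (eta x) 0 1); auto; now apply Omega_cont].
    apply cont_in_plus; [lra| |apply cont_in_const].
    apply cont_in_minus; [lra| |apply cont_in_id].
    apply cont_in_mult; [lra|apply cont_in_const|]. apply cont_in_minus; auto; lra.
  - apply cont_in_plus; [lra| |apply cont_in_mult; [lra|apply cont_in_const|apply cont_in_id]].
    apply cont_in_minus; [lra| |].
    + apply (cont_in_comp_in 0 (eta x) 0 1 (psi x) (Gf om hodo x)); auto. apply UC_cont_in. apply CG.
    + apply cont_in_mult; [lra|apply cont_in_const|]. apply cont_in_mult; try lra; apply cont_in_id.
  - intros y Hy.
    assert (Hp : 0 < psi x y < 1).
    { pose proof (psi_incr x 0 y ltac:(lra) ltac:(lra) ltac:(lra)). pose proof (psi_incr x y (eta x) ltac:(lra) ltac:(lra) ltac:(lra)).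
      rewrite Hbot in *. rewrite Htop in *. nra. }
    assert (Dpsi : is_derive (psi x) y (psiy x y)) by (apply Hpsi; exact Hy).
    pose proof (D1_dp _ _ _ x (psi x y) (C1_D _ _ _ CG) Hp) as DG.
    eapply is_derive_eq.
    apply (is_derive_plus (V := R_NormedModule) (fun y => Gf om hodo x (psi x y) - / 2 * (y * y)) (fun y => (Omega om 1 + r) * y)).
    apply (is_derive_minus (V := R_NormedModule) (fun y => Gf om hodo x (psi x y)) (fun y => / 2 * (y * y))).
    apply (is_derive_comp (Gf om hodo x) (psi x) y _ _ DG Dpsi).
    instantiate (1 := y). auto_derive; auto; field.
    instantiate (1 := Omega om 1 + r). auto_derive; auto; ring.
    unfold minus, plus, opp, scal; simpl; unfold mult; simpl. unfold g1. simpl. unfold u, v.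
    rewrite (proj2 (h_unique x y ltac:(lra))). specialize (Hc' x y Hy). field. lra.
Qed.

End with_height.
End hodograph.

(** * Solitary waves *)

Lemma sym_solitary_intro (d x0 : R) (eta : R -> R) : (forall x, eta (x0 + x) = eta (x0 - x)) -> (forall x, d < eta x) ->
  (forall eps, 0 < eps -> exists N, forall q, N <= q -> eta q < d + eps) -> sym_solitary d eta.
Proof.
  intros Hsym Hpos Hlim. split; [now exists x0|]. split; auto. split.
  - intros P [e He]. destruct (Hlim e (cond_pos e)) as [N HN]. exists N. intros x Hx. apply He.
    apply Rabs_def1; specialize (HN x ltac:(lra)); specialize (Hpos x); unfold minus, plus, opp; simpl; lra.
  - intros P [e He]. destruct (Hlim e (cond_pos e)) as [N HN]. exists (2 * x0 - N). intros x Hx. apply He.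
    specialize (HN (x0 + (x0 - x)) ltac:(lra)). rewrite Hsym in HN. replace (x0 - (x0 - x)) with x in HN by ring.
    apply Rabs_def1; specialize (Hpos x); unfold minus, plus, opp; simpl; lra.
Qed.

Lemma sym_solitary_refl d eta : sym_solitary d (fun q => eta (2 * 0 - q)) -> sym_solitary d eta.
Proof.
  intros [[x0 Hsym] [Hpos [L1 L2]]]. split; [|split; [|split]].
  - exists (- x0). intros x. specialize (Hsym (- x)). simpl in Hsym.
    replace (2 * 0 - (x0 + - x)) with (- x0 + x) in Hsym by ring.
    replace (2 * 0 - (x0 - - x)) with (- x0 - x) in Hsym by ring. exact Hsym.
  - intros x. specialize (Hpos (- x)). simpl in Hpos. replace (2 * 0 - - x) with x in Hpos by ring. exact Hpos.
  - intros P HP. destruct (L2 P HP) as [M HM]. exists (- M). intros x Hx. specialize (HM (- x) ltac:(lra)). simpl in HM.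
    replace (2 * 0 - - x) with x in HM by ring. exact HM.
  - intros P HP. destruct (L1 P HP) as [M HM]. exists (- M). intros x Hx. specialize (HM (- x) ltac:(lra)). simpl in HM.
    replace (2 * 0 - - x) with x in HM by ring. exact HM.
Qed.

(** If the infimum is not approached at the right end, then, as it is not attained on any compact
    interval either, values near it occur arbitrarily far to the left. *)
Lemma inf_tail (d : R) (eta : R -> R) : (forall x, continuous eta x) -> is_inf d eta -> (forall q, d < eta q) ->
  (forall N eps, 0 < eps -> exists q, N < q /\ eta q < d + eps) \/
  (forall N eps, 0 < eps -> exists q, N < q /\ eta (2 * 0 - q) < d + eps).
Proof.
  intros Hc [_ Hinf] Hpos.
  destruct (classic (forall N eps, 0 < eps -> exists q, N < q /\ eta q < d + eps)) as [H|H]; [now left|right].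
  apply not_all_ex_not in H. destruct H as [N0 H]. apply not_all_ex_not in H. destruct H as [e0 H].
  apply imply_to_and in H. destruct H as [He0 H].
  assert (H0 : forall q, N0 < q -> d + e0 <= eta q).
  { intros q Hq. apply Rnot_lt_le. intros L. apply H. exists q; auto. }
  intros N eps Heps. set (a := Rmin (- N) N0 - 1).
  assert (Ha : a < - N /\ a < N0) by (unfold a; pose proof (Rmin_l (- N) N0); pose proof (Rmin_r (- N) N0); lra).
  destruct (cont_in_min a N0 eta ltac:(lra)) as [x0 [Hx0 Hm]]. apply cont_in_continuous; auto.
  set (e := Rmin eps (Rmin e0 (eta x0 - d))).
  assert (He : 0 < e) by (specialize (Hpos x0); repeat apply Rmin_pos; lra).
  assert (Hee : e <= eps /\ e <= e0 /\ e <= eta x0 - d).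
  { unfold e. pose proof (Rmin_l eps (Rmin e0 (eta x0 - d))). pose proof (Rmin_r eps (Rmin e0 (eta x0 - d))).
    pose proof (Rmin_l e0 (eta x0 - d)). pose proof (Rmin_r e0 (eta x0 - d)). lra. }
  destruct (Hinf e He) as [q Hq]. exists (- q). replace (2 * 0 - - q) with q by ring. split; [|lra].
  apply Rnot_le_lt. intros L. destruct (Rle_or_lt q N0) as [L1|L1].
  - specialize (Hm q ltac:(lra)). lra.
  - specialize (H0 q L1). lra.
Qed.

Theorem theorem2p1
  (gamma : R) (om : R -> R) (sc : R) (R0 : Rbar) (r sm sp : R)
  (eta : R -> R) (psi psix psiy psixx psixy psiyy : R -> R -> R) :
  0 < gamma < 1 ->
  cont_on_01 om ->
  (* s_c, R_c = R(s_c), R_0 = lim_{s -> s0+} R(s) *)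
  is_sc om sc ->
  filterlim (Bern om) (at_right (s0 om)) (Rbar_locally R0) ->
  (* r in (R_c, R_0) *)
  Bern om sc < r -> Rbar_lt r R0 ->
  (* s_-(r) < s_c < s_+(r), the two solutions of R(s) = r *)
  s0 om < sm -> sm < sc -> sc < sp -> Bern om sm = r -> Bern om sp = r ->
  (* the water wave (psi, eta) *)
  (forall x, 0 < eta x) ->
  C2g_R gamma eta ->
  C2g_Dbar gamma eta psi psix psiy psixx psixy psiyy ->
  (forall x y, Dom eta x y -> psixx x y + psiyy x y + om (psi x y) = 0) ->
  (forall x, / 2 * (psix x (eta x) ^ 2 + psiy x (eta x) ^ 2) + eta x = r) ->
  (forall x, psi x (eta x) = 1) ->
  (forall x, psi x 0 = 0) ->
  (exists c, 0 < c /\ forall x y, Dom eta x y -> c <= psiy x y) ->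
  (forall x, sigmaF om sp r <= flowforce om r eta psi psix psiy x <= sigmaF om sm r)
  /\ (forall x, flowforce om r eta psi psix psiy x = sigmaF om sp r ->
        laminar om sp eta psi \/ sym_solitary (depth om sp) eta)
  /\ (forall x, flowforce om r eta psi psix psiy x = sigmaF om sm r ->
        laminar om sm eta psi).
Proof.
  intros Hgam Ho [Hsc0 Hsc] _ _ _ Hsm Hmc Hcp HBm HBp Heta0 Heta Hpsi Hpde Hber Htop Hbot [c [Hc Hc']].
  change (cont_in 0 1 om) in Ho.
  assert (Hex : exists h : fun2, forall q p, 0 <= p <= 1 -> 0 <= h q p <= eta q /\ psi q (h q p) = p) by (eapply height_ex; eassumption).
  destruct Hex as [h Hh].
  set (f := hodo psix psiy psixx psixy psiyy h).
  assert (Hs : sol om f) by (eapply hodo_sol; eassumption).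
  assert (HT : top_bc f r) by (eapply hodo_top; eassumption).
  assert (H1 : forall q, fh f q 1 = eta q) by (intros q; eapply h_1; eassumption).
  assert (Hinv : forall q y, 0 <= y <= eta q -> 0 <= psi q y <= 1 /\ h q (psi q y) = y).
  { intros q y Hy. eapply h_unique; eassumption. }
  assert (HF : forall x, flowforce om r eta psi psix psiy x = FF om f r 0).
  { intros x. rewrite (FF_const om f r Ho Hs HT 0 x). eapply hodo_flowforce; eassumption. }
  destruct (adm_of_s0 om sm Ho Hsm) as [Ham Psm].
  destruct (adm_of_s0 om sc Ho Hsc0) as [Hac _].
  destruct (adm_of_s0 om sp Ho ltac:(lra)) as [Hap _].
  rewrite (sigmaF_St om sm r Ho Ham HBm), (sigmaF_St om sp r Ho Hap HBp).
  set (tm := sm ^ 2) in *. set (tp := sp ^ 2) in *. set (tc := sc ^ 2) in *.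
  assert (Hmp : tm < tp) by (unfold tm, tp; nra). assert (Htcp : tc < tp) by (unfold tc, tp; nra).
  assert (Nm : Nt om tm = r) by exact HBm. assert (Np : Nt om tp = r) by exact HBp.
  assert (Hlam : forall s, (forall q p, 0 <= p <= 1 -> fh f q p = Ht om (s ^ 2) p) -> laminar om s eta psi).
  { intros s E. split.
    - intros x. rewrite <- H1, E by lra. reflexivity.
    - intros x y Hy. destruct (Hinv x y Hy) as [A1 A2]. split; auto.
      change (Ht om (s ^ 2) (psi x y) = y). rewrite <- (E x) by auto. exact A2. }
  split; [|split].
  - intros x. rewrite HF. split; [exact (lower_bound om f r Ho Hs HT tm tp Ham Hmp Nm Np)|exact (upper_bound om f r Ho Hs HT tm tp Ham Hmp Nm Np)].
  - intros x. rewrite HF. intros E.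
    destruct (classic (exists q0, eta q0 = dt om tp)) as [[q0 Hq0]|Hnt].
    { left. apply Hlam. apply (touch_eq om f r Ho Hs HT tm tp Ham Hmp Nm Np q0 E). rewrite H1. exact Hq0. }
    right. change (sym_solitary (dt om tp) eta).
    assert (Hpos : forall q, dt om tp < fh f q 1).
    { intros q. assert (G : dt om tp <= fh f q 1) by (apply (eta_ge om f r Ho Hs HT tm tp Ham Hmp Nm Np); exact E).
      destruct G as [G|G]; auto. exfalso. apply Hnt. exists q. rewrite <- H1. auto. }
    assert (Kp : kap om r tp = dt om tp) by (now apply kap_dt_p).
    assert (Km : kap om r tm = dt om tm) by (now apply kap_dt_m).
    assert (Hd2 : dt om tp < dt om tm) by (unfold kap in *; lra).
    assert (Hsup : RInt (fun p => / mt om tp p ^ 3) 0 1 < 1).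
    { eapply Rlt_le_trans. exact (mt3_lt om tc tp Ho Hac Htcp). right. exact Hsc. }
    assert (Hcrit : forall L, dt om tp < L <= dt om tm -> exists del, 0 < del /\
      forall q, Rabs (fh f q 1 - L) < del -> Rabs (fu f q 1) < del -> False).
    (* Heights in this range correspond to squared speeds from [tm] up to but excluding [tp], where
       [St] exceeds [St tp], the flow force of the wave. *)
    { intros L HL. assert (Ht : tm <= 2 * (r + Omega om 1 - L) < tp) by (unfold kap in *; lra).
      apply (no_critical om f r Ho Hs HT L). apply adm_mono with tm; auto; lra.
      rewrite E. apply (St_decr om r tm tp Ho Ham Nm Np); lra. }
    assert (Hconj : forall t, adm om t -> dt om t = kap om r t -> dt om t = dt om tp \/ dt om t = dt om tm).
    { intros t Hat Et. pose proof (kap_dt om r t) as Ek.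
      destruct (Rtotal_order t tm) as [L|[->|L]]; auto.
      - pose proof (Nt_left om r tm tp Ho Hmp Nm Np t Hat L). lra.
      - destruct (Rtotal_order t tp) as [L'|[->|L']]; auto.
        + pose proof (Nt_between om r tm tp Ho Ham Nm Np t ltac:(lra)). lra.
        + pose proof (Nt_right om r tm tp Ho Ham Hmp Nm Np t L'). lra. }
    assert (Hinf : is_inf (dt om tp) (fun q => fh f q 1)) by exact (lower_eq om f r Ho Hs HT tm tp Ham Hmp Nm Np E).
    (* Stated for a general flow, to be applied to the wave when the depth is approached on the
       right and to its mirror image otherwise. *)
    assert (Ef : forall g, sol om g -> top_bc g r -> (forall q, dt om tp < fh g q 1) ->
      (forall L, dt om tp < L <= dt om tm -> exists del, 0 < del /\
         forall q, Rabs (fh g q 1 - L) < del -> Rabs (fu g q 1) < del -> False) ->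
      (forall N eps, 0 < eps -> exists q, N < q /\ fh g q 1 < dt om tp + eps) ->
      sym_solitary (dt om tp) (fun q => fh g q 1)).
    { intros g Sg Tg Pg Cg Lg.
      destruct (symmetric om g r tp (dt om tm) Ho Sg Tg Hap Kp Hd2 Pg Hsup Cg Hconj Lg) as [x0 Hx0].
      apply sym_solitary_intro with x0; auto. intros eps Heps. eapply tail_limit; eassumption. }
    assert (Hex : sym_solitary (dt om tp) (fun q => fh f q 1)).
    { destruct (inf_tail (dt om tp) (fun q => fh f q 1)) as [L|L]; auto.
      { intros x'. exact (is_derive_cont _ _ _ (top_dq om f Hs x')). }
      apply sym_solitary_refl. apply (Ef (refl f 0)); auto.
      - now apply refl_sol.
      - now apply refl_top.
      - intros q. apply Hpos.
      - intros L0 HL. destruct (Hcrit L0 HL) as [del [Hdel K]]. exists del. split; auto.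
        intros q K1 K2. apply (K (2 * 0 - q)); auto. simpl in K2. now rewrite Rabs_Ropp in K2. }
    destruct Hex as [[x0 S1] [S2 [S3 S4]]]. split; [exists x0; intros y; rewrite <- !H1; apply S1|].
    split; [intros y; rewrite <- H1; apply S2|].
    split; (eapply filterlim_ext; [exact H1|assumption]).
  - intros x. rewrite HF. intros E. apply Hlam. exact (upper_eq om f r Ho Hs HT tm tp Ham Hmp Nm Np E).
Qed.
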